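(* Let $g\colon M\to\mathbb{S}^5$ be a compact pseudoholomorphic curve (i.e. $M$ is compact). If $M$ is not homeomorphic to the torus, then for $4\le n\le 7$ the moduli space of all noncongruent substantial minimal surfaces $f\colon M\to\mathbb{S}^n$ that are isometric to $g$ is empty, unless $n=5$, in which case the moduli space is a finite set.
   Context: Surfaces. $M$ is a connected oriented $2$-dimensional Riemannian manifold (Riemann surface). A minimal surface $f\colon M\to\mathbb{S}^n$ is a minimal isometric immersion into the unit sphere. It is substantial if $f(M)$ is not contained in any proper totally geodesic submanifold (subsphere) of $\mathbb{S}^n$. Two surfaces are congruent if they differ by an isometry of the ambient sphere. The moduli space of noncongruent surfaces of some kind is the set of congruence classes of such surfaces. Pseudoholomorphic curves. $\mathbb{S}^6$ is the unit sphere in the imaginary Cayley numbers $\mathbb{R}^7=\mathrm{Im}\,\mathbb{O}$, with the nearly Kähler almost complex structure induced by Cayley multiplication ($v\mapsto p\cdot v$ on $T_p\mathbb{S}^6$). A pseudoholomorphic curve is a nonconstant smooth map $g\colon M\to\mathbb{S}^6$ from a Riemann surface whose differential is complex linear. $M$ carries the metric induced by $g$, and $g$ is regarded as an isometric immersion. A pseudoholomorphic curve in $\mathbb{S}^5$ is one whose image lies in a totally geodesic $\mathbb{S}^5\subset\mathbb{S}^6$. A surface $f\colon M\to\mathbb{S}^n$ is isometric to $g\colon M\to\mathbb{S}^6$ if $f$ and $g$ induce the same Riemannian metric on $M$. *)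

(* Defs.v *)
From HB Require Import structures.
From mathcomp Require Import all_boot all_order all_algebra.
From mathcomp Require Import all_classical all_reals all_analysis.
Set Implicit Arguments.
Unset Strict Implicit.
Unset Printing Implicit Defensive.
Import Order.TTheory GRing.Theory Num.Theory numFieldNormedType.Exports.
Local Open Scope classical_set_scope.
Local Open Scope ring_scope.

Definition dot (R : realType) (n : nat) (u v : 'rV[R]_n) : R :=
  (u *m v^T) 0 0.

Definition usphere (R : realType) (n : nat) : set 'rV[R]_n.+1 :=
  [set x | dot x x = 1].
Arguments usphere : clear implicits.

(* The totally geodesic subspheres of S^n are its intersections with the
   linear subspaces V of R^(n+1); this one has dimension \dim V - 1. *)
Definition great_subsphere (R : realType) (n : nat)
    (V : {vspace 'rV[R]_n.+1}) : set 'rV[R]_n.+1 :=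
  usphere R n `&` [set x | x \in V].

(* Isometries for the geodesic distance, which is arccos <x, y>. *)
Definition sphere_isometry (R : realType) (n : nat)
    (t : 'rV[R]_n.+1 -> 'rV[R]_n.+1) : Prop :=
  set_bij (usphere R n) (usphere R n) t /\
  forall x y, usphere R n x -> usphere R n y ->
    acos (dot (t x) (t y)) = acos (dot x y).

Definition torus (R : realType) : set ('rV[R]_2 * 'rV[R]_2) :=
  usphere R 1 `*` usphere R 1.
Arguments torus : clear implicits.

Definition homeomorphic_to (X Y : topologicalType) (B : set Y) : Prop :=
  exists (h : X -> Y) (k : Y -> X),
    [/\ continuous h, {within B, continuous k},
        forall x, B (h x), cancel h k & {in B, cancel k h}].

(* The Cayley numbers are pairs (real part, imaginary part). The imaginary
   units e_0, ..., e_6 satisfy e_i e_(i+1) = e_(i+3), indices modulo 7, together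
   with the cyclic permutations of these relations; addition in 'I_7 is modulo
   7. *)
Definition cayley (R : realType) : Type := (R * 'rV[R]_7)%type.

Definition cayley_cross (R : realType) (x y : 'rV[R]_7) : 'rV[R]_7 :=
  \row_(k < 7)
    (x 0 (k + 1) * y 0 (k + 3%:R) - x 0 (k + 3%:R) * y 0 (k + 1)
     + (x 0 (k + 2%:R) * y 0 (k + 6%:R) - x 0 (k + 6%:R) * y 0 (k + 2%:R))
     + (x 0 (k + 4%:R) * y 0 (k + 5%:R) - x 0 (k + 5%:R) * y 0 (k + 4%:R))).

Definition cayley_mul (R : realType) (a b : cayley R) : cayley R :=
  (a.1 * b.1 - dot a.2 b.2,
   a.1 *: b.2 + b.1 *: a.2 + cayley_cross a.2 b.2).

Definition imO (R : realType) (v : 'rV[R]_7) : cayley R := (0, v).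

(* For v tangent to S^6 at p, the product p . v is imaginary. *)
Definition nearly_kahler_J (R : realType) (p v : 'rV[R]_7) : 'rV[R]_7 :=
  (cayley_mul (imO p) (imO v)).2.

Definition basis_vec (R : realType) (i : 'I_2) : 'rV[R]_2 := delta_mx 0 i.

Definition partials (R : realType) (k : nat) (s : seq 'I_2)
    (u : 'rV[R]_2 -> 'rV[R]_k.+1) : 'rV[R]_2 -> 'rV[R]_k.+1 :=
  foldr (fun i w => 'D_(basis_vec R i) w) u s.

(* C^oo on an open set U. *)
Definition smooth_on (R : realType) (k : nat) (U : set 'rV[R]_2)
    (u : 'rV[R]_2 -> 'rV[R]_k.+1) : Prop :=
  forall (s : seq 'I_2) (x : 'rV[R]_2), U x ->
    {for x, continuous (partials s u)} /\
    forall i : 'I_2, derivable (partials s u) x (basis_vec R i).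

(* Multiplication by the imaginary unit, R^2 being identified with C by
   (x, y) |-> x + i y. *)
Definition mul_i (R : realType) (v : 'rV[R]_2) : 'rV[R]_2 :=
  - v 0 1 *: basis_vec R 0 + v 0 0 *: basis_vec R 1.

Definition holomorphic_on (R : realType) (U : set 'rV[R]_2)
    (u : 'rV[R]_2 -> 'rV[R]_2) : Prop :=
  smooth_on U u /\
  forall x v, U x -> 'D_(mul_i v) u x = mul_i ('D_v u x).

(* Only the values of chart_inv on the open set chart_cod are meaningful. *)
Record chart (R : realType) (M : topologicalType) := Chart {
  chart_dom : set M ;
  chart_map : M -> 'rV[R]_2 ;
  chart_inv : 'rV[R]_2 -> M ;
  chart_dom_open : open chart_dom ;
  chart_cod_open : open (chart_map @` chart_dom) ;
  chart_mapK : {in chart_dom, cancel chart_map chart_inv} ;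
  chart_map_continuous : {within chart_dom, continuous chart_map} ;
  chart_inv_continuous :
    {within chart_map @` chart_dom, continuous chart_inv}
}.

Definition chart_cod (R : realType) (M : topologicalType) (c : chart R M) :
    set 'rV[R]_2 := chart_map c @` chart_dom c.

Record riemannSurface (R : realType) := RiemannSurface {
  carrier :> topologicalType ;
  surface_hausdorff : hausdorff_space carrier ;
  surface_second_countable : @second_countable carrier ;
  surface_connected : connected [set: carrier] ;
  atlas : set (chart R carrier) ;
  atlas_cover : forall p : carrier, exists2 c, atlas c & chart_dom c p ;
  atlas_holomorphic : forall c d, atlas c -> atlas d ->
    holomorphic_on (chart_map c @` (chart_dom c `&` chart_dom d))
                   (chart_map d \o chart_inv c)
}.

Section Surfaces.
Variables (R : realType) (M : riemannSurface R).

Definition local_rep (k : nat) (f : M -> 'rV[R]_k.+1) (c : chart R M) :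
    'rV[R]_2 -> 'rV[R]_k.+1 := f \o chart_inv c.

Definition smooth_map (k : nat) (f : M -> 'rV[R]_k.+1) : Prop :=
  forall c, atlas c -> smooth_on (chart_cod c) (local_rep f c).

(* Row a is the a-th partial derivative of f in the chart c. *)
Definition jacobian (k : nat) (f : M -> 'rV[R]_k.+1) (c : chart R M)
    (x : 'rV[R]_2) : 'M[R]_(2, k.+1) :=
  \matrix_(a < 2, j < k.+1) ('D_(basis_vec R a) (local_rep f c) x) 0 j.

Definition immersion (k : nat) (f : M -> 'rV[R]_k.+1) : Prop :=
  smooth_map f /\
  forall c x, atlas c -> chart_cod c x -> row_free (jacobian f c x).

(* The matrix <f_a, f_b> of the first fundamental form in the chart c. *)
Definition induced_metric (k : nat) (f : M -> 'rV[R]_k.+1) (c : chart R M)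
    (x : 'rV[R]_2) : 'M[R]_2 :=
  jacobian f c x *m (jacobian f c x)^T.

Definition isometric (k l : nat) (f : M -> 'rV[R]_k.+1)
    (g : M -> 'rV[R]_l.+1) : Prop :=
  forall c x, atlas c -> chart_cod c x ->
    induced_metric f c x = induced_metric g c x.

(* Orthogonal projection of v onto the normal space, inside the tangent space
   of the sphere at f, of an immersion f into the sphere. *)
Definition normal_part (k : nat) (f : M -> 'rV[R]_k.+1) (c : chart R M)
    (x : 'rV[R]_2) (v : 'rV[R]_k.+1) : 'rV[R]_k.+1 :=
  let p := local_rep f c x in
  let J := jacobian f c x in
  v - dot v p *: p - v *m J^T *m invmx (induced_metric f c x) *m J.

Definition second_form (k : nat) (f : M -> 'rV[R]_k.+1) (c : chart R M)
    (x : 'rV[R]_2) (a b : 'I_2) : 'rV[R]_k.+1 :=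
  normal_part f c x
    ('D_(basis_vec R a) ('D_(basis_vec R b) (local_rep f c)) x).

Definition mean_curvature (k : nat) (f : M -> 'rV[R]_k.+1) (c : chart R M)
    (x : 'rV[R]_2) : 'rV[R]_k.+1 :=
  2%:R^-1 *: \sum_(a < 2) \sum_(b < 2)
    invmx (induced_metric f c x) a b *: second_form f c x a b.

Definition minimal_surface (n : nat) (f : M -> 'rV[R]_n.+1) : Prop :=
  [/\ range f `<=` usphere R n, immersion f &
      forall c x, atlas c -> chart_cod c x -> mean_curvature f c x = 0].

Definition substantial (n : nat) (f : M -> 'rV[R]_n.+1) : Prop :=
  forall V : {vspace 'rV[R]_n.+1}, V <> fullv ->
    ~ (range f `<=` great_subsphere V).

Definition congruent (n : nat) (f f' : M -> 'rV[R]_n.+1) : Prop :=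
  exists2 t : 'rV[R]_n.+1 -> 'rV[R]_n.+1,
    sphere_isometry t & forall p, f' p = t (f p).

Definition pseudoholomorphic_curve (g : M -> 'rV[R]_7) : Prop :=
  [/\ range g `<=` usphere R 6,
      exists p q, g p <> g q,
      smooth_map g &
      forall c x v, atlas c -> chart_cod c x ->
        'D_(mul_i v) (local_rep g c) x =
        nearly_kahler_J (local_rep g c x) ('D_v (local_rep g c) x)].

Definition lies_in_S5 (g : M -> 'rV[R]_7) : Prop :=
  exists2 V : {vspace 'rV[R]_7}, \dim V = 6%N & range g `<=` great_subsphere V.

Definition isometric_minimal_surfaces (g : M -> 'rV[R]_7) (n : nat) :
    set (M -> 'rV[R]_n.+1) :=
  [set f | [/\ minimal_surface f, substantial f & isometric f g]].

Definition moduli_space (g : M -> 'rV[R]_7) (n : nat) :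
    set (set (M -> 'rV[R]_n.+1)) :=
  [set C | exists2 f, isometric_minimal_surfaces g f &
     C = [set f' | isometric_minimal_surfaces g f' /\ congruent f f']].

End Surfaces.
Arguments isometric_minimal_surfaces {R M} g n.
Arguments moduli_space {R M} g n.

(* Main.v *)
(* In a conformal coordinate z let rho be the conformal factor of the metric and
   sigma = rho + (log rho)_(z zbar). Every minimal surface f isometric to g has
   |F|^2 = rho sigma, where F is the (2,0) part of its second fundamental form, and
   the cubic differential Q = <G, g_z x xi> of g, with G the (2,0) part for g and xi
   the normal of the hyperplane containing S^5, satisfies |Q|^2 = rho^2 sigma.

   If Q vanishes identically, f lies in a 2-sphere. If Q has no zeros, its cube
   roots are local holomorphic coordinates that differ by translations and cube
   roots of unity; continuing them gives a map from the plane onto M, and a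
   holonomy other than the identity would have a fixed point, so M is the quotient
   of the plane by a lattice.

   Otherwise Q has isolated zeros. The quartic differential <F, F> vanishes, by the
   maximum principle for |<F, F>|^6 / |Q|^8, which is 0 at the zeros of Q. Then
   e = rho F / Q and eta = e_z / rho complete f, f_z to a unitary frame, and
   c = <eta, eta> is holomorphic and bounded, hence constant. If |c| < 1 there are
   two more normal directions, so that n >= 6; n = 6 leaves no room for the second
   of them, and n = 7 forces sigma = rho, which fails at the zeros of Q. If |c| = 1
   the six vectors span a fixed space, whence n = 5, and c determines f up to
   congruence. Coordinate functions of surfaces with distinct c are linearly
   independent solutions of u_(z zbar) = - rho u, and by a gradient estimate these
   form a finite-dimensional space on a compact surface. *)

Require Import Defs.
From HB Require Import structures.
From mathcomp Require Import all_boot all_order all_algebra.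
From mathcomp Require Import all_classical all_reals all_analysis.
From mathcomp Require Import complex ring lra.
Set Implicit Arguments.
Unset Strict Implicit.
Unset Printing Implicit Defensive.
Import Order.TTheory GRing.Theory Num.Theory.
Import numFieldNormedType.Exports.
Local Open Scope classical_set_scope.
Local Open Scope ring_scope.

(** * Smooth functions of two real variables *)

(** The metric is 2 rho |dz|^2, so that sigma = rho (1 - K) with K the Gauss curvature: Q vanishes
    exactly where K = 1, and the quotient [qM] is 1 - K.

    The local geometry is done in an abstract commutative ring with d/dz and conjugation, the
    structure [dring]; the structure equations become identities for [ring], and only their
    consequences are evaluated at points.

    The obstacle is that e, eta and c exist only off the zeros of Q. These are isolated, so the rest
    of M stays connected, and multiplying a power of a bounded holomorphic function by a coordinate
    that vanishes at the puncture makes the maximum principle applicable there. Identities are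
    carried over the zeros by density. The expression |<F, F>|^6 / |Q|^8 is |<F, F>^3 / Q^4|^2: the
    degrees 4 and 3 of the differentials balance, and its bound (rho sigma)^6 / (rho^2 sigma)^4 =
    (sigma / rho)^2 vanishes with sigma.

    Function theory rests on the maximum principle for |F|^2 and a mean value inequality in place of
    Cauchy's integral formula. *)

Lemma differentiable_near (K : numFieldType) (V W : normedModType K) (f : V -> W)
    (L : {linear V -> W}) (x : V) : continuous L ->
  (forall e : K, 0 < e ->
    \forall h \near (0 : V), `|f (h + x) - (f x + L h)| <= e * `|h|) ->
  differentiable f x.
Proof.
move=> cL Lf.
have key : f \o shift x = cst (f x) + L +o_ 0 id by apply/eqaddoP => e /Lf.
have dL : 'd f x = L :> (V -> W) by apply: diff_unique.
by apply/diff_locallyP; rewrite dL.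
Qed.

Lemma ord2_ind (P : 'I_2 -> Prop) : P 0 -> P 1 -> forall i, P i.
Proof.
move=> P0 P1 [[|[|//]] i].
  by rewrite (_ : Ordinal i = 0) //; apply: val_inj.
by rewrite (_ : Ordinal i = 1) //; apply: val_inj.
Qed.

Section Calculus.
Context {R : realType}.
Notation V := 'rV[R]_2.
Notation E := (@basis_vec R).
Implicit Types (u v : V -> R) (U : set V) (x : V).

Lemma is_derive_line (W : normedModType R) (f : W -> R) (x v : W) (t : R) :
  derivable f (x + t *: v) v ->
  is_derive t (1 : R) (fun s : R => f (x + s *: v)) ('D_v f (x + t *: v)).
Proof.
move=> df.
have E1 : (fun h : R => h^-1 *: ((f \o shift (x + t *: v)) (h *: v)
     - f (x + t *: v))) =
   (fun h : R => h^-1 *: (((fun s => f (x + s *: v)) \o shift t) (h *: 1)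
     - f (x + t *: v))).
  apply: funext => h /=; congr (_ *: (f _ - _)).
  by rewrite [h%:A]mulr1 scalerDl addrCA.
apply: DeriveDef.
  by move: df; rewrite /derivable E1.
by rewrite /derive E1.
Qed.

(** The intermediate point is located only by [|t| <= |s|], so that increments of either sign are
    covered at once. *)
Lemma line_MVT (W : normedModType R) (f : W -> R) (x v : W) (s : R) :
  (forall t : R, `|t| <= `|s| -> derivable f (x + t *: v) v) ->
  exists2 t : R, `|t| <= `|s| & f (x + s *: v) - f x = s * 'D_v f (x + t *: v).
Proof.
move=> df.
pose h t := f (x + t *: v).
have dh (t : R) : `|t| <= `|s| -> is_derive t (1 : R) h ('D_v f (x + t *: v)).
  by move=> /df; exact: is_derive_line.
have ch a b : (forall t, t \in `[a, b] -> `|t| <= `|s|) ->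
    {within `[a, b], continuous h}.
  move=> ab; apply: derivable_within_continuous => t /ab /dh.
  by case.
have h0 : h 0 = f x by rewrite /h scale0r addr0.
have [s0|s0] := leP 0 s.
  have ab t : t \in `[0, s] -> `|t| <= `|s|.
    by rewrite in_itv /= => /andP[t0 ts]; rewrite !ger0_norm.
  have [t0|] := @MVT_segment _ h (fun t => 'D_v f (x + t *: v)) _ _ s0 _ (ch _ _ ab).
    by move=> /subset_itv_oo_cc /ab /dh.
  move=> t /ab ts e; exists t => //.
  by rewrite -h0 -/(h s) e subr0 mulrC.
have ab t : t \in `[s, 0] -> `|t| <= `|s|.
  by rewrite in_itv /= => /andP[t0 ts]; rewrite !ler0_norm ?lerN2// ltW.
have [t0|] := @MVT_segment _ h (fun t => 'D_v f (x + t *: v)) _ _ (ltW s0) _ (ch _ _ ab).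
  by move=> /subset_itv_oo_cc /ab /dh.
move=> t /ab ts e; exists t => //.
rewrite -h0 -/(h s); apply: oppr_inj; rewrite opprB e.
by rewrite sub0r mulrN mulrC.
Qed.

Lemma row2E (h : V) : h = h 0 0 *: E 0 + h 0 1 *: E 1.
Proof.
apply/rowP => j; rewrite !mxE /=.
by case: j => [[|[|//]] ?]; rewrite /= ?mulr1 ?mulr0 ?addr0 ?add0r;
  congr (h _ _); apply: val_inj.
Qed.

Lemma row2_norm (h : V) i : `|h 0 i| <= `|h|.
Proof.
rewrite [leRHS]/Num.Def.normr/= mx_normrE.
exact: (le_bigmax _ (fun j : 'I_1 * 'I_2 => `|h j.1 j.2|) (0, i)).
Qed.

Lemma normE i : `|E i| <= 1 :> R.
Proof.
rewrite [leLHS]/Num.Def.normr/= mx_normrE; apply: bigmax_le => //= -[a b] _ /=.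
by rewrite mxE; case: (_ && _); rewrite ?normr1 ?normr0.
Qed.

Definition lin2 (a b : R) (h : V) : R^o := h 0 0 * a + h 0 1 * b.

Fact lin2_linear a b : linear (lin2 a b).
Proof. by move=> c h k; rewrite /lin2 !mxE /GRing.scale /=; ring. Qed.

HB.instance Definition _ a b :=
  GRing.isLinear.Build R V R^o *:%R (lin2 a b) (lin2_linear a b).

Lemma lin2_continuous a b : continuous (lin2 a b).
Proof.
have c i c0 : continuous (fun h : V => h 0 i * c0).
  move=> y; apply: continuousM; last exact: cst_continuous.
  exact: coord_continuous.
by move=> y; apply: (@continuousD _ R^o _ (fun h : V => h 0 0 * a) (fun h : V => h 0 1 * b)); exact: c.
Qed.

(** Intermediate points of the mean value theorem are known only to lie within [|h|] of [x], so the
    property is needed at all such points. *)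
Lemma near0_small (x : V) (P : set V) : nbhs x P ->
  \forall h \near (0 : V), forall k : V, `|k| <= `|h| -> P (x + k).
Proof.
move=> /nbhs_ballP[d /= d0 dP]; apply/nbhs_ballP; exists d => //= h.
rewrite -ball_normE /ball_ /= sub0r normrN => hd k kh.
apply: dP; rewrite -ball_normE /ball_ /= opprD addNKr normrN.
exact: le_lt_trans hd.
Qed.

(** The step from x to x + h is split into two steps parallel to the axes. The mean value theorem on
    each leaves the oscillation of a partial derivative times a coordinate of h. *)
Lemma differentiable_C1 U u : open U ->
  (forall x i, U x -> derivable u x (E i)) ->
  (forall x i, U x -> {for x, continuous ('D_(E i) u)}) ->
  forall x, U x -> differentiable u x.
Proof.
move=> oU du cu x Ux.
pose L' := lin2 ('D_(E 0) u x) ('D_(E 1) u x).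
have cL : continuous L' by exact: lin2_continuous.
apply: (differentiable_near cL) => e e0.
have NU : \forall h \near (0 : V), forall k, `|k| <= `|h| -> U (x + k).
  by apply: near0_small; apply: open_nbhs_nbhs; split.
have ND : \forall h \near (0 : V), forall i : 'I_2, forall k, `|k| <= `|h| ->
    `|'D_(E i) u (x + k) - 'D_(E i) u x| <= e / 2.
  have N i : nbhs x (fun y => `|'D_(E i) u y - 'D_(E i) u x| <= e / 2).
    have /cvgrPdist_le /(_ (e / 2)) := cu x i Ux.
    move=> /(_ (divr_gt0 e0 (ltr0Sn _ _))); apply: filterS => y.
    by rewrite distrC.
  move: (near0_small (N 0)) (near0_small (N 1)); apply: filterS2 => h h0 h1.
  by apply: ord2_ind.
move: NU ND; apply: filterS2 => h hU hD.
  rewrite /L' /lin2 /=.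
  have -> : h + x = x + h 0 0 *: E 0 + h 0 1 *: E 1.
    by rewrite -addrA -row2E addrC.
  have a0 : `|h 0 0| <= `|h| by exact: row2_norm.
  have a1 : `|h 0 1| <= `|h| by exact: row2_norm.
  have b0 t : `|t| <= `|h 0 0| -> `|t *: E 0| <= `|h|.
    move=> th; rewrite normrZ (le_trans _ a0)// (le_trans _ th)//.
    by rewrite ler_piMr // normE.
  have b1 t : `|t| <= `|h 0 1| -> `|h 0 0 *: E 0 + t *: E 1| <= `|h|.
    move=> th; rewrite [leLHS]/Num.Def.normr/= mx_normrE.
    apply: bigmax_le => //= -[i j] _ /=; rewrite ord1 !mxE.
    case: j => [[|[|//]] ?]; rewrite /= ?mulr1 ?mulr0 ?addr0 ?add0r//.
    exact: le_trans th a1.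
  have [t th e1] : exists2 t, `|t| <= `|h 0 0| &
     u (x + h 0 0 *: E 0) - u x = h 0 0 * 'D_(E 0) u (x + t *: E 0).
    by apply: line_MVT => t th; apply/du/hU/b0.
  have [s sh e2] : exists2 s, `|s| <= `|h 0 1| &
     u (x + h 0 0 *: E 0 + h 0 1 *: E 1) - u (x + h 0 0 *: E 0) =
     h 0 1 * 'D_(E 1) u (x + h 0 0 *: E 0 + s *: E 1).
    by apply: line_MVT => s sh; rewrite -addrA; apply/du/hU/b1.
  set P := u (x + _ + _) in e2 *.
  set D0 := 'D__ u x; set D1 := 'D__ u x.
  have -> : P - (u x + (h 0 0 * D0 + h 0 1 * D1)) =
    h 0 0 * ('D_(E 0) u (x + t *: E 0) - D0) +
    h 0 1 * ('D_(E 1) u (x + (h 0 0 *: E 0 + s *: E 1)) - D1).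
    rewrite !mulrBr -e1 (addrA x) -e2; ring.
  apply: le_trans (ler_normD _ _) _; rewrite !normrM.
  have -> : e * `|h| = `|h| * (e / 2) + `|h| * (e / 2) by field.
  apply: lerD; apply: ler_pM => //.
    exact/hD/b0.
  exact/hD/b1.
Qed.

End Calculus.

Lemma continuous_near_le (R : realType) (T : topologicalType) (f : T -> R)
    (x : T) (e : R) :
  {for x, continuous f} -> 0 < e -> \forall y \near x, `|f y - f x| <= e.
Proof.
move=> cf e0; have /cvgrPdist_le /(_ e e0) := cf.
by apply: filterS => y; rewrite distrC.
Qed.

Lemma near_eq_continuous (R : realType) (T : topologicalType) (f g : T -> R)
    (x : T) : (\forall y \near x, f y = g y) ->
  {for x, continuous f} -> {for x, continuous g}.
Proof.
move=> fg cf; apply/cvgrPdist_le => e e0; have /cvgrPdist_le /(_ e e0) := cf.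
have fx := nbhs_singleton fg.
by apply: filterS2 fg => y <-; rewrite -fx.
Qed.

Section Smooth.
Context {R : realType}.
Notation V := 'rV[R]_2.
Notation E := (@basis_vec R).
Implicit Types (u v : V -> R) (U : set V) (x : V).

(** Each level asks for differentiability rather than for mere partial derivatives, so that the
    product and chain rules hold without a further continuity argument. *)
Fixpoint Ck (k : nat) U u : Prop :=
  if k is k'.+1 then
    (forall x, U x -> differentiable u x) /\ forall i, Ck k' U ('D_(E i) u)
  else forall x, U x -> {for x, continuous u}.

Definition smooth U u := forall k, Ck k U u.

Lemma near_open U x (P : V -> Prop) : open U -> U x -> (forall y, U y -> P y) ->
  \forall y \near x, P y.
Proof.
move=> oU Ux UP; have : nbhs x U by apply: open_nbhs_nbhs; split.
exact: filterS.
Qed.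

Lemma near_eq_differentiable (f g : V -> R) x :
  (\forall y \near x, f y = g y) -> differentiable f x -> differentiable g x.
Proof.
move=> fg df.
apply: (@differentiable_near _ _ _ g ('d f x)) => [|e e0].
  exact: diff_continuous.
have /diff_locallyP[_ /eqaddoP /(_ e e0)] := df.
have fg0 := fg.
have : \forall h \near (0 : V), f (h + x) = g (h + x).
  have /near0_small := fg0; apply: filterS => h /(_ h (lexx _)).
  by rewrite addrC.
apply: filterS2 => h eh /=.
by rewrite /= !fctE /= -eh -(nbhs_singleton fg0).
Qed.

Lemma Ck_ext k U u v : open U -> (forall x, U x -> u x = v x) ->
  Ck k U u -> Ck k U v.
Proof.
move=> oU; elim: k u v => [|k IH] u v uv /=.
all: have N x : U x -> \forall y \near x, u y = v y
  by move=> Ux; apply: (near_open oU Ux) => y; exact: uv.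
  move=> cu x Ux; exact: near_eq_continuous (N x Ux) (cu x Ux).
move=> [du cu]; split=> [x Ux|i].
  apply: near_eq_differentiable (du x Ux); exact: N.
apply: IH (cu i) => x Ux; apply: near_eq_derive; exact: N.
Qed.

Lemma Ck_le k U u : Ck k.+1 U u -> Ck k U u.
Proof.
elim: k u => [|k IH] u [du cu]; first by move=> x /du /differentiable_continuous.
by split=> // i; exact: IH.
Qed.

Lemma Ck_sub k U U' u : U' `<=` U -> Ck k U u -> Ck k U' u.
Proof.
move=> sU; elim: k u => [|k IH] u /=; first by move=> cu x /sU; exact: cu.
by move=> [du cu]; split=> [x /sU /du//|i]; exact: IH.
Qed.

Lemma Ck_cst k U (a : R) : Ck k U (fun=> a).
Proof.
elim: k a => [|k IH] a /=; first by move=> x _; exact: cst_continuous.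
split=> [x _|i]; first exact: differentiable_cst.
rewrite (_ : 'D_(E i) _ = fun=> 0); first exact: IH.
by apply: funext => x; rewrite derive_cst.
Qed.

Lemma Ck_add k U u v : open U -> Ck k U u -> Ck k U v ->
  Ck k U (fun x => u x + v x).
Proof.
move=> oU; elim: k u v => [|k IH] u v.
  by move=> cu cv x Ux; apply: continuousD; [exact: cu|exact: cv].
move=> [du cu] [dv cv]; split=> [x Ux|i].
  by apply: differentiableD; [exact: du|exact: dv].
apply: Ck_ext (IH _ _ (cu i) (cv i)) => // x Ux.
by rewrite deriveD //; apply: diff_derivable; [exact: du|exact: dv].
Qed.

Lemma Ck_mul k U u v : open U -> Ck k U u -> Ck k U v ->
  Ck k U (fun x => u x * v x).
Proof.
move=> oU; elim: k u v => [|k IH] u v.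
  by move=> cu cv x Ux; apply: continuousM; [exact: cu|exact: cv].
move=> Cu Cv; have Cu' := Ck_le Cu; have Cv' := Ck_le Cv.
move: Cu Cv => [du cu] [dv cv]; split=> [x Ux|i].
  by apply: differentiableM; [exact: du|exact: dv].
apply: Ck_ext (Ck_add oU (IH _ _ Cu' (cv i)) (IH _ _ Cv' (cu i))) => // x Ux.
by rewrite deriveM //; apply: diff_derivable; [exact: du|exact: dv].
Qed.

Lemma Ck_opp k U u : open U -> Ck k U u -> Ck k U (fun x => - u x).
Proof.
move=> oU Cu; apply: Ck_ext (Ck_mul oU (Ck_cst k U (- 1)) Cu) => // x _.
by rewrite mulN1r.
Qed.

Lemma Ck_inv k U u : open U -> (forall x, U x -> u x != 0) -> Ck k U u ->
  Ck k U (fun x => (u x)^-1).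
Proof.
move=> oU u0; elim: k => [|k IH].
  by move=> cu x Ux; apply: continuousV; [exact: u0|exact: cu].
move=> Cu; have Cv := IH (Ck_le Cu).
move: Cu => [du cu]; split=> [x Ux|i].
  by apply: differentiableV; [exact: du|exact: u0].
apply: Ck_ext (Ck_opp oU (Ck_mul oU (Ck_mul oU Cv Cv) (cu i))) => // x Ux.
rewrite deriveV ?u0 //; last by apply: diff_derivable; exact: du.
by rewrite /GRing.scale /= -exprVn expr2 mulNr.
Qed.

Lemma diff_row2 (W : normedModType R) (f : V -> W) x (h : V) : differentiable f x ->
  'd f x h = h 0 0 *: 'D_(E 0) f x + h 0 1 *: 'D_(E 1) f x.
Proof.
by move=> df; rewrite [X in 'd f x X = _]row2E linearD !linearZ !deriveE.
Qed.

Lemma differentiable_row2 (t : V -> V) x :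
  (forall j, differentiable (fun y => t y 0 j) x) -> differentiable t x.
Proof.
move=> dt.
rewrite (_ : t = (fun y => t y 0 0 *: E 0) + (fun y => t y 0 1 *: E 1)).
  by apply: differentiableD; apply: differentiableZl.
by apply: funext => y; rewrite {1}(row2E (t y)).
Qed.

Lemma derive_comp2 u (t : V -> V) x i :
  differentiable u (t x) -> (forall j, differentiable (fun y => t y 0 j) x) ->
  'D_(E i) (u \o t) x =
    'D_(E 0) u (t x) * 'D_(E i) (fun y => t y 0 0) x +
    'D_(E 1) u (t x) * 'D_(E i) (fun y => t y 0 1) x.
Proof.
move=> du dt; have dt' := differentiable_row2 dt.
rewrite deriveE; last exact: differentiable_comp.
rewrite diff_comp //= diff_row2 // -deriveE //.
rewrite derive_mx; last exact: diff_derivable.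
by rewrite !mxE /GRing.scale /=; congr (_ + _); rewrite mulrC.
Qed.

Lemma Ck_comp k U U' u (t : V -> V) : open U -> open U' ->
  (forall x, U' x -> U (t x)) ->
  Ck k U u -> (forall j, Ck k U' (fun x => t x 0 j)) -> Ck k U' (u \o t).
Proof.
move=> oU oU' tU; elim: k u => [|k IH] u.
  move=> cu ct x Ux.
  have ctx : {for x, continuous t}.
    rewrite (_ : t = (fun y => t y 0 0 *: E 0) + (fun y => t y 0 1 *: E 1)).
      by apply: continuousD; apply: continuousZr_tmp; exact: ct.
    by apply: funext => y; rewrite {1}(row2E (t y)).
  by apply: continuous_comp => //; exact/cu/tU.
move=> [du cu] ct; split=> [x Ux|i].
  apply: differentiable_comp; last exact/du/tU.
  by apply: differentiable_row2 => j; apply: (ct j).1.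
have ct' j := Ck_le (ct j).
apply: Ck_ext (Ck_add oU' (Ck_mul oU' (IH _ (cu 0) ct') ((ct 0).2 i))
  (Ck_mul oU' (IH _ (cu 1) ct') ((ct 1).2 i))) => // x Ux.
by rewrite derive_comp2 //=; [exact/du/tU|move=> j; apply: (ct j).1].
Qed.

(** The mean value theorem is applied first to the difference of u in direction [E j], then to
    ['D_(E i) u]. For i != j this yields the symmetry of mixed derivatives, for i = j the second
    derivative test at a maximum. *)
Lemma second_difference u x (i j : 'I_2) (s : R) :
  (forall k, `|k| <= `|s| *+ 2 -> differentiable u (x + k) /\
     differentiable ('D_(E i) u) (x + k)) ->
  exists2 k, `|k| <= `|s| *+ 2 &
  u (x + s *: E i + s *: E j) - u (x + s *: E i) - u (x + s *: E j) + u x =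
    s * s * 'D_(E j) ('D_(E i) u) (x + k).
Proof.
move=> dU.
have bnd (a : R) l : `|a| <= `|s| -> `|a *: E l| <= `|s|.
  by move=> h; rewrite normrZ (le_trans _ h) // ler_piMr // normE.
pose phi y := u (y + s *: E j) - u y.
have dphi t : `|t| <= `|s| ->
    is_derive (x + t *: E i) (E i) phi
     ('D_(E i) u (x + t *: E i + s *: E j) - 'D_(E i) u (x + t *: E i)).
  move=> ts; apply: is_deriveB; last first.
    apply/derivableP/diff_derivable; apply: (dU _ _).1.
    by rewrite (le_trans (bnd _ _ ts)) // mulr2n lerDl.
  have du1 : derivable u (x + t *: E i + s *: E j) (E i).
    apply/diff_derivable; rewrite -addrA; apply: (dU _ _).1.
    by rewrite (le_trans (ler_normD _ _)) // mulr2n lerD // bnd.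
  have E1 : (fun h : R => h^-1 *: ((u \o shift (x + t *: E i + s *: E j)) (h *: E i)
      - u (x + t *: E i + s *: E j))) =
    (fun h : R => h^-1 *: (((fun y => u (y + s *: E j)) \o shift (x + t *: E i)) (h *: E i)
      - u (x + t *: E i + s *: E j))).
    by apply: funext => h /=; rewrite addrA.
  by apply: DeriveDef; [move: du1; rewrite /derivable E1|rewrite /derive E1].
have [t ts e1] : exists2 t : R, `|t| <= `|s| & phi (x + s *: E i) - phi x =
    s * 'D_(E i) phi (x + t *: E i).
  by apply: line_MVT => t ts; case: (dphi t ts).
have [r rs e2] : exists2 r : R, `|r| <= `|s| &
  'D_(E i) u (x + t *: E i + s *: E j) - 'D_(E i) u (x + t *: E i) =
  s * 'D_(E j) ('D_(E i) u) (x + t *: E i + r *: E j).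
  apply: (@line_MVT _ _ ('D_(E i) u) (x + t *: E i) (E j) s) => r rs.
  apply: diff_derivable.
  have -> : x + t *: E i + r *: E j = x + (t *: E i + r *: E j) by rewrite addrA.
  apply: (dU _ _).2.
  by rewrite (le_trans (ler_normD _ _)) // mulr2n lerD // bnd.
exists (t *: E i + r *: E j).
  by rewrite (le_trans (ler_normD _ _)) // mulr2n lerD // bnd.
move: e1; rewrite (@derive_val _ _ _ _ _ _ _ (dphi t ts)) e2 mulrA addrA => <-.
by rewrite /phi opprB addrA; ring.
Qed.

Lemma ler_dist_half (a b c e : R) :
  `|c - a| <= e / 2 -> `|c - b| <= e / 2 -> `|a - b| <= e.
Proof.
move=> h1 h2; rewrite (splitr e) (le_trans (ler_distD c _ _)) // lerD //.
by rewrite distrC.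
Qed.

(** The second difference does not depend on the order of i and j, so the two mixed derivatives
    agree at two points close to x; continuity moves both points to x. *)
Lemma schwarz U u x (i j : 'I_2) : open U -> Ck 2 U u -> U x ->
  'D_(E i) ('D_(E j) u) x = 'D_(E j) ('D_(E i) u) x.
Proof.
move=> oU [du cu] Ux; apply/eqP; rewrite -subr_eq0; apply/eqP.
apply/normr0_eq0/eqP; rewrite eq_le normr_ge0 andbT.
apply/ler_addgt0Pr => e e0; rewrite add0r.
have c2 a b : \forall y \near x,
    `|'D_(E a) ('D_(E b) u) y - 'D_(E a) ('D_(E b) u) x| <= e / 2.
  by apply: continuous_near_le; [exact: (cu b).2|rewrite divr_gt0].
have /near0_small : \forall y \near x, [/\ U y,
    `|'D_(E i) ('D_(E j) u) y - 'D_(E i) ('D_(E j) u) x| <= e / 2 &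
    `|'D_(E j) ('D_(E i) u) y - 'D_(E j) ('D_(E i) u) x| <= e / 2].
  have := open_nbhs_nbhs (conj oU Ux).
  by apply: filterS3 (c2 i j) (c2 j i) => y *.
move=> /nbhs_ballP[d /= d0 dP].
pose h : V := const_mx (d / 2).
have hd : `|h| = d / 2.
  rewrite [LHS]/Num.Def.normr/= mx_normrE; apply/eqP; rewrite eq_le; apply/andP; split.
    apply: bigmax_le => [|[a b] _]; first by rewrite ltW // divr_gt0.
    by rewrite mxE ger0_norm // ltW // divr_gt0.
  apply: le_trans (le_bigmax _ _ (0, 0)); rewrite /= mxE ler_norm//.
have P k : `|k| <= d / 2 -> [/\ U (x + k),
    `|'D_(E i) ('D_(E j) u) (x + k) - 'D_(E i) ('D_(E j) u) x| <= e / 2 &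
    `|'D_(E j) ('D_(E i) u) (x + k) - 'D_(E j) ('D_(E i) u) x| <= e / 2].
  move=> kd; apply: (dP h); last by rewrite hd.
  by rewrite -ball_normE /ball_ /= sub0r normrN hd ltr_pdivrMr // ltr_pMr // ltr1n.
(* The points of [second_difference] lie within 2 |s| = d / 2 of x, where [P] applies. *)
pose s := d / 4.
have s0 : 0 < s by rewrite divr_gt0.
have s2 : `|s| *+ 2 = d / 2 by rewrite gtr0_norm // /s -mulr_natr; field.
have dd a k : `|k| <= `|s| *+ 2 -> differentiable u (x + k) /\
     differentiable ('D_(E a) u) (x + k).
  rewrite s2 => /P[Uk _ _]; split; [exact: du|exact: (cu a).1].
have [k ks ek] := second_difference j (dd i).
have [l ls el] := second_difference i (dd j).
have : 'D_(E j) ('D_(E i) u) (x + k) = 'D_(E i) ('D_(E j) u) (x + l).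
  apply: (@mulfI _ (s * s)); first by rewrite mulf_neq0 // gt_eqF.
  apply: (etrans (esym ek)); apply: (etrans _ el).
  have -> : x + s *: E j + s *: E i = x + s *: E i + s *: E j by rewrite addrAC.
  by congr (_ + _); exact: addrAC.
rewrite s2 in ks ls; have [_ _ h1] := P _ ks; have [_ h2 _] := P _ ls.
by move=> e3; rewrite e3 in h1; exact: ler_dist_half h2 h1.
Qed.

End Smooth.

(** * Local theory of minimal surfaces *)

(* Smooth complex functions on a plane domain: [dz] is d/dz, [cj] the conjugation
   and [dk] embeds the constants. *)
Record dring (R : rcfType) := DRing {
  dcar :> comPzRingType ;
  dz : dcar -> dcar ;
  cj : {rmorphism dcar -> dcar} ;
  dk : {rmorphism R[i] -> dcar} ;
  dzD : {morph dz : a b / a + b} ;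
  dzM : forall a b, dz (a * b) = dz a * b + a * dz b ;
  dz_dk : forall z, dz (dk z) = 0 ;
  cjK : involutive cj ;
  cj_dk : forall z, cj (dk z) = dk (conjc z) ;
  dz_cjC : forall a, dz (cj (dz (cj a))) = cj (dz (cj (dz a)))
}.
Arguments dz {R d} _.
Arguments cj {R d}.
Arguments dk {R d}.

(** The derivation d/dzbar; [dz_cjC] says that it commutes with d/dz. *)
Definition db (R : rcfType) (A : dring R) (a : A) : A := cj (dz (cj a)).

Section Derivations.
Variables (R : rcfType) (A : dring R).
Implicit Types a b : A.

Lemma dz0 : dz (0 : A) = 0.
Proof. by apply: (@addrI _ (dz (0 : A))); rewrite -dzD !addr0. Qed.
Lemma dzN a : dz (- a) = - dz a.
Proof. by apply: (@addrI _ (dz a)); rewrite -dzD !subrr dz0. Qed.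
Lemma dzB a b : dz (a - b) = dz a - dz b. Proof. by rewrite dzD dzN. Qed.
Lemma dz1 : dz (1 : A) = 0.
Proof. by rewrite -(rmorph1 (@dk _ A)) dz_dk. Qed.
Lemma dz_cj a : dz (cj a) = cj (db a). Proof. by rewrite /db cjK. Qed.
Lemma db_cj a : db (cj a) = cj (dz a). Proof. by rewrite /db cjK. Qed.
Lemma dbD a b : db (a + b) = db a + db b. Proof. by rewrite /db rmorphD dzD rmorphD. Qed.
Lemma dbN a : db (- a) = - db a. Proof. by rewrite /db rmorphN dzN rmorphN. Qed.
Lemma dbB a b : db (a - b) = db a - db b. Proof. by rewrite dbD dbN. Qed.
Lemma db0 : db (0 : A) = 0. Proof. by rewrite /db rmorph0 dz0 rmorph0. Qed.
Lemma db1 : db (1 : A) = 0. Proof. by rewrite /db rmorph1 dz1 rmorph0. Qed.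
Lemma dbM a b : db (a * b) = db a * b + a * db b.
Proof. by rewrite /db rmorphM dzM rmorphD !rmorphM !cjK. Qed.
Lemma db_dk z : db (dk z : A) = 0. Proof. by rewrite /db cj_dk dz_dk rmorph0. Qed.
Lemma dz_db a : dz (db a) = db (dz a). Proof. exact: dz_cjC. Qed.

Lemma dz_sum I (r : seq I) P (F : I -> A) :
  dz (\sum_(i <- r | P i) F i) = \sum_(i <- r | P i) dz (F i).
Proof. by apply: (big_morph (@dz R A)); [exact: dzD|exact: dz0]. Qed.
Lemma db_sum I (r : seq I) P (F : I -> A) :
  db (\sum_(i <- r | P i) F i) = \sum_(i <- r | P i) db (F i).
Proof. by apply: (big_morph (@db R A)); [exact: dbD|exact: db0]. Qed.

Lemma dz_inv a r : a * r = 1 -> dz r = - (dz a * r * r).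
Proof.
move=> ar; have := dz1; rewrite -ar dzM => h.
have -> : dz r = (a * r) * dz r by rewrite ar mul1r.
have -> : a * r * dz r = r * (dz a * r + a * dz r) - dz a * r * r by ring.
by rewrite h mulr0 sub0r.
Qed.
Lemma cj_inv a r : a * r = 1 -> cj a * cj r = 1.
Proof. by move=> ar; rewrite -rmorphM ar rmorph1. Qed.
Lemma db_inv a r : a * r = 1 -> db r = - (db a * r * r).
Proof.
move=> ar; rewrite /db (dz_inv (cj_inv ar)) rmorphN !rmorphM !cjK //.
Qed.
End Derivations.

Section Vectors.
Variables (R : rcfType) (A : dring R) (m : nat).
Implicit Types (v w : 'rV[A]_m) (a : A).

(** The complex bilinear form, not the Hermitian one: [ip v v = 0] is isotropy, and the Hermitian
    product is [ip v (cjv w)]. *)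
Definition ip (B : comPzRingType) (k : nat) (v w : 'rV[B]_k) : B := \sum_j v 0 j * w 0 j.
Definition dzv v : 'rV[A]_m := map_mx dz v.
Definition dbv v : 'rV[A]_m := map_mx (@db _ A) v.
Definition cjv v : 'rV[A]_m := map_mx cj v.

Lemma dz_ip v w : dz (ip v w) = ip (dzv v) w + ip v (dzv w).
Proof.
rewrite /ip dz_sum -big_split /=; apply: eq_bigr => j _.
by rewrite dzM !mxE.
Qed.
Lemma db_ip v w : db (ip v w) = ip (dbv v) w + ip v (dbv w).
Proof.
rewrite /ip db_sum -big_split /=; apply: eq_bigr => j _.
by rewrite dbM !mxE.
Qed.
Lemma cj_ip v w : cj (ip v w) = ip (cjv v) (cjv w).
Proof. by rewrite /ip rmorph_sum; apply: eq_bigr => j _; rewrite rmorphM !mxE. Qed.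
Lemma dzvD v w : dzv (v + w) = dzv v + dzv w.
Proof. by apply/rowP => j; rewrite !mxE dzD. Qed.
Lemma dzvN v : dzv (- v) = - dzv v.
Proof. by apply/rowP => j; rewrite !mxE dzN. Qed.
Lemma dzvB v w : dzv (v - w) = dzv v - dzv w.
Proof. by rewrite dzvD dzvN. Qed.
Lemma dzvZ a v : dzv (a *: v) = dz a *: v + a *: dzv v.
Proof. by apply/rowP => j; rewrite !mxE dzM. Qed.
Lemma dbvD v w : dbv (v + w) = dbv v + dbv w.
Proof. by apply/rowP => j; rewrite !mxE dbD. Qed.
Lemma dbvN v : dbv (- v) = - dbv v.
Proof. by apply/rowP => j; rewrite !mxE dbN. Qed.
Lemma dbvB v w : dbv (v - w) = dbv v - dbv w.
Proof. by rewrite dbvD dbvN. Qed.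
Lemma dbvZ a v : dbv (a *: v) = db a *: v + a *: dbv v.
Proof. by apply/rowP => j; rewrite !mxE dbM. Qed.
Lemma dzv_cj v : dzv (cjv v) = cjv (dbv v).
Proof. by apply/rowP => j; rewrite !mxE dz_cj. Qed.
Lemma dbv_cj v : dbv (cjv v) = cjv (dzv v).
Proof. by apply/rowP => j; rewrite !mxE db_cj. Qed.
Lemma dzv_dbv v : dzv (dbv v) = dbv (dzv v).
Proof. by apply/rowP => j; rewrite !mxE dz_db. Qed.
Lemma cjvK v : cjv (cjv v) = v.
Proof. by apply/rowP => j; rewrite !mxE cjK. Qed.
Lemma cjvD v w : cjv (v + w) = cjv v + cjv w.
Proof. by apply/rowP => j; rewrite !mxE rmorphD. Qed.
Lemma cjvN v : cjv (- v) = - cjv v.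
Proof. by apply/rowP => j; rewrite !mxE rmorphN. Qed.
Lemma cjvB v w : cjv (v - w) = cjv v - cjv w.
Proof. by rewrite cjvD cjvN. Qed.
Lemma cjvZ a v : cjv (a *: v) = cj a *: cjv v.
Proof. by apply/rowP => j; rewrite !mxE rmorphM. Qed.
End Vectors.

Section InnerProduct.
Variables (B : comPzRingType) (m : nat).
Implicit Types (u v w : 'rV[B]_m) (a : B).
Lemma ipC v w : ip v w = ip w v.
Proof. by apply: eq_bigr => j _; rewrite mulrC. Qed.
Lemma ipDl u v w : ip (u + v) w = ip u w + ip v w.
Proof. by rewrite /ip -big_split; apply: eq_bigr => j _; rewrite mxE mulrDl. Qed.
Lemma ipDr u v w : ip w (u + v) = ip w u + ip w v.
Proof. by rewrite ipC ipDl !(ipC w). Qed.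
Lemma ipZl a v w : ip (a *: v) w = a * ip v w.
Proof. by rewrite /ip mulr_sumr; apply: eq_bigr => j _; rewrite mxE mulrA. Qed.
Lemma ipZr a v w : ip v (a *: w) = a * ip v w.
Proof. by rewrite ipC ipZl ipC. Qed.
Lemma ipNl v w : ip (- v) w = - ip v w.
Proof. by rewrite -scaleN1r ipZl mulN1r. Qed.
Lemma ipNr v w : ip v (- w) = - ip v w.
Proof. by rewrite ipC ipNl ipC. Qed.
Lemma ip0l v : ip 0 v = 0.
Proof. by rewrite /ip big1 // => j _; rewrite mxE mul0r. Qed.
Lemma ip0r v : ip v 0 = 0. Proof. by rewrite ipC ip0l. Qed.
Definition ipE := (ipDl, ipDr, ipNl, ipNr, ipZl, ipZr, ip0l, ip0r).
End InnerProduct.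

(** 2 is invertible because [dk] embeds the constants. Differentiating a symmetric product such as
    <f, f> = 1 gives twice the desired relation. *)
Lemma eqr_half (R : rcfType) (A : dring R) (a b : A) : a + a = b + b -> a = b.
Proof.
move=> e; have h (c : A) : c = dk (2^-1) * (c + c).
  rewrite -[c + c]mulr2n -[c *+ 2]mulr_natl mulrA -(rmorph_nat (@dk _ A) 2).
  by rewrite -rmorphM mulVf ?pnatr_eq0 // rmorph1 mul1r.
by rewrite (h a) e -h.
Qed.

Section LocalSurface.
Variables (R : rcfType) (A : dring R) (m : nat).
Implicit Types (f : 'rV[A]_m) (rho r : A).

(* [r] is the inverse of the conformal factor [rho]. *)
Record conformal_minimal f rho r : Prop := ConformalMinimal {
  cm_real : cjv f = f ;
  cm_sphere : ip f f = 1 ;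
  cm_conformal : ip (dzv f) (dzv f) = 0 ;
  cm_rho : ip (dzv f) (cjv (dzv f)) = rho ;
  cm_inv : rho * r = 1 ;
  cm_minimal : dbv (dzv f) = - rho *: f
}.

(* For [q] the inverse of the cubic differential [Q] the frame equations are
   f1_z = (rho_z / rho) f1 + (Q / rho) e, e_z = rho eta and eta_zbar = - e.
   The locks keep [ring] and unification from unfolding the frame. *)
Definition F2 f rho r := locked (dzv (dzv f) - (dz rho * r) *: dzv f).
Definition sigma rho r := rho + db (dz rho * r).
Definition Fe f rho r q := locked ((rho * q) *: F2 f rho r).
Definition Feta f rho r q := locked (r *: dzv (Fe f rho r q)).
Definition Fc f rho r q := locked (ip (Feta f rho r q) (Feta f rho r q)).

Lemma F2E f rho r : F2 f rho r = dzv (dzv f) - (dz rho * r) *: dzv f.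
Proof. by rewrite /F2 -lock. Qed.
Lemma FeE f rho r q : Fe f rho r q = (rho * q) *: F2 f rho r.
Proof. by rewrite /Fe -lock. Qed.
Lemma FetaE f rho r q : Feta f rho r q = r *: dzv (Fe f rho r q).
Proof. by rewrite /Feta -lock. Qed.
(* The component of [dz eta] normal to [f, f1, e, eta] and their conjugates, when
   [c] is constant. *)
Definition Fk f rho r q :=
  locked (dzv (Feta f rho r q) + Fc f rho r q *: cjv (Fe f rho r q)).
Lemma FkE f rho r q : Fk f rho r q =
  dzv (Feta f rho r q) + Fc f rho r q *: cjv (Fe f rho r q).
Proof. by rewrite /Fk -lock. Qed.
Lemma FcE f rho r q : Fc f rho r q = ip (Feta f rho r q) (Feta f rho r q).
Proof. by rewrite /Fc -lock. Qed.

Section Basic.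
Variables (f : 'rV[A]_m) (rho r : A).
Hypothesis cm : conformal_minimal f rho r.
Notation f1 := (dzv f).
Notation f2 := (F2 f rho r).
Let hr := cm_inv cm.

Lemma cj_rho : cj rho = rho.
Proof. by rewrite -(cm_rho cm) cj_ip cjvK ipC. Qed.

Lemma dz_rhoE : dz rho = ip (dzv f1) (cjv f1).
Proof.
rewrite -(cm_rho cm) dz_ip dzv_cj (cm_minimal cm) cjvZ rmorphN cj_rho (cm_real cm).
suff -> : ip (dzv f) (- rho *: f) = 0 by rewrite addr0.
rewrite ipZr; suff -> : ip (dzv f) f = 0 by rewrite mulr0.
apply: (@eqr_half _ A); rewrite addr0 -[X in _ = X](dz1 A) -(cm_sphere cm) dz_ip.
by rewrite (ipC f).
Qed.

Lemma ip_f1f : ip f1 f = 0.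
Proof.
apply: (@eqr_half _ A); rewrite addr0 -[X in _ = X](dz1 A) -(cm_sphere cm) dz_ip.
by rewrite (ipC f).
Qed.
Lemma ip_f1bf : ip (cjv f1) f = 0.
Proof. by have := congr1 cj ip_f1f; rewrite cj_ip (cm_real cm) rmorph0. Qed.

Lemma ip_f2f : ip f2 f = 0.
Proof.
rewrite F2E !ipE ip_f1f mulr0 subr0.
have := congr1 dz ip_f1f; rewrite dz_ip dz0 .
by rewrite (cm_conformal cm) addr0.
Qed.

Lemma ip_f2f1 : ip f2 f1 = 0.
Proof.
rewrite F2E !ipE (cm_conformal cm) mulr0 subr0.
apply: (@eqr_half _ A); rewrite addr0 -[X in _ = X](dz0 A) -(cm_conformal cm) dz_ip.
by rewrite (ipC f1).
Qed.

Lemma ip_f2f1b : ip f2 (cjv f1) = 0.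
Proof. by rewrite F2E !ipE (cm_rho cm) -dz_rhoE; ring: hr. Qed.

(** The Codazzi equation: f_zz is differentiated by commuting d/dz with d/dzbar and inserting f_(z
    zbar) = - rho f; the zbar-derivative of rho_z / rho supplies sigma. *)
Lemma dbv_f2 : dbv f2 = - sigma rho r *: f1.
Proof.
rewrite F2E dbvB dbvZ -dzv_dbv (cm_minimal cm) dzvZ dzN.
by apply/rowP => j; rewrite !mxE /sigma; ring: hr.
Qed.

Lemma dzv_f1 : dzv f1 = (dz rho * r) *: f1 + f2.
Proof. by rewrite F2E addrC subrK. Qed.

(** The Gauss equation, obtained by applying d/dzbar to <F, conj f_z> = 0. *)
Lemma ip_f2f2b : ip f2 (cjv f2) = sigma rho r * rho.
Proof.
have := congr1 (@db _ A) ip_f2f1b; rewrite db_ip db0 dbv_f2 dbv_cj dzv_f1 cjvD cjvZ !ipE.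
rewrite ip_f2f1b (cm_rho cm) => /eqP; rewrite mulr0 add0r addrC addr_eq0 => /eqP ->.
by rewrite mulNr opprK.
Qed.

Lemma cj_sigma : cj (sigma rho r) = sigma rho r.
Proof.
have h : sigma rho r = ip f2 (cjv f2) * r by rewrite ip_f2f2b; ring: hr.
have cr : cj r = r.
  have e : rho * cj r = 1 by rewrite -[in LHS]cj_rho cj_inv.
  by rewrite -[LHS]mul1r -hr mulrAC e mul1r.
by rewrite h rmorphM cj_ip cjvK ipC cr.
Qed.

Lemma cj_r : cj r = r.
Proof.
have e : rho * cj r = 1 by rewrite -[in LHS]cj_rho cj_inv.
by rewrite -[LHS]mul1r -hr mulrAC e mul1r.
Qed.

(** F_zbar is a multiple of f_z, to which F is orthogonal; so the quartic differential is
    holomorphic. *)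
Lemma db_phi1 : db (ip f2 f2) = 0.
Proof. by rewrite db_ip dbv_f2 !ipE (ipC f1) ip_f2f1 mulr0 addr0. Qed.

Section Isotropic.
Variables (Q q : A).
Hypotheses (dbQ : db Q = 0) (hq : Q * q = 1).
Hypothesis QQ : Q * cj Q = rho * rho * sigma rho r.
Hypothesis iso : ip f2 f2 = 0.
Notation e := (Fe f rho r q).
Notation eta := (Feta f rho r q).
Notation c := (Fc f rho r q).

Lemma eE : f2 = (Q * r) *: e.
Proof.
rewrite FeE scalerA; have -> : Q * r * (rho * q) = (Q * q) * (rho * r) by ring.
by rewrite hq hr mulr1 scale1r.
Qed.

Lemma dzv_f1e : dzv f1 = (dz rho * r) *: f1 + (Q * r) *: e.
Proof. by rewrite dzv_f1 eE. Qed.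

Lemma dzv_e : dzv e = rho *: eta.
Proof. by rewrite FetaE scalerA hr scale1r. Qed.

Lemma db_q : db q = 0.
Proof. by rewrite (db_inv hq) dbQ !mul0r oppr0. Qed.

Lemma sigmaE : sigma rho r = Q * cj Q * r * r.
Proof. by rewrite QQ; ring: hr. Qed.

Lemma dbv_e : dbv e = (db rho * r) *: e - (cj Q * r) *: f1.
Proof.
rewrite {1}FeE dbvZ dbv_f2 dbM db_q mulr0 addr0  eE sigmaE.
apply/rowP => j; rewrite !mxE; ring: hr hq.
Qed.

Lemma dzv_f1b : dzv (cjv f1) = - rho *: f.
Proof. by rewrite dzv_cj (cm_minimal cm) cjvZ rmorphN cj_rho (cm_real cm). Qed.

Lemma dzv_eb : dzv (cjv e) = (dz rho * r) *: cjv e - (Q * r) *: cjv f1.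
Proof.
rewrite dzv_cj dbv_e cjvB !cjvZ !rmorphM cjK cj_r; congr (_ *: _ - _).
by rewrite -dz_cj cj_rho.
Qed.

Lemma dbv_eb : dbv (cjv e) = rho *: cjv eta.
Proof. by rewrite dbv_cj dzv_e cjvZ cj_rho. Qed.

Lemma ip_ef : ip e f = 0.
Proof. by rewrite FeE ipZl ip_f2f mulr0. Qed.
Lemma ip_ebf : ip (cjv e) f = 0.
Proof. by have := congr1 cj ip_ef; rewrite cj_ip (cm_real cm) rmorph0. Qed.
Lemma ip_ef1 : ip e f1 = 0.
Proof. by rewrite FeE ipZl ip_f2f1 mulr0. Qed.
Lemma ip_ef1b : ip e (cjv f1) = 0.
Proof. by rewrite FeE ipZl ip_f2f1b mulr0. Qed.
Lemma ip_ee : ip e e = 0.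
Proof. by rewrite FeE !ipE iso !mulr0. Qed.
Lemma ip_eeb : ip e (cjv e) = rho.
Proof.
rewrite FeE cjvZ !ipE ip_f2f2b sigmaE rmorphM cj_rho.
have hqb := cj_inv hq; ring: hr hq hqb.
Qed.

(** Differentiate <e, v> = 0 and divide by rho. *)
Lemma eta_ortho v : ip e v = 0 -> ip e (dzv v) = 0 -> ip eta v = 0.
Proof.
move=> h0 h1; have := congr1 dz h0; rewrite dz_ip dz0 h1 addr0 dzv_e ipZl => h.
by rewrite -[LHS]mul1r -hr mulrAC h mul0r.
Qed.

Lemma ip_etaf : ip eta f = 0.
Proof. by apply: eta_ortho; rewrite ?ip_ef ?ip_ef1. Qed.
Lemma ip_etaf1 : ip eta f1 = 0.
Proof. by apply: eta_ortho; rewrite ?dzv_f1e ?ipE ?ip_ef1 ?ip_ee ?mulr0 ?addr0. Qed.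
Lemma ip_etaf1b : ip eta (cjv f1) = 0.
Proof. by apply: eta_ortho; rewrite ?dzv_f1b ?ipE ?ip_ef1b ?ip_ef ?mulr0. Qed.
Lemma ip_etae : ip eta e = 0.
Proof.
apply: (@eqr_half _ A); rewrite addr0.
have := congr1 dz ip_ee; rewrite dz_ip dz0 dzv_e !ipE (ipC e) => h.
by rewrite -[LHS]mul1r -hr -[RHS](mulr0 r) -h; ring.
Qed.
Lemma ip_etaeb : ip eta (cjv e) = 0.
Proof.
have := congr1 dz ip_eeb; rewrite dz_ip dzv_e dzv_eb !ipE ip_eeb ip_ef1b => h.
have : rho * ip eta (cjv e) = 0.
  by rewrite -(subrr (dz rho)) -[X in _ = X - _]h; ring: hr.
by move=> h'; rewrite -[LHS]mul1r -hr mulrAC h' mul0r.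
Qed.

(** The mixed derivative e_(z zbar) is computed in both orders. Here sigma - rho is (log rho)_(z
    zbar), and sigma cancels against |Q|^2 / rho^2, which leaves - rho e. *)
Lemma dbv_eta : dbv eta = - e.
Proof.
have h : rho *: dbv eta + db rho *: eta = dzv (dbv e).
  by rewrite dzv_dbv dzv_e dbvZ addrC.
have h2 : rho *: dbv eta = - rho *: e.
  rewrite -[LHS](addrK (db rho *: eta)) h dbv_e dzvB !dzvZ dzv_e dzv_f1e.
  have := sigmaE; rewrite /sigma => /(canRL (addKr _)) hs.
  have hs' : dz (db rho * r) = db (dz rho * r).
    by rewrite dzM dbM (dz_inv hr) (db_inv hr) dz_db; ring.
  rewrite hs' hs dzM dz_cj dbQ rmorph0 (dz_inv hr).
  apply/rowP => j; rewrite !mxE; ring: hr.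
rewrite -[LHS]scale1r -hr mulrC -scalerA h2 scalerA.
by rewrite mulrN mulrC hr scaleN1r.
Qed.

Lemma ip_etaetab : ip eta (cjv eta) = 1.
Proof.
have := congr1 (@db _ A) ip_etaeb; rewrite db_ip db0 dbv_eta dbv_eb !ipE ip_eeb => h.
have : rho * ip eta (cjv eta) = rho.
  by apply/eqP; rewrite -subr_eq0 addrC h.
by move=> h'; rewrite -[LHS]mul1r -hr mulrAC h' hr.
Qed.

Lemma dbv_etab : dzv (cjv eta) = - cjv e.
Proof. by rewrite dzv_cj dbv_eta cjvN. Qed.

(** Since eta_zbar = - e and <e, eta> = 0. *)
Lemma db_c : db c = 0.
Proof. by rewrite FcE db_ip dbv_eta !ipE  (ipC e) ip_etae !oppr0 addr0. Qed.

Lemma dzv_eta_degenerate : dz c = 0 -> cjv eta = cj c *: eta -> c * cj c = 1 ->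
  dzv eta = - c *: cjv e.
Proof.
move=> dc h cc.
have -> : eta = c *: cjv eta by rewrite h scalerA cc scale1r.
by rewrite dzvZ dc scale0r add0r dbv_etab scaleNr scalerN.
Qed.

Notation k := (Fk f rho r q).
Hypothesis dc : dz c = 0.

Lemma ip_kf : ip k f = 0.
Proof.
rewrite FkE !ipE.
have := congr1 dz ip_etaf; rewrite dz_ip dz0  ip_etaf1 addr0 => ->.
by rewrite ip_ebf mulr0 add0r.
Qed.
Lemma ip_kf1 : ip k f1 = 0.
Proof.
rewrite FkE !ipE.
have := congr1 dz ip_etaf1; rewrite dz_ip dz0 dzv_f1e !ipE ip_etaf1 ip_etae !mulr0.
rewrite !addr0 => ->.
by rewrite -(cjvK f1) -cj_ip ip_ef1b rmorph0 mulr0 add0r.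
Qed.
Lemma ip_kf1b : ip k (cjv f1) = 0.
Proof.
rewrite FkE !ipE.
have := congr1 dz ip_etaf1b; rewrite dz_ip dz0 dzv_f1b !ipE ip_etaf mulr0 addr0 => ->.
by rewrite -cj_ip ip_ef1 rmorph0 mulr0 add0r.
Qed.
Lemma ip_ke : ip k e = 0.
Proof.
rewrite FkE !ipE.
have := congr1 dz ip_etae; rewrite dz_ip dz0 dzv_e !ipE  -?FcE => h.
by rewrite (ipC (cjv e)) ip_eeb -h FcE ; ring.
Qed.
Lemma ip_keb : ip k (cjv e) = 0.
Proof.
rewrite FkE !ipE.
have := congr1 dz ip_etaeb; rewrite dz_ip dz0 dzv_eb !ipE ip_etaeb ip_etaf1b => h.
rewrite -cj_ip ip_ee rmorph0 mulr0 addr0 -h; ring.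
Qed.
Lemma ip_keta : ip k eta = 0.
Proof.
rewrite FkE !ipE (ipC (cjv e)) ip_etaeb mulr0 addr0.
apply: (@eqr_half _ A); rewrite addr0 -[RHS]dc FcE dz_ip .
by rewrite (ipC eta).
Qed.
Lemma ip_ketab : ip k (cjv eta) = 0.
Proof.
rewrite FkE !ipE -cj_ip (ipC e) ip_etae rmorph0 mulr0 addr0.
have := congr1 dz ip_etaetab; rewrite dz_ip dz1 dbv_etab !ipE ip_etaeb oppr0 addr0.
by [].
Qed.

Lemma dbv_k : dbv k = - rho *: eta + (c * rho) *: cjv eta.
Proof.
rewrite FkE dbvD dbvZ -dzv_dbv dbv_eta dzvN dzv_e db_c scale0r add0r dbv_eb.
by rewrite scalerA scaleNr.
Qed.

Lemma db_kk : db (ip k k) = 0.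
Proof.
rewrite db_ip dbv_k !ipE (ipC _ k) (ipC _ k) ip_keta ip_ketab !mulr0 !addr0 //.
Qed.

(** The zbar-derivative of <k, conj eta> = 0 contains <k, conj k>, and the other terms follow from
    [dbv_k]. *)
Lemma ip_kkb : ip k (cjv k) = rho * (1 - c * cj c).
Proof.
have := congr1 (@db _ A) ip_ketab; rewrite db_ip db0 dbv_k dbv_cj.
have -> : dzv eta = k - c *: cjv e by rewrite FkE addrK.
rewrite cjvB cjvZ cjvK !ipE ip_etaetab ip_ke.
have -> : ip (cjv eta) (cjv eta) = cj c by rewrite FcE cj_ip.
move=> h; apply/eqP; rewrite -subr_eq0; apply/eqP; rewrite -[RHS]h; ring.
Qed.

End Isotropic.
End Basic.
End LocalSurface.

(** * Orthogonal families in C^m *)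

Section Hermitian.
Variables (R : rcfType) (m : nat).
Notation C := R[i].
Implicit Types u v : 'rV[C]_m.

Definition conjv v : 'rV[C]_m := map_mx (@conjc R) v.
Definition hip u v : C := ip u (conjv v).

Lemma hip_conj u v : conjc (hip u v) = hip v u.
Proof.
rewrite /hip /ip rmorph_sum; apply: eq_bigr => j _.
by rewrite rmorphM !mxE /= conjcK mulrC.
Qed.

Lemma hip_eq0 v : hip v v = 0 -> v = 0.
Proof.
move=> /eqP; rewrite psumr_eq0 => [/allP h|j _]; last by rewrite mxE mulcJ_ge0.
apply/rowP => j; have := h j (mem_index_enum _); rewrite !mxE /= -sqr_normc.
by rewrite sqrf_eq0 normr_eq0 => /eqP.
Qed.

(** The Gram matrix is diagonal with nonzero diagonal, hence invertible, and it factors through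
    C^m. *)
Lemma ortho_size (s : seq 'rV[C]_m) : all (fun v => hip v v != 0) s ->
  pairwise (fun u v => hip u v == 0) s -> (size s <= m)%N.
Proof.
move=> /allP nz /(pairwiseP 0) orth.
pose S := \matrix_(i < size s) s`_i.
pose D := S *m (map_mx (@conjc R) S)^T.
have DE i j : D i j = hip s`_i s`_j.
  by rewrite mxE; apply: eq_bigr => k _; rewrite !mxE.
have Dd : D = diag_mx (\row_i D i i).
  apply/matrixP => i j; rewrite [RHS]mxE [in RHS]mxE; case: eqVneq => [->|ij] //=.
  rewrite mulr0n DE; have := ij; rewrite -val_eqE neq_ltn => /orP[lt|lt].
    by apply/eqP; apply: (orth i j) => //; rewrite inE.
  by rewrite -hip_conj (eqP (orth j i _ _ lt)) ?inE // rmorph0.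
have uD : D \in unitmx.
  rewrite unitmxE Dd det_diag unitfE; apply/prodf_neq0 => i _.
  by rewrite mxE DE nz // mem_nth.
have := mxrankM_maxl S (map_mx (@conjc R) S)^T.
rewrite -/D (mxrank_unit uD) => /leq_trans; apply; exact: rank_leq_col.
Qed.
End Hermitian.

(** * Laplacians for real solutions of u_(z zbar) = - rho u *)

Section Scalar.
Variables (R : rcfType) (A : dring R) (rho r u : A).
Hypotheses (hr : rho * r = 1) (rr : cj rho = rho).
Hypotheses (ur : cj u = u) (hu : db (dz u) = - (rho * u)).
Let u2 := dz (dz u) - dz rho * r * dz u.

Lemma cj_invr : cj r = r.
Proof.
have e : rho * cj r = 1 by rewrite -[in LHS]rr cj_inv.
by rewrite -[LHS]mul1r -hr mulrAC e mul1r.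
Qed.

(** The Bochner formula for |u_z|^2 / rho: [u2] is the (2,0) part of the Hessian of u, and sigma /
    rho + 1 is 2 - K. *)
Lemma laplacian_gradient :
  db (dz (dz u * cj (dz u) * r)) =
  u2 * cj u2 * r - (sigma rho r * r + 1) * (dz u * cj (dz u)) + rho * (u * u).
Proof.
have dcu : dz (cj (dz u)) = - (rho * u).
  by rewrite dz_cj hu rmorphN rmorphM rr ur.
have h1 : dz (dz u * cj (dz u) * r) = u2 * cj (dz u) * r - u * dz u.
  by rewrite !dzM dcu (dz_inv hr) /u2; ring: hr.
have h2 : db u2 = - sigma rho r * dz u.
  rewrite /u2 dbB dbM hu -dz_db hu dzN dzM /sigma; ring: hr.
have h3 : db (cj (dz u)) = cj u2 + cj (dz rho * r) * cj (dz u).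
  by rewrite db_cj -rmorphM -rmorphD /u2 subrK.
have h4 : db r = - (cj (dz rho) * r * r).
  by rewrite (db_inv hr) /db rr.
have du : db u = cj (dz u) by rewrite /db ur.
rewrite h1 dbB !dbM h2 h3 h4 du hu rmorphM cj_invr; ring: hr.
Qed.

Lemma laplacian_square : db (dz (u * u)) =
  dz u * cj (dz u) + dz u * cj (dz u) - (rho * (u * u) + rho * (u * u)).
Proof.
have du : db u = cj (dz u) by rewrite /db ur.
by rewrite dzM dbD !dbM hu du; ring.
Qed.
End Scalar.

(** * Behaviour under a holomorphic change of coordinate *)

Section Transition.
Variables (R : rcfType) (A A' : dring R) (phi : {rmorphism A -> A'}) (l li : A').

(* [phi] is composition with a holomorphic map with derivative [l], whose inverse
   is [li]. *)
Record dmorph : Prop := DMorph {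
  dm_dz : forall a, dz (phi a) = l * phi (dz a) ;
  dm_cj : forall a, cj (phi a) = phi (cj a) ;
  dm_inv : l * li = 1 ;
  dm_hol : db l = 0
}.
Hypothesis dm : dmorph.
Let hl := dm_inv dm.

Definition mapv m (v : 'rV[A]_m) : 'rV[A']_m := map_mx phi v.

Lemma dz_mapv m (v : 'rV[A]_m) : dzv (mapv v) = l *: mapv (dzv v).
Proof. by apply/rowP => j; rewrite !mxE (dm_dz dm). Qed.
Lemma cj_mapv m (v : 'rV[A]_m) : cjv (mapv v) = mapv (cjv v).
Proof. by apply/rowP => j; rewrite !mxE (dm_cj dm). Qed.
Lemma ip_mapv m (v w : 'rV[A]_m) : ip (mapv v) (mapv w) = phi (ip v w).
Proof. by rewrite /ip rmorph_sum; apply: eq_bigr => j _; rewrite rmorphM !mxE. Qed.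
Lemma mapvZ m a (v : 'rV[A]_m) : mapv (a *: v) = phi a *: mapv v.
Proof. by apply/rowP => j; rewrite !mxE rmorphM. Qed.
Lemma mapvB m (v w : 'rV[A]_m) : mapv (v - w) = mapv v - mapv w.
Proof. by apply/rowP => j; rewrite !mxE rmorphB. Qed.
Lemma dz_cjl : dz (cj l) = 0.
Proof. by rewrite dz_cj (dm_hol dm) rmorph0. Qed.

Section Surface.
Variables (m : nat) (f : 'rV[A]_m) (f' : 'rV[A']_m) (rho r : A) (rho' r' : A').
Hypothesis (hr : rho * r = 1) (hr' : rho' * r' = 1).
Hypotheses (fE : f' = mapv f) (rhoE : rho' = l * cj l * phi rho).

Lemma r_transition : r' = li * cj li * phi r.
Proof.
have hlb := cj_inv hl.
have hp : phi rho * phi r = 1 by rewrite -rmorphM hr rmorph1.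
have h : rho' * (li * cj li * phi r) = 1.
  by rewrite rhoE -[RHS]mul1r -{1}hl -[RHS]mulr1 -{2}hlb -hp; ring.
by rewrite -[LHS]mulr1 -h mulrA [r' * _]mulrC hr' mul1r.
Qed.

Lemma f1_transition : dzv f' = l *: mapv (dzv f).
Proof. by rewrite fE dz_mapv. Qed.

Lemma drho_transition : dz rho' * r' = l * phi (dz rho * r) + dz l * li.
Proof.
rewrite r_transition rhoE !dzM dz_cjl (dm_dz dm) rmorphM.
have hlb := cj_inv hl.
have hp : phi rho * phi r = 1 by rewrite -rmorphM hr rmorph1.
by ring: hl hlb hp.
Qed.

Lemma F2_transition : F2 f' rho' r' = l ^+ 2 *: mapv (F2 f rho r).
Proof.
rewrite !F2E f1_transition drho_transition dzvZ dz_mapv mapvB mapvZ rmorphM.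
by apply/rowP => j; rewrite !mxE; ring: hl.
Qed.

Lemma sigma_transition : sigma rho' r' = l * cj l * phi (sigma rho r).
Proof.
rewrite /sigma drho_transition dbD dbM (dm_hol dm) mul0r add0r.
have hh : db (dz l * li) = 0.
  rewrite dbM -dz_db (dm_hol dm) dz0 mul0r add0r (db_inv hl) (dm_hol dm).
  by rewrite !mul0r oppr0 mulr0.
have hd a : db (phi a) = cj l * phi (db a).
  by rewrite /db (dm_cj dm) (dm_dz dm) rmorphM (dm_cj dm).
by rewrite hh addr0 hd rmorphD rhoE; ring.
Qed.

Variables (Q q : A) (Q' q' : A').
Hypothesis (hq : Q * q = 1) (hq' : Q' * q' = 1).
Hypothesis QE : Q' = l ^+ 3 * phi Q.

(** The weights are l^2 for F, l conj l for rho and l^3 for Q, so e = rho F / Q has weight conj l.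
    Then eta = e_z / rho has weight 0: it does not depend on the coordinate, and neither does c. *)
Lemma Fe_transition : Fe f' rho' r' q' = cj l *: mapv (Fe f rho r q).
Proof.
have qE : q' = li ^+ 3 * phi q.
  have hp : phi Q * phi q = 1 by rewrite -rmorphM hq rmorph1.
  have h : Q' * (li ^+ 3 * phi q) = 1 by rewrite QE; ring: hl hp.
  by rewrite -[LHS]mulr1 -h mulrA [q' * _]mulrC hq' mul1r.
rewrite !FeE F2_transition mapvZ qE rhoE rmorphM.
by apply/rowP => j; rewrite !mxE; ring: hl.
Qed.

Lemma Feta_transition : Feta f' rho' r' q' = mapv (Feta f rho r q).
Proof.
rewrite !FetaE Fe_transition dzvZ dz_cjl scale0r add0r dz_mapv mapvZ r_transition.
have hlb := cj_inv hl.
by apply/rowP => j; rewrite !mxE; ring: hl hlb.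
Qed.

Lemma Fc_transition : Fc f' rho' r' q' = phi (Fc f rho r q).
Proof. by rewrite !FcE Feta_transition ip_mapv. Qed.
End Surface.
End Transition.

(** * Comparison of two surfaces with the same constant c of modulus 1 *)

Section Frames.
Variables (R : rcfType) (A : dring R) (rho r Q q c : A).

(* The case |c| = 1, in which [eta] and its conjugate span a line. *)
Record degenerate m (f : 'rV[A]_m) : Prop := Degenerate {
  dg_cm : conformal_minimal f rho r ;
  dg_iso : ip (F2 f rho r) (F2 f rho r) = 0 ;
  dg_c : Fc f rho r q = c ;
  dg_eta : cjv (Feta f rho r q) = cj c *: Feta f rho r q
}.
Hypotheses (dbQ : db Q = 0) (hq : Q * q = 1).
Hypothesis QQ : Q * cj Q = rho * rho * sigma rho r.
Hypotheses (cc : c * cj c = 1) (dc : dz c = 0).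

(* The matrix that takes the frame of [f] to that of [f']. *)
Definition transfer m m' (f : 'rV[A]_m) (f' : 'rV[A]_m') : 'M[A]_(m, m') :=
  \matrix_(i, j) (f 0 i * f' 0 j +
  r * (cjv (dzv f) 0 i * dzv f' 0 j + dzv f 0 i * cjv (dzv f') 0 j) +
  r * (cjv (Fe f rho r q) 0 i * Fe f' rho r q 0 j +
       Fe f rho r q 0 i * cjv (Fe f' rho r q) 0 j) +
  cjv (Feta f rho r q) 0 i * Feta f' rho r q 0 j).

Lemma transferE m m' (f : 'rV[A]_m) (f' : 'rV[A]_m') : transfer f f' =
  f^T *m f' +
  r *: ((cjv (dzv f))^T *m dzv f' + (dzv f)^T *m cjv (dzv f')) +
  r *: ((cjv (Fe f rho r q))^T *m Fe f' rho r q +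
        (Fe f rho r q)^T *m cjv (Fe f' rho r q)) +
  (cjv (Feta f rho r q))^T *m Feta f' rho r q.
Proof. by apply/matrixP => i j; rewrite !mxE !big_ord1 !mxE. Qed.

Lemma mul_outer m m' (v f : 'rV[A]_m) (f' : 'rV[A]_m') :
  v *m (f^T *m f') = ip v f *: f'.
Proof.
rewrite mulmxA; apply/rowP => j; rewrite !mxE big_ord1 !mxE; congr (_ * _).
by apply: eq_bigr => k _; rewrite !mxE.
Qed.

Lemma mul_transfer m m' (v f : 'rV[A]_m) (f' : 'rV[A]_m') :
  v *m transfer f f' = ip v f *: f' +
  r *: (ip v (cjv (dzv f)) *: dzv f' + ip v (dzv f) *: cjv (dzv f')) +
  r *: (ip v (cjv (Fe f rho r q)) *: Fe f' rho r q +
        ip v (Fe f rho r q) *: cjv (Fe f' rho r q)) +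
  ip v (cjv (Feta f rho r q)) *: Feta f' rho r q.
Proof. by rewrite transferE !mulmxDr -!scalemxAr !mulmxDr !mul_outer. Qed.

Lemma eta_conj m (f : 'rV[A]_m) : degenerate f ->
  Feta f rho r q = c *: cjv (Feta f rho r q).
Proof. by move=> df; rewrite (dg_eta df) scalerA cc scale1r. Qed.

(** Both conjugations produce the same constant c. This is where equality of the constants makes the
    eta term of [transfer] real, and symmetric in the two surfaces. *)
Lemma eta_swap m m' (f : 'rV[A]_m) (f' : 'rV[A]_m') i j :
  degenerate f -> degenerate f' ->
  Feta f rho r q 0 i * cjv (Feta f' rho r q) 0 j =
  cjv (Feta f rho r q) 0 i * Feta f' rho r q 0 j.
Proof.
move=> df df'.
have h1 := congr1 (fun v : 'rV[A]_m => v 0 i) (eta_conj df).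
have h2 := congr1 (fun v : 'rV[A]_m' => v 0 j) (dg_eta df').
by rewrite !mxE in h1 h2 *; rewrite {1}h1 h2; ring: cc.
Qed.

Lemma transfer_tr m m' (f : 'rV[A]_m) (f' : 'rV[A]_m') :
  degenerate f -> degenerate f' -> (transfer f f')^T = transfer f' f.
Proof.
move=> df df'; apply/matrixP => i j; rewrite mxE mxE [RHS]mxE.
by rewrite -(eta_swap i j df' df) [cjv (Feta f rho r q) 0 j * _]mulrC; ring.
Qed.

Lemma cj_entry m (v : 'rV[A]_m) i : cj (v 0 i) = cjv v 0 i.
Proof. by rewrite mxE. Qed.
Lemma dz_entry m (v : 'rV[A]_m) i : dz (v 0 i) = dzv v 0 i.
Proof. by rewrite mxE. Qed.

Section TwoSurfaces.
Variables (m m' : nat) (f : 'rV[A]_m) (f' : 'rV[A]_m').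
Hypotheses (df : degenerate f) (df' : degenerate f').
Let hr := cm_inv (dg_cm df).

Lemma cj_transfer i j : cj (transfer f f' i j) = transfer f f' i j.
Proof.
rewrite mxE !rmorphD !rmorphM !rmorphD !rmorphM.
rewrite !cj_entry !cjvK (cj_r (dg_cm df)) (cm_real (dg_cm df)) (cm_real (dg_cm df')).
by rewrite (eta_swap i j df df'); ring.
Qed.

Section Scalars.
Variables (m0 : nat) (g : 'rV[A]_m0) (i : 'I_m0).
Hypothesis dg : degenerate g.
Let cm := dg_cm dg.
Let iso := dg_iso dg.

Let ent (u v w : 'rV[A]_m0) a b : u = a *: v + b *: w ->
   u 0 i = a * v 0 i + b * w 0 i.
Proof. by move=> ->; rewrite !mxE. Qed.
Let ent1 (u v : 'rV[A]_m0) a : u = a *: v -> u 0 i = a * v 0 i.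
Proof. by move=> ->; rewrite !mxE. Qed.

Lemma scalar_system1 : [/\ dz (g 0 i) = dzv g 0 i,
    dz (dzv g 0 i) = dz rho * r * dzv g 0 i + Q * r * Fe g rho r q 0 i,
    dz (cjv (dzv g) 0 i) = - rho * g 0 i &
    dz (Fe g rho r q 0 i) = rho * Feta g rho r q 0 i].
Proof.
split; rewrite ?dz_entry //.
- by apply: ent; apply: (dzv_f1e cm).
- by apply: ent1; apply: (dzv_f1b cm).
- by apply: ent1; apply: (dzv_e cm).
Qed.

Lemma scalar_system2 : [/\ dz (cjv (Fe g rho r q) 0 i) =
        dz rho * r * cjv (Fe g rho r q) 0 i - Q * r * cjv (dzv g) 0 i,
    dz (Feta g rho r q 0 i) = - c * cjv (Fe g rho r q) 0 i,
    dz (cjv (Feta g rho r q) 0 i) = - cjv (Fe g rho r q) 0 i &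
    Feta g rho r q 0 i = c * cjv (Feta g rho r q) 0 i].
Proof.
split; rewrite ?dz_entry //.
- rewrite -mulNr; apply: ent.
  by rewrite scaleNr; apply: (dzv_eb cm).
- apply: ent1; rewrite -(dg_c dg).
  apply: (dzv_eta_degenerate cm dbQ hq QQ); rewrite ?(dg_c dg) //.
  exact: dg_eta.
- rewrite -mulN1r; apply: ent1; rewrite scaleN1r.
  exact: (dbv_etab cm dbQ hq QQ).
- by apply: ent1; exact: eta_conj.
Qed.
End Scalars.

(** Both frames satisfy the same linear system, and it is skew for the pairing in [transfer], so
    that the terms cancel in pairs. *)
Lemma dz_transfer i j : dz (transfer f f' i j) = 0.
Proof.
have [a1 a2 a3 a4] := scalar_system1 i df.
have [a5 a6 a7 a8] := scalar_system2 i df.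
have [b1 b2 b3 b4] := scalar_system1 j df'.
have [b5 b6 b7 b8] := scalar_system2 j df'.
rewrite mxE !(dzD, dzM) a1 a2 a3 a4 a5 a7 b1 b2 b3 b4 b5 b6 (dz_inv hr) a8.
move: (f 0 i) (f' 0 j) (dzv f 0 i) (dzv f' 0 j) (cjv (dzv f) 0 i)
  (cjv (dzv f') 0 j) (Fe f rho r q 0 i) (Fe f' rho r q 0 j)
  (cjv (Fe f rho r q) 0 i) (cjv (Fe f' rho r q) 0 j) (cjv (Feta f rho r q) 0 i)
  (Feta f' rho r q 0 j).
by move=> *; ring: hr.
Qed.

Lemma transfer_f : f *m transfer f f' = f'.
Proof.
have cm := dg_cm df; rewrite mul_transfer (cm_sphere cm).
rewrite !(ipC f) (ip_f1f cm) (ip_f1bf cm) (ip_ef cm) (ip_ebf cm).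
have -> : ip (cjv (Feta f rho r q)) f = 0.
  by rewrite (dg_eta df) ipZl (ip_etaf cm) ?mulr0.
by rewrite !scale0r !addr0 !scaler0 !addr0 scale1r.
Qed.

Let O := transfer f f'.
(** The transfer matrix is constant and real, so it commutes with differentiation and conjugation.
    Starting from f O = f', this carries each frame vector of f to that of f'. *)
Lemma dzv_mul_transfer (v : 'rV[A]_m) : dzv (v *m O) = dzv v *m O.
Proof.
apply/rowP => j; rewrite !mxE dz_sum; apply: eq_bigr => k _.
by rewrite dzM dz_transfer mulr0 addr0 !mxE.
Qed.
Lemma cjv_mul_transfer (v : 'rV[A]_m) : cjv (v *m O) = cjv v *m O.
Proof.
apply/rowP => j; rewrite !mxE rmorph_sum; apply: eq_bigr => k _.
by rewrite rmorphM /= cj_transfer !mxE.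
Qed.
Lemma transfer_f1 : dzv f *m O = dzv f'.
Proof. by rewrite -dzv_mul_transfer transfer_f. Qed.
Lemma transfer_e : Fe f rho r q *m O = Fe f' rho r q.
Proof.
rewrite !FeE !F2E -scalemxAl mulmxBl -scalemxAl transfer_f1.
by rewrite -dzv_mul_transfer transfer_f1.
Qed.
Lemma transfer_eta : Feta f rho r q *m O = Feta f' rho r q.
Proof. by rewrite !FetaE -scalemxAl -dzv_mul_transfer transfer_e. Qed.
End TwoSurfaces.

(** With f'' = f, together with [transfer_tr], it shows that [transfer f f'] times its transpose is
    [transfer f f], which turns out to be the identity for a substantial f. *)
Lemma transfer_comp m m' m'' (f : 'rV[A]_m) (f' : 'rV[A]_m') (f'' : 'rV[A]_m'') :
  degenerate f -> degenerate f' -> degenerate f'' ->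
  transfer f f' *m transfer f' f'' = transfer f f''.
Proof.
move=> df df' df''; rewrite (transferE f f') (transferE f f'').
rewrite !mulmxDl -!scalemxAl !mulmxDl -!mulmxA -!cjv_mul_transfer //.
by rewrite transfer_f // transfer_f1 // transfer_e // transfer_eta.
Qed.

End Frames.

(** * Pseudoholomorphic curves *)

(* [cayley_cross] is needed over the complex numbers and over rings of functions. *)
Section Cross.
Variable B : comPzRingType.
Implicit Types x y z : 'rV[B]_7.

Definition cross x y : 'rV[B]_7 :=
  \row_(k < 7)
    (x 0 (k + 1) * y 0 (k + 3%:R) - x 0 (k + 3%:R) * y 0 (k + 1)
     + (x 0 (k + 2%:R) * y 0 (k + 6%:R) - x 0 (k + 6%:R) * y 0 (k + 2%:R))
     + (x 0 (k + 4%:R) * y 0 (k + 5%:R) - x 0 (k + 5%:R) * y 0 (k + 4%:R))).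

Let i0 : 'I_7 := @Ordinal 7 0 isT.
Let i1 : 'I_7 := @Ordinal 7 1 isT.
Let i2 : 'I_7 := @Ordinal 7 2 isT.
Let i3 : 'I_7 := @Ordinal 7 3 isT.
Let i4 : 'I_7 := @Ordinal 7 4 isT.
Let i5 : 'I_7 := @Ordinal 7 5 isT.
Let i6 : 'I_7 := @Ordinal 7 6 isT.

(** The index arithmetic modulo 7 is settled once, with fixed ordinals, so that the identities below
    reach [ring] as polynomial identities in the coordinates. *)
Fact cross_entry x y k a b c d e f : k + 1 = a -> k + 3%:R = b -> k + 2%:R = c ->
  k + 6%:R = d -> k + 4%:R = e -> k + 5%:R = f ->
  cross x y 0 k = x 0 a * y 0 b - x 0 b * y 0 a + (x 0 c * y 0 d - x 0 d * y 0 c)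
     + (x 0 e * y 0 f - x 0 f * y 0 e).
Proof. by move=> <- <- <- <- <- <-; rewrite mxE. Qed.

Fact cross0 x y : cross x y 0 i0 = x 0 i1 * y 0 i3 - x 0 i3 * y 0 i1 +
  (x 0 i2 * y 0 i6 - x 0 i6 * y 0 i2) + (x 0 i4 * y 0 i5 - x 0 i5 * y 0 i4).
Proof. by apply: cross_entry; apply: val_inj. Qed.
Fact cross1 x y : cross x y 0 i1 = x 0 i2 * y 0 i4 - x 0 i4 * y 0 i2 +
  (x 0 i3 * y 0 i0 - x 0 i0 * y 0 i3) + (x 0 i5 * y 0 i6 - x 0 i6 * y 0 i5).
Proof. by apply: cross_entry; apply: val_inj. Qed.
Fact cross2 x y : cross x y 0 i2 = x 0 i3 * y 0 i5 - x 0 i5 * y 0 i3 +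
  (x 0 i4 * y 0 i1 - x 0 i1 * y 0 i4) + (x 0 i6 * y 0 i0 - x 0 i0 * y 0 i6).
Proof. by apply: cross_entry; apply: val_inj. Qed.
Fact cross3 x y : cross x y 0 i3 = x 0 i4 * y 0 i6 - x 0 i6 * y 0 i4 +
  (x 0 i5 * y 0 i2 - x 0 i2 * y 0 i5) + (x 0 i0 * y 0 i1 - x 0 i1 * y 0 i0).
Proof. by apply: cross_entry; apply: val_inj. Qed.
Fact cross4 x y : cross x y 0 i4 = x 0 i5 * y 0 i0 - x 0 i0 * y 0 i5 +
  (x 0 i6 * y 0 i3 - x 0 i3 * y 0 i6) + (x 0 i1 * y 0 i2 - x 0 i2 * y 0 i1).
Proof. by apply: cross_entry; apply: val_inj. Qed.
Fact cross5 x y : cross x y 0 i5 = x 0 i6 * y 0 i1 - x 0 i1 * y 0 i6 +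
  (x 0 i0 * y 0 i4 - x 0 i4 * y 0 i0) + (x 0 i2 * y 0 i3 - x 0 i3 * y 0 i2).
Proof. by apply: cross_entry; apply: val_inj. Qed.
Fact cross6 x y : cross x y 0 i6 = x 0 i0 * y 0 i2 - x 0 i2 * y 0 i0 +
  (x 0 i1 * y 0 i5 - x 0 i5 * y 0 i1) + (x 0 i3 * y 0 i4 - x 0 i4 * y 0 i3).
Proof. by apply: cross_entry; apply: val_inj. Qed.
Let crossE := (cross0, cross1, cross2, cross3, cross4, cross5, cross6).

Fact ip7 x y : ip x y = x 0 i0 * y 0 i0 + (x 0 i1 * y 0 i1 + (x 0 i2 * y 0 i2 +
  (x 0 i3 * y 0 i3 + (x 0 i4 * y 0 i4 + (x 0 i5 * y 0 i5 + x 0 i6 * y 0 i6))))).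
Proof.
rewrite /ip !big_ord_recl big_ord0 addr0.
do ![congr (_ + _)]; congr (x 0 _ * y 0 _); exact: val_inj.
Qed.

Fact rowD x y i : (x + y) 0 i = x 0 i + y 0 i. Proof. by rewrite mxE. Qed.
Fact rowZ a x i : (a *: x) 0 i = a * x 0 i. Proof. by rewrite mxE. Qed.

Fact row7P x y : x 0 i0 = y 0 i0 -> x 0 i1 = y 0 i1 -> x 0 i2 = y 0 i2 ->
  x 0 i3 = y 0 i3 -> x 0 i4 = y 0 i4 -> x 0 i5 = y 0 i5 -> x 0 i6 = y 0 i6 -> x = y.
Proof.
move=> e0 e1 e2 e3 e4 e5 e6; apply/rowP => -[[|[|[|[|[|[|[|//]]]]]]] h];
[move: e0|move: e1|move: e2|move: e3|move: e4|move: e5|move: e6];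
by congr (x 0 _ = y 0 _); apply: val_inj.
Qed.

Lemma crossC x y : cross y x = - cross x y.
Proof. by apply/rowP => k; rewrite !mxE; ring. Qed.
Lemma crossxx x : cross x x = 0.
Proof. by apply/rowP => k; rewrite !mxE; ring. Qed.
Lemma crossZl a x y : cross (a *: x) y = a *: cross x y.
Proof. by apply/rowP => k; rewrite !mxE; ring. Qed.
Lemma crossDr x y z : cross z (x + y) = cross z x + cross z y.
Proof. by apply/rowP => k; rewrite !mxE; ring. Qed.
Lemma crossZr a x y : cross x (a *: y) = a *: cross x y.
Proof. by apply/rowP => k; rewrite !mxE; ring. Qed.
Lemma cross0r x : cross x 0 = 0.
Proof. by apply/rowP => k; rewrite !mxE; ring. Qed.

Lemma ip_cross x y z : ip (cross x y) z = ip (cross y z) x.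
Proof. by rewrite !ip7 !crossE; ring. Qed.
Lemma ip_crossxx x y : ip (cross x y) x = 0.
Proof. by rewrite ip_cross ip_cross crossxx ip0l. Qed.
Lemma ip_crossyy x y : ip (cross x y) y = 0.
Proof. by rewrite ip_cross crossxx ip0l. Qed.

Lemma ip_cross_cross x y z : ip (cross x z) (cross y z) =
  ip x y * ip z z - ip x z * ip y z.
Proof. by rewrite !ip7 !crossE; ring. Qed.

(** The polarized form of [cross_twice], which expresses the alternative law x(xz) = (xx)z of the
    Cayley numbers. *)
Lemma cross_cross x y z : cross x (cross y z) + cross y (cross x z) =
  - (ip x y *+ 2) *: z + ip x z *: y + ip y z *: x.
Proof.
apply: row7P; rewrite ?(rowD, rowZ) !crossE !ip7.
all: by ring.
Qed.

Lemma cross_twice x y : cross x (cross x y) = - ip x x *: y + ip x y *: x.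
Proof.
apply: row7P; rewrite ?(rowD, rowZ) !crossE !ip7.
all: by ring.
Qed.
End Cross.

Section HolomorphicFrame.
Variable R : rcfType.
Notation C := R[i].
Implicit Types (y z : 'rV[C]_7).

Lemma conjv_cross y z : conjv (cross y z) = cross (conjv y) (conjv z).
Proof.
by apply/rowP => k; rewrite !mxE !(rmorphB, rmorphD, rmorphM).
Qed.
Lemma conj_ip y z : conjc (ip y z) = ip (conjv y) (conjv z).
Proof. by rewrite /ip rmorph_sum; apply: eq_bigr => j _; rewrite rmorphM !mxE. Qed.
Lemma conjvK y : conjv (conjv y) = y.
Proof. by apply/rowP => j; rewrite !mxE conjcK. Qed.
Lemma conjvZ a y : conjv (a *: y) = conjc a *: conjv y.
Proof. by apply/rowP => j; rewrite !mxE rmorphM. Qed.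

Variables p x a b : 'rV[C]_7.
Hypotheses (pr : conjv p = p) (xr : conjv x = x).
Hypotheses (pp : ip p p = 1) (xx : ip x x = 1) (px : ip p x = 0).
Notation I := ('i%C : C).
Hypotheses (pa : cross p a = I *: a) (pb : cross p b = I *: b).
Hypotheses (ax : ip a x = 0) (bx : ip b x = 0) (ba : ip b (conjv a) = 0).
Notation rho := (ip a (conjv a)).
Hypothesis rho0 : rho != 0.

Let I0 : I != 0.
Proof. by rewrite eq_complex /= eqxx oner_eq0. Qed.
Let half (c : C) : c = - c -> c = 0.
Proof.
move=> /eqP; rewrite -subr_eq0 opprK -mulr2n -mulr_natr mulf_eq0 pnatr_eq0 orbF.
by move/eqP.
Qed.
Let isotropic y z : cross p y = I *: y -> cross p z = I *: z -> ip y z = 0.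
Proof.
move=> hy hz; apply: half; apply: (mulfI I0).
by rewrite -ipZl -hy ip_cross ip_cross crossC hz ipNl ipZl mulrN (ipC z).
Qed.
Let tangent y : cross p y = I *: y -> ip y p = 0.
Proof. by move=> hy; apply: (mulfI I0); rewrite mulr0 -ipZl -hy ip_crossxx. Qed.

Let w := cross (conjv a) x.
Let u := cross a x.
Let wu : conjv w = u. Proof. by rewrite /w /u conjv_cross conjvK xr. Qed.
Let pab : cross p (conjv a) = - I *: conjv a.
Proof.
rewrite -{1}pr -conjv_cross pa conjvZ.
congr (_ *: _); by apply/eqP; rewrite eq_complex /= oppr0 !eqxx.
Qed.
Let pw : cross p w = I *: w.
Proof.
have h := cross_cross x p (conjv a).
have axb : ip (conjv a) x = 0 by rewrite -xr -conj_ip ax rmorph0.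
have apb : ip (conjv a) p = 0 by rewrite -pr -conj_ip tangent // rmorph0.
move: h; rewrite (ipC x p) px (ipC x) axb (ipC p) apb mul0rn oppr0 !scale0r !addr0.
have hx : cross x (conjv a) = -1 *: w by rewrite crossC scaleN1r.
rewrite pab crossZr hx crossZr => /eqP; rewrite addrC addr_eq0 scaleN1r eqr_opp.
by move=> /eqP ->; rewrite scalerA mulrN1 opprK.
Qed.

(** Among the vectors v orthogonal to x with [cross p v = I *: v], the vectors a and w =
    [cross (conjv a) x] form an orthogonal basis. So b, being orthogonal to a, is a multiple of w:
    otherwise its remainder d would be the eighth nonzero vector of an orthogonal family in C^7. *)
Lemma cross_frame_norm :
  ip b u * conjc (ip b u) = rho * ip b (conjv b).
Proof.
have axb : ip (conjv a) x = 0 by rewrite -xr -conj_ip ax rmorph0.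
have apb : ip (conjv a) p = 0 by rewrite -pr -conj_ip tangent // rmorph0.
have wx : ip w x = 0 by rewrite /w ip_crossyy.
have wub : ip w u = rho.
  by rewrite /w /u ip_cross_cross xx axb mul0r subr0 mulr1 ipC.
pose be := ip b u / rho; pose d := b - be *: w.
have pd : cross p d = I *: d.
  rewrite /d crossDr -scaleNr crossZr pb pw scalerDr !scalerA.
  by rewrite [I * _]mulrC.
have dx : ip d x = 0 by rewrite /d ipDl ipNl ipZl bx wx mulr0 subr0.
have du : ip d u = 0 by rewrite /d ipDl ipNl ipZl wub /be divfK // subrr.
have wa : ip w (conjv a) = 0 by rewrite ip_crossxx.
have da : ip d (conjv a) = 0 by rewrite /d ipDl ipNl ipZl ba wa mulr0 subr0.
have db0 : d = 0.
  apply: hip_eq0; apply/eqP; apply/negPn/negP => d0.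
  pose s := [:: p; x; cross p x; a; conjv a; u; w; d].
  have pxp : conjv (cross p x) = cross p x by rewrite conjv_cross pr xr.
  have uw : conjv u = w by rewrite -wu conjvK.
  have cj0 y z : ip y z = 0 -> ip (conjv y) (conjv z) = 0.
    by move=> h; rewrite -conj_ip h rmorph0.
  have pxE y : cross p y = I *: y -> ip y x = 0 -> ip y (cross p x) = 0.
    move=> hy hx; rewrite ipC ip_cross ip_cross crossC ipNl hy ipZl hx.
    by rewrite mulr0 oppr0.
  have : (size s <= 7)%N; last by [].
  apply: ortho_size.
    rewrite /= d0 /hip pr xr pxp uw wu conjvK (ipC u) (ipC (conjv a)) wub.
    rewrite pp xx oner_eq0 rho0 /= ip_cross_cross pp xx px mulr0 subr0 mulr1.
    by rewrite oner_eq0.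
  have e1 := isotropic pa pa; have e2 := isotropic pa pw.
  have e3 := isotropic pa pd; have e4 := isotropic pw pw.
  have e5 := isotropic pw pd.
  have pxb y : cross p y = I *: y -> ip y x = 0 -> ip (conjv y) (cross p x) = 0.
    by move=> h h'; rewrite -pxp cj0 // pxE.
  have n1 : ip p (cross p x) = 0 by rewrite ipC ip_crossxx.
  have n2 : ip x (cross p x) = 0 by rewrite ipC ip_crossyy.
  have p1 : ip p a = 0 by rewrite ipC tangent.
  have p2 : ip p (conjv a) = 0 by rewrite ipC.
  have p3 : ip p w = 0 by rewrite ipC tangent.
  have p4 : ip p u = 0 by rewrite ipC -pr -wu cj0 // tangent.
  have p5 : ip p (conjv d) = 0 by rewrite ipC -pr cj0 // tangent.
  have x1 : ip x a = 0 by rewrite ipC.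
  have x2 : ip x (conjv a) = 0 by rewrite ipC.
  have x3 : ip x w = 0 by rewrite ipC.
  have x4 : ip x u = 0 by rewrite ipC -xr -wu cj0.
  have x5 : ip x (conjv d) = 0 by rewrite ipC -xr cj0.
  have m1 : ip (cross p x) a = 0 by rewrite ipC pxE.
  have m2 : ip (cross p x) (conjv a) = 0 by rewrite ipC pxb.
  have m3 : ip (cross p x) w = 0 by rewrite ipC pxE.
  have m4 : ip (cross p x) u = 0 by rewrite ipC -wu pxb.
  have m5 : ip (cross p x) (conjv d) = 0 by rewrite ipC pxb.
  have a1 : ip a u = 0 by rewrite ipC ip_crossxx.
  have a2 : ip a (conjv d) = 0 by rewrite -[a]conjvK cj0 // ipC.
  have a3 : ip (conjv a) w = 0 by rewrite ipC.
  have a4 : ip (conjv a) u = 0 by rewrite -wu cj0.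
  have a5 : ip (conjv a) (conjv d) = 0 by rewrite cj0.
  have u1 : ip u u = 0 by rewrite -wu cj0.
  have u2 : ip u (conjv d) = 0 by rewrite -wu cj0.
  have w1 : ip w (conjv d) = 0 by rewrite -uw cj0 // ipC.
  rewrite {}/s; move: (cross p x) pxp n1 n2 m1 m2 m3 m4 m5 => n nr n1 n2 m1 m2 m3 m4 m5.
  clearbody u w d.
  rewrite /= /hip xr nr uw wu conjvK.
  rewrite px n1 n2 p1 p2 p3 p4 p5 x1 x2 x3 x4 x5 m1 m2 m3 m4 m5 e1 e2 a1 a2 a3 a4 a5.
  by rewrite u1 u2 w1 !eqxx.
have bE : b = be *: w by apply/eqP; rewrite -subr_eq0; apply/eqP.
have beu : ip b u = be * rho by rewrite /be divfK.
have rr : conjc rho = rho by rewrite conj_ip conjvK ipC.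
have bb : ip b (conjv b) = be * conjc be * rho.
  by rewrite [in LHS]bE conjvZ wu ipZl ipZr wub mulrA.
by rewrite beu rmorphM /= rr bb; ring.
Qed.
End HolomorphicFrame.

Section HolomorphicCurve.
Variables (R : rcfType) (A : dring R).
Notation I := (dk ('i%C : R[i]) : A).

Lemma dzv_cross (v w : 'rV[A]_7) : dzv (cross v w) = cross (dzv v) w + cross v (dzv w).
Proof. by apply/rowP => k; rewrite !mxE !(dzD, dzN, dzM); ring. Qed.
Lemma cjv_cross (v w : 'rV[A]_7) : cjv (cross v w) = cross (cjv v) (cjv w).
Proof. by apply/rowP => k; rewrite !mxE !(rmorphB, rmorphD, rmorphM). Qed.
Lemma dbv_cross (v w : 'rV[A]_7) : dbv (cross v w) = cross (dbv v) w + cross v (dbv w).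
Proof.
rewrite -[LHS]cjvK -dzv_cj cjv_cross dzv_cross cjvD !cjv_cross !cjvK.
by rewrite !dzv_cj !cjvK.
Qed.

Variables (g : 'rV[A]_7) (rho r : A).
Hypotheses (gr : cjv g = g) (gg : ip g g = 1).
Hypotheses (gJ : cross g (dzv g) = I *: dzv g).
Hypotheses (grho : ip (dzv g) (cjv (dzv g)) = rho) (hr : rho * r = 1).

Fact ii : I * I = -1.
Proof. by rewrite -rmorphM -expr2 sqr_i rmorphN1. Qed.
Fact cj_i : cj I = - I.
Proof.
have h : conjc ('i%C : R[i]) = - 'i%C.
  by apply/eqP; rewrite eq_complex /= oppr0 !eqxx.
by rewrite cj_dk h rmorphN.
Qed.

Lemma ip_g1g : ip (dzv g) g = 0.
Proof.
apply: (@eqr_half _ A); rewrite addr0 -[X in _ = X](dz1 A) -gg dz_ip.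
by rewrite (ipC g).
Qed.

Lemma holomorphic_conformal : ip (dzv g) (dzv g) = 0.
Proof.
have h : I * ip (dzv g) (dzv g) = 0 by rewrite -ipZl -gJ ip_crossyy.
by rewrite -[LHS]mul1r -[1]opprK -ii mulNr -mulrA h mulr0 oppr0.
Qed.

(** L = g_(z zbar) is real. Differentiating [gJ] by d/dzbar and adding the conjugate equation
    cancels the right-hand sides and leaves [cross g L = 0]; by [cross_twice], L is a multiple of
    g. *)
Lemma holomorphic_minimal : dbv (dzv g) = - rho *: g.
Proof.
set L := dbv (dzv g).
have cL : cjv L = L.
  by rewrite /L -dzv_cj -dbv_cj gr dzv_dbv.
have bg : dbv g = cjv (dzv g) by rewrite -dbv_cj gr.
have h1 := congr1 (@dbv _ A 7) gJ.
rewrite dbv_cross dbvZ db_dk scale0r add0r bg -/L in h1.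
have h2 := congr1 (@cjv _ A 7) h1.
rewrite cjvD !cjv_cross cjvK cjvZ cL gr cj_i in h2.
have h3 : cross g L + cross g L = 0.
  have : cross (cjv (dzv g)) (dzv g) + cross g L +
    (cross (dzv g) (cjv (dzv g)) + cross g L) = I *: L + - I *: L by rewrite h1 h2.
  by rewrite scaleNr subrr crossC addrACA addNr add0r.
have h4 : cross g L = 0.
  apply/rowP => k; have := congr1 (fun v : 'rV[A]_7 => v 0 k) h3.
  have e0 : (0 : 'rV[A]_7) 0 k = 0 by rewrite mxE.
  by rewrite rowD e0 => h; apply: (@eqr_half _ A); rewrite addr0.
have := cross_twice g L; rewrite h4 cross0r gg scaleN1r.
move=> /esym /eqP; rewrite addrC addr_eq0 opprK => /eqP <-; congr (_ *: _).
have := congr1 (@db _ A) ip_g1g; rewrite db_ip db0 bg -/L grho => /eqP.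
by rewrite addr_eq0 ipC => /eqP.
Qed.

Lemma holomorphic_curve_minimal : conformal_minimal g rho r.
Proof. by split=> //; [exact: holomorphic_conformal|exact: holomorphic_minimal]. Qed.
Let cm := holomorphic_curve_minimal.

Lemma cross_gF2 : cross g (F2 g rho r) = I *: F2 g rho r.
Proof.
have := congr1 (@dzv _ A 7) gJ; rewrite dzv_cross crossxx add0r dzvZ dz_dk scale0r.
rewrite add0r F2E crossDr -scaleNr crossZr => ->; rewrite gJ scalerDr !scalerA.
by rewrite [I * _]mulrC.
Qed.

Variable xi : 'rV[A]_7.
Hypotheses (dxi : dzv xi = 0) (cxi : cjv xi = xi) (gxi : ip g xi = 0).

Lemma ip_g1xi : ip (dzv g) xi = 0.
Proof. by have := congr1 dz gxi; rewrite dz_ip dz0 dxi ip0r addr0. Qed.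
Lemma ip_F2xi : ip (F2 g rho r) xi = 0.
Proof.
have := congr1 dz ip_g1xi; rewrite dz_ip dz0 dxi ip0r addr0 => h.
by rewrite F2E ipDl ipNl ipZl h ip_g1xi mulr0 subr0.
Qed.

Definition cubic := ip (F2 g rho r) (cross (dzv g) xi).

(** F_zbar is a multiple of g_z, which kills the first term. In the second, g_(z zbar) is a multiple
    of g, and [cross g F = I *: F] reduces it to <F, xi> = 0. *)
Lemma db_cubic : db cubic = 0.
Proof.
rewrite /cubic db_ip (dbv_f2 cm) dbv_cross holomorphic_minimal.
have -> : dbv xi = 0 by rewrite -cxi dbv_cj dxi; apply/rowP => j; rewrite !mxE rmorph0.
rewrite cross0r addr0 crossZl !ipZl !ipZr ipC ip_crossxx mulr0 add0r.
rewrite ipC ip_cross ip_cross crossC cross_gF2 ipNl ipZl ip_F2xi.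
by rewrite !(mulr0, oppr0).
Qed.
End HolomorphicCurve.

Lemma cubic_transition (R : rcfType) (A A' : dring R) (phi : {rmorphism A -> A'})
    (l li : A') (g : 'rV[A]_7) (rho r : A) (rho' r' : A') (xi : 'rV[A]_7) :
  dmorph phi l li -> rho * r = 1 -> rho' * r' = 1 -> rho' = l * cj l * phi rho ->
  cubic (mapv phi g) rho' r' (mapv phi xi) = l ^+ 3 * phi (cubic g rho r xi).
Proof.
move=> dm hr hr' rhoE; rewrite /cubic (F2_transition dm hr hr' erefl rhoE).
rewrite (f1_transition dm erefl) crossZl !ipZl !ipZr -(ip_mapv phi) mulrA -exprSr.
congr (_ * ip _ _); apply/rowP => k.
by rewrite !mxE !(rmorphB, rmorphD, rmorphM).
Qed.

(** * Codimension count *)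

Section FrameRing.
Variables (R : rcfType) (A : dring R) (m : nat) (f : 'rV[A]_m) (rho r Q q : A).
Hypothesis cm : conformal_minimal f rho r.
Hypotheses (dbQ : db Q = 0) (hq : Q * q = 1).
Hypothesis QQ : Q * cj Q = rho * rho * sigma rho r.
Hypothesis iso : ip (F2 f rho r) (F2 f rho r) = 0.
Notation f1 := (dzv f).
Notation e := (Fe f rho r q).
Notation eta := (Feta f rho r q).
Notation c := (Fc f rho r q).
Notation k := (Fk f rho r q).

(** The component of conj eta orthogonal to eta. Its square norm is 1 - |c|^2, so it is a new normal
    direction unless |c| = 1. *)
Definition eta_defect := cjv eta - cj c *: eta.
Notation w := eta_defect.

Lemma cj_eq0 (a : A) : cj a = 0 -> a = 0.
Proof. by move=> h; rewrite -[a]cjK h rmorph0. Qed.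

(** The known orthogonality relations; [frame_zero] closes them under symmetry and conjugation. *)
Ltac frame_base := first [exact (ip_f1f cm) | exact (ip_f1bf cm) | exact (cm_conformal cm)
  | exact (ip_ef cm q) | exact (ip_ebf cm q) | exact (ip_ef1 cm q) | exact (ip_ef1b cm q)
  | exact (ip_ee q iso) | exact (ip_etaf cm q) | exact (ip_etaf1 cm hq iso)
  | exact (ip_etaf1b cm q) | exact (ip_etae cm q iso) | exact (ip_etaeb cm dbQ hq QQ)
  | exact (ip_kf cm hq iso) | exact (ip_kf1 cm hq iso) | exact (ip_kf1b cm q)
  | exact (ip_ke cm hq QQ iso) | exact (ip_keb cm dbQ hq QQ iso)
  | exact (ip_ketab cm dbQ hq QQ iso)
  | match goal with dc : dz c = 0 |- _ => exact (ip_keta cm dbQ hq QQ dc) end ].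
Ltac frame_zero := rewrite ?cjvK; first [ frame_base | rewrite ipC; frame_base
  | apply: cj_eq0; rewrite cj_ip ?cjvK ?(cm_real cm); first [ frame_base | rewrite ipC; frame_base ] ].

Definition frame : seq 'rV[A]_m := [:: f; f1; cjv f1; e; cjv e; eta].
Notation orth := (fun u v => ip u (cjv v) == 0).

Lemma frame_ortho : pairwise orth frame.
Proof. by rewrite /= !andbT; do ?[apply/andP; split]; apply/eqP; frame_zero. Qed.

Lemma ip_defect u : ip u eta = 0 -> ip u (cjv eta) = 0 -> ip u (cjv w) = 0.
Proof. by move=> h1 h2; rewrite cjvB cjvZ !cjvK cjK ipDr ipNr ipZr h1 h2 mulr0 subr0. Qed.

Lemma frame_ortho_defect : all (orth^~ w) frame.
Proof.
rewrite /= !andbT; do ?[apply/andP; split]; apply/eqP.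
1-5: by apply: ip_defect; frame_zero.
by rewrite cjvB cjvZ !cjvK cjK ipDr ipNr ipZr (ip_etaetab cm dbQ hq QQ) mulr1 FcE subrr.
Qed.

Lemma ip_defect_defect : ip w (cjv w) = 1 - c * cj c.
Proof.
rewrite cjvB cjvZ !cjvK cjK !(ipDl, ipDr, ipNl, ipNr, ipZl, ipZr) -FcE.
have -> : ip (cjv eta) (cjv eta) = cj c by rewrite FcE cj_ip.
rewrite (ipC (cjv eta)) (ip_etaetab cm dbQ hq QQ); ring.
Qed.

Lemma frame_norm : [/\ ip f (cjv f) = 1, ip f1 (cjv f1) = rho, ip (cjv f1) f1 = rho,
  ip e (cjv e) = rho & ip eta (cjv eta) = 1].
Proof.
split; rewrite ?(cm_real cm); [exact: cm_sphere cm|exact: cm_rho cm|rewrite ipC; exact: cm_rho cm|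
 exact: (ip_eeb cm hq QQ)|exact: (ip_etaetab cm dbQ hq QQ)].
Qed.

Section Constant.
Hypothesis dc : dz c = 0.
Lemma frame_ortho_k : all (orth^~ k) (rcons frame w).
Proof.
rewrite /= !andbT; do ?[apply/andP; split]; apply/eqP.
1-6: frame_zero.
rewrite ipDl ipNl ipZl.
have -> : ip (cjv eta) (cjv k) = 0 by frame_zero.
have -> : ip eta (cjv k) = 0 by frame_zero.
by rewrite mulr0 subr0.
Qed.

Lemma frame_ortho_kb : all (orth^~ (cjv k)) (rcons frame w).
Proof.
rewrite /= !andbT; do ?[apply/andP; split]; apply/eqP.
1-6: frame_zero.
rewrite cjvK ipDl ipNl ipZl.
have -> : ip (cjv eta) k = 0 by frame_zero.
have -> : ip eta k = 0 by frame_zero.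
by rewrite mulr0 subr0.
Qed.

(* When [k] and its conjugate are parallel, [ip k k] is holomorphic of constant
   length relative to the metric, which makes the metric [rho] flat. *)
Lemma sigma_of_parallel mi : ip k k * mi = 1 ->
  ip k k * cj (ip k k) = (rho * (1 - c * cj c)) ^+ 2 -> sigma rho r = rho.
Proof.
move=> hm mm; have hr := cm_inv cm.
pose mu := ip k k; pose kap := 1 - c * cj c.
have dk : dz kap = 0.
  by rewrite dzB dz1 dzM dc dz_cj (db_c cm dbQ hq QQ iso) rmorph0 mul0r mulr0 addr0 subr0.
have dbm : db mu = 0 by exact: (db_kk cm dbQ hq QQ iso dc).
have h1 : dz mu * cj mu = rho * dz rho * kap ^+ 2 + rho * dz rho * kap ^+ 2.
  have := congr1 dz mm; rewrite -/mu -/kap dzM dz_cj dbm rmorph0 mulr0 addr0 => ->.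
  by rewrite expr2 !dzM dk mulr0 addr0; ring.
have cmi : cj mu * cj mi = 1 by rewrite -rmorphM hm rmorph1.
(* This is (log rho)_z. It is shown that mu_z = 2 s mu, and d/dzbar of this equation gives 2 s_zbar
   mu = 0. *)
pose s := dz rho * r.
have h2 : dz mu = (s + s) * mu.
  have : (dz mu - (s + s) * mu) * cj mu = 0.
    have mm' : mu * cj mu = (rho * kap) ^+ 2 by exact: mm.
    by rewrite mulrBl h1 -(mulrA (s + s)) mm' /s; ring: hr.
  move=> /(congr1 (fun x => x * cj mi)); rewrite -mulrA cmi mulr1 mul0r => /eqP.
  by rewrite subr_eq0 => /eqP.
have h3 : (db s + db s) * mu = 0.
  have := congr1 (@db _ A) h2; rewrite -dz_db dbm dz0 dbM dbm mulr0 addr0 dbD.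
  by move=> <-.
have h4 : db s = 0.
  apply: (@eqr_half _ A); rewrite addr0 -[LHS]mulr1 -hm mulrA -/mu h3.
  by rewrite mul0r.
by rewrite /sigma -/s h4 addr0.
Qed.
End Constant.

Section Flat.
Hypothesis F20 : F2 f rho r = 0.

(** The orthogonal projection onto the span of f, f_z and its conjugate; it is constant when F =
    0. *)
Definition transfer3 : 'M[A]_m := \matrix_(i, j) (f 0 i * f 0 j +
  r * (cjv f1 0 i * f1 0 j + f1 0 i * cjv f1 0 j)).

Lemma mul_transfer3 v : v *m transfer3 =
  ip v f *: f + r *: (ip v (cjv f1) *: f1 + ip v f1 *: cjv f1).
Proof.
apply/rowP => j; rewrite !mxE !mulr_suml -big_split mulr_sumr -big_split /=.
by apply: eq_bigr => i _; rewrite !mxE; ring.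
Qed.

Lemma cj_transfer3 i j : cj (transfer3 i j) = transfer3 i j.
Proof.
have h l : cj (f 0 l) = f 0 l by rewrite -{2}(cm_real cm) !mxE.
by rewrite !mxE !(rmorphD, rmorphM) /= !cjK !h (cj_r cm); ring.
Qed.

Lemma dz_transfer3 i j : dz (transfer3 i j) = 0.
Proof.
have hr := cm_inv cm.
have d1 l : dz (f1 0 l) = dz rho * r * f1 0 l.
  have := congr1 (fun v : 'rV[A]_m => v 0 l) (dzv_f1 f rho r).
  by rewrite F20 addr0 !mxE.
have d2 l : dz (cjv f1 0 l) = - rho * f 0 l.
  have := congr1 (fun v : 'rV[A]_m => v 0 l) (dzv_f1b cm).
  by rewrite !mxE.
have d0 l : dz (f 0 l) = f1 0 l by rewrite mxE.
rewrite mxE; move: (d0 i) (d0 j) (d1 i) (d1 j) (d2 i) (d2 j).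
move: (f1 0 i) (f1 0 j) (cjv f1 0 i) (cjv f1 0 j) (f 0 i) (f 0 j) => a a' b b' x x' e1 e2 e3 e4 e5 e6.
by rewrite !(dzD, dzM) (dz_inv hr) e1 e2 e3 e4 e5 e6; ring: hr.
Qed.
End Flat.
End FrameRing.

Section TransferTransition.
Variables (R : rcfType) (A A' : dring R) (phi : {rmorphism A -> A'}) (l li : A').
Hypothesis dm : dmorph phi l li.
Variables (m m' : nat) (f : 'rV[A]_m) (g : 'rV[A]_m') (f' : 'rV[A']_m) (g' : 'rV[A']_m').
Variables (rho r : A) (rho' r' : A').
Hypothesis (hr : rho * r = 1) (hr' : rho' * r' = 1).
Hypotheses (fE : f' = mapv phi f) (gE : g' = mapv phi g) (rhoE : rho' = l * cj l * phi rho).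

Lemma transfer3_transition i j : transfer3 f' r' i j = phi (transfer3 f r i j).
Proof.
have hl := dm_inv dm; have hlb := cj_inv hl.
have e0 k : f' 0 k = phi (f 0 k) by rewrite fE mxE.
have e1 k : dzv f' 0 k = l * phi (dzv f 0 k) by rewrite (f1_transition dm fE) !mxE.
have e2 k : cjv (dzv f') 0 k = cj l * phi (cjv (dzv f) 0 k).
  by rewrite (f1_transition dm fE) cjvZ (cj_mapv dm) !mxE.
rewrite mxE [in RHS]mxE !(rmorphD, rmorphM) !e0 !e1 !e2 (r_transition dm hr hr' rhoE).
by ring: hl hlb.
Qed.

Variables (Q q : A) (Q' q' : A').
Hypothesis (hq : Q * q = 1) (hq' : Q' * q' = 1).
Hypothesis QE : Q' = l ^+ 3 * phi Q.

Lemma transfer_transition i j :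
  transfer rho' r' q' f' g' i j = phi (transfer rho r q f g i j).
Proof.
have hl := dm_inv dm; have hlb := cj_inv hl.
have e0 k : f' 0 k = phi (f 0 k) by rewrite fE mxE.
have e0' k : g' 0 k = phi (g 0 k) by rewrite gE mxE.
have e1 k : dzv f' 0 k = l * phi (dzv f 0 k) by rewrite (f1_transition dm fE) !mxE.
have e1' k : dzv g' 0 k = l * phi (dzv g 0 k) by rewrite (f1_transition dm gE) !mxE.
have e2 k : cjv (dzv f') 0 k = cj l * phi (cjv (dzv f) 0 k).
  by rewrite (f1_transition dm fE) cjvZ (cj_mapv dm) !mxE.
have e2' k : cjv (dzv g') 0 k = cj l * phi (cjv (dzv g) 0 k).
  by rewrite (f1_transition dm gE) cjvZ (cj_mapv dm) !mxE.
have ee := Fe_transition dm hr hr' fE rhoE hq hq' QE.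
have ee' := Fe_transition dm hr hr' gE rhoE hq hq' QE.
have e3 k : Fe f' rho' r' q' 0 k = cj l * phi (Fe f rho r q 0 k) by rewrite ee !mxE.
have e3' k : Fe g' rho' r' q' 0 k = cj l * phi (Fe g rho r q 0 k) by rewrite ee' !mxE.
have e4 k : cjv (Fe f' rho' r' q') 0 k = l * phi (cjv (Fe f rho r q) 0 k).
  by rewrite ee cjvZ (cj_mapv dm) cjK !mxE.
have e4' k : cjv (Fe g' rho' r' q') 0 k = l * phi (cjv (Fe g rho r q) 0 k).
  by rewrite ee' cjvZ (cj_mapv dm) cjK !mxE.
have et := Feta_transition dm hr hr' fE rhoE hq hq' QE.
have et' := Feta_transition dm hr hr' gE rhoE hq hq' QE.
have e5 k : cjv (Feta f' rho' r' q') 0 k = phi (cjv (Feta f rho r q) 0 k).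
  by rewrite et (cj_mapv dm) !mxE.
have e5' k : Feta g' rho' r' q' 0 k = phi (Feta g rho r q 0 k) by rewrite et' !mxE.
rewrite mxE [in RHS]mxE !(rmorphD, rmorphM) e0 e0' e1 e1' e2 e2' e3 e3' e4 e4' e5 e5'.
rewrite (r_transition dm hr hr' rhoE).
move: (phi (f 0 i)) (phi (g 0 j)) (phi (dzv f 0 i)) (phi (dzv g 0 j))
  (phi (cjv (dzv f) 0 i)) (phi (cjv (dzv g) 0 j)) (phi (Fe f rho r q 0 i))
  (phi (Fe g rho r q 0 j)) (phi (cjv (Fe f rho r q) 0 i)) (phi (cjv (Fe g rho r q) 0 j))
  (phi (cjv (Feta f rho r q) 0 i)) (phi (Feta g rho r q 0 j)) (phi r).
move=> *; ring: hl hlb.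
Qed.
End TransferTransition.

(** * Smooth and holomorphic functions *)

Section ComplexSmooth.
Context {R : realType}.
Notation V := 'rV[R]_2.
Notation E := (@basis_vec R).
Notation C := R[i].
Implicit Types (U : set V) (F G : V -> C) (x : V).

Lemma cReD (a b : C) : complex.Re (a + b) = complex.Re a + complex.Re b.
Proof. by case: a b => [? ?] []. Qed.
Lemma cImD (a b : C) : complex.Im (a + b) = complex.Im a + complex.Im b.
Proof. by case: a b => [? ?] []. Qed.
Lemma cReM (a b : C) : complex.Re (a * b) =
  complex.Re a * complex.Re b - complex.Im a * complex.Im b.
Proof. by case: a b => [? ?] []. Qed.
Lemma cImM (a b : C) : complex.Im (a * b) =
  complex.Re a * complex.Im b + complex.Im a * complex.Re b.
Proof. by case: a b => [? ?] []. Qed.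
Lemma cRe_conj (a : C) : complex.Re (conjc a) = complex.Re a.
Proof. by case: a. Qed.
Lemma cIm_conj (a : C) : complex.Im (conjc a) = - complex.Im a.
Proof. by case: a. Qed.
Lemma complex_eq (a b : C) : complex.Re a = complex.Re b ->
  complex.Im a = complex.Im b -> a = b.
Proof. by case: a b => [? ?] [? ?] /= -> ->. Qed.

Lemma smooth_ext U (u v : V -> R) : open U -> (forall x, U x -> u x = v x) ->
  smooth U u -> smooth U v.
Proof. by move=> oU uv su k; exact: Ck_ext (su k). Qed.

Lemma smooth_derive U (u : V -> R) i : smooth U u -> smooth U ('D_(E i) u).
Proof. by move=> su k; apply: (su k.+1).2. Qed.

Lemma smooth_differentiable U (u : V -> R) x : smooth U u -> U x ->
  differentiable u x.
Proof. by move=> su; apply: (su 1).1. Qed.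

Lemma smooth_derivable U (u : V -> R) x v : smooth U u -> U x -> derivable u x v.
Proof. by move=> su Ux; apply/diff_derivable/smooth_differentiable/Ux. Qed.

Definition csm U F :=
  smooth U (fun x => complex.Re (F x)) /\ smooth U (fun x => complex.Im (F x)).

Fact cderive_ex : {D : 'I_2 -> (V -> C) -> V -> C | forall i F x,
  complex.Re (D i F x) = 'D_(E i) (fun x => complex.Re (F x)) x /\
  complex.Im (D i F x) = 'D_(E i) (fun x => complex.Im (F x)) x}.
Proof.
by exists (fun i F x => Complex ('D_(E i) (fun x => complex.Re (F x)) x)
    ('D_(E i) (fun x => complex.Im (F x)) x)).
Qed.
(* Opaque, because unfolding derivatives makes unification diverge. *)
Definition cderive := sval cderive_ex.

Lemma Re_cderive i F x :
  complex.Re (cderive i F x) = 'D_(E i) (fun x => complex.Re (F x)) x.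
Proof. exact: (svalP cderive_ex i F x).1. Qed.
Lemma Im_cderive i F x :
  complex.Im (cderive i F x) = 'D_(E i) (fun x => complex.Im (F x)) x.
Proof. exact: (svalP cderive_ex i F x).2. Qed.
Definition cderiveE := (Re_cderive, Im_cderive).

Lemma conjcD (a b : C) : conjc (a + b) = conjc a + conjc b. Proof. exact: rmorphD. Qed.
Lemma conjcB (a b : C) : conjc (a - b) = conjc a - conjc b. Proof. exact: rmorphB. Qed.
Lemma conjcM (a b : C) : conjc (a * b) = conjc a * conjc b. Proof. exact: rmorphM. Qed.
Lemma conjci : conjc ('i%C : C) = - 'i%C. Proof. by apply: complex_eq; rewrite //= oppr0. Qed.

Lemma csm_ext U F G : open U -> (forall x, U x -> F x = G x) -> csm U F -> csm U G.
Proof.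
by move=> oU FG [sr si]; split; [move: sr|move: si]; apply: smooth_ext => // x /FG ->.
Qed.

Lemma csm_sub U U' F : U' `<=` U -> csm U F -> csm U' F.
Proof. by move=> sU [sr si]; split=> k; [move: (sr k)|move: (si k)]; apply: Ck_sub. Qed.

Lemma csm_cst U (a : C) : csm U (fun=> a).
Proof. by split=> k; exact: Ck_cst. Qed.

Lemma csm_real U (u : V -> R) : smooth U u -> csm U (fun x => (u x)%:C%C).
Proof. by move=> su; split=> // k; exact: Ck_cst. Qed.

Lemma csm_add U F G : open U -> csm U F -> csm U G -> csm U (fun x => F x + G x).
Proof.
move=> oU [a b] [c d]; split.
  by apply: smooth_ext (fun k => Ck_add oU (a k) (c k)) => // x _; rewrite cReD.
by apply: smooth_ext (fun k => Ck_add oU (b k) (d k)) => // x _; rewrite cImD.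
Qed.

Lemma csm_mul U F G : open U -> csm U F -> csm U G -> csm U (fun x => F x * G x).
Proof.
move=> oU [a b] [c d]; split.
  apply: smooth_ext (fun k => Ck_add oU (Ck_mul oU (a k) (c k))
    (Ck_opp oU (Ck_mul oU (b k) (d k)))) => // x _; by rewrite cReM.
apply: smooth_ext (fun k => Ck_add oU (Ck_mul oU (a k) (d k))
    (Ck_mul oU (b k) (c k))) => // x _; by rewrite cImM.
Qed.

Lemma csm_conj U F : open U -> csm U F -> csm U (fun x => conjc (F x)).
Proof.
move=> oU [a b]; split; first by apply: smooth_ext a => // x _; rewrite cRe_conj.
by apply: smooth_ext (fun k => Ck_opp oU (b k)) => // x _; rewrite cIm_conj.
Qed.

Lemma csm_inv U F : open U -> (forall x, U x -> F x != 0) -> csm U F ->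
  csm U (fun x => (F x)^-1).
Proof.
move=> oU F0 sF.
have [sr _] := csm_mul oU sF (csm_conj oU sF).
have n0 x : U x -> complex.Re (F x * conjc (F x)) != 0.
  move=> Ux; have := F0 x Ux; apply: contra => /eqP h.
  have : F x * conjc (F x) = 0.
    by apply: complex_eq; rewrite //= cImM cRe_conj cIm_conj mulrN mulrC addNr.
  by move=> /eqP; rewrite mulf_eq0 conjc_eq0 orbb.
have si : smooth U (fun x => (complex.Re (F x * conjc (F x)))^-1).
  by move=> k; apply: Ck_inv.
apply: csm_ext (csm_mul oU (csm_real si) (csm_conj oU sF)) => // x Ux.
have h : (complex.Re (F x * conjc (F x)))%:C%C = F x * conjc (F x).
  by apply: complex_eq; rewrite //= cImM cRe_conj cIm_conj mulrN mulrC addNr.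
rewrite fmorphV /= h invfM -mulrA mulVf ?mulr1 // conjc_eq0; exact: F0.
Qed.

Lemma csm_derive U F i : csm U F -> csm U (cderive i F).
Proof.
move=> [a b]; split.
  rewrite (_ : (fun x => _) = 'D_(E i) (fun x => complex.Re (F x))).
    exact: smooth_derive.
  by apply: funext => x; rewrite Re_cderive.
rewrite (_ : (fun x => _) = 'D_(E i) (fun x => complex.Im (F x))).
  exact: smooth_derive.
by apply: funext => x; rewrite Im_cderive.
Qed.

Lemma cderive_ext U F G i x : open U -> (forall x, U x -> F x = G x) -> U x ->
  cderive i F x = cderive i G x.
Proof.
move=> oU FG Ux; apply: complex_eq; rewrite !cderiveE; apply: near_eq_derive;
by apply: (near_open oU Ux) => y /FG ->.
Qed.

Lemma cderiveD U F G i x : csm U F -> csm U G -> U x ->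
  cderive i (fun x => F x + G x) x = cderive i F x + cderive i G x.
Proof.
move=> [a b] [c d] Ux; apply: complex_eq; rewrite ?cReD ?cImD !cderiveE.
  rewrite (_ : (fun x => complex.Re (F x + G x)) =
    (fun x => complex.Re (F x)) + (fun x => complex.Re (G x))).
    by rewrite deriveD //; exact: smooth_derivable Ux.
  by apply: funext => y; rewrite cReD.
rewrite (_ : (fun x => complex.Im (F x + G x)) =
    (fun x => complex.Im (F x)) + (fun x => complex.Im (G x))).
  by rewrite deriveD //; exact: smooth_derivable Ux.
by apply: funext => y; rewrite cImD.
Qed.

Lemma cderiveM U F G i x : csm U F -> csm U G -> U x ->
  cderive i (fun x => F x * G x) x = cderive i F x * G x + F x * cderive i G x.
Proof.
move=> [a b] [c d] Ux.
have dd (u v : V -> R) : smooth U u -> smooth U v ->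
    'D_(E i) (fun x => u x * v x) x = u x * 'D_(E i) v x + v x * 'D_(E i) u x.
  by move=> su sv; rewrite deriveM //; exact: smooth_derivable Ux.
have dm (u v : V -> R) : smooth U u -> smooth U v -> 
   derivable (fun x => u x * v x) x (E i).
  by move=> su sv; apply: derivableM; exact: smooth_derivable Ux.
apply: complex_eq; rewrite ?cReD ?cImD ?cReM ?cImM !cderiveE.
  rewrite (_ : (fun x => complex.Re (F x * G x)) =
    (fun x => complex.Re (F x) * complex.Re (G x)) -
    (fun x => complex.Im (F x) * complex.Im (G x))).
    by rewrite deriveB ?dd //; [ring|exact: dm..].
  by apply: funext => y; rewrite cReM.
rewrite (_ : (fun x => complex.Im (F x * G x)) =
    (fun x => complex.Re (F x) * complex.Im (G x)) +
    (fun x => complex.Im (F x) * complex.Re (G x))).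
  by rewrite deriveD ?dd //; [ring|exact: dm..].
by apply: funext => y; rewrite cImM.
Qed.

Lemma cderive_conj U F i x : csm U F -> U x ->
  cderive i (fun x => conjc (F x)) x = conjc (cderive i F x).
Proof.
move=> [a b] Ux; apply: complex_eq; rewrite ?cRe_conj ?cIm_conj !cderiveE.
  by rewrite (_ : (fun x => complex.Re (conjc (F x))) = (fun x => complex.Re (F x))) //;
    apply: funext => y; rewrite cRe_conj.
rewrite (_ : (fun x => complex.Im (conjc (F x))) = - (fun x => complex.Im (F x))).
  by rewrite deriveN //; exact: smooth_derivable Ux.
by apply: funext => y; rewrite cIm_conj.
Qed.

Lemma cderive_cst (a : C) i x : cderive i (fun=> a) x = 0.
Proof. by apply: complex_eq; rewrite !cderiveE derive_cst. Qed.

Lemma cderiveC U F i j x : open U -> csm U F -> U x ->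
  cderive i (cderive j F) x = cderive j (cderive i F) x.
Proof.
move=> oU [a b] Ux; apply: complex_eq;
    rewrite 1?Re_cderive 1?Im_cderive 1?[RHS]Re_cderive 1?[RHS]Im_cderive.
  rewrite (_ : (fun x => complex.Re (cderive j F x)) =
    'D_(E j) (fun x => complex.Re (F x))); last first.
    by apply: funext => y; rewrite Re_cderive.
  rewrite (_ : (fun x => complex.Re (cderive i F x)) =
    'D_(E i) (fun x => complex.Re (F x))); last first.
    by apply: funext => y; rewrite Re_cderive.
  exact: schwarz (a 2) Ux.
rewrite (_ : (fun x => complex.Im (cderive j F x)) =
  'D_(E j) (fun x => complex.Im (F x))); last first.
  by apply: funext => y; rewrite Im_cderive.
rewrite (_ : (fun x => complex.Im (cderive i F x)) =
  'D_(E i) (fun x => complex.Im (F x))); last first.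
  by apply: funext => y; rewrite Im_cderive.
exact: schwarz (b 2) Ux.
Qed.

End ComplexSmooth.

Record oset (T : topologicalType) := Oset { os : set T ; os_open : open os }.

Section SmoothRing.
Context {R : realType}.
Notation V := 'rV[R]_2.
Notation C := R[i].
Variable U0 : oset V.
Notation U := (os U0).
Let oU : open U := os_open U0.

(* Functions are normalized to be 0 outside U, so that they are equal as soon as
   they agree on U. *)
Record smoothfun := Sf {
  sv :> V -> C ;
  sv_smooth : csm U sv ;
  sv_out : forall x, ~ U x -> sv x = 0
}.

Lemma sfP (a b : smoothfun) : (forall x, U x -> a x = b x) -> a = b.
Proof.
case: a b => [f sf f0] [g sg g0] /= h.
have e : f = g.
  apply: funext => x; have [Ux|nUx] := pselect (U x); first exact: h.
  by rewrite f0 // g0.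
by subst g; congr Sf; exact: Prop_irrelevance.
Qed.

Fact mksf_ex F : csm U F -> {a : smoothfun | forall x, U x -> a x = F x}.
Proof.
move=> sF; pose G x : C := if pselect (U x) then F x else 0.
have GE x : U x -> G x = F x by rewrite /G; case: pselect.
have sG : csm U G by apply: csm_ext sF => // x /GE.
have G0 x : ~ U x -> G x = 0 by rewrite /G; case: pselect.
by exists (Sf sG G0).
Qed.
Definition mksf F (sF : csm U F) : smoothfun := sval (mksf_ex sF).
Lemma mksfE F (sF : csm U F) x : U x -> mksf sF x = F x.
Proof. exact: (svalP (mksf_ex sF)). Qed.

(** Total in F, with the zero function as default value, so that definitions built on it carry no
    proof of smoothness. *)
Definition sfof (F : V -> C) : smoothfun :=
  if pselect (csm U F) is left sF then mksf sF else mksf (csm_cst U 0).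
Lemma sfofE F x : csm U F -> U x -> sfof F x = F x.
Proof. by move=> sF Ux; rewrite /sfof; case: pselect => // sF'; rewrite mksfE. Qed.

Definition sf_cst (z : C) : smoothfun := mksf (csm_cst U z).
Definition sf_add (a b : smoothfun) : smoothfun := mksf (csm_add oU (sv_smooth a) (sv_smooth b)).
Definition sf_mul (a b : smoothfun) : smoothfun := mksf (csm_mul oU (sv_smooth a) (sv_smooth b)).
Definition sf_opp (a : smoothfun) : smoothfun := sf_mul (sf_cst (- 1)) a.
Definition sf_conj (a : smoothfun) : smoothfun := mksf (csm_conj oU (sv_smooth a)).
Definition sf_derive i (a : smoothfun) : smoothfun := mksf (csm_derive i (sv_smooth a)).

HB.instance Definition _ := gen_eqMixin smoothfun.
HB.instance Definition _ := gen_choiceMixin smoothfun.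

Ltac sf_pw := move=> *; apply: sfP => x Ux; rewrite !mksfE //.

Fact sf_addA : associative sf_add. Proof. by sf_pw; exact: addrA. Qed.
Fact sf_addC : commutative sf_add. Proof. by sf_pw; exact: addrC. Qed.
Fact sf_add0 : left_id (sf_cst 0) sf_add. Proof. by sf_pw; exact: add0r. Qed.
Fact sf_addN : left_inverse (sf_cst 0) sf_opp sf_add.
Proof. by sf_pw; rewrite mulN1r addNr. Qed.
HB.instance Definition _ := GRing.isZmodule.Build smoothfun sf_addA sf_addC sf_add0 sf_addN.
Fact sf_mulA : associative sf_mul. Proof. by sf_pw; exact: mulrA. Qed.
Fact sf_mulC : commutative sf_mul. Proof. by sf_pw; exact: mulrC. Qed.
Fact sf_mul1 : left_id (sf_cst 1) sf_mul. Proof. by sf_pw; exact: mul1r. Qed.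
Fact sf_mulD : left_distributive sf_mul sf_add. Proof. by sf_pw; exact: mulrDl. Qed.
HB.instance Definition _ :=
  GRing.Zmodule_isComPzRing.Build smoothfun sf_mulA sf_mulC sf_mul1 sf_mulD.

Lemma sfD (a b : smoothfun) x : U x -> (a + b) x = a x + b x. Proof. exact: mksfE. Qed.
Lemma sfM (a b : smoothfun) x : U x -> (a * b) x = a x * b x. Proof. exact: mksfE. Qed.
Lemma sf1 x : U x -> (1 : smoothfun) x = 1. Proof. exact: mksfE. Qed.
Lemma sf0 x : U x -> (0 : smoothfun) x = 0. Proof. exact: mksfE. Qed.
Lemma sfN (a : smoothfun) x : U x -> (- a) x = - a x.
Proof. by move=> Ux; rewrite mksfE // mksfE // mulN1r. Qed.

Fact sf_conj_zmod : zmod_morphism sf_conj.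
Proof.
move=> a b; apply: sfP => x Ux.
by rewrite mksfE // !(sfD, sfN) // !mksfE // rmorphB.
Qed.
Fact sf_conj_monoid : monoid_morphism sf_conj.
Proof.
split; first by apply: sfP => x Ux; rewrite mksfE // sf1 // rmorph1.
by move=> a b; apply: sfP => x Ux; rewrite mksfE // !sfM // !mksfE // rmorphM.
Qed.
HB.instance Definition _ := GRing.isZmodMorphism.Build smoothfun smoothfun sf_conj sf_conj_zmod.
HB.instance Definition _ := GRing.isMonoidMorphism.Build smoothfun smoothfun sf_conj sf_conj_monoid.

Fact sf_cst_zmod : zmod_morphism sf_cst.
Proof. by move=> a b; apply: sfP => x Ux; rewrite !(sfD, sfN) // !mksfE. Qed.
Fact sf_cst_monoid : monoid_morphism sf_cst.
Proof.
split; first by apply: sfP => x Ux.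
by move=> a b; apply: sfP => x Ux; rewrite !sfM // !mksfE.
Qed.
HB.instance Definition _ := GRing.isZmodMorphism.Build C smoothfun sf_cst sf_cst_zmod.
HB.instance Definition _ := GRing.isMonoidMorphism.Build C smoothfun sf_cst sf_cst_monoid.

Fact sf_dz_ex : {D : smoothfun -> smoothfun | forall a x, U x ->
  D a x = 2^-1 * (cderive 0 a x - 'i%C * cderive 1 a x)}.
Proof.
exists (fun a => sf_cst 2^-1 * (sf_derive 0 a - sf_cst 'i%C * sf_derive 1 a)).
by move=> a x Ux; rewrite !(sfM, sfD, sfN) // !mksfE.
Qed.
Definition sf_dz := sval sf_dz_ex.

Lemma sf_dzE (a : smoothfun) x : U x ->
  sf_dz a x = 2^-1 * (cderive 0 a x - 'i%C * cderive 1 a x).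
Proof. exact: (svalP sf_dz_ex a x). Qed.

Fact sf_dzD : {morph sf_dz : a b / a + b}.
Proof.
move=> a b; apply: sfP => x Ux; rewrite (sfD _ _ Ux) !(sf_dzE _ Ux).
have h i : cderive i (a + b) x = cderive i a x + cderive i b x.
  rewrite -(cderiveD _ (sv_smooth a) (sv_smooth b) Ux).
  by apply: (cderive_ext (U := U)) => // y Uy; rewrite sfD.
by rewrite !h; ring.
Qed.
Fact sf_dzM a b : sf_dz (a * b) = sf_dz a * b + a * sf_dz b.
Proof.
apply: sfP => x Ux; rewrite (sfD _ _ Ux) !(sfM _ _ Ux) !(sf_dzE _ Ux).
have h i : cderive i (a * b) x = cderive i a x * b x + a x * cderive i b x.
  rewrite -(cderiveM _ (sv_smooth a) (sv_smooth b) Ux).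
  by apply: (cderive_ext (U := U)) => // y Uy; rewrite sfM.
by rewrite !h; ring.
Qed.
Fact sf_dz_cst z : sf_dz (sf_cst z) = 0.
Proof.
apply: sfP => x Ux; rewrite sf_dzE // sf0 //.
have h i : cderive i (sf_cst z) x = 0.
  rewrite -(cderive_cst z i x).
  by apply: (cderive_ext (U := U)) => // y Uy; rewrite mksfE.
by rewrite !h; ring.
Qed.
Fact sf_conjK : involutive sf_conj.
Proof. by move=> a; apply: sfP => x Ux; rewrite !mksfE // conjcK. Qed.
Fact sf_conj_cst z : sf_conj (sf_cst z) = sf_cst (conjc z).
Proof. by apply: sfP => x Ux; rewrite !mksfE. Qed.

Lemma sf_dbE (a : smoothfun) x : U x -> sf_conj (sf_dz (sf_conj a)) x =
  2^-1 * (cderive 0 a x + 'i%C * cderive 1 a x).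
Proof.
move=> Ux; rewrite mksfE // sf_dzE //.
have h i : cderive i (sf_conj a) x = conjc (cderive i a x).
  rewrite -(cderive_conj _ (sv_smooth a) Ux).
  by apply: (cderive_ext (U := U)) => // y Uy; rewrite mksfE.
rewrite !h conjcM conjcB conjcM !conjcK conjc_inv conjc_nat conjci; ring.
Qed.

Fact sf_dz_conjC a : sf_dz (sf_conj (sf_dz (sf_conj a))) =
  sf_conj (sf_dz (sf_conj (sf_dz a))).
Proof.
apply: sfP => x Ux; rewrite sf_dzE // sf_dbE //.
have sa i : csm U (cderive i a) by apply/csm_derive/sv_smooth.
have h1 i s t : cderive i (fun y => s * (cderive 0 a y + t * cderive 1 a y)) x =
    s * (cderive i (cderive 0 a) x + t * cderive i (cderive 1 a) x).
  have sc := csm_mul oU (csm_cst U t) (sa 1).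
  rewrite (cderiveM _ (csm_cst U s) (csm_add oU (sa 0) sc) Ux).
  rewrite (cderiveD _ (sa 0) sc Ux) (cderiveM _ (csm_cst U t) (sa 1) Ux).
  by rewrite (cderive_cst s i x) (cderive_cst t i x); ring.
have h2 i : cderive i (sf_conj (sf_dz (sf_conj a))) x =
    2^-1 * (cderive i (cderive 0 a) x + 'i%C * cderive i (cderive 1 a) x).
  by rewrite -h1; apply: (cderive_ext (U := U)) => // y Uy; rewrite sf_dbE.
have h3 i : cderive i (sf_dz a) x =
    2^-1 * (cderive i (cderive 0 a) x + (- 'i%C) * cderive i (cderive 1 a) x).
  rewrite -h1; apply: (cderive_ext (U := U)) => // y Uy.
  by rewrite sf_dzE // mulNr.
rewrite !h2 !h3 (cderiveC 1 0 oU (sv_smooth a) Ux); ring.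
Qed.

Definition sfR : dring R :=
  @DRing R smoothfun sf_dz sf_conj sf_cst sf_dzD sf_dzM sf_dz_cst sf_conjK sf_conj_cst
    sf_dz_conjC.

End SmoothRing.

(** * The plane as R^2 and as C *)

Section Plane.
Context {R : realType}.
Notation V := 'rV[R]_2.
Notation E := (@basis_vec R).
Notation C := R[i].
Notation N := (@Normc.normc R).
Implicit Types (x y h : V) (z : C).

Definition toC x : C := Complex (x 0 0) (x 0 1).
Definition ofC z : V := complex.Re z *: E 0 + complex.Im z *: E 1.

Lemma toCD x y : toC (x + y) = toC x + toC y.
Proof. by apply: complex_eq; rewrite ?cReD ?cImD /= mxE. Qed.
Lemma toCN x : toC (- x) = - toC x.
Proof. by apply: complex_eq; rewrite /= mxE. Qed.
Lemma toCB x y : toC (x - y) = toC x - toC y.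
Proof. by rewrite toCD toCN. Qed.
Lemma toCZ (a : R) x : toC (a *: x) = a%:C%C * toC x.
Proof. by apply: complex_eq; rewrite ?cReM ?cImM /= !mxE; ring. Qed.
Lemma toC0 : toC 0 = 0. Proof. by apply: complex_eq; rewrite /= mxE. Qed.
Lemma toCK : cancel toC ofC.
Proof. by move=> x; rewrite /ofC /= -row2E. Qed.
Lemma basisE (i j : 'I_2) : E i 0 j = (i == j)%:R.
Proof. by rewrite mxE eqxx /= eq_sym. Qed.
Lemma ofCK : cancel ofC toC.
Proof.
by move=> z; apply: complex_eq;
  rewrite /= !mxE /= ?mulr1 ?mulr0 ?addr0 ?add0r.
Qed.
Lemma toC_inj : injective toC. Proof. exact: can_inj toCK. Qed.

Lemma N_ge0 z : 0 <= N z. Proof. by case: z => a b; exact: sqrtr_ge0. Qed.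
Lemma N_eq0 z : (N z == 0) = (z == 0).
Proof.
apply/eqP/eqP => [/Normc.eq0_normc//|->]; exact: Normc.normc0.
Qed.
Lemma N_gt0 z : (0 < N z) = (z != 0).
Proof. by rewrite lt_neqAle eq_sym N_eq0 N_ge0 andbT. Qed.
Lemma N_sqr z : N z ^+ 2 = complex.Re z ^+ 2 + complex.Im z ^+ 2.
Proof. by case: z => a b; rewrite /= sqr_sqrtr // addr_ge0 // sqr_ge0. Qed.
Lemma NX z n : N (z ^+ n) = N z ^+ n.
Proof. by elim: n => [|n IH]; rewrite ?Normc.normc1 // !exprS Normc.normcM IH. Qed.
Lemma NN z : N (- z) = N z.
Proof. by case: z => a b; rewrite /= !sqrrN. Qed.
Lemma N_conj z : N (conjc z) = N z.
Proof. by case: z => a b; rewrite /= sqrrN. Qed.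
Lemma N_real (a : R) : N a%:C%C = `|a|.
Proof. by rewrite /= expr0n /= addr0 sqrtr_sqr. Qed.
Lemma NB z z' : N (z - z') = N (z' - z). Proof. by rewrite -NN opprB. Qed.
Lemma ND z z' : N (z + z') <= N z + N z'. Proof. exact: le_normcD. Qed.
Lemma N_Re z : `|complex.Re z| <= N z.
Proof.
rewrite -(ler_pXn2r (n := 2)) ?nnegrE ?N_ge0 // N_sqr real_normK ?num_real //.
by rewrite lerDl sqr_ge0.
Qed.
Lemma N_Im z : `|complex.Im z| <= N z.
Proof.
rewrite -(ler_pXn2r (n := 2)) ?nnegrE ?N_ge0 // N_sqr real_normK ?num_real //.
by rewrite lerDr sqr_ge0.
Qed.
Lemma N_mul_conj z : complex.Re (z * conjc z) = N z ^+ 2.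
Proof. by rewrite N_sqr cReM cRe_conj cIm_conj mulrN opprK !expr2. Qed.

(** The norm of ['rV[R]_2] is the sup norm. This bound and the next one allow neighbourhoods to be
    described by Euclidean discs, for which the modulus is multiplicative. *)
Lemma mx_norm_le_N h : `|h| <= N (toC h).
Proof.
have hN i : `|h 0 i| <= N (toC h).
  by move: i; apply: ord2_ind; [exact: (N_Re (toC h))|exact: (N_Im (toC h))].
move: (N (toC h)) (N_ge0 (toC h)) hN => n n0 hN.
rewrite [leLHS]/Num.Def.normr/= mx_normrE; apply: bigmax_le => // -[i j] _.
by rewrite ord1.
Qed.

Lemma N_le_mx_norm h : N (toC h) <= `|h| *+ 2.
Proof.
have -> : toC h = (h 0 0)%:C%C + (h 0 1)%:C%C * 'i%C.
  by apply: complex_eq; rewrite ?cReD ?cImD ?cReM ?cImM /=; ring.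
apply: le_trans (ND _ _) _; rewrite Normc.normcM !N_real mulr2n.
have -> : N 'i%C = 1 by rewrite /= expr0n expr1n add0r sqrtr1.
by rewrite mulr1 lerD // row2_norm.
Qed.

Lemma nbhs_disc x (P : set V) : nbhs x P ->
  exists2 d : R, 0 < d & forall y, N (toC (y - x)) < d -> P y.
Proof.
move=> /nbhs_ballP[d /= d0 dP]; exists d => // y yd; apply: dP.
rewrite -ball_normE /ball_ /= distrC; exact: le_lt_trans (mx_norm_le_N _) yd.
Qed.

Lemma disc_nbhs x (d : R) : 0 < d -> nbhs x [set y | N (toC (y - x)) < d].
Proof.
move=> d0; apply/nbhs_ballP; exists (d / 2); first by rewrite /= divr_gt0.
move=> y; rewrite -ball_normE /ball_ /= distrC => yx.
apply: le_lt_trans (N_le_mx_norm _) _.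
by rewrite -mulr_natr -ltr_pdivlMr.
Qed.

End Plane.

(** * Holomorphic functions and the mean value inequality *)

Section Holomorphic.
Context {R : realType}.
Notation V := 'rV[R]_2.
Notation E := (@basis_vec R).
Notation C := R[i].
Notation N := (@Normc.normc R).
Implicit Types (U : set V) (F G : V -> C) (x : V).

Definition hol U F := csm U F /\
  forall x, U x -> cderive 1 F x = 'i%C * cderive 0 F x.

Lemma hol_csm U F : hol U F -> csm U F. Proof. by case. Qed.

Lemma hol_ext U F G : open U -> (forall x, U x -> F x = G x) -> hol U F -> hol U G.
Proof.
move=> oU FG [sF hF]; split; first exact: csm_ext sF.
by move=> x Ux; rewrite -!(cderive_ext _ oU FG Ux) hF.
Qed.
Lemma hol_sub U U' F : U' `<=` U -> hol U F -> hol U' F.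
Proof.
by move=> sU [sF hF]; split; [exact: csm_sub sF|move=> x /sU /hF].
Qed.
Lemma hol_cst U (a : C) : hol U (fun=> a).
Proof.
split; first exact: csm_cst.
by move=> x _; rewrite !cderive_cst mulr0.
Qed.
Lemma hol_add U F G : open U -> hol U F -> hol U G -> hol U (fun x => F x + G x).
Proof.
move=> oU [sF hF] [sG hG]; split; first exact: csm_add.
by move=> x Ux; rewrite !(cderiveD _ sF sG Ux) hF // hG // mulrDr.
Qed.
Lemma hol_mul U F G : open U -> hol U F -> hol U G -> hol U (fun x => F x * G x).
Proof.
move=> oU [sF hF] [sG hG]; split; first exact: csm_mul.
by move=> x Ux; rewrite !(cderiveM _ sF sG Ux) hF // hG //; ring.
Qed.
Lemma hol_exp U F n : open U -> hol U F -> hol U (fun x => F x ^+ n).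
Proof.
move=> oU hF; elim: n => [|n IH].
  by apply: hol_ext (hol_cst _ 1) => // x _; rewrite expr0.
by apply: hol_ext (hol_mul oU hF IH) => // x _; rewrite exprS.
Qed.
Lemma cderive_inv U F i x : open U -> csm U F -> (forall x, U x -> F x != 0) ->
  U x -> cderive i (fun x => (F x)^-1) x = - cderive i F x / F x ^+ 2.
Proof.
move=> oU sF F0 Ux; have sV := csm_inv oU F0 sF.
have h : cderive i (fun x => F x * (F x)^-1) x = 0.
  rewrite -(cderive_cst 1 i x); apply: (cderive_ext _ oU) => // y Uy.
  by rewrite divff // F0.
move: h; rewrite (cderiveM _ sF sV Ux) => /eqP; rewrite addrC addr_eq0 => /eqP h.
have f0 := F0 x Ux; apply: (mulfI f0); rewrite h.
by field.
Qed.
Lemma hol_inv U F : open U -> (forall x, U x -> F x != 0) -> hol U F ->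
  hol U (fun x => (F x)^-1).
Proof.
move=> oU F0 [sF hF]; split; first exact: csm_inv.
by move=> x Ux; rewrite !(cderive_inv _ oU sF F0 Ux) hF //; ring.
Qed.
Lemma hol_derive U F : open U -> hol U F -> hol U (cderive 0 F).
Proof.
move=> oU [sF hF]; split; first exact: csm_derive.
move=> x Ux; rewrite (cderiveC _ _ oU sF Ux).
rewrite (cderive_ext 0 oU hF Ux).
rewrite (cderiveM _ (csm_cst U 'i%C) (csm_derive 0 sF) Ux) cderive_cst.
by rewrite mul0r add0r.
Qed.

Lemma derive_coord i j x : 'D_(E j) (fun x : V => x 0 i) x = (j == i)%:R.
Proof.
have := @derive_id R V x (E j).
have dd : derivable (id : V -> V) x (E j) by [].
rewrite (derive_mx dd) => /matrixP /(_ 0 i); rewrite mxE => ->.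
by rewrite basisE.
Qed.

Lemma coord_Ck k U i : Ck k U (fun x : V => x 0 i).
Proof.
case: k => [|k]; first by move=> x _; exact: coord_continuous.
split=> [x _|j]; first exact: differentiable_coord.
have -> : 'D_(E j) (fun x : V => x 0 i) = (fun=> (j == i)%:R : R).
  by apply: funext => x; rewrite derive_coord.
exact: Ck_cst.
Qed.

Lemma csm_toC U : csm U toC. Proof. by split=> k; exact: coord_Ck. Qed.
Lemma cderive0_toC x : cderive 0 toC x = 1.
Proof. by apply: complex_eq; rewrite cderiveE derive_coord. Qed.
Lemma cderive1_toC x : cderive 1 toC x = 'i%C.
Proof. by apply: complex_eq; rewrite cderiveE derive_coord. Qed.
Lemma hol_toC U : hol U toC.
Proof.
split; first exact: csm_toC.
by move=> x _; rewrite cderive0_toC cderive1_toC mulr1.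
Qed.
Lemma hol_shift U x0 : open U -> hol U (fun x => toC (x - x0)).
Proof.
move=> oU; apply: hol_ext (hol_add oU (hol_toC U) (hol_cst U (- toC x0))) => //.
by move=> x _; rewrite toCB.
Qed.
Lemma cderive0_shift x0 x : cderive 0 (fun x => toC (x - x0)) x = 1.
Proof.
rewrite -(cderive0_toC x) -[RHS]addr0 -(cderive_cst (- toC x0) 0 x).
rewrite -(cderiveD (U := setT)) //; [|exact: csm_toC|exact: csm_cst].
by apply: (cderive_ext _ openT) => // y _; rewrite toCB.
Qed.
Lemma cderive0_exp U F n x : open U -> hol U F -> U x ->
  cderive 0 (fun x => F x ^+ n.+1) x = n.+1%:R * F x ^+ n * cderive 0 F x.
Proof.
move=> oU hF Ux; elim: n => [|n IH].
  rewrite expr0 !mul1r; apply: (cderive_ext _ oU) => // y _; exact: expr1.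
have e : forall y, U y -> F y ^+ n.+2 = F y * F y ^+ n.+1 by move=> y _; rewrite exprS.
rewrite (cderive_ext _ oU e Ux).
rewrite (cderiveM _ (hol_csm hF) (hol_csm (hol_exp n.+1 oU hF)) Ux) IH.
rewrite exprS -[in RHS]natr1; ring.
Qed.

Lemma is_derive_comb (u s : V -> R) (a b : R) (x v : V) :
  derivable u x v -> derivable s x v ->
  is_derive x v (a *: u - b *: s) (a * 'D_v u x - b * 'D_v s x).
Proof.
move=> /derivableP du /derivableP ds; apply: is_deriveB; exact: is_deriveZ.
Qed.

Lemma hol_directional U F (w : C) (v x : V) : hol U F -> U x ->
  is_derive x v (fun y => complex.Re (w * F y)) (complex.Re (w * cderive 0 F x * toC v)).
Proof.
move=> [[sr si] hF] Ux.
have dr := smooth_differentiable sr Ux; have di := smooth_differentiable si Ux.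
rewrite (_ : (fun y => complex.Re (w * F y)) =
  complex.Re w *: (fun y => complex.Re (F y)) -
  complex.Im w *: (fun y => complex.Im (F y))); last first.
  by apply: funext => y; rewrite cReM.
apply: is_derive_eq (is_derive_comb _ _ (diff_derivable dr) (diff_derivable di)) _.
rewrite !deriveE // !diff_row2 //.
have := hF x Ux => /[dup] /(congr1 (@complex.Re R)) h1 /(congr1 (@complex.Im R)) h2.
move: h1 h2; rewrite cReM cImM !cderiveE /= => h1 h2.
rewrite h1 h2 !(cReM, cImM) !cderiveE /= /GRing.scale /=; ring.
Qed.

(** The real mean value theorem is applied to Re (conj w G) with w the increment of G; the increment
    of this function is |w|^2. *)
Lemma hol_MVT U G (x0 v : V) (M : R) : hol U G ->
  (forall t : R, `|t| <= 1 -> U (x0 + t *: v) /\ N (cderive 0 G (x0 + t *: v)) <= M) ->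
  N (G (x0 + v) - G x0) <= M * N (toC v).
Proof.
move=> hG hU; set w := G (x0 + v) - G x0.
have [->|w0] := eqVneq w 0.
  rewrite Normc.normc0 mulr_ge0 ?N_ge0 //.
  have h0 : `|0 : R| <= 1 by rewrite normr0.
  by have [_] := hU 0 h0; exact: le_trans (N_ge0 _).
pose f y := complex.Re (conjc w * G y).
have df (t : R) : `|t| <= 1 -> is_derive (x0 + t *: v) v f
     (complex.Re (conjc w * cderive 0 G (x0 + t *: v) * toC v)).
  by move=> /hU[Ut _]; exact: hol_directional hG Ut.
have [t|t t1] := @line_MVT _ _ f x0 v 1.
  by rewrite normr1 => t1; case: (df t t1).
rewrite normr1 in t1; rewrite scale1r mul1r; have /@derive_val -> := df t t1.
have -> : f (x0 + v) - f x0 = N w ^+ 2.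
  rewrite /f -N_mul_conj [w * _]mulrC {3}/w mulrBr.
  by rewrite [RHS]cReD; case: (_ * G x0).
move=> h; have Nw : 0 < N w by rewrite N_gt0.
rewrite -(ler_pM2l Nw) -expr2 h.
apply: le_trans (ler_norm _) _; apply: le_trans (N_Re _) _.
rewrite !Normc.normcM N_conj -mulrA ler_wpM2l ?N_ge0 // ler_wpM2r ?N_ge0 //.
by have [] := hU t t1.
Qed.
End Holomorphic.

Lemma within_continuousD (R : realType) (T : topologicalType) (K : set T)
    (f g : T -> R) : {within K, continuous f} -> {within K, continuous g} ->
  {within K, continuous (fun x => f x + g x)}.
Proof.
by move=> cf cg x; exact: (cvgD (cf x) (cg x)).
Qed.

Lemma within_continuousM (R : realType) (T : topologicalType) (K : set T)
    (f g : T -> R) : {within K, continuous f} -> {within K, continuous g} ->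
  {within K, continuous (fun x => f x * g x)}.
Proof.
by move=> cf cg x; exact: (cvgM (cf x) (cg x)).
Qed.

Lemma ler0_dist (R : realDomainType) (a b e : R) : a <= 0 -> `|a - b| <= e -> b <= e.
Proof. by move=> a0; rewrite ler_distlC => /andP[_ h]; lra. Qed.

(** * Maximum principle for square moduli of holomorphic functions *)

Section MaximumPrinciple.
Context {R : realType}.
Notation V := 'rV[R]_2.
Notation E := (@basis_vec R).
Notation C := R[i].
Notation N := (@Normc.normc R).
Implicit Types (U : set V) (F G : V -> C) (x : V).

Lemma second_derivative_at_max U (u : V -> R) x i : open U -> smooth U u -> U x ->
  (forall y, U y -> u y <= u x) -> 'D_(E i) ('D_(E i) u) x <= 0.
Proof.
move=> oU su Ux umax; apply/ler_addgt0Pr => e e0; rewrite add0r.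
have /nbhs_ballP[d /= d0 dP] : \forall y \near x, U y /\
    `|'D_(E i) ('D_(E i) u) y - 'D_(E i) ('D_(E i) u) x| <= e.
  have c2 := continuous_near_le (((su 2).2 i).2 i x Ux) e0.
  by have := open_nbhs_nbhs (conj oU Ux); apply: filterS2 c2.
have P k : `|k| < d -> U (x + k) /\
    `|'D_(E i) ('D_(E i) u) (x + k) - 'D_(E i) ('D_(E i) u) x| <= e.
  by move=> kd; apply: dP; rewrite -ball_normE /ball_ /= opprD addNKr normrN.
pose s := d / 4.
have s0 : 0 < s by rewrite divr_gt0.
have sd k : `|k| <= `|s| *+ 2 -> `|- (s *: E i) + k| < d.
  move=> ks; apply: le_lt_trans (ler_normD _ _) _.
  have h1 : `|- (s *: E i)| <= s.
    by rewrite normrN normrZ gtr0_norm // ler_piMr // ?normE // ltW.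
  apply: le_lt_trans (lerD h1 ks) _.
  by rewrite gtr0_norm // /s mulr2n; lra.
have dd k : `|k| <= `|s| *+ 2 -> differentiable u (x - s *: E i + k) /\
     differentiable ('D_(E i) u) (x - s *: E i + k).
  rewrite -addrA => /sd /P[Uk _]; split; first exact: (su 1).1.
  exact: ((su 2).2 i).1.
(* Based at [x - s *: E i], this is the central difference u(x + h) - 2 u(x) + u(x - h), which is
   nonpositive at a maximum. *)
have [k /sd ks ek] := second_difference i dd.
have [Uk hk] := P _ ks; rewrite addrA in hk.
have h : 'D_(E i) ('D_(E i) u) (x - s *: E i + k) <= 0.
  rewrite -(pmulr_rle0 _ (mulr_gt0 s0 s0)) -ek subrK.
  have Us1 : U (x + s *: E i).
    apply: (P _ _).1; rewrite normrZ gtr0_norm //.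
    apply: le_lt_trans (ler_piMr (ltW s0) (normE i)) _; rewrite /s; lra.
  have Us2 : U (x - s *: E i).
    apply: (P _ _).1; rewrite normrN normrZ gtr0_norm //.
    apply: le_lt_trans (ler_piMr (ltW s0) (normE i)) _; rewrite /s; lra.
  have := umax _ Us1; have := umax _ Us2; lra.
exact: ler0_dist h hk.
Qed.

Section Sf.
Variable U0 : oset V.
Notation U := (os U0).
Let oU : open U := os_open U0.

Lemma sf_laplacian (s : smoothfun U0) x : U x ->
  (db (dz (s : sfR U0)) : smoothfun U0) x =
  4^-1 * (cderive 0 (cderive 0 s) x + cderive 1 (cderive 1 s) x).
Proof.
move=> Ux; rewrite sf_dbE //.
have sa i : csm U (cderive i s) by apply/csm_derive/sv_smooth.
have h3 i : cderive i (sf_dz s) x =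
    2^-1 * (cderive i (cderive 0 s) x - 'i%C * cderive i (cderive 1 s) x).
  have sc := csm_mul oU (csm_cst U (- 'i%C)) (sa 1).
  have e y : U y -> sf_dz s y = 2^-1 * (cderive 0 s y + - 'i%C * cderive 1 s y).
    by move=> Uy; rewrite sf_dzE // mulNr.
  rewrite (cderive_ext _ oU e Ux).
  rewrite (cderiveM _ (csm_cst U 2^-1) (csm_add oU (sa 0) sc) Ux).
  rewrite (cderiveD _ (sa 0) sc Ux) (cderiveM _ (csm_cst U (- 'i%C)) (sa 1) Ux).
  by rewrite (cderive_cst 2^-1 i x) (cderive_cst (- 'i%C) i x); ring.
rewrite !h3 (cderiveC 1 0 oU (sv_smooth s) Ux).
have -> : (4^-1 : C) = 2^-1 * 2^-1 by rewrite -invfM -natrM.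
have ii : 'i%C * 'i%C = -1 :> C by rewrite -expr2 sqr_i.
by ring: ii.
Qed.

Lemma laplacian_at_max (s : smoothfun U0) x : U x ->
  (forall y, U y -> complex.Re (s y) <= complex.Re (s x)) ->
  complex.Re ((db (dz (s : sfR U0)) : smoothfun U0) x) <= 0.
Proof.
move=> Ux smax; rewrite sf_laplacian //.
have -> : (4^-1 : C) = (4^-1)%:C%C by rewrite fmorphV rmorph_nat.
rewrite cReM /= mul0r subr0 cReD !cderiveE.
have [sr _] := sv_smooth s.
have h i : 'D_(E i) (fun x => complex.Re (cderive i s x)) x <= 0.
  have -> : (fun x => complex.Re (cderive i s x)) =
      'D_(E i) (fun x => complex.Re (s x)).
    by apply: funext => y; rewrite cderiveE.
  exact: second_derivative_at_max Ux smax.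
by rewrite pmulr_rle0 ?invr_gt0 // -[leRHS]addr0 lerD.
Qed.

Lemma hol_db F : hol U F -> db (sfof U0 F : sfR U0) = 0.
Proof.
move=> [sF hF]; apply: sfP => x Ux; rewrite sf_dbE // sf0 //.
have e i : cderive i (sfof U0 F) x = cderive i F x.
  by apply: (cderive_ext _ oU) => // y Uy; rewrite sfofE.
rewrite !e hF // mulrA -expr2 sqr_i; ring.
Qed.

Lemma db_hol (a : smoothfun U0) : db (a : sfR U0) = 0 -> hol U a.
Proof.
move=> h; split=> [|x Ux]; first exact: sv_smooth.
have := congr1 (fun b : smoothfun U0 => b x) h.
rewrite sf_dbE // sf0 // => /eqP; rewrite mulf_eq0 invr_eq0 pnatr_eq0 /= addrC.
rewrite addr_eq0 => /eqP h1.
have ii : 'i%C * 'i%C = -1 :> C by rewrite -expr2 sqr_i.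
have : 'i%C * ('i%C * cderive 1 a x) = 'i%C * (- cderive 0 a x) by rewrite h1.
by rewrite mulrA ii mulN1r mulrN => /oppr_inj.
Qed.

Lemma hol_dz (a : smoothfun U0) x : hol U a -> U x -> (dz (a : sfR U0) : smoothfun U0) x = cderive 0 a x.
Proof.
move=> [_ h] Ux; rewrite sf_dzE // h // mulrA -expr2 sqr_i mulN1r opprK.
by field.
Qed.
End Sf.

Lemma N_toC_continuous : continuous (fun x : V => N (toC x) ^+ 2).
Proof.
have -> : (fun x : V => N (toC x) ^+ 2) =
    (fun x : V => x 0 0 * x 0 0 + x 0 1 * x 0 1).
  by apply: funext => x; rewrite N_sqr /= !expr2.
move=> x; apply: (@continuousD _ _ _ (fun x : V => x 0 0 * x 0 0)
  (fun x : V => x 0 1 * x 0 1)).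
  by apply: (@continuousM _ _ (fun x : V => x 0 0) (fun x : V => x 0 0));
    exact: coord_continuous.
by apply: (@continuousM _ _ (fun x : V => x 0 1) (fun x : V => x 0 1));
  exact: coord_continuous.
Qed.

(** Adding a small multiple of |x|^2 makes the Laplacian strictly positive wherever w is |F|^2, so a
    maximum above M cannot lie there. The alternative [w x <= M] admits exceptional interior points,
    such as punctures, where w is not of this form. *)
Lemma maximum_principle (K B : set V) (w : V -> R) (M : R) : compact K ->
  {within K, continuous w} -> (forall x, B x -> w x <= M) ->
  (forall x, K x -> ~ B x -> w x <= M \/ exists U, [/\ open U, U x, U `<=` K &
    exists2 F, hol U F & forall y, U y -> w y = N (F y) ^+ 2]) ->
  forall x, K x -> w x <= M.
Proof.
move=> cK cw wB wK x0 Kx0; rewrite leNgt; apply/negP => Mw.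
have K0 : K !=set0 by exists x0.
have cq : {within K, continuous (fun x : V => N (toC x) ^+ 2)}.
  exact/continuous_subspaceT/N_toC_continuous.
have [c /set_mem Kc cmax] := compact_EVT_max K0 cK cq.
pose b := N (toC c) ^+ 2 + 1.
have b0 : 0 < b by rewrite ltr_wpDl // exprn_ge0 // N_ge0.
(* Since b bounds |x|^2 on K, the perturbation stays within half of the excess of w over M. *)
pose e := (w x0 - M) / (2 * b).
have e0 : 0 < e by rewrite divr_gt0 ?subr_gt0 // mulr_gt0.
pose v x := w x + e * N (toC x) ^+ 2.
have cv : {within K, continuous v}.
  apply: within_continuousD => //; apply: within_continuousM => //.
  by apply: continuous_subspaceT => x; exact: cst_continuous.
have [p /set_mem Kp pmax] := compact_EVT_max K0 cK cv.
have wp : M < w p.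
  have h1 : w x0 <= v p.
    apply: le_trans (pmax x0 _); last exact/mem_set.
    by rewrite lerDl mulr_ge0 ?exprn_ge0 ?N_ge0 // ltW.
  have h2 : N (toC p) ^+ 2 <= b.
    by rewrite ler_wpDr // cmax //; exact/mem_set.
  have h3 : e * N (toC p) ^+ 2 <= (w x0 - M) / 2.
    apply: le_trans (ler_wpM2l (ltW e0) h2) _; rewrite /e.
    by have -> : (w x0 - M) / (2 * b) * b = (w x0 - M) / 2
      by field; rewrite gt_eqF.
  move: h1; rewrite /v; lra.
have nB : ~ B p by move=> /wB; rewrite leNgt wp.
have [|[U [oU Up UK [F hF wF]]]] := wK p Kp nB; first by rewrite leNgt wp.
pose U0 := Oset oU.
pose a : sfR U0 := sfof U0 F; pose t : sfR U0 := sfof U0 toC.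
have dba : db a = 0 by exact: (hol_db (U0 := U0)).
have dbt : db t = 0 by exact: (hol_db (U0 := U0) (hol_toC _)).
have dzt : dz t = 1.
  apply: sfP => x Ux; rewrite sf1 //.
  rewrite hol_dz //; last exact: (db_hol dbt).
  rewrite -(cderive0_toC x); apply: (cderive_ext _ oU) => // y Uy.
  by rewrite sfofE //; exact: csm_toC.
pose s : sfR U0 := a * cj a + dk e%:C%C * (t * cj t).
have dbs : db (dz s) = dz a * cj (dz a) + dk e%:C%C.
  rewrite /s dzD !dzM dz_dk !dz_cj dba dbt !rmorph0 !mulr0 !addr0 mul0r add0r dzt.
  rewrite dbD !dbM db_dk db_cj -dz_db dba dz0 db1 !mul0r !add0r db_cj dzt rmorph1.
  by rewrite mul1r mulr1.
have sE y : U y -> complex.Re ((s : smoothfun U0) y) = v y.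
  move=> Uy; rewrite (sfD _ _ (U0 := U0)) // !(sfM _ _ (U0 := U0)) //.
  rewrite !mksfE // !sfofE //; [|exact: csm_toC|exact: hol_csm].
  rewrite cReD N_mul_conj -wF // cReM /= mul0r subr0; congr (_ + _ * _).
  by rewrite -N_mul_conj cReM cRe_conj cIm_conj.
have := @laplacian_at_max U0 s p Up.
rewrite dbs => /(_ _)/wrap[].
  move=> y Uy; rewrite !sE //; apply: pmax; exact/mem_set/UK.
rewrite (sfD _ _ (U0 := U0)) // (sfM _ _ (U0 := U0)) // !mksfE // cReD N_mul_conj.
rewrite leNgt => /negP; apply.
by rewrite ltr_wpDl // exprn_ge0 // N_ge0.
Qed.

End MaximumPrinciple.

#[local] Arguments Normc.normc : simpl never.
#[local] Arguments toC : simpl never.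

(** * Taylor expansion, isolated zeros and the strong maximum principle *)

Section Taylor.
Context {R : realType}.
Notation V := 'rV[R]_2.
Notation E := (@basis_vec R).
Notation C := R[i].
Notation N := (@Normc.normc R).
Implicit Types (U : set V) (F G : V -> C) (x : V).

Lemma N_i : N 'i%C = 1.
Proof. by rewrite /Normc.normc /= expr0n expr1n add0r sqrtr1. Qed.

Lemma near_le_continuous (T : topologicalType) (f : T -> R) (x : T) :
  (forall e, 0 < e -> \forall y \near x, `|f y - f x| <= e) -> {for x, continuous f}.
Proof.
move=> h; apply/cvgrPdist_le => e /h; apply: filterS => y.
by rewrite distrC.
Qed.

Lemma continuous_div_exp (T : topologicalType) (f g : T -> R) (x : T) k :
  {for x, continuous f} -> {for x, continuous g} -> g x != 0 ->
  {for x, continuous (fun y => f y / g y ^+ k)}.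
Proof.
move=> cf cg g0.
have cgk : {for x, continuous (fun y => g y ^+ k)}.
  elim: k => [|k IH].
    have -> : (fun y => g y ^+ 0) = (fun=> 1) by apply: funext => y; rewrite expr0.
    exact: cst_continuous.
  have -> : (fun y => g y ^+ k.+1) = (fun y => g y * g y ^+ k).
    by apply: funext => y; rewrite exprS.
  exact: (cvgM cg IH).
by apply: (cvgM cf); apply: cvgV => //; rewrite expf_neq0.
Qed.

Lemma csm_continuous U F x : csm U F -> U x ->
  {for x, continuous (fun y => complex.Re (F y))} /\
  {for x, continuous (fun y => complex.Im (F y))}.
Proof.
by move=> [sr si] Ux; split; apply: differentiable_continuous;
  [exact: (sr 1).1|exact: (si 1).1].
Qed.

Lemma csm_continuous_N U F x : csm U F -> U x ->
  {for x, continuous (fun y => N (F y) ^+ 2)}.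
Proof.
move=> sF Ux; have [cr ci] := csm_continuous sF Ux.
have -> : (fun y => N (F y) ^+ 2) = (fun y => complex.Re (F y) * complex.Re (F y) +
    complex.Im (F y) * complex.Im (F y)).
  by apply: funext => y; rewrite N_sqr !expr2.
exact: (cvgD (cvgM cr cr) (cvgM ci ci)).
Qed.

Lemma csm_continuous_dist U F x (e : R) : csm U F -> U x -> 0 < e ->
  exists2 d, 0 < d & forall y, N (toC (y - x)) < d -> N (F y - F x) <= e.
Proof.
move=> sF Ux e0; have [cr ci] := csm_continuous sF Ux.
have e2 : 0 < e / 2 by rewrite divr_gt0.
have : \forall y \near x, N (F y - F x) <= e.
  apply: filterS2 (continuous_near_le cr e2) (continuous_near_le ci e2) => y h1 h2.
  have -> : F y - F x = (complex.Re (F y) - complex.Re (F x))%:C%C +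
      (complex.Im (F y) - complex.Im (F x))%:C%C * 'i%C.
    by apply: complex_eq; rewrite ?(cReD, cImD, cReM, cImM) /=;
      case: (F y) (F x) => [? ?] [? ?] /=; ring.
  apply: le_trans (ND _ _) _; rewrite Normc.normcM !N_real.
  by rewrite N_i mulr1 (splitr e) lerD.
exact: nbhs_disc.
Qed.

Definition cderivn k F := iter k (cderive 0) F.

(** Induction on k: the expansion of the derivative is integrated by [hol_MVT]. *)
Lemma hol_taylor U F x0 k : open U -> hol U F -> U x0 ->
  (forall j, (j < k)%N -> cderivn j F x0 = 0) -> forall e : R, 0 < e ->
  exists2 d, 0 < d & forall x, N (toC (x - x0)) < d -> U x /\
    N (F x - cderivn k F x0 / k`!%:R * toC (x - x0) ^+ k) <=
      e * N (toC (x - x0)) ^+ k.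
Proof.
move=> oU; elim: k F => [|k IH] F hF Ux0 F0 e e0.
  have [d1 d10 h1] := csm_continuous_dist (hol_csm hF) Ux0 e0.
  have [d2 d20 h2] := nbhs_disc (open_nbhs_nbhs (conj oU Ux0)).
  exists (Num.min d1 d2) => [|x]; first by rewrite lt_min d10.
  rewrite lt_min => /andP[x1 x2]; split; first exact: h2.
  by rewrite !expr0 !mulr1 fact0 divr1; exact: h1.
have [j jk|d d0 hd] := IH _ (hol_derive oU hF) Ux0 _ e e0.
  by rewrite /cderivn -iterSr; exact: (F0 j.+1).
exists d => // x xd; split; first by have [] := hd x xd.
pose a := cderivn k.+1 F x0 / (k.+1)`!%:R.
pose G y := F y + (- a) * toC (y - x0) ^+ k.+1.
have hs := hol_shift x0 oU.
have hG : hol U G by apply: hol_add => //; apply: hol_mul => //; [exact: hol_cst|exact: hol_exp].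
have G0 : G x0 = 0.
  by rewrite /G subrr toC0 expr0n mulr0 addr0; exact: (F0 0%N).
rewrite -/a; have -> : F x - a * toC (x - x0) ^+ k.+1 = G (x0 + (x - x0)) - G x0.
  have e0' : x0 + (x - x0) = x by rewrite addrC subrK.
  by rewrite G0 subr0 e0' /G mulNr.
rewrite exprSr mulrA; apply: hol_MVT hG _ => t t1.
have xt : N (toC (x0 + t *: (x - x0) - x0)) <= N (toC (x - x0)).
  by rewrite [x0 + _]addrC addrK toCZ Normc.normcM N_real ler_piMl // N_ge0.
have [Ut ht] := hd _ (le_lt_trans xt xd); split=> //.
have -> : cderive 0 G (x0 + t *: (x - x0)) = cderive 0 F (x0 + t *: (x - x0)) -
    cderivn k (cderive 0 F) x0 / k`!%:R * toC (x0 + t *: (x - x0) - x0) ^+ k.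
  rewrite (cderiveD _ (hol_csm hF) (hol_csm (hol_mul oU (hol_cst U (- a))
     (hol_exp k.+1 oU hs))) Ut).
  rewrite (cderiveM _ (csm_cst U (- a)) (hol_csm (hol_exp k.+1 oU hs)) Ut).
  rewrite (cderive_cst (- a) 0) mul0r add0r (cderive0_exp k oU hs Ut) cderive0_shift mulr1.
  rewrite mulNr /a /cderivn iterSr; congr (_ - _); rewrite mulrA; congr (_ * _).
  rewrite factS natrM; move: (iter _ _ _ _) => c.
  have n1 : k.+1%:R != 0 :> C by rewrite pnatr_eq0.
  have n2 : k`!%:R != 0 :> C by rewrite pnatr_eq0 -lt0n fact_gt0.
  move: n1 n2; move: (k.+1%:R) (k`!%:R) => b b' n1 n2.
  by field; rewrite n1 n2.
apply: le_trans ht _; rewrite ler_wpM2l ?(ltW e0) // lerXn2r // nnegrE N_ge0 //.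
Qed.

Lemma compact_square x0 (r : R) : compact [set y : V | `|y - x0| <= r].
Proof.
have -> : [set y : V | `|y - x0| <= r] = closed_ball_ Num.norm x0 r.
  by apply/seteqP; split=> y /=; rewrite distrC.
apply: bounded_closed_compact; last exact: closed_closed_ball_.
exists (`|x0| + r); split; first by rewrite num_real.
move=> M hM y /= yr; apply: ltW; apply: le_lt_trans hM.
rewrite -[y](subrKC x0) addrC; apply: le_trans (ler_normD _ _) _.
by rewrite addrC lerD // distrC.
Qed.

Lemma open_square x0 (r : R) : open [set y : V | `|y - x0| < r].
Proof.
have -> : [set y : V | `|y - x0| < r] = ball x0 r.
  by rewrite -ball_normE; apply/seteqP; split=> y /=; rewrite distrC.
exact: ball_open.
Qed.

(** The maximum principle for |F|^2 / |x - x0|^(2k) on a square of half side r bounds |F|^2 by M q^k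
    with q = (|x - x0| / r)^2; for |x - x0| < r, let k tend to infinity. At x0 the quotient has the
    value 0, and flatness makes it continuous there. *)
Lemma hol_flat U F x0 : open U -> hol U F -> U x0 ->
  (forall j, cderivn j F x0 = 0) ->
  exists2 d, 0 < d & forall x, N (toC (x - x0)) < d -> F x = 0.
Proof.
move=> oU hF Ux0 F0.
have /nbhs_ballP[d /= d0 dU] := open_nbhs_nbhs (conj oU Ux0).
pose r := d / 2.
have r0 : 0 < r by rewrite divr_gt0.
have KU (y : V) : `|y - x0| <= r -> U y.
  move=> yr; apply: dU; rewrite -ball_normE /ball_ /= distrC.
  by apply: le_lt_trans yr _; rewrite /r; lra.
pose K := [set y : V | `|y - x0| <= r].
have cK : compact K by exact: compact_square.
have cF : {within K, continuous (fun y => N (F y) ^+ 2)}.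
  apply: continuous_in_subspaceT => y /set_mem /KU Uy.
  exact: csm_continuous_N (hol_csm hF) Uy.
have K0 : K !=set0 by exists x0; rewrite /K /= subrr normr0 ltW.
have [c _ cmax] := compact_EVT_max K0 cK cF.
pose M := N (F c) ^+ 2.
have M0 : 0 <= M by rewrite exprn_ge0 // N_ge0.
pose w k (y : V) := N (F y) ^+ 2 / (N (toC (y - x0)) ^+ 2) ^+ k.
have Fx0 : F x0 = 0 by exact: (F0 0%N).
have cz (y : V) : {for y, continuous (fun z : V => N (toC (z - x0)) ^+ 2)}.
  exact: (csm_continuous_N (U := setT) (hol_csm (hol_shift x0 openT))).
have toCn0 (y : V) : y != x0 -> toC (y - x0) != 0.
  by rewrite -(inj_eq (@toC_inj R)) toCB subr_eq0.
have Nn0 (y : V) : y != x0 -> N (toC (y - x0)) ^+ 2 != 0.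
  by move=> /toCn0; rewrite expf_eq0 N_eq0.
have key k (y : V) : `|y - x0| <= r -> w k.+1 y <= M / (r ^+ 2) ^+ k.+1.
  apply: (@maximum_principle _ K [set y | `|y - x0| = r]) => //.
  - apply: continuous_in_subspaceT => {}y /set_mem Ky.
    have [->|yx0] := eqVneq y x0.
      apply: near_le_continuous => e e0.
      have [dd dd0 hdd] := hol_taylor (k := k.+2) oU hF Ux0 (fun j _ => F0 j) ltr01.
      have : \forall y \near x0, N (toC (y - x0)) < dd /\ N (toC (y - x0)) ^+ 2 <= e.
        have := continuous_near_le (cz x0) e0; have := disc_nbhs x0 dd0.
        apply: filterS2 => z /= zd; rewrite subrr toC0 Normc.normc0 expr0n subr0.
        by move=> /ler_normlP[_].
      apply: filterS => z [/hdd[_]]; rewrite F0 mul0r mul0r subr0 mul1r => hz ze.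
      rewrite /w Fx0 Normc.normc0 expr0n mul0r subr0 ger0_norm; last first.
        by rewrite divr_ge0 ?exprn_ge0 ?N_ge0.
      have [->|zx0] := eqVneq z x0.
        by rewrite Fx0 Normc.normc0 expr0n mul0r ltW.
      have pz : 0 < N (toC (z - x0)) by rewrite N_gt0 toCn0.
      apply: le_trans ze; rewrite ler_pdivrMr ?exprn_gt0 //.
      rewrite -exprS -exprM mulnC exprM lerXn2r ?nnegrE ?N_ge0 ?exprn_ge0 //.
      exact: N_ge0.
    apply: continuous_div_exp (cz y) (Nn0 y yx0).
    exact: csm_continuous_N (hol_csm hF) (KU y Ky).
  - move=> {}y /= yr; rewrite /w ler_pM ?invr_ge0 ?exprn_ge0 ?N_ge0 //.
      by apply: cmax; rewrite inE /K /= yr.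
    have h : r <= N (toC (y - x0)) by rewrite -yr; exact: mx_norm_le_N.
    rewrite lef_pV2 ?posrE ?exprn_gt0 //; last exact: lt_le_trans h.
    by rewrite lerXn2r ?nnegrE ?exprn_ge0 ?N_ge0 ?(ltW r0) //
      lerXn2r ?nnegrE ?N_ge0 ?(ltW r0).
  - move=> {}y /= Ky nBy; have [->|yx0] := eqVneq y x0.
      by left; rewrite /w Fx0 Normc.normc0 expr0n mul0r divr_ge0 // exprn_ge0 // exprn_ge0 // ltW.
    right; pose W := [set y : V | `|y - x0| < r] `&` ~` [set x0].
    have oW : open W.
      apply: openI; first exact: open_square.
      by rewrite openC; apply: accessible_closed_set1; apply: hausdorff_accessible; exact: norm_hausdorff.
    exists W; split=> //.
    + split=> //; last exact/eqP.
      by rewrite /= lt_neqAle Ky andbT; apply/eqP.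
    + by move=> z [/ltW zr _].
    + exists (fun y => F y * (toC (y - x0) ^+ k.+1)^-1).
        apply: hol_mul => //.
          by apply: hol_sub hF => z [/ltW /KU].
        apply: hol_inv => //; last exact/hol_exp/hol_shift.
        by move=> z [_ /eqP zx0]; rewrite expf_neq0 // toCn0.
      move=> z _; rewrite /w Normc.normcM Normc.normcV NX expr_div_n.
      by rewrite -!exprM mulnC.
exists r => // y yr; apply/eqP; rewrite -N_eq0 -sqrf_eq0; apply/eqP.
have [->|yx0] := eqVneq y x0; first by rewrite Fx0 Normc.normc0 expr0n.
have yr' : `|y - x0| <= r by apply: ltW; exact: le_lt_trans (mx_norm_le_N _) yr.
pose q := N (toC (y - x0)) ^+ 2 / r ^+ 2.
have q0 : 0 <= q by rewrite divr_ge0 ?exprn_ge0 ?N_ge0 // ltW.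
have q1 : q < 1.
  rewrite ltr_pdivrMr ?exprn_gt0 // mul1r ltrXn2r ?nnegrE ?N_ge0 ?(ltW r0) //.
have h k : N (F y) ^+ 2 <= M * q ^+ k.+1.
  have := key k y yr'; rewrite /w ler_pdivrMr.
    by move=> /le_trans; apply; rewrite [q ^+ _]expr_div_n mulrAC -mulrA.
  by rewrite exprn_gt0 // lt_neqAle eq_sym Nn0 // exprn_ge0 // N_ge0.
apply/eqP; rewrite eq_le exprn_ge0 ?N_ge0 // andbT leNgt; apply/negP => p0.
have ck : (fun k => M * q ^+ k.+1) @ \oo --> (0 : R).
  rewrite -(mulr0 M); apply: cvgM; first exact: cvg_cst.
  by rewrite (cvg_shiftS (fun k => q ^+ k)); apply: cvg_expr; rewrite ger0_norm.
have [n _ /(_ n (leqnn n))] := @cvgr_dist_lt _ _ _ _ _ _ _ ck _ p0.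
rewrite /= sub0r normrN ger0_norm ?mulr_ge0 ?exprn_ge0 ?N_ge0 //.
by rewrite ltNge h.
Qed.

Lemma hol_nonzero_order U F x0 : open U -> hol U F -> U x0 ->
  ~ (exists2 d, 0 < d & forall x, N (toC (x - x0)) < d -> F x = 0) ->
  exists k, (forall j, (j < k)%N -> cderivn j F x0 = 0) /\ cderivn k F x0 <> 0.
Proof.
move=> oU hF Ux0 nz.
have ex : exists k, cderivn k F x0 != 0.
  apply: contra_notP nz => nex; apply: hol_flat hF Ux0 _ => // j.
  by apply/eqP; apply: contra_notT nex => h; exists j.
exists (ex_minn ex); case: ex_minnP => k /eqP hk hmin; split=> // j jk.
by apply/eqP; apply: contraTT jk => /hmin; rewrite -leqNgt.
Qed.

(** Near a zero of finite order the Taylor remainder is at most half of the leading term. *)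
Lemma hol_isolated U F x0 : open U -> hol U F -> U x0 ->
  (exists2 d, 0 < d & forall x, N (toC (x - x0)) < d -> F x = 0) \/
  (exists2 d, 0 < d & forall x, N (toC (x - x0)) < d -> x <> x0 -> F x <> 0).
Proof.
move=> oU hF Ux0; case: (pselect (exists2 d, 0 < d & forall x, N (toC (x - x0)) < d -> F x = 0)); first by left.
move=> /(hol_nonzero_order oU hF Ux0)[k [h0 /eqP hk]]; right.
pose a := cderivn k F x0 / k`!%:R.
have a0 : a != 0 by rewrite mulf_neq0 // invr_neq0 // pnatr_eq0 -lt0n fact_gt0.
have Na : 0 < N a by rewrite N_gt0.
have [d d0 hd] := hol_taylor oU hF Ux0 h0 (divr_gt0 Na (ltr0n R 2)).
exists d => // x /hd[_ +] /eqP xx0 Fx0; rewrite Fx0 sub0r NN Normc.normcM NX.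
have zp : 0 < N (toC (x - x0)) ^+ k.
  by rewrite exprn_gt0 // N_gt0 toCB subr_eq0 (inj_eq (@toC_inj R)).
rewrite ler_pM2r // -/a => h; move: h Na; lra.
Qed.

Lemma complex_root (c : C) k : (0 < k)%N -> exists z, z ^+ k = c.
Proof.
move=> k0; have [x] := @solve_monicpoly C k (fun i => if i == 0%N then c else 0) k0.
rewrite -(prednK k0) big_ord_recl big1 ?addr0 => [xk|i _]; last by rewrite mul0r.
by exists x; rewrite xk expr0 mulr1.
Qed.

(* Near [x0], [F - F x0] behaves like a (x - x0)^k, and a k-th root of a suitable
   direction increases |F|. *)
Lemma hol_strong_max U F x0 : open U -> hol U F -> U x0 ->
  (\forall x \near x0, N (F x) <= N (F x0)) -> \forall x \near x0, F x = F x0.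
Proof.
move=> oU hF Ux0 mx; apply: contrapT => nc.
pose G x := F x - F x0.
have hG : hol U G by apply: hol_add => //; exact: hol_cst.
have [|k [h0 /eqP hk]] := hol_nonzero_order oU hG Ux0.
  move=> [d d0 hd]; apply: nc; have := disc_nbhs x0 d0; apply: filterS => x /hd /eqP.
  by rewrite subr_eq0 => /eqP.
have k0 : (0 < k)%N.
  by rewrite lt0n; apply: contraNneq hk => ->; rewrite /cderivn /= /G subrr.
pose a := cderivn k G x0 / k`!%:R.
have a0 : a != 0 by rewrite mulf_neq0 // invr_neq0 // pnatr_eq0 -lt0n fact_gt0.
have [F0|F0] := eqVneq (F x0) 0.
  apply: nc; apply: filterS mx => x; rewrite F0 Normc.normc0 => h.
  by apply/eqP; rewrite -N_eq0 eq_le h N_ge0.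
(* At z = t u the leading term a z^k is t^k F(x0), so |F| grows by t^k |F(x0)| up to an error of at
   most half of this. *)
have [u hu] := complex_root (F x0 / a) k0.
have [d1 d10 hd1] := nbhs_disc mx.
have e0 : 0 < N a / 2 by rewrite divr_gt0 // N_gt0.
have [d d0 hd] := hol_taylor oU hG Ux0 h0 e0.
have u0 : u != 0.
  by apply: contraNneq (mulf_neq0 F0 (invr_neq0 a0)) => u0; rewrite -hu u0 expr0n gtn_eqF.
have Nu : 0 < N u by rewrite N_gt0.
pose t := Num.min (1/2) (Num.min d d1 / N u / 2).
have dd : 0 < Num.min d d1 by rewrite lt_min d0.
have t0 : 0 < t by rewrite lt_min !divr_gt0.
have t1 : t <= 1/2 by rewrite ge_min lexx.
pose z := t%:C%C * u.
have Nz : N z = t * N u by rewrite Normc.normcM N_real ger0_norm // ltW.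
have zd : N z < Num.min d d1.
  have h : t <= Num.min d d1 / N u / 2 by rewrite ge_min lexx orbT.
  rewrite Nz -ltr_pdivlMr //; apply: le_lt_trans h _.
  by rewrite ltr_pdivrMr // ltr_pMr ?divr_gt0 // ltr1n.
pose x := x0 + ofC z.
have ex : toC (x - x0) = z by rewrite /x addrC addKr ofCK.
have /hd[_ {}hd] : N (toC (x - x0)) < d by rewrite ex (lt_le_trans zd) // ge_min lexx.
have {}hd1 : N (F x) <= N (F x0).
  by apply: hd1; rewrite ex (lt_le_trans zd) // ge_min lexx orbT.
move: hd; rewrite ex -/a.
have -> : a * z ^+ k = (t ^+ k)%:C%C * F x0.
  by rewrite /z exprMn hu rmorphXn /= mulrCA; congr (_ * _); rewrite mulrC divfK.
have NaF : N a * N u ^+ k = N (F x0).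
  by rewrite -NX hu -Normc.normcM mulrC divfK.
have tk : 0 < t ^+ k by rewrite exprn_gt0.
have NF : 0 < N (F x0) by rewrite N_gt0.
have -> : N a / 2 * N z ^+ k = t ^+ k * N (F x0) / 2.
  by rewrite Nz exprMn -NaF; ring.
have -> : G x - (t ^+ k)%:C%C * F x0 = F x - (1 + t ^+ k)%:C%C * F x0.
  by rewrite /G rmorphD /= rmorph1; ring.
have e1 : (1 + t ^+ k)%:C%C * F x0 = F x - (F x - (1 + t ^+ k)%:C%C * F x0) by ring.
move=> hd; have : N ((1 + t ^+ k)%:C%C * F x0) <= N (F x0) + t ^+ k * N (F x0) / 2.
  by rewrite {1}e1; apply: le_trans (ND _ _) _; rewrite NN; exact: lerD.
rewrite Normc.normcM N_real ger0_norm ?addr_ge0 ?ler01 ?(ltW tk) // mulrDl mul1r.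
have : 0 < t ^+ k * N (F x0) by rewrite mulr_gt0.
move: (t ^+ k * N (F x0)) => b; lra.
Qed.

End Taylor.

(** * Change of coordinates and charts *)

Section Pull.
Context {R : realType}.
Notation V := 'rV[R]_2.
Notation E := (@basis_vec R).
Notation C := R[i].
Variables (U U' : oset V) (T : V -> V).

Lemma csm_comp F : csm (os U) F -> csm (os U') (fun x => toC (T x)) ->
  (forall x, os U' x -> os U (T x)) -> csm (os U') (fun x => F (T x)).
Proof.
move=> [sr si] [tr ti] TU.
have tj k j : Ck k (os U') (fun x => T x 0 j).
  by move: j; apply: ord2_ind; [exact: tr|exact: ti].
split=> k.
  exact: (Ck_comp (os_open U) (os_open U') TU (sr k)).
exact: (Ck_comp (os_open U) (os_open U') TU (si k)).
Qed.

Lemma cderive_comp F i x : csm (os U) F -> csm (os U') (fun x => toC (T x)) ->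
  os U' x -> os U (T x) -> cderive i (fun x => F (T x)) x =
  cderive 0 F (T x) * (complex.Re (cderive i (fun x => toC (T x)) x))%:C%C +
  cderive 1 F (T x) * (complex.Im (cderive i (fun x => toC (T x)) x))%:C%C.
Proof.
move=> [sr si] [tr ti] U'x UTx.
have dT j : differentiable (fun y => T y 0 j) x.
  by move: j; apply: ord2_ind; [apply: (smooth_differentiable tr)|apply: (smooth_differentiable ti)].
have h (u : V -> R) : smooth (os U) u -> 'D_(E i) (fun x => u (T x)) x =
    'D_(E 0) u (T x) * 'D_(E i) (fun y => T y 0 0) x +
    'D_(E 1) u (T x) * 'D_(E i) (fun y => T y 0 1) x.
  by move=> su; apply: derive_comp2 => //; exact: (smooth_differentiable su).
apply: complex_eq; rewrite ?cReD ?cImD ?cReM ?cImM /= !cderiveE.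
  by rewrite (h (fun x => complex.Re (F x))) //= !mulr0 !subr0.
by rewrite (h (fun x => complex.Im (F x))) //= !mulr0 !add0r.
Qed.

Hypothesis (TU : forall x, os U' x -> os U (T x)).
Hypothesis (hT : hol (os U') (fun x => toC (T x))).
Let T' x := cderive 0 (fun x => toC (T x)) x.

(** The chain rule for 2 d/dz and 2 d/dzbar when only T is holomorphic: the factors are T' and its
    conjugate. *)
Lemma cderive_pull F x : csm (os U) F -> os U' x ->
  cderive 0 (fun x => F (T x)) x - 'i%C * cderive 1 (fun x => F (T x)) x =
  T' x * (cderive 0 F (T x) - 'i%C * cderive 1 F (T x)) /\
  cderive 0 (fun x => F (T x)) x + 'i%C * cderive 1 (fun x => F (T x)) x =
  conjc (T' x) * (cderive 0 F (T x) + 'i%C * cderive 1 F (T x)).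
Proof.
move=> sF U'x.
rewrite !(cderive_comp _ sF (hol_csm hT)) ?hT.2 //; try exact: TU.
rewrite -/(T' x).
have -> : complex.Re ('i%C * T' x) = - complex.Im (T' x).
  by rewrite cReM /= mul0r mul1r sub0r.
have -> : complex.Im ('i%C * T' x) = complex.Re (T' x).
  by rewrite cImM /= mul0r mul1r add0r.
have ii : 'i%C * 'i%C = -1 :> C by rewrite -expr2 sqr_i.
have e1 : T' x = (complex.Re (T' x))%:C%C + 'i%C * (complex.Im (T' x))%:C%C.
  by case: (T' x) => a b; apply: complex_eq; rewrite ?(cReD, cImD, cReM, cImM) /=; ring.
have e2 : conjc (T' x) = (complex.Re (T' x))%:C%C - 'i%C * (complex.Im (T' x))%:C%C.
  by rewrite {1}e1 conjcD conjcM conjci mulNr; congr (_ + - (_ * _)); apply: complex_eq; rewrite /= ?oppr0.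
rewrite e2 [X in _ = X * _ /\ _]e1 raddfN /=.
move: (cderive 0 F (T x)) (cderive 1 F (T x)) (complex.Im _)%:C%C (complex.Re _)%:C%C => a b c d.
by split; ring: ii.
Qed.

Lemma hol_comp F : hol (os U) F -> hol (os U') (fun x => F (T x)).
Proof.
move=> [sF hF]; split; first exact: (csm_comp sF (hol_csm hT) TU).
move=> x U'x; have [_] := cderive_pull sF U'x.
rewrite (hF (T x) (TU U'x)).
have ii : 'i%C * 'i%C = -1 :> C by rewrite -expr2 sqr_i.
rewrite mulrA ii mulN1r subrr mulr0 => h.
move: h; move: (cderive 0 _ _) (cderive 1 _ _) => a b /eqP; rewrite addr_eq0 => /eqP ->.
by rewrite mulrN mulrA ii mulN1r opprK.
Qed.

Lemma cderive0_comp F x : hol (os U) F -> os U' x ->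
  cderive 0 (fun x => F (T x)) x = cderive 0 F (T x) * T' x.
Proof.
move=> [sF hF] U'x; rewrite (cderive_comp 0 sF (hol_csm hT) U'x (TU U'x)) -/(T' x) (hF (T x) (TU U'x)).
case: (T' x) => a b; rewrite ['i%C * _]mulrC -mulrA -mulrDr; congr (_ * _).
by apply: complex_eq; rewrite ?(cReD, cImD, cReM, cImM) /=; ring.
Qed.

Lemma pull_ex : {phi : {rmorphism sfR U -> sfR U'} |
  forall (a : smoothfun U) x, os U' x -> (phi a : smoothfun U') x = a (T x)}.
Proof.
pose p (a : smoothfun U) : smoothfun U' := mksf (csm_comp (sv_smooth a) (hol_csm hT) TU).
have pz : zmod_morphism p.
  by move=> a b; apply: sfP => x Ux; rewrite mksfE // !(sfD, sfN) ?mksfE //; exact: TU.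
have pm : monoid_morphism p.
  by split=> [|a b]; apply: sfP => x Ux; rewrite mksfE // ?sfM ?sf1 ?mksfE //; exact: TU.
pose Pz := GRing.isZmodMorphism.Build (smoothfun U) (smoothfun U') p pz.
pose Pm := GRing.isMonoidMorphism.Build (smoothfun U) (smoothfun U') p pm.
pose P : {rmorphism smoothfun U -> smoothfun U'} := HB.pack p Pz Pm.
by exists P => a x Ux; rewrite mksfE.
Qed.
Definition pull := sval pull_ex.
Lemma pullE (a : smoothfun U) x : os U' x -> (pull a : smoothfun U') x = a (T x).
Proof. exact: (svalP pull_ex a x). Qed.

Definition jac : sfR U' := sfof U' T'.
Definition jaci : sfR U' := sfof U' (fun x => (T' x)^-1).

Hypothesis (T'0 : forall x, os U' x -> T' x != 0).

Lemma pull_dmorph : dmorph pull jac jaci.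
Proof.
have sT' : csm (os U') T' by apply: csm_derive; exact: hol_csm.
have oU' := os_open U'.
split.
- move=> a; apply: sfP => x Ux; rewrite sfM // pullE //.
  rewrite [LHS]sf_dzE // (sfofE sT' Ux) [X in _ = _ * X](sf_dzE _ (TU Ux)) mulrCA; congr (_ * _).
  rewrite -(cderive_pull (sv_smooth a) Ux).1.
  have e i : cderive i (pull a : smoothfun U') x = cderive i (fun x => a (T x)) x.
    by apply: (cderive_ext _ oU') => // y Uy; rewrite pullE.
  by rewrite !e.
- by move=> a; apply: sfP => x Ux; rewrite mksfE // !pullE // mksfE //; exact: TU.
- apply: sfP => x Ux; rewrite sfM // sf1 // !sfofE //.
    by rewrite divff ?T'0.
  exact: csm_inv.
- exact/hol_db/hol_derive.
Qed.

End Pull.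

Section Charts.
Context {R : realType} (M : riemannSurface R).
Notation V := 'rV[R]_2.
Notation E := (@basis_vec R).
Notation C := R[i].
Implicit Types (c d : chart R M) (p : M).

Lemma chart_invK c x : chart_cod c x -> chart_map c (chart_inv c x) = x.
Proof. by move=> [p cp <-]; rewrite chart_mapK // inE. Qed.

Lemma chart_inv_dom c x : chart_cod c x -> chart_dom c (chart_inv c x).
Proof. by move=> [p cp <-]; rewrite chart_mapK // inE. Qed.

Lemma nbhs_chart c p (P : M -> Prop) : chart_dom c p ->
  (\forall x \near chart_map c p, P (chart_inv c x)) -> \forall q \near p, P q.
Proof.
move=> cp h; have oc := chart_dom_open c.
have := @chart_map_continuous _ _ c; rewrite continuous_open_subspace // => cc.
have /cc := mem_set cp => cm.
have h1 : nbhs p (chart_dom c) by apply: open_nbhs_nbhs.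
have h2 : \forall q \near p, P (chart_inv c (chart_map c q)) by exact: (cm _ h).
by apply: filterS2 h1 h2 => q cq; rewrite chart_mapK // inE.
Qed.

Lemma chart_nbhs c x (P : M -> Prop) : chart_cod c x ->
  (\forall q \near chart_inv c x, P q) -> \forall y \near x, P (chart_inv c y).
Proof.
move=> cx h; have oc : open (chart_cod c) by exact: chart_cod_open.
have := @chart_inv_continuous _ _ c; rewrite continuous_open_subspace // => cc.
exact: (cc _ (mem_set cx) _ h).
Qed.

Definition chart_oset c : oset V := Oset (@chart_cod_open _ _ c).

Lemma overlap_open c d : open (chart_map c @` (chart_dom c `&` chart_dom d)).
Proof.
have -> : chart_map c @` (chart_dom c `&` chart_dom d) =
    [set x | chart_cod c x /\ chart_dom d (chart_inv c x)].
  apply/seteqP; split=> x.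
    by move=> [p [cp dp] <-]; split; [exists p|rewrite chart_mapK // inE].
  move=> [cx dx]; exists (chart_inv c x); last exact: chart_invK.
  by split=> //; exact: chart_inv_dom.
rewrite openE => x [cx dx]; apply: filterI.
  by apply: open_nbhs_nbhs; split=> //; exact: (@chart_cod_open _ _ c).
by apply: (chart_nbhs cx); apply: open_nbhs_nbhs; split=> //; exact: chart_dom_open.
Qed.

End Charts.

Arguments dot : simpl never.

(** * Vector-valued maps as elements of the ring of smooth functions *)

Section Local.
Context {R : realType}.
Notation V := 'rV[R]_2.
Notation E := (@basis_vec R).
Notation C := R[i].

Lemma dotE n (u v : 'rV[R]_n) : dot u v = ip u v.
Proof. by rewrite /dot /ip mxE; apply: eq_bigr => j _; rewrite mxE. Qed.

Lemma dot_eq0 n (u : 'rV[R]_n) : dot u u = 0 -> u = 0.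
Proof.
rewrite dotE /ip => /eqP; rewrite psumr_eq0 => [/allP h|j _]; last by rewrite -expr2 sqr_ge0.
apply/rowP => j; have := h j (mem_index_enum _); rewrite mxE /= -expr2 sqrf_eq0.
by move=> /eqP.
Qed.

Lemma dot_ge0 n (u : 'rV[R]_n) : 0 <= dot u u.
Proof. by rewrite dotE; apply: sumr_ge0 => j _; rewrite -expr2 sqr_ge0. Qed.

Definition rc n (u : 'rV[R]_n) : 'rV[C]_n := map_mx (fun a => a%:C%C) u.
Lemma ip_rc n (u v : 'rV[R]_n) : ip (rc u) (rc v) = (dot u v)%:C%C.
Proof.
by rewrite dotE /ip rmorph_sum; apply: eq_bigr => j _; rewrite rmorphM !mxE.
Qed.
Lemma conjv_rc n (u : 'rV[R]_n) : conjv (rc u) = rc u.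
Proof. by apply/rowP => j; rewrite !mxE; apply: complex_eq; rewrite /= ?oppr0. Qed.

Lemma dotC n (u v : 'rV[R]_n) : dot u v = dot v u.
Proof. by rewrite !dotE ipC. Qed.
Lemma rcD n (u v : 'rV[R]_n) : rc (u + v) = rc u + rc v.
Proof. by apply/rowP => j; rewrite !mxE rmorphD. Qed.
Lemma rcZ n a (u : 'rV[R]_n) : rc (a *: u) = a%:C%C *: rc u.
Proof. by apply/rowP => j; rewrite !mxE rmorphM. Qed.

Fact pd_ex n : {pd : 'I_2 -> (V -> 'rV[R]_n) -> V -> 'rV[R]_n |
  forall i F x j, pd i F x 0 j = 'D_(E i) (fun x => F x 0 j) x}.
Proof.
by exists (fun i F x => \row_j 'D_(E i) (fun x => F x 0 j) x) => *; rewrite mxE.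
Qed.
Definition pd n := sval (pd_ex n).
Lemma pdE n i (F : V -> 'rV[R]_n) x j :
  pd i F x 0 j = 'D_(E i) (fun x => F x 0 j) x.
Proof. exact: (svalP (pd_ex n)). Qed.

Variable W : oset V.

(** Evaluation as a ring morphism: rewriting with it from right to left lets the [rmorph] lemmas
    evaluate sums and products in the ring. *)
Lemma ev_ex x : os W x -> {phi : {rmorphism smoothfun W -> C} | forall a, phi a = a x}.
Proof.
move=> Wx; pose p (a : smoothfun W) := a x.
have pz : zmod_morphism p by move=> a b; rewrite /p sfD // sfN.
have pm : monoid_morphism p by split=> [|a b]; rewrite /p ?sf1 ?sfM.
pose Pz := GRing.isZmodMorphism.Build (smoothfun W) C p pz.
pose Pm := GRing.isMonoidMorphism.Build (smoothfun W) C p pm.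
pose P : {rmorphism smoothfun W -> C} := HB.pack p Pz Pm.
by exists P.
Qed.

Definition ev n (v : 'rV[sfR W]_n) x : 'rV[C]_n := map_mx (fun a : smoothfun W => a x) v.

Lemma ev_ip n (v w : 'rV[sfR W]_n) x : os W x ->
  (ip v w : smoothfun W) x = ip (ev v x) (ev w x).
Proof.
move=> Wx; have [phi hphi] := ev_ex Wx.
rewrite -hphi /ip rmorph_sum; apply: eq_bigr => j _.
by rewrite rmorphM !hphi !mxE.
Qed.

Lemma ev_ext n (v w : 'rV[sfR W]_n) : (forall x, os W x -> ev v x = ev w x) -> v = w.
Proof.
move=> h; apply/rowP => j; apply: sfP => x Wx.
by have := congr1 (fun u : 'rV_n => u 0 j) (h x Wx); rewrite !mxE.
Qed.

Lemma evD n (v w : 'rV[sfR W]_n) x : os W x -> ev (v + w) x = ev v x + ev w x.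
Proof. by move=> Wx; apply/rowP => j; rewrite !mxE sfD. Qed.
Lemma evZ n a (v : 'rV[sfR W]_n) x : os W x -> ev (a *: v) x = (a : smoothfun W) x *: ev v x.
Proof. by move=> Wx; apply/rowP => j; rewrite !mxE sfM. Qed.
Lemma ev_cjv n (v : 'rV[sfR W]_n) x : os W x -> ev (cjv v) x = conjv (ev v x).
Proof. by move=> Wx; apply/rowP => j; rewrite !mxE mksfE. Qed.
Lemma ev_cross (v w : 'rV[sfR W]_7) x : os W x ->
  ev (cross v w) x = cross (ev v x) (ev w x).
Proof.
move=> Wx; have [phi hphi] := ev_ex Wx.
apply/rowP => k; rewrite !mxE -hphi !(rmorphB, rmorphD, rmorphM) /=.
by rewrite !hphi.
Qed.

Definition smoothv n (F : V -> 'rV[R]_n) := forall j, smooth (os W) (fun x => F x 0 j).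
Definition rv n (F : V -> 'rV[R]_n) : 'rV[sfR W]_n :=
  \row_j sfof W (fun x => (F x 0 j)%:C%C).

Section Rv.
Variables (n : nat) (F : V -> 'rV[R]_n).
Hypothesis sF : smoothv F.
Let oW := os_open W.

Lemma ev_rv x : os W x -> ev (rv F) x = rc (F x).
Proof. by move=> Wx; apply/rowP => j; rewrite !mxE sfofE //; exact: csm_real. Qed.

Lemma cderive_real (u : V -> R) i x : smooth (os W) u -> os W x ->
  cderive i (sfof W (fun x => (u x)%:C%C)) x = ('D_(E i) u x)%:C%C.
Proof.
move=> su Wx; rewrite (@cderive_ext _ (os W) _ (fun x => (u x)%:C%C)) //.
  by apply: complex_eq; rewrite !cderiveE //= derive_cst.
by move=> y Wy; rewrite sfofE //; exact: csm_real.
Qed.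

Lemma ev_dz_rv x : os W x ->
  ev (dzv (rv F)) x = 2^-1 *: (rc (pd 0 F x) - 'i%C *: rc (pd 1 F x)).
Proof.
move=> Wx; apply/rowP => j; rewrite !mxE [LHS]sf_dzE //.
by rewrite !cderive_real // !pdE.
Qed.

Lemma ev_lap_rv x : os W x -> ev (dbv (dzv (rv F))) x =
  rc (4^-1 *: (pd 0 (pd 0 F) x + pd 1 (pd 1 F) x)).
Proof.
move=> Wx; apply/rowP => j.
have -> : rc (4^-1 *: (pd 0 (pd 0 F) x + pd 1 (pd 1 F) x)) 0 j =
  4^-1 * ((pd 0 (pd 0 F) x 0 j)%:C%C + (pd 1 (pd 1 F) x 0 j)%:C%C).
  by rewrite rcZ rcD !mxE fmorphV rmorph_nat.
rewrite !mxE sf_laplacian //.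
have h i : cderive i (cderive i (sfof W (fun x => (F x 0 j)%:C%C))) x =
    ('D_(E i) (fun x => pd i F x 0 j) x)%:C%C.
  rewrite (@cderive_ext _ (os W) _ (fun x => (pd i F x 0 j)%:C%C)) //.
    by apply: complex_eq; rewrite !cderiveE //= derive_cst.
  by move=> y Wy; rewrite cderive_real // pdE.
by rewrite !h !pdE.
Qed.

Lemma cjv_rv : cjv (rv F) = rv F.
Proof. by apply: ev_ext => x Wx; rewrite ev_cjv // ev_rv // conjv_rc. Qed.

Let A := pd 0 F.
Let B := pd 1 F.

Lemma ip_half (u v a b : 'rV[R]_n) (i : C) :
  ip (2^-1 *: (rc u - 'i%C *: rc v)) (2^-1 *: (rc a + i *: rc b)) =
  4^-1 * ((dot u a)%:C%C + i * (dot u b)%:C%C - 'i%C * (dot v a)%:C%C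
     - 'i%C * i * (dot v b)%:C%C).
Proof.
have -> : (4^-1 : C) = 2^-1 * 2^-1 by rewrite -invfM -natrM.
rewrite !(ipZl, ipZr) !(ipDl, ipDr) !ipNl !(ipZl, ipZr) !ip_rc; ring.
Qed.

Lemma ip_dz_rv x : os W x -> (ip (dzv (rv F)) (dzv (rv F)) : smoothfun W) x =
  4^-1 * ((dot (A x) (A x) - dot (B x) (B x))%:C%C
     - 'i%C * (dot (A x) (B x) *+ 2)%:C%C).
Proof.
move=> Wx; rewrite ev_ip // ev_dz_rv // -[X in ip _ (_ *: (_ + X))]scaleNr ip_half.
have ii : 'i%C * 'i%C = -1 :> C by rewrite -expr2 sqr_i.
rewrite [dot (pd 1 F x) (pd 0 F x)]dotC rmorphB rmorphMn -/(A x) -/(B x) /=.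
move: (dot _ _)%:C%C (dot (A x) (B x))%:C%C (dot (B x) _)%:C%C => a b c.
by congr (_ * _); ring: ii.
Qed.

Lemma ip_dz_cj_rv x : os W x ->
  (ip (dzv (rv F)) (cjv (dzv (rv F))) : smoothfun W) x =
  (4^-1 * (dot (A x) (A x) + dot (B x) (B x)))%:C%C.
Proof.
move=> Wx; rewrite ev_ip // ev_cjv // ev_dz_rv //.
have -> (u v : 'rV[R]_n) : conjv (2^-1 *: (rc u - 'i%C *: rc v)) =
    2^-1 *: (rc u + 'i%C *: rc v).
  have -> : 2^-1 = (2^-1)%:C%C :> C by rewrite fmorphV rmorph_nat.
  by apply/rowP => j; rewrite !mxE; apply: complex_eq; rewrite ?(cRe_conj, cIm_conj)
    ?(cReM, cImM) ?(cReD, cImD) /= ?(cReM, cImM) /=; ring.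
have ii : 'i%C * 'i%C = -1 :> C by rewrite -expr2 sqr_i.
rewrite ip_half ii [dot (pd 1 F x) (pd 0 F x)]dotC rmorphM rmorphD fmorphV rmorph_nat -/(A x) -/(B x) /=.
move: (dot _ _)%:C%C (dot (A x) (B x))%:C%C (dot (B x) _)%:C%C => a b c.
by congr (_ * _); ring.
Qed.

Hypothesis sph : forall x, os W x -> dot (F x) (F x) = 1.

Lemma ip_rv_sphere : ip (rv F) (rv F) = 1.
Proof. by apply: sfP => x Wx; rewrite ev_ip // ev_rv // ip_rc sph // sf1. Qed.

Hypothesis cAA : forall x, os W x -> dot (A x) (A x) = dot (B x) (B x).
Hypothesis cAB : forall x, os W x -> dot (A x) (B x) = 0.

Lemma ip_rv_conformal : ip (dzv (rv F)) (dzv (rv F)) = 0.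
Proof.
apply: sfP => x Wx; rewrite ip_dz_rv // cAA // cAB // subrr mul0rn mulr0 subr0 mulr0.
by rewrite sf0.
Qed.

Variables (rho r : sfR W).
Hypothesis hr : rho * r = 1.
Hypothesis rhoE : forall x, os W x ->
  (rho : smoothfun W) x = (2^-1 * dot (A x) (A x))%:C%C.

Lemma ip_rv_rho : ip (dzv (rv F)) (cjv (dzv (rv F))) = rho.
Proof.
apply: sfP => x Wx; rewrite ip_dz_cj_rv // rhoE // -cAA //.
by congr (_ +i* _)%C; field.
Qed.

Hypothesis lapF : forall x, os W x -> exists a b c,
  pd 0 (pd 0 F) x + pd 1 (pd 1 F) x = a *: F x + b *: A x + c *: B x.

(** By differentiating the sphere and conformality relations, F_(z zbar) + rho F is orthogonal to F
    and to both partial derivatives. By [lapF] it also lies in their span, so it is orthogonal to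
    itself. *)
Lemma conformal_minimal_rv : conformal_minimal (rv F) rho r.
Proof.
have h1 : ip (dzv (rv F)) (rv F) = 0.
  apply: (@eqr_half _ (sfR W)); rewrite addr0 -[X in _ = X](dz1 (sfR W)).
  by rewrite -ip_rv_sphere dz_ip (ipC (rv F)).
have h2 : ip (dbv (dzv (rv F))) (rv F) = - rho.
  have := congr1 (@db _ (sfR W)) h1; rewrite db0 db_ip => /eqP.
  rewrite addr_eq0 => /eqP ->; congr (- _).
  by rewrite -{2}cjv_rv dbv_cj ip_rv_rho.
have h3 : ip (dbv (dzv (rv F))) (dzv (rv F)) = 0.
  apply: (@eqr_half _ (sfR W)); rewrite addr0 -[X in _ = X](db0 (sfR W)).
  by rewrite -ip_rv_conformal db_ip (ipC (dzv _)).
split; [exact: cjv_rv|exact: ip_rv_sphere|exact: ip_rv_conformal|exact: ip_rv_rho|exact: hr|].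
apply/eqP; rewrite -subr_eq0 scaleNr opprK; apply/eqP.
set w := dbv _ + _.
have w1 : ip w (rv F) = 0 by rewrite ipDl ipZl ip_rv_sphere mulr1 h2 addNr.
have w2 : ip w (dzv (rv F)) = 0 by rewrite ipDl ipZl h3 ipC h1 mulr0 addr0.
apply: ev_ext => x Wx.
pose u := 4^-1 *: (pd 0 (pd 0 F) x + pd 1 (pd 1 F) x) + (2^-1 * dot (A x) (A x)) *: F x.
have wu : ev w x = rc u.
  rewrite evD // evZ // ev_lap_rv // ev_rv // rhoE //.
  by rewrite -rcZ -rcD.
have u1 : dot u (F x) = 0.
  have := congr1 (fun a : smoothfun W => complex.Re (a x)) w1.
  by rewrite ev_ip // wu ev_rv // ip_rc sf0.
have u2 : dot u (A x) = 0 /\ dot u (B x) = 0.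
  have := congr1 (fun a : smoothfun W => 2 * a x) w2.
  rewrite ev_ip // wu ev_dz_rv // ipZr ipDr ipNr ipZr !ip_rc sf0 // mulr0.
  rewrite mulrA mulfV ?pnatr_eq0 // mul1r => /eqP; rewrite eq_complex /=.
  by rewrite !mul0r !mul1r !add0r ?subr0 ?oppr0 ?addr0 ?oppr_eq0 => /andP[/eqP -> /eqP].
have [a [b [c h]]] := lapF Wx.
have uE : u = (4^-1 * a + 2^-1 * dot (A x) (A x)) *: F x + (4^-1 * b) *: A x + (4^-1 * c) *: B x.
  rewrite /u h; apply/rowP => j; rewrite !mxE; ring.
have : dot u u = 0.
  by rewrite {2}uE !dotE !(ipDr, ipZr) -!dotE u1 u2.1 u2.2 !mulr0 !addr0.
rewrite wu => /dot_eq0 ->; apply/rowP => j; rewrite !mxE sf0 //.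
Qed.
End Rv.
End Local.

Section Defs.
Context {R : realType}.
Notation V := 'rV[R]_2.
Notation E := (@basis_vec R).
Notation C := R[i].

Lemma derive_entry k (u : V -> 'rV[R]_k.+1) x i j : derivable u x (E i) ->
  ('D_(E i) u x) 0 j = 'D_(E i) (fun x => u x 0 j) x.
Proof. by move=> /derive_mx ->; rewrite mxE. Qed.

(** Stated for all iterated partials [s], because the induction on [n] passes from [s] to
    [i :: s]. *)
Lemma smooth_on_partials k U (u : V -> 'rV[R]_k.+1) j n s : open U ->
  smooth_on U u -> Ck n U (fun x => partials s u x 0 j).
Proof.
move=> oU su; elim: n s => [|n IH] s.
  move=> x Ux; have [cu _] := su s x Ux.
  apply: (@continuous_comp _ _ _ (partials s u) (fun v : 'rV[R]_k.+1 => v 0 j)) => //.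
  exact: coord_continuous.
have e i x : U x -> partials (i :: s) u x 0 j = 'D_(E i) (fun x => partials s u x 0 j) x.
  by move=> Ux /=; apply: derive_entry; exact: (su s x Ux).2.
split.
  apply: differentiable_C1 => // x i Ux.
    by have /derivable_mxP := (su s x Ux).2 i; apply.
  apply: (near_eq_continuous (f := fun x => partials (i :: s) u x 0 j)).
    by apply: (near_open oU Ux) => y Uy; exact: e.
  have [cu _] := su (i :: s) x Ux.
  apply: (@continuous_comp _ _ _ (partials (i :: s) u) (fun v : 'rV[R]_k.+1 => v 0 j)) => //.
  exact: coord_continuous.
by move=> i; apply: Ck_ext (IH (i :: s)) => // x Ux; exact: e.
Qed.

Variables (M : riemannSurface R) (k : nat) (f : M -> 'rV[R]_k.+1) (c : chart R M).
Hypothesis (ac : atlas c) (sf : smooth_map f).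
Notation U := (chart_cod c).
Notation F := (local_rep f c).
Let oU : open U. Proof. exact: (os_open (chart_oset c)). Qed.

Lemma smooth_map_smoothv (W : oset V) : os W `<=` U -> smoothv W F.
Proof. by move=> WU j n; apply: Ck_sub (smooth_on_partials j n [::] oU (sf ac)). Qed.

Lemma pd_local_rep i x : U x -> pd i F x = 'D_(E i) F x.
Proof.
move=> Ux; apply/rowP => j; rewrite pdE derive_entry //; exact: (sf ac [::] Ux).2.
Qed.

Lemma pd_pd_local_rep i x : U x -> pd i (pd i F) x = 'D_(E i) ('D_(E i) F) x.
Proof.
move=> Ux; apply/rowP => j; rewrite pdE derive_entry; last exact: (sf ac [:: i] Ux).2.
apply: near_eq_derive; rewrite ?oner_eq0 //.
by apply: (near_open oU Ux) => y Uy; rewrite pd_local_rep.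
Qed.

Lemma jacobian_pd a j x : U x -> Defs.jacobian f c x a j = pd a F x 0 j.
Proof. by move=> Ux; rewrite mxE pd_local_rep. Qed.

Lemma induced_metric_dot a b x : U x ->
  induced_metric f c x a b = dot (pd a F x) (pd b F x).
Proof.
move=> Ux; rewrite mxE dotE; apply: eq_bigr => j _.
by rewrite [_^T _ _]mxE !jacobian_pd.
Qed.

Lemma mul_jacobian (v : 'rV[R]_2) x : U x ->
  v *m Defs.jacobian f c x = v 0 0 *: pd 0 F x + v 0 1 *: pd 1 F x.
Proof.
move=> Ux; apply/rowP => j; rewrite mxE big_ord_recl big_ord1 !jacobian_pd // !mxE.
by congr (_ + v 0 _ * pd _ F x 0 j); apply: val_inj.
Qed.

Lemma sum_scalar_mx (W : lmodType R) (lam : R) (s : 'I_2 -> 'I_2 -> W) :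
  \sum_(a < 2) \sum_(b < 2) (lam%:M : 'M[R]_2) a b *: s a b = lam *: (s 0 0 + s 1 1).
Proof.
rewrite big_ord_recl big_ord1 !big_ord_recl !big_ord0 !addr0 !mxE /= !mulr1n !mulr0n.
rewrite !scale0r addr0 add0r -scalerDr; congr (_ *: (s _ _ + s _ _)); exact: val_inj.
Qed.

(** For a conformal metric the mean curvature is a multiple of the normal part of the Laplacian,
    which differs from the Laplacian by a combination of F and its partial derivatives. *)
Lemma mean_curvature_conformal lam x : U x -> lam != 0 ->
  induced_metric f c x = lam%:M -> mean_curvature f c x = 0 ->
  exists a b d, pd 0 (pd 0 F) x + pd 1 (pd 1 F) x =
    a *: F x + b *: pd 0 F x + d *: pd 1 F x.
Proof.
move=> Ux lam0 hI; rewrite /mean_curvature hI.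
have -> : invmx (lam%:M : 'M[R]_2) = lam^-1%:M by rewrite invmx_scalar.
move=> /eqP; rewrite scaler_eq0 invr_eq0 pnatr_eq0 /=.
rewrite sum_scalar_mx scaler_eq0 invr_eq0 (negbTE lam0) /=.
rewrite /second_form -(pd_pd_local_rep 0 Ux) -(pd_pd_local_rep 1 Ux) /normal_part.
rewrite !mul_jacobian //.
move: (pd 0 (pd 0 F) x) (pd 1 (pd 1 F) x) (pd 0 F x) (pd 1 F x) (F x) => u v a b p.
move: (dot _ _) (dot _ _) (_ *m _ *m _) (_ *m _ *m _) => d e w z /eqP h.
exists (d + e), (w 0 0 + z 0 0), (w 0 1 + z 0 1).
apply/eqP; rewrite -subr_eq0; apply/eqP; rewrite -h.
by apply/rowP => j; rewrite !mxE; ring.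
Qed.
End Defs.

(** * Local equations of the curve and of the surfaces isometric to it *)

Section Curve.
Context {R : realType} (M : riemannSurface R) (g : M -> 'rV[R]_7).
Notation V := 'rV[R]_2.
Notation E := (@basis_vec R).
Notation C := R[i].
Hypotheses (hg : pseudoholomorphic_curve g) (ig : immersion g).
Variables (c : chart R M) (ac : atlas c).
Notation U := (chart_cod c).
Notation G := (local_rep g c).
Let sg : smooth_map g. Proof. exact: ig.1. Qed.

Lemma mul_i_basis0 : mul_i (E 0) = E 1.
Proof. by rewrite /mul_i !basisE /= oppr0 scale0r scale1r add0r. Qed.
Lemma mul_i_basis1 : mul_i (E 1) = - E 0.
Proof. by rewrite /mul_i !basisE /= scale0r addr0 scaleN1r. Qed.

Lemma nearly_kahlerE (p v : 'rV[R]_7) : nearly_kahler_J p v = cross p v.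
Proof. by rewrite /nearly_kahler_J /= !scale0r !add0r. Qed.

Lemma curve_cauchy_riemann x : U x ->
  pd 1 G x = cross (G x) (pd 0 G x) /\ - pd 0 G x = cross (G x) (pd 1 G x).
Proof.
move=> Ux; have [_ _ _ hJ] := hg.
have h i := pd_local_rep ac sg i Ux.
have j0 := hJ c x (E 0) ac Ux; rewrite mul_i_basis0 nearly_kahlerE -(h 0) -(h 1) in j0.
have j1 := hJ c x (E 1) ac Ux; rewrite mul_i_basis1 nearly_kahlerE -(h 1) in j1.
split; first exact: j0.
rewrite -j1 (h 0) {j0 j1 h}.
have dG i : derivable G x (E i) by exact: (sg ac [::] Ux).2.
apply/rowP => j; rewrite mxE.
have h v : derivable G x v -> ('D_v G x) 0 j = 'D_v (fun x => G x 0 j) x.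
  by move=> /derive_mx ->; rewrite mxE.
have df : differentiable (fun x => G x 0 j) x.
  exact: (smooth_differentiable (smooth_map_smoothv ac sg (W := chart_oset c) (fun _ h => h) j)).
have dN : derivable G x (- E 0).
  by apply/derivable_mxP => i j'; rewrite (ord1 i); apply: diff_derivable;
   exact: (smooth_differentiable (smooth_map_smoothv ac sg (W := chart_oset c) (fun _ h => h) j')).
have e v : 'D_v (fun x => G x 0 j) x = 'd (fun x => G x 0 j) x v by exact: deriveE.
by rewrite (h _ (dG 0)) (h _ dN) (e (E 0)) (e (- E 0)); rewrite linearN.
Qed.

Lemma curve_sphere x : dot (G x) (G x) = 1.
Proof. by have [h _ _ _] := hg; apply: h; exists (chart_inv c x). Qed.

Lemma curve_conformal x : U x ->
  dot (pd 0 G x) (pd 0 G x) = dot (pd 1 G x) (pd 1 G x) /\ dot (pd 0 G x) (pd 1 G x) = 0.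
Proof.
move=> Ux; have [h1 h2] := curve_cauchy_riemann Ux.
have ge : ip (G x) (G x) = 1 by rewrite -dotE curve_sphere.
have gA : ip (G x) (pd 0 G x) = 0.
  have : ip (cross (G x) (pd 1 G x)) (G x) = 0 by rewrite ip_crossxx.
  by rewrite -h2 ipNl => /eqP; rewrite oppr_eq0 ipC => /eqP.
split; rewrite !dotE h1; last by rewrite ipC ip_crossyy.
rewrite (crossC (pd 0 G x) (G x)) ipNl ipNr opprK ip_cross_cross ge mulr1.
by rewrite [ip (pd 0 G x) (G x)]ipC gA mulr0 subr0.
Qed.

Lemma curve_speed x : U x -> 0 < dot (pd 0 G x) (pd 0 G x).
Proof.
move=> Ux; rewrite lt_neqAle dot_ge0 andbT eq_sym; apply/eqP => h0.
have [h1 _] := curve_conformal Ux.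
have A0 := dot_eq0 h0; rewrite h1 in h0; have B0 := dot_eq0 h0.
have := ig.2 c x ac Ux; rewrite /row_free.
have -> : Defs.jacobian g c x = 0.
  apply/matrixP => a j; rewrite (jacobian_pd ac sg) // [RHS]mxE.
  by move: a; apply: ord2_ind; rewrite ?A0 ?B0 mxE.
by rewrite mxrank0.
Qed.

Definition conf (x : V) : R := 2^-1 * dot (pd 0 G x) (pd 0 G x).

Lemma conf_gt0 x : U x -> 0 < conf x.
Proof. by move=> Ux; rewrite mulr_gt0 ?curve_speed // invr_gt0. Qed.

Variable W : oset V.
Hypothesis WU : os W `<=` U.
Notation Rv f := (rv W (local_rep f c)).
Definition rhoW : sfR W := ip (dzv (Rv g)) (cjv (dzv (Rv g))).
Definition rW : sfR W := sfof W (fun x => ((rhoW : smoothfun W) x)^-1).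
Let sG : smoothv W G. Proof. exact: smooth_map_smoothv. Qed.

Lemma rhoWE x : os W x -> (rhoW : smoothfun W) x = (conf x)%:C%C.
Proof.
move=> Wx; rewrite /rhoW ip_dz_cj_rv // -(curve_conformal (WU Wx)).1 /conf.
by congr (_ +i* _)%C; field.
Qed.

Lemma rhoW_inv : rhoW * rW = 1.
Proof.
have nz x : os W x -> (rhoW : smoothfun W) x != 0.
  move=> Wx; rewrite rhoWE // eq_complex /= eqxx andbT gt_eqF // conf_gt0 //; exact: WU.
apply: sfP => x Wx; rewrite sfM // sf1 // sfofE //; first by rewrite divff // nz.
by apply: csm_inv nz _; [exact: os_open|exact: sv_smooth].
Qed.

Lemma curve_sphere_ring : ip (Rv g) (Rv g) = 1.
Proof. by apply: ip_rv_sphere => // x _; exact: curve_sphere. Qed.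

Lemma curve_J_ring : cross (Rv g) (dzv (Rv g)) = dk ('i%C : C) *: dzv (Rv g).
Proof.
apply: ev_ext => x Wx; rewrite ev_cross // evZ // ev_dz_rv // ev_rv // mksfE //.
have [h1 h2] := curve_cauchy_riemann (WU Wx).
have hc (u v : 'rV[R]_7) : cross (rc u) (rc v) = rc (cross u v).
  by apply/rowP => k; rewrite !mxE !(rmorphB, rmorphD, rmorphM).
rewrite crossZr crossDr -scaleNr crossZr !hc -h1 -h2 scalerA mulrC -scalerA.
congr (_ *: _); rewrite scalerDr scalerA mulrN -expr2 sqr_i opprK scale1r addrC.
by rewrite -[- pd 0 G x]scaleN1r rcZ scalerA rmorphN1 mulrNN mulr1 addrC.
Qed.

Lemma curve_cm : conformal_minimal (Rv g) rhoW rW.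
Proof.
apply: holomorphic_curve_minimal => //; first exact: cjv_rv.
- exact: curve_sphere_ring.
- exact: curve_J_ring.
- exact: rhoW_inv.
Qed.

(** Conformality of f and its factor rho are inherited from g through the isometry; the Laplacian is
    governed by the minimality of f. *)
Lemma surface_cm n (f : M -> 'rV[R]_n.+1) : minimal_surface f -> isometric f g ->
  conformal_minimal (Rv f) rhoW rW.
Proof.
move=> [fS [sf _] fH] fg.
have sF : smoothv W (local_rep f c) by exact: smooth_map_smoothv.
have met a b x : os W x -> dot (pd a (local_rep f c) x) (pd b (local_rep f c) x) =
    dot (pd a G x) (pd b G x).
  by move=> /WU Ux; rewrite -(induced_metric_dot ac sf) // -(induced_metric_dot ac sg) // fg.
apply: conformal_minimal_rv => //.
- by move=> x Wx; apply: fS; exists (chart_inv c x).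
- by move=> x Wx; rewrite !met // (curve_conformal (WU Wx)).1.
- by move=> x Wx; rewrite !met // (curve_conformal (WU Wx)).2.
- exact: rhoW_inv.
- by move=> x Wx; rewrite rhoWE // met.
- move=> x Wx; have Ux := WU Wx.
  apply: (mean_curvature_conformal ac sf (lam := dot (pd 0 G x) (pd 0 G x))) => //.
  + by rewrite gt_eqF // curve_speed.
  + apply/matrixP => a b; rewrite (induced_metric_dot ac sf) // met // !mxE.
    have [e1 e2] := curve_conformal Ux.
    by move: a b; apply: ord2_ind; apply: ord2_ind; rewrite /= ?mulr1n ?mulr0n // dotC.
  + exact: fH.
Qed.
End Curve.

(** * Coordinate patches and gluing *)

Section Patches.
Context {R : realType} (M : riemannSurface R).
Notation V := 'rV[R]_2.
Notation E := (@basis_vec R).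
Notation C := R[i].

Lemma mul_iE (v : V) : mul_i v 0 0 = - v 0 1 /\ mul_i v 0 1 = v 0 0.
Proof. by rewrite /mul_i !mxE !mulr0 !mulr1 addr0 add0r. Qed.

Lemma holomorphic_on_hol (U : set V) (u : V -> V) : open U -> holomorphic_on U u ->
  hol U (fun x => toC (u x)).
Proof.
move=> oU [su hu]; split.
  by split=> k; exact: (smooth_on_partials _ k [::] oU su).
move=> x Ux; have e i j : 'D_(E i) (fun x => u x 0 j) x = ('D_(E i) u x) 0 j.
  by rewrite derive_entry //; exact: (su [::] x Ux).2.
have e1 : 'D_(E 1) u x = mul_i ('D_(E 0) u x).
  by have h := hu x (E 0) Ux; rewrite mul_i_basis0 in h; exact: h.
have h j : ('D_(E 1) u x) 0 j = mul_i ('D_(E 0) u x) 0 j by rewrite e1.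
have [m0 m1] := mul_iE ('D_(E 0) u x).
have [r1 i1] := (Re_cderive 1 (fun x => toC (u x)) x, Im_cderive 1 (fun x => toC (u x)) x).
have [r0 i0] := (Re_cderive 0 (fun x => toC (u x)) x, Im_cderive 0 (fun x => toC (u x)) x).
rewrite /= in r1 i1 r0 i0; rewrite e h m0 in r1; rewrite e h m1 in i1; rewrite e in r0; rewrite e in i0.
apply: complex_eq; rewrite ?(cReM, cImM) ?r1 ?i1 ?r0 ?i0 /=.
  by rewrite mul0r sub0r mul1r.
by rewrite mul0r add0r mul1r.
Qed.

(** A chart cut down to an open set. The atlas is not assumed maximal, so a smaller domain, such as
    one free of zeros of Q, need not come from a chart of it. *)
Record cpatch := CPatch {
  pc : chart R M ; pc_atlas : atlas pc ; pW : oset V ;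
  pW_sub : os pW `<=` chart_cod pc
}.
Implicit Types P : cpatch.
Definition inP P (p : M) := chart_dom (pc P) p /\ os (pW P) (chart_map (pc P) p).
Definition sub_patch P' P := forall p, inP P' p -> inP P p.

Definition px P (p : M) : V := chart_map (pc P) p.
Definition ptoM P (x : V) : M := chart_inv (pc P) x.

Lemma inP_inv P x : os (pW P) x -> inP P (ptoM P x).
Proof.
move=> Wx; have cx := pW_sub Wx; split; first exact: chart_inv_dom.
by rewrite /ptoM chart_invK.
Qed.
Lemma px_inv P x : os (pW P) x -> px P (ptoM P x) = x.
Proof. by move=> /(@pW_sub P); exact: chart_invK. Qed.
Lemma ptoMK P p : inP P p -> ptoM P (px P p) = p.
Proof. by move=> [cp _]; rewrite /ptoM /px chart_mapK // inE. Qed.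
Lemma px_W P p : inP P p -> os (pW P) (px P p).
Proof. by case. Qed.

Lemma nbhs_patch P p (S : M -> Prop) : inP P p ->
  (\forall x \near px P p, S (ptoM P x)) -> \forall q \near p, S q.
Proof. by move=> [cp _]; exact: nbhs_chart. Qed.

Lemma patch_nbhs P p (S : M -> Prop) : inP P p ->
  (\forall q \near p, S q) -> \forall y \near px P p, os (pW P) y /\ S (ptoM P y).
Proof.
move=> Pp Sp; have [cp Wp] := Pp; apply: filterI.
  by apply: open_nbhs_nbhs; split=> //; exact: os_open.
by apply: chart_nbhs; [exact: pW_sub|rewrite -/(ptoM P _) ptoMK].
Qed.

Lemma inP_near P p : inP P p -> \forall q \near p, inP P q.
Proof.
move=> Pp; have [cp Wp] := Pp; apply: (nbhs_patch Pp).
have : nbhs (px P p) (os (pW P)) by apply: open_nbhs_nbhs; split=> //; exact: os_open.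
by apply: filterS => x; exact: inP_inv.
Qed.

Lemma inter_open P P' :
  open [set x | os (pW P') x /\ inP P (ptoM P' x)].
Proof.
rewrite openE => x [Wx Px].
have h := patch_nbhs (inP_inv Wx) (inP_near Px); rewrite px_inv // in h.
Qed.

(** The overlap carries the coordinate of [P']. *)
Definition inter_patch P P' : cpatch :=
  @CPatch (pc P') (pc_atlas P') (Oset (@inter_open P P'))
   (fun x h => @pW_sub P' x h.1).

Lemma inter_patchP P P' p : inP (inter_patch P P') p <-> inP P p /\ inP P' p.
Proof.
split; last first.
  move=> [Pp P'p]; split; first exact: P'p.1.
  by split; [exact: P'p.2|rewrite /= -/(px P' p) ptoMK].
move=> [/= cp [Wp Pp]]; have P'p : inP P' p by split.
by split=> //; move: Pp; rewrite -/(px P' p) ptoMK.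
Qed.

Definition restrict_patch P (S : set V) (oS : open S) : cpatch :=
  @CPatch (pc P) (pc_atlas P) (Oset (openI (os_open (pW P)) oS))
   (fun x h => @pW_sub P x h.1).

Definition ptrans P P' (x : V) : V := px P (ptoM P' x).

Lemma overlap_hol (c d : chart R M) : atlas c -> atlas d ->
  hol (chart_map c @` (chart_dom c `&` chart_dom d))
    (fun x => toC (chart_map d (chart_inv c x) : V)).
Proof.
move=> ac ad.
exact: holomorphic_on_hol (@overlap_open _ M c d) (atlas_holomorphic ac ad).
Qed.

Section Sub.
Variables (P P' : cpatch).
Hypothesis PP : sub_patch P' P.

Lemma sub_overlap x : os (pW P') x ->
  (chart_map (pc P') @` (chart_dom (pc P') `&` chart_dom (pc P))) x.
Proof.
move=> Wx; exists (ptoM P' x); last exact: px_inv.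
by split; [exact: (inP_inv Wx).1|exact: (PP (inP_inv Wx)).1].
Qed.

Lemma ptrans_W x : os (pW P') x -> os (pW P) (ptrans P P' x).
Proof. by move=> /inP_inv /PP []. Qed.

Lemma ptrans_hol : hol (os (pW P')) (fun x => toC (ptrans P P' x)).
Proof. exact: hol_sub sub_overlap (overlap_hol (pc_atlas P') (pc_atlas P)). Qed.

(** The inverse transition is holomorphic too, and the chain rule for the identity makes the product
    of the two derivatives equal to 1. *)
Lemma ptrans_derive0 x : os (pW P') x ->
  cderive 0 (fun x => toC (ptrans P P' x)) x != 0.
Proof.
move=> Wx; pose c := pc P; pose c' := pc P'.
pose S x : V := chart_map c' (chart_inv c x).
pose O := Oset (@overlap_open _ M c c').
have TO y : os (pW P') y -> os O (ptrans P P' y).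
  move=> /inP_inv P'y; exists (ptoM P' y) => //.
  by split; [exact: (PP P'y).1|exact: P'y.1].
have hS : hol (os O) (fun x => toC (S x)) by exact: overlap_hol (pc_atlas P) (pc_atlas P').
have := cderive0_comp TO ptrans_hol hS Wx.
have -> : cderive 0 (fun x => toC (S (ptrans P P' x))) x = 1.
  rewrite -(cderive0_toC x); apply: (cderive_ext _ (os_open (pW P'))) => // y Wy.
  have P'y := inP_inv Wy.
  by rewrite /S /ptrans -/(ptoM P _) (ptoMK (PP P'y)); congr toC; exact: px_inv.
by move=> h; apply: contra_eq_neq h => ->; rewrite mulr0 oner_eq0.
Qed.

Definition pphi := pull ptrans_W ptrans_hol.
Definition pjac := jac (pW P') (ptrans P P').
Definition pjaci := jaci (pW P') (ptrans P P').

Lemma pphi_dmorph : dmorph pphi pjac pjaci.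
Proof. exact: pull_dmorph ptrans_derive0. Qed.

Lemma pphiE (a : smoothfun (pW P)) x : os (pW P') x ->
  (pphi a : smoothfun (pW P')) x = a (ptrans P P' x).
Proof. exact: pullE. Qed.

Lemma pjac_neq0 x : os (pW P') x -> (pjac : smoothfun (pW P')) x != 0.
Proof.
move=> Wx; rewrite /pjac sfofE ?ptrans_derive0 //.
by apply: csm_derive; exact: hol_csm ptrans_hol.
Qed.
End Sub.

Definition pv P n (f : M -> 'rV[R]_n.+1) : 'rV[sfR (pW P)]_n.+1 :=
  rv (pW P) (local_rep f (pc P)).

Lemma pv_smooth P n (f : M -> 'rV[R]_n.+1) : smooth_map f ->
  smoothv (pW P) (local_rep f (pc P)).
Proof. by move=> sf; exact: (smooth_map_smoothv (pc_atlas P) sf (@pW_sub P)). Qed.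

Lemma pv_trans P P' (PP : sub_patch P' P) n (f : M -> 'rV[R]_n.+1) : smooth_map f ->
  pv P' f = mapv (pphi PP) (pv P f).
Proof.
move=> sf; apply/rowP => j; apply: sfP => x Wx; rewrite !mxE pphiE //.
have sc Q : csm (os (pW Q)) (fun x => (local_rep f (pc Q) x 0 j)%:C%C).
  by apply: csm_real; exact: pv_smooth.
rewrite !sfofE //; last exact: ptrans_W.
by congr (_%:C)%C; rewrite /local_rep /= -/(ptoM P _) ptoMK //; apply: PP; exact: inP_inv.
Qed.

Lemma ev_pv P n (f : M -> 'rV[R]_n.+1) p : smooth_map f -> inP P p ->
  ev (pv P f) (px P p) = rc (f p).
Proof.
move=> sf Pp; rewrite (ev_rv (@pv_smooth P n f sf) (px_W Pp)).
by rewrite /local_rep /= -/(ptoM P (px P p)) ptoMK.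
Qed.

Lemma cover_patch (p : M) : exists P, inP P p.
Proof.
have [c ac cp] := atlas_cover p.
exists (@CPatch c ac (chart_oset c) (fun _ h => h)); split=> //=.
by exists p.
Qed.

Definition some_patch p := projT1 (cid (cover_patch p)).
Lemma some_patchP p : inP (some_patch p) p.
Proof. exact: projT2 (cid (cover_patch p)). Qed.

(** Two patches around p are compared through their intersection, a sub-patch of both. [x0] is the
    value at points that lie in no good patch. *)
Lemma patch_glue (X : Type) (x0 : X) (good : cpatch -> Prop) (I : cpatch -> V -> X) :
  (forall P P', good P -> sub_patch P' P -> good P' /\
     forall p, inP P' p -> I P' (px P' p) = I P (px P p)) ->
  exists G : M -> X, forall P p, good P -> inP P p -> G p = I P (px P p).
Proof.
move=> hI.
pose G p := if pselect (exists P, good P /\ inP P p) is left h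
  then let P := projT1 (cid h) in I P (px P p) else x0.
exists G => P p gP Pp; rewrite /G; case: pselect => [h|[]]; last by exists P.
case: (cid h) => /= P1 [gP1 P1p].
have s1 : sub_patch (inter_patch P P1) P by move=> q /inter_patchP[].
have s2 : sub_patch (inter_patch P P1) P1 by move=> q /inter_patchP[].
have ip : inP (inter_patch P P1) p by apply/inter_patchP.
by rewrite -(hI _ _ gP s1).2 // -(hI _ _ gP1 s2).2.
Qed.
End Patches.

(** * Invariants of a pseudoholomorphic curve *)

Section Invariants.
Context {R : realType} (M : riemannSurface R) (g : M -> 'rV[R]_7) (xi : 'rV[R]_7).
Notation V := 'rV[R]_2.
Notation E := (@basis_vec R).
Notation C := R[i].
Notation N := (@Normc.normc R).
Hypotheses (hg : pseudoholomorphic_curve g) (ig : immersion g).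
Hypotheses (xi1 : dot xi xi = 1) (gxi : forall p, dot (g p) xi = 0).
Implicit Types P : cpatch M.

(* The objects of the algebraic theory in the ring of smooth functions on [P]:
   [prho] and [prhoV] are the conformal factor and its inverse, [pQ] the cubic
   differential, and [pqi] is meaningful only on good patches, where [pQ] has no
   zeros. *)
Definition prho P : sfR (pW P) := rhoW g (pc P) (pW P).
Definition prhoV P : sfR (pW P) := rW g (pc P) (pW P).
Definition pxi P : 'rV[sfR (pW P)]_7 := rv (pW P) (fun=> xi).
Definition psig P : sfR (pW P) := sigma (prho P) (prhoV P).
Definition pQ P : sfR (pW P) := cubic (pv P g) (prho P) (prhoV P) (pxi P).
Definition pqi P : sfR (pW P) := sfof (pW P) (fun x => ((pQ P : smoothfun (pW P)) x)^-1).
Definition good P := forall x, os (pW P) x -> (pQ P : smoothfun (pW P)) x != 0.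

Lemma prho_inv P : prho P * prhoV P = 1.
Proof. exact: (rhoW_inv hg ig (pc_atlas P) (@pW_sub _ _ P)). Qed.

Lemma curve_cmP P : conformal_minimal (pv P g) (prho P) (prhoV P).
Proof. exact: (curve_cm hg ig (pc_atlas P) (@pW_sub _ _ P)). Qed.

Lemma smooth_cst_vec (W : oset V) n (v : 'rV[R]_n) : smoothv W (fun=> v).
Proof. by move=> j k; exact: Ck_cst. Qed.

Lemma dzv_cst_vec (W : oset V) n (v : 'rV[R]_n) : dzv (rv W (fun=> v)) = 0.
Proof.
apply: ev_ext => x Wx; rewrite ev_dz_rv //; last exact: smooth_cst_vec.
have e i : pd i (fun=> v) x = 0 by apply/rowP => j; rewrite pdE derive_cst mxE.
apply/rowP => j; rewrite !e !mxE sf0 // mulr0 subr0 mulr0 //.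
Qed.

Lemma ev_pxi P x : os (pW P) x -> ev (pxi P) x = rc xi.
Proof. by move=> Wx; rewrite (ev_rv (@smooth_cst_vec (pW P) 7 xi) Wx). Qed.
Lemma ev_pg P x : os (pW P) x -> ev (pv P g) x = rc (local_rep g (pc P) x).
Proof. by move=> Wx; rewrite (ev_rv (@pv_smooth _ _ P _ g ig.1) Wx). Qed.

Lemma ip_gxi P : ip (pv P g) (pxi P) = 0.
Proof.
apply: sfP => x Wx; rewrite ev_ip // ev_pg // ev_pxi //.
by rewrite ip_rc gxi sf0.
Qed.

Lemma cjv_pxi P : cjv (pxi P) = pxi P.
Proof. by apply: cjv_rv; exact: smooth_cst_vec. Qed.

Lemma pg_J P : cross (pv P g) (dzv (pv P g)) = dk ('i%C : C) *: dzv (pv P g).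
Proof. exact: (curve_J_ring hg ig (pc_atlas P) (@pW_sub _ _ P)). Qed.

Lemma db_pQ P : db (pQ P) = 0.
Proof.
have cm := curve_cmP P.
apply: (db_cubic (cm_real cm) (cm_sphere cm) (pg_J P) (cm_rho cm) (cm_inv cm)).
- exact: dzv_cst_vec.
- exact: cjv_pxi.
- exact: ip_gxi.
Qed.

Lemma hol_pQ P : hol (os (pW P)) (pQ P : smoothfun (pW P)).
Proof. exact: db_hol (db_pQ P). Qed.

Definition rhoR P x : R := complex.Re ((prho P : smoothfun (pW P)) x).
Definition sigR P x : R := complex.Re ((psig P : smoothfun (pW P)) x).

Lemma prhoE P x : os (pW P) x -> (prho P : smoothfun (pW P)) x = (rhoR P x)%:C%C /\ 0 < rhoR P x.
Proof.
move=> Wx; rewrite /rhoR /prho (rhoWE hg ig (pc_atlas P) (@pW_sub _ _ P)) //.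
by split=> //=; apply: (conf_gt0 hg ig (pc_atlas P)); exact: pW_sub.
Qed.

Lemma prhoVE P x : os (pW P) x -> (prhoV P : smoothfun (pW P)) x = ((rhoR P x)^-1)%:C%C.
Proof.
move=> Wx; have [e0 h0] := prhoE Wx.
have := congr1 (fun a : smoothfun (pW P) => a x) (prho_inv P).
have c0 : (rhoR P x)%:C%C != 0 :> C by rewrite eq_complex /= eqxx andbT gt_eqF.
rewrite sfM // sf1 // e0 => h; apply: (mulfI c0).
by rewrite h -rmorphM /= divff // gt_eqF.
Qed.

Lemma psigE P x : os (pW P) x -> (psig P : smoothfun (pW P)) x = (sigR P x)%:C%C.
Proof.
move=> Wx; have := congr1 (fun a : smoothfun (pW P) => complex.Im (a x)) (cj_sigma (curve_cmP P)).
rewrite /sigR /psig mksfE // cIm_conj => h.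
apply: complex_eq => //=; move: h; set a := complex.Im _ => h; lra.
Qed.

(** This is [cross_frame_norm] at each point, for a = g_z and b = F, combined with the Gauss
    equation. *)
Lemma QQP P : pQ P * cj (pQ P) = prho P * prho P * psig P.
Proof.
have cm := curve_cmP P.
apply: sfP => x Wx; rewrite !sfM // mksfE //.
have -> : (pQ P : smoothfun (pW P)) x = ip (ev (F2 (pv P g) (prho P) (prhoV P)) x)
    (cross (ev (dzv (pv P g)) x) (rc xi)).
  by rewrite /pQ /cubic ev_ip // (ev_cross _ _ Wx) ev_pxi.
have eg := ev_pg Wx.
have eJ (v : 'rV[sfR (pW P)]_7) : cross (pv P g) v = dk ('i%C : C) *: v ->
    cross (rc (local_rep g (pc P) x)) (ev v x) = 'i%C *: ev v x.
  by move=> h; rewrite -eg -ev_cross // h evZ // mksfE.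
have exi := ev_pxi Wx.
have er : ip (ev (dzv (pv P g)) x) (conjv (ev (dzv (pv P g)) x)) = (prho P : smoothfun (pW P)) x.
  by rewrite -ev_cjv // -ev_ip // (cm_rho cm).
rewrite (@cross_frame_norm _ (rc (local_rep g (pc P) x)) (rc xi)) ?conjv_rc //.
- rewrite er -ev_cjv // -ev_ip // (ip_f2f2b cm) sfM // /psig; ring.
- by rewrite ip_rc curve_sphere.
- by rewrite ip_rc xi1.
- by rewrite ip_rc gxi.
- by apply: eJ; exact: pg_J.
- by apply: eJ; apply: cross_gF2; exact: pg_J.
- by rewrite -exi -ev_ip // ip_g1xi ?sf0 //; [exact: dzv_cst_vec|exact: ip_gxi].
- by rewrite -exi -ev_ip // ip_F2xi ?sf0 //; [exact: dzv_cst_vec|exact: ip_gxi].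
- by rewrite -ev_cjv // -ev_ip // (ip_f2f1b cm) sf0.
- by rewrite er (prhoE Wx).1 eq_complex /= eqxx andbT gt_eqF // (prhoE Wx).2.
Qed.

Lemma N_pQ P x : os (pW P) x ->
  N ((pQ P : smoothfun (pW P)) x) ^+ 2 = rhoR P x ^+ 2 * sigR P x.
Proof.
move=> Wx; have := congr1 (fun a : smoothfun (pW P) => complex.Re (a x)) (QQP P).
rewrite !sfM // (mksfE _ Wx) N_mul_conj (prhoE Wx).1 psigE //.
by rewrite -!rmorphM /= => ->; rewrite expr2.
Qed.

Lemma sigR_ge0 P x : os (pW P) x -> 0 <= sigR P x.
Proof.
move=> Wx; have [_ h] := prhoE Wx.
by rewrite -(pmulr_rge0 _ (exprn_gt0 2 h)) -N_pQ // exprn_ge0 // N_ge0.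
Qed.

Lemma pQ_eq0 P x : os (pW P) x -> ((pQ P : smoothfun (pW P)) x == 0) = (sigR P x == 0).
Proof.
move=> Wx; have [_ h] := prhoE Wx.
by rewrite -N_eq0 -sqrf_eq0 N_pQ // mulf_eq0 sqrf_eq0 (gt_eqF h).
Qed.

Lemma good_inv P : good P -> pQ P * pqi P = 1.
Proof.
move=> gP; apply: sfP => x Wx; rewrite sfM // sf1 // sfofE ?divff ?gP //.
by apply: csm_inv => //; [exact: os_open|exact: sv_smooth].
Qed.

Section Transition.
Variables (P P' : cpatch M) (PP : sub_patch P' P).
Notation l := (pjac P P').
Notation phi := (pphi PP).
Let dm := pphi_dmorph PP.

Lemma prho_trans : prho P' = l * cj l * phi (prho P).
Proof.
rewrite -(cm_rho (curve_cmP P')) -(cm_rho (curve_cmP P)).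
rewrite (pv_trans PP ig.1) (dz_mapv dm) cjvZ (cj_mapv dm) ipZl ipZr ip_mapv mulrA.
by [].
Qed.

Lemma psig_trans : psig P' = l * cj l * phi (psig P).
Proof. exact: (sigma_transition dm (prho_inv P) (prho_inv P') prho_trans). Qed.

Lemma pQ_trans : pQ P' = l ^+ 3 * phi (pQ P).
Proof.
rewrite -(cubic_transition _ _ dm (prho_inv P) (prho_inv P') prho_trans).
rewrite -(pv_trans PP ig.1) /pQ; congr cubic.
apply/rowP => j; apply: sfP => x Wx; rewrite !mxE pphiE //.
rewrite !sfofE //; try exact: csm_cst; exact: ptrans_W.
Qed.

Lemma good_sub : good P -> good P'.
Proof.
move=> gP x Wx; rewrite pQ_trans sfM //.
have -> : (l ^+ 3 : smoothfun (pW P')) x = (l : smoothfun (pW P')) x ^+ 3.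
  by rewrite !exprS expr0 !sfM // sf1.
rewrite mulf_neq0 ?expf_neq0 ?pjac_neq0 // pphiE // gP //; exact: ptrans_W.
Qed.

Lemma ptrans_px p : inP P' p -> ptrans P P' (px P' p) = px P p.
Proof. by move=> P'p; rewrite /ptrans ptoMK. Qed.

Definition lN p : R := N ((l : smoothfun (pW P')) (px P' p)).

Lemma lN_gt0 p : inP P' p -> 0 < lN p.
Proof. by move=> P'p; rewrite N_gt0 (pjac_neq0 PP (px_W P'p)). Qed.

Lemma ll_val p : inP P' p -> ((l * cj l : sfR (pW P')) : smoothfun (pW P')) (px P' p) = (lN p ^+ 2)%:C%C.
Proof.
move=> P'p; have Wx := px_W P'p; rewrite sfM // mksfE //.
set z := _ (px P' p); apply: complex_eq; rewrite ?N_mul_conj //=.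
by rewrite cImM cRe_conj cIm_conj mulrN mulrC addNr.
Qed.

Lemma rhoR_trans p : inP P' p -> rhoR P' (px P' p) = lN p ^+ 2 * rhoR P (px P p).
Proof.
move=> P'p; have Pp := PP P'p; have W'x := px_W P'p.
rewrite /rhoR prho_trans sfM // ll_val // pphiE // ptrans_px // (prhoE (px_W Pp)).1.
by rewrite -rmorphM.
Qed.

Lemma sigR_trans p : inP P' p -> sigR P' (px P' p) = lN p ^+ 2 * sigR P (px P p).
Proof.
move=> P'p; have Pp := PP P'p; have W'x := px_W P'p.
rewrite /sigR psig_trans sfM // ll_val // pphiE // ptrans_px // (psigE (px_W Pp)).
by rewrite -rmorphM.
Qed.
End Transition.

(* |Q|^2 / rho^3, which does not depend on the coordinate. *)
Lemma qM_ex : {q : M -> R | forall P p, inP P p -> q p = sigR P (px P p) / rhoR P (px P p)}.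
Proof.
apply: cid; have [|G hG] := @patch_glue R M R 0 (fun=> True) (fun P x => sigR P x / rhoR P x).
  move=> P P' _ PP; split=> // p P'p; rewrite (rhoR_trans PP) // (sigR_trans PP) //.
  by rewrite -mulf_div divff ?mul1r // expf_neq0 // gt_eqF // lN_gt0.
by exists G => P p; exact: hG.
Qed.
Definition qM := sval qM_ex.
Lemma qME P p : inP P p -> qM p = sigR P (px P p) / rhoR P (px P p).
Proof. exact: (svalP qM_ex). Qed.

Lemma qM_eq0 P p : inP P p -> (qM p == 0) = ((pQ P : smoothfun (pW P)) (px P p) == 0).
Proof.
move=> Pp; have Wx := px_W Pp; rewrite (qME Pp) pQ_eq0 // mulf_eq0 invr_eq0.
by rewrite [X in _ || X]gt_eqF ?orbF // (prhoE Wx).2.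
Qed.

Lemma qM_ge0 p : 0 <= qM p.
Proof.
have Pp := some_patchP p; have Wx := px_W Pp.
by rewrite (qME Pp) divr_ge0 // ?sigR_ge0 // ltW // (prhoE Wx).2.
Qed.

Lemma Re_continuous (W : oset V) (a : smoothfun W) x : os W x ->
  {for x, continuous (fun y => complex.Re (a y))}.
Proof. by move=> Wx; exact: (csm_continuous (sv_smooth a) Wx).1. Qed.

Lemma patch_continuous (h : M -> R) :
  (forall p, exists2 P, inP P p & {for px P p, continuous (fun x => h (ptoM P x))}) ->
  continuous h.
Proof.
move=> hh p S Sp; have [P Pp cP] := hh p; apply: (nbhs_patch Pp).
by apply: cP; rewrite ptoMK.
Qed.

Lemma continuous_div (T : topologicalType) (a b : T -> R) (x : T) : {for x, continuous a} ->
  {for x, continuous b} -> b x != 0 -> {for x, continuous (fun y => a y / b y)}.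
Proof. by move=> ca cb b0; apply: (cvgM ca); exact: (cvgV b0 cb). Qed.

Lemma qM_continuous : continuous qM.
Proof.
apply: patch_continuous => p; have Pp := some_patchP p; exists (some_patch p) => //.
have Wx := px_W Pp.
apply: (near_eq_continuous (f := fun x => sigR (some_patch p) x / rhoR (some_patch p) x)).
  apply: (near_open (os_open (pW (some_patch p))) Wx) => y Wy.
  by rewrite (qME (inP_inv Wy)) px_inv.
have nz : rhoR (some_patch p) (px (some_patch p) p) != 0 by rewrite gt_eqF // (prhoE Wx).2.
have h1 := @Re_continuous (pW (some_patch p)) (psig (some_patch p)) _ Wx.
have h2 := @Re_continuous (pW (some_patch p)) (prho (some_patch p)) _ Wx.
by refine (continuous_div h1 h2 nz).
Qed.

Definition isosurface n (f : M -> 'rV[R]_n.+1) := minimal_surface f /\ isometric f g.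

Section Surface.
Variables (n : nat) (f : M -> 'rV[R]_n.+1).
Hypothesis hf : isosurface f.
Let sf : smooth_map f. Proof. by have [[_ []]] := hf. Qed.

Lemma surface_cmP P : conformal_minimal (pv P f) (prho P) (prhoV P).
Proof. by have [h1 h2] := hf; exact: (surface_cm hg ig (pc_atlas P) (@pW_sub _ _ P)). Qed.

Definition pF2 P := F2 (pv P f) (prho P) (prhoV P).
Definition pPhi P : sfR (pW P) := ip (pF2 P) (pF2 P).

Lemma db_pPhi P : db (pPhi P) = 0.
Proof. exact: db_phi1 (surface_cmP P). Qed.

Lemma pF2_trans P P' (PP : sub_patch P' P) : pF2 P' = pjac P P' ^+ 2 *: mapv (pphi PP) (pF2 P).
Proof.
exact: (F2_transition (pphi_dmorph PP) (prho_inv P) (prho_inv P') (pv_trans PP sf) (prho_trans PP)).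
Qed.

Lemma pPhi_trans P P' (PP : sub_patch P' P) : pPhi P' = pjac P P' ^+ 4 * pphi PP (pPhi P).
Proof. by rewrite /pPhi (pF2_trans PP) ipZl ipZr ip_mapv mulrA -exprD. Qed.

End Surface.
End Invariants.

(** * Connectedness arguments *)

Section Connectedness.
Context {R : realType}.
Notation V := 'rV[R]_2.
Notation C := R[i].
Notation N := (@Normc.normc R).

Lemma clopen_connected (T : topologicalType) (A B : set T) : connected A ->
  (forall x, A x -> B x -> \forall y \near x, B y) ->
  (forall x, A x -> ~ B x -> \forall y \near x, ~ B y) ->
  forall x y, A x -> A y -> B x -> B y.
Proof.
move=> cA h1 h2 x y Ax Ay Bx.
suff e : A `&` B = A by have : A y by []; rewrite -{1}e => -[].
apply: cA; first by exists x.
  exists B°; first exact: open_interior.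
  apply/seteqP; split=> z [Az Bz]; split=> //; first exact: h1.
  exact: nbhs_singleton Bz.
exists (~` (~` B)°); first by apply: open_closedC; exact: open_interior.
apply/seteqP; split=> z [Az Bz]; split=> //.
  by move=> /nbhs_singleton; apply.
by apply: contrapT => nB; apply: Bz; exact: h2.
Qed.

Lemma segment_clopen (B : set V) (x v : V) :
  (forall t : R, 0 <= t <= 1 -> B (x + t *: v) -> \forall y \near x + t *: v, B y) ->
  (forall t : R, 0 <= t <= 1 -> ~ B (x + t *: v) -> \forall y \near x + t *: v, ~ B y) ->
  B x -> B (x + v).
Proof.
move=> h1 h2 Bx.
have cl (t : R) (S : set V) : nbhs (x + t *: v) S -> \forall s \near t, S (x + s *: v).
  have c : continuous (fun s : R => x + s *: v).
    move=> u; apply: (@continuousD _ _ _ (fun=> x) (fun s : R => s *: v)).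
      exact: cst_continuous.
    exact: scalel_continuous.
  exact: (c t S).
have := @clopen_connected R `[0, 1]%classic [set t | B (x + t *: v)] (@segment_connected _ 0 1) _ _ 0 1.
rewrite /= scale0r scale1r addr0; apply => //=; rewrite ?in_itv /= ?lexx ?ler01 //.
- by move=> t; rewrite in_itv /= => t01 /(h1 _ t01) /cl.
- by move=> t; rewrite in_itv /= => t01 /(h2 _ t01) /cl.
Qed.

(** Two points are joined by a segment or, if it passes through x0, by way of the point w obtained
    from x by a quarter turn about x0. *)
Lemma punctured_disc_clopen (B : set V) (x0 : V) (d : R) :
  (forall x, N (toC (x - x0)) < d -> x != x0 -> B x -> \forall y \near x, B y) ->
  (forall x, N (toC (x - x0)) < d -> x != x0 -> ~ B x -> \forall y \near x, ~ B y) ->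
  forall x y, N (toC (x - x0)) < d -> x != x0 -> N (toC (y - x0)) < d -> y != x0 ->
  B x -> B y.
Proof.
move=> h1 h2.
have seg x y : N (toC (x - x0)) < d -> N (toC (y - x0)) < d ->
    (forall t : R, 0 <= t <= 1 -> x + t *: (y - x) != x0) -> B x -> B y.
  move=> xd yd av Bx; rewrite -(subrKC x y).
  have nd (t : R) : 0 <= t <= 1 -> N (toC (x + t *: (y - x) - x0)) < d.
    move=> /andP[t0 t1].
    have -> : x + t *: (y - x) - x0 = (1 - t) *: (x - x0) + t *: (y - x0).
      by rewrite scalerBl scale1r !scalerBr; apply/rowP => j; rewrite !mxE; ring.
    rewrite toCD !toCZ; apply: le_lt_trans (ND _ _) _; rewrite !Normc.normcM !N_real.
    rewrite (ger0_norm t0) ger0_norm ?subr_ge0 //.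
    have [->|tn0] := eqVneq t 0; first by rewrite subr0 mul1r mul0r addr0.
    have tp : 0 < t by rewrite lt_neqAle eq_sym tn0.
    have -> : d = (1 - t) * d + t * d by ring.
    by rewrite ler_ltD // ?ler_wpM2l ?subr_ge0 ?(ltW xd) // ltr_pM2l.
  by apply: segment_clopen => // t t01; [apply: h1|apply: h2]; rewrite ?nd ?av.
move=> x y xd xx yd yx Bx.
pose w := x0 + ofC ('i%C * toC (x - x0)).
have ew : toC (w - x0) = 'i%C * toC (x - x0) by rewrite /w addrC addKr ofCK.
have wd : N (toC (w - x0)) < d by rewrite ew Normc.normcM N_i mul1r.
have an (z : V) : z != x0 -> toC (z - x0) != 0.
  by move=> zx; rewrite toCB subr_eq0 (inj_eq (@toC_inj R)).
have comb (u z : V) (t : R) : u + t *: (z - u) = x0 ->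
    (1 - t)%:C%C * toC (u - x0) + t%:C%C * toC (z - x0) = 0.
  move=> h; rewrite -!toCZ -toCD -[RHS](@toC0 R); congr toC.
  apply/eqP; rewrite -subr_eq0 subr0 -[X in _ == X](subrr x0) -{3}h; apply/eqP.
  by apply/rowP => j; rewrite !mxE; ring.
have Bw : B w.
  apply: (seg x w) => // t _; apply/eqP => /comb; rewrite ew mulrCA mulrA -mulrDl => /eqP.
  rewrite mulf_eq0 (negbTE (an _ xx)) orbF eq_complex ?cReD ?cImD ?cReM ?cImM /=.
  by move=> /andP[/eqP h /eqP h']; move: h h'; rewrite !(mul0r,mul1r,mulr0,mulr1) => h h'; lra.
case: (pselect (forall t : R, 0 <= t <= 1 -> x + t *: (y - x) != x0)) => [h|].
  exact: (seg x y).
move=> /existsNP[t] /not_implyP[t01] /negP; rewrite negbK => /eqP /comb ht.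
apply: (seg w y) => // s s01; apply/eqP => /comb; rewrite ew => hs.
have t0 : t != 0.
  apply/eqP => t0; move/eqP: ht; rewrite t0 subr0 mul1r mul0r addr0.
  by rewrite (negbTE (an _ xx)).
have s0 : s != 0.
  apply/eqP => s0; move/eqP: hs; rewrite s0 subr0 mul1r mul0r addr0 mulf_eq0.
  by rewrite (negbTE (an _ xx)) orbF eq_complex /= oner_eq0 andbF.
have : ((s * (1 - t))%:C%C - (t * (1 - s))%:C%C * 'i%C) * toC (x - x0) = 0.
  rewrite !rmorphM /= mulrBl -!mulrA.
  have -> : (1 - t)%:C%C * toC (x - x0) = - (t%:C%C * toC (y - x0)) by apply/eqP; rewrite -addr_eq0 ht.
  have -> : (1 - s)%:C%C * ('i%C * toC (x - x0)) = - (s%:C%C * toC (y - x0)) by apply/eqP; rewrite -addr_eq0 hs.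
  ring.
move=> /eqP; rewrite mulf_eq0 (negbTE (an _ xx)) orbF eq_complex ?cReD ?cImD ?cReM ?cImM /=.
move=> /andP[/eqP h _]; move: h; rewrite mulr0 mul0r subr0 => h.
have {h} : s * (1 - t) = 0 by move: h; rewrite ?subr0 ?oppr0 ?addr0.
move=> /eqP; rewrite mulf_eq0 (negbTE s0) /= subr_eq0 => /eqP t1.
by move/eqP: ht; rewrite -t1 subrr mul0r add0r mul1r (negbTE (an _ yx)).
Qed.

End Connectedness.

(** * The zeros of the cubic differential *)

Section Global.
Context {R : realType} (M : riemannSurface R) (g : M -> 'rV[R]_7) (xi : 'rV[R]_7).
Notation V := 'rV[R]_2.
Notation E := (@basis_vec R).
Notation C := R[i].
Notation N := (@Normc.normc R).
Hypotheses (hg : pseudoholomorphic_curve g) (ig : immersion g).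
Hypotheses (xi1 : dot xi xi = 1) (gxi : forall p, dot (g p) xi = 0).
Notation qM := (qM hg ig).
Notation pQ := (pQ g xi).

Lemma clopen_surface (B : set M) : (forall x, B x -> \forall y \near x, B y) ->
  (forall x, ~ B x -> \forall y \near x, ~ B y) -> forall x y, B x -> B y.
Proof.
move=> h1 h2 x y.
exact: (@clopen_connected M setT B (@surface_connected R M) (fun z _ => h1 z) (fun z _ => h2 z) x y I I).
Qed.

Lemma qM_isolated p : (\forall q \near p, qM q = 0) \/
  exists P d, [/\ inP P p, 0 < d,
    forall x, N (toC (x - px P p)) < d -> os (pW P) x &
    forall x, N (toC (x - px P p)) < d -> x <> px P p -> qM (ptoM P x) != 0].
Proof.
pose P := some_patch p; have Pp : inP P p := some_patchP p.
have Wx := px_W Pp.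
have [d1 d10 hd1] : exists2 d, 0 < d & forall x, N (toC (x - px P p)) < d -> os (pW P) x.
  by apply: nbhs_disc; apply: open_nbhs_nbhs; split=> //; exact: os_open.
have [[d d0 hd]|[d d0 hd]] := hol_isolated (os_open (pW P)) (hol_pQ hg ig gxi P) Wx.
  left; apply: (nbhs_patch Pp).
  apply: filterS2 (disc_nbhs (px P p) d0) (disc_nbhs (px P p) d10) => x /= /hd h /hd1 Wx'.
  apply/eqP; rewrite (qM_eq0 hg ig xi1 gxi (inP_inv Wx')) px_inv //; exact/eqP.
right; exists P, (Num.min d1 d); split=> //; first by rewrite lt_min d10.
  by move=> x; rewrite lt_min => /andP[/hd1].
move=> x; rewrite lt_min => /andP[/hd1 Wx' /hd h] /h.
by rewrite (qM_eq0 hg ig xi1 gxi (inP_inv Wx')) px_inv // => /eqP.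
Qed.

(** The points near which [qM] vanishes form an open set; it is also closed, because every other
    point has a punctured neighbourhood free of zeros. *)
Lemma qM_flat (p0 : M) : (\forall q \near p0, qM q = 0) -> forall p, qM p = 0.
Proof.
move=> h0 p; suff : \forall q \near p, qM q = 0 by move=> /nbhs_singleton.
move: p0 p h0; apply: clopen_surface => p.
  by move=> /nbhs_interior.
move=> np; have [//|[P [d [Pp d0 dW hd]]]] := qM_isolated p.
apply: (nbhs_patch Pp).
apply: filterS (disc_nbhs (px P p) d0) => x /= xd /nbhs_interior h.
have Wx := dW _ xd.
have [xp|xp] := eqVneq x (px P p).
  by apply: np; move: h; rewrite xp ptoMK // => /nbhs_singleton.
by have := hd x xd (elimN eqP xp); rewrite (nbhs_singleton (nbhs_singleton h)) eqxx.
Qed.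

Hypothesis iso : forall p : M, ~ \forall q \near p, qM q = 0.

Lemma qM_neq0_near p : qM p != 0 -> \forall q \near p, qM q != 0.
Proof.
move=> qp; have h : continuous qM by exact: qM_continuous.
have q0 : 0 < qM p by rewrite lt_neqAle eq_sym qp (qM_ge0 hg ig xi1 gxi).
have q2 : 0 < qM p / 2 by rewrite divr_gt0.
apply: filterS (continuous_near_le (h p) q2) => x hx; rewrite gt_eqF //.
by move: hx q0 => /ler_normlP[+ _]; lra.
Qed.

(** Isolated points do not disconnect a surface. A is extended to T, to which a zero of Q belongs
    when A holds on a punctured neighbourhood; as punctured discs are connected, T is open and
    closed. *)
Lemma clopen_regular (A : set M) :
  (forall p, qM p != 0 -> A p -> \forall q \near p, A q) ->
  (forall p, qM p != 0 -> ~ A p -> \forall q \near p, ~ A q) ->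
  forall p q, qM p != 0 -> qM q != 0 -> A p -> A q.
Proof.
move=> h1 h2.
pose T p := (qM p != 0 /\ A p) \/ (qM p = 0 /\ \forall q \near p, q <> p -> A q).
move=> p q; suff hT : T p -> T q.
  move=> p0 q0 Ap; have [||] := hT; first by left.
    by case.
  by move=> [q1]; move: q0; rewrite q1 eqxx.
move: p q; have disc p : qM p = 0 -> exists P d, [/\ inP P p, 0 < d,
    forall x, N (toC (x - px P p)) < d -> os (pW P) x,
    forall x, N (toC (x - px P p)) < d -> x <> px P p -> qM (ptoM P x) != 0 &
    forall x y, N (toC (x - px P p)) < d -> x != px P p -> N (toC (y - px P p)) < d ->
      y != px P p -> A (ptoM P x) -> A (ptoM P y)].
  move=> qp; have [/iso//|[P [d [Pp d0 dW hd]]]] := qM_isolated p.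
  exists P, d; split=> //; apply: punctured_disc_clopen => x xd /eqP xp.
    move=> Ax; have Px := inP_inv (dW _ xd).
    have := patch_nbhs Px (h1 _ (hd _ xd xp) Ax); rewrite px_inv; last exact: dW.
    by apply: filterS => y [].
  move=> Ax; have Px := inP_inv (dW _ xd).
  have := patch_nbhs Px (h2 _ (hd _ xd xp) Ax); rewrite px_inv; last exact: dW.
  by apply: filterS => y [].
have fromx P p x : inP P p -> os (pW P) x -> ptoM P x <> p -> x != px P p.
  by move=> Pp Wx h; apply/eqP => xp; apply: h; rewrite xp ptoMK.
apply: clopen_surface => p.
  move=> [[p0 Ap]|[p0 nA]].
    by apply: filterS2 (qM_neq0_near p0) (h1 _ p0 Ap) => q q0 Aq; left.
  have [P [d [Pp d0 dW hd _]]] := disc p p0.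
  have hq : \forall q \near p, q <> p -> qM q != 0.
    apply: (nbhs_patch Pp); apply: filterS (disc_nbhs (px P p) d0) => x /= xd xp.
    by apply: hd => //; apply/eqP/fromx => //; exact: dW.
  have nA' := nA; apply: filterS2 hq nA' => q q0 Aq.
  have [->|qp] := pselect (q = p); first by right.
  by left; split; [exact: q0|exact: Aq].
move=> nT; have [p0|p0] := eqVneq (qM p) 0; last first.
  have nA : ~ A p by move=> Ap; apply: nT; left.
  apply: filterS2 (qM_neq0_near p0) (h2 _ p0 nA) => q q0 nAq [[_ //]|[q1 _]].
  by move: q0; rewrite q1 eqxx.
have [P [d [Pp d0 dW hd hA]]] := disc p p0.
have nAx x : N (toC (x - px P p)) < d -> x != px P p -> ~ A (ptoM P x).
  move=> xd xp Ax; apply: nT; right; split=> //.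
  apply: (nbhs_patch Pp); apply: filterS (disc_nbhs (px P p) d0) => y /= yd yp.
  by apply: (hA x) => //; apply: fromx => //; exact: dW.
apply: (nbhs_patch Pp); apply: filterS (disc_nbhs (px P p) d0) => x /= xd.
have [xp|xp] := eqVneq x (px P p); first by rewrite xp ptoMK.
move=> [[_ /nAx]|[x0 _]]; first by apply.
by have := hd x xd (elimN eqP xp); rewrite x0 eqxx.
Qed.
End Global.

(** * Bounded holomorphic functions off the zeros of Q, and isotropy of F *)

Section Global.
Context {R : realType} (M : riemannSurface R) (g : M -> 'rV[R]_7) (xi : 'rV[R]_7).
Notation V := 'rV[R]_2.
Notation C := R[i].
Notation N := (@Normc.normc R).
Hypotheses (hg : pseudoholomorphic_curve g) (ig : immersion g).
Hypotheses (xi1 : dot xi xi = 1) (gxi : forall p, dot (g p) xi = 0).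
Notation qM := (qM hg ig).
Notation pQ := (pQ g xi).
Notation good := (good g xi).

Lemma N_ip_le n (v : 'rV[C]_n) : N (ip v v) <= complex.Re (hip v v).
Proof.
have hs (F : 'I_n -> C) : N (\sum_j F j) <= \sum_j N (F j).
  apply: (big_ind2 (fun a b => N a <= b)) => //; first by rewrite Normc.normc0.
  by move=> a b a' b' h h'; apply: le_trans (ND _ _) _; exact: lerD.
apply: le_trans (hs _) _; rewrite /hip /ip.
have -> : complex.Re (\sum_j v 0 j * conjv v 0 j) = \sum_j complex.Re (v 0 j * conjv v 0 j).
  by apply: (big_ind2 (fun a b => complex.Re a = b)) => // a b a' b' <- <-; rewrite cReD.
by apply: ler_sum => j _; rewrite mxE N_mul_conj Normc.normcM expr2.
Qed.

Lemma regular_patch p : qM p != 0 -> exists P, inP P p /\ good P.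
Proof.
move=> qp; pose P := some_patch p; have Pp : inP P p := some_patchP p.
have oS : open [set x | os (pW P) x /\ (pQ P : smoothfun (pW P)) x != 0].
  rewrite openE => x [Wx Qx]; have n0 : 0 < N ((pQ P : smoothfun (pW P)) x) by rewrite N_gt0.
  have [d d0 hd] := csm_continuous_dist (sv_smooth (pQ P : smoothfun (pW P))) Wx (divr_gt0 n0 (ltr0n R 2)).
  apply: filterS2 (disc_nbhs x d0) (open_nbhs_nbhs (conj (os_open (pW P)) Wx)) => y /= yd Wy.
  split=> //; apply/eqP => Qy; have := hd y yd; rewrite Qy sub0r NN; move: n0; lra.
pose P' := restrict_patch P oS.
have PP : sub_patch P' P by move=> r [/= h1 [h2 _]]; split.
exists P'; split.
  split; first exact: Pp.1.
  by split; first exact: Pp.2; split; [exact: Pp.2|rewrite -(qM_eq0 hg ig xi1 gxi Pp)].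
move=> x Wx; have Px := inP_inv Wx.
rewrite -[x](px_inv Wx) -(qM_eq0 hg ig xi1 gxi Px) (qM_eq0 hg ig xi1 gxi (PP _ Px)).
have [_ [_ h]] := Wx.
by have -> : px P (ptoM P' x) = x by exact: (px_inv Wx).
Qed.

Lemma good_regular P p : good P -> inP P p -> qM p != 0.
Proof. by move=> gP Pp; rewrite (qM_eq0 hg ig xi1 gxi Pp) gP //; exact: (px_W Pp). Qed.

Hypothesis cM : compact [set: M].
Hypothesis iso : forall p : M, ~ \forall q \near p, qM q = 0.
Let qM_isolated := qM_isolated hg ig xi1 gxi.

Lemma exists_regular : exists p, qM p != 0.
Proof.
have [_ [p _] _ _] := hg; apply: contrapT => h; apply: (iso (p := p)).
by apply: filterE => q; apply/eqP; apply: contra_notT h => h; exists q.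
Qed.

Section Bounded.
Variable h : M -> C.
Hypothesis hh : forall P, good P -> hol (os (pW P)) (fun x => h (ptoM P x)).

Lemma regular_continuous_N p (e : R) : qM p != 0 -> 0 < e ->
  \forall q \near p, N (h q - h p) <= e.
Proof.
move=> qp e0; have [P [Pp gP]] := regular_patch qp.
have [d d0 hd] := csm_continuous_dist (hol_csm (hh gP)) (px_W Pp) e0.
apply: (nbhs_patch Pp); apply: filterS (disc_nbhs _ d0) => x /= /hd.
by rewrite ptoMK.
Qed.

Lemma regular_locally_max p : qM p != 0 -> (forall q, qM q != 0 -> N (h q) <= N (h p)) ->
  forall q, qM q != 0 -> h q = h p.
Proof.
move=> qp hmax q qq; have cr := @clopen_regular _ _ _ _ hg ig xi1 gxi iso [set q | h q = h p].
apply: (cr _ _ p q qp qq (erefl (h p))) => {q qq cr} r r0 /= hr.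
  have [P [Pr gP]] := regular_patch r0.
  apply: (nbhs_patch Pr).
  have := @hol_strong_max _ _ _ _ (os_open (pW P)) (hh gP) (px_W Pr).
  rewrite ptoMK // hr; apply.
  apply: (near_open (os_open (pW P)) (px_W Pr)) => y Wy; apply: hmax.
  exact: good_regular gP (inP_inv Wy).
have e0 : 0 < N (h r - h p) / 2.
  by rewrite divr_gt0 // N_gt0 subr_eq0; apply/eqP.
apply: filterS (regular_continuous_N r0 e0) => x hx xp; move: hx e0.
by rewrite xp NB; move: (N _) => a; lra.
Qed.

Hypothesis hb : forall p, qM p != 0 -> N (h p) <= 1.

(* [h ^ m z] extends continuously by 0 over the puncture, so the weak maximum
   principle applies to it; then let [m] tend to infinity. *)
Lemma puncture_bound p (S : R) : qM p = 0 -> (forall q, qM q != 0 -> N (h q) < S) ->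
  exists2 s, s < S & \forall q \near p, qM q != 0 -> N (h q) <= s.
Proof.
move=> qp hS; have [/iso//|[P [d [Pp d0 dW hd]]]] := qM_isolated p.
set x0 := px P p in dW hd.
pose r := d / 4; have r0 : 0 < r by rewrite divr_gt0.
pose F x := h (ptoM P x).
have rd (x : V) : `|x - x0| <= r -> N (toC (x - x0)) < d.
  move=> xr; apply: le_lt_trans (N_le_mx_norm _) _.
  by have := xr; rewrite /r mulr2n; move: (`|x - x0|) d0 => a; lra.
have Fh x : N (toC (x - x0)) < d -> x <> x0 -> exists2 U : oset V, os U x &
    hol (os U) F /\ os U `<=` [set y | y <> x0].
  move=> xd xx; have q0 := hd x xd xx.
  have Px := inP_inv (dW x xd).
  have [P1 [P1x gP1]] := regular_patch q0.
  have PP : sub_patch (inter_patch P1 P) P1 by move=> z /inter_patchP[].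
  have gP := good_sub hg ig PP gP1.
  have Ix : inP (inter_patch P1 P) (ptoM P x) by apply/inter_patchP.
  exists (pW (inter_patch P1 P)).
    by have := px_W Ix; rewrite /px /= -/(px P _) px_inv //; exact: dW.
  split; first exact: hh gP.
  move=> y Wy yx; have := good_regular gP (inP_inv Wy).
  by rewrite yx /= /ptoM /= -/(ptoM P _) ptoMK // qp eqxx.
pose B := [set x : V | `|x - x0| = r].
have cB : compact B.
  apply: (@subclosed_compact _ _ _ _ (@compact_square R x0 r)); last by move=> x /= ->.
  have -> : B = (fun x : V => `|x - x0|) @^-1` [set r] by [].
  apply: closed_comp => [x _|]; last exact: closed_eq.
  apply: (@continuous_comp _ _ _ (fun x : V => x - x0) (fun x : V => `|x|)).
    by apply: continuousB => //; exact: cst_continuous.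
  exact: norm_continuous.
have Bx0 x : B x -> x <> x0 by move=> Bx xx; move: Bx r0; rewrite /B /= xx subrr normr0 => ->; rewrite ltxx.
have cF : {within B, continuous (fun x => N (F x) ^+ 2)}.
  apply: continuous_in_subspaceT => x /set_mem Bx.
  have [|U Ux [hU _]] := Fh x _ (Bx0 x Bx); first by apply: rd; rewrite Bx.
  exact: csm_continuous_N (hol_csm hU) Ux.
have B0 : B !=set0.
  exists (x0 + r *: basis_vec R 0); rewrite /B /= addrC addKr normrZ gtr0_norm //.
  suff -> : `|basis_vec R 0 : V| = 1 by rewrite mulr1.
  by apply/eqP; rewrite eq_le normE /=; rewrite -(@normr1 R) -[X in `|X| <= _](basisE 0 0); exact: row2_norm.
have [b /set_mem Bb bmax] := compact_EVT_max B0 cB cF.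
pose s := N (F b).
have sS : s < S by apply: hS; apply: hd; [apply: rd; rewrite Bb|exact: Bx0].
have s0 : 0 <= s by exact: N_ge0.
exists s => //.
have r2 : 0 <= 2 * r by rewrite mulr_ge0 // ltW.
suff key (x : V) : `|x - x0| <= r -> x <> x0 -> N (F x) <= s.
  apply: (nbhs_patch Pp); apply: filterS (disc_nbhs x0 r0) => x /= xr.
  have [->|/eqP xx] := eqVneq x x0; first by rewrite ptoMK // qp eqxx.
  by move=> _; apply: key => //; apply: ltW; exact: le_lt_trans (mx_norm_le_N _) xr.
move=> xr xx.
have bound m : N (F x) ^+ 2 ^+ m * N (toC (x - x0)) ^+ 2 <= s ^+ 2 ^+ m * (2 * r) ^+ 2.
  apply: (@maximum_principle _ _ B (fun y => N (F y) ^+ 2 ^+ m * N (toC (y - x0)) ^+ 2)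
    _ (@compact_square R x0 r)) => //.
  - apply: continuous_in_subspaceT => y /set_mem yr.
    have [->|yx] := eqVneq y x0; last first.
      have [U Uy [hU _]] := Fh y (rd y yr) (elimN eqP yx).
      have c1 := csm_continuous_N (hol_csm (hol_exp m (os_open U) hU)) Uy.
      have c2 := csm_continuous_N (hol_csm (hol_shift x0 (os_open U))) Uy.
      have -> : (fun y => N (F y) ^+ 2 ^+ m * N (toC (y - x0)) ^+ 2) =
          (fun y => N (F y ^+ m) ^+ 2 * N (toC (y - x0)) ^+ 2).
        by apply: funext => z; rewrite NX -!exprM mulnC.
      by refine (cvgM c1 c2).
    apply: near_le_continuous => e e0.
    have c2 := csm_continuous_N (U := setT) (hol_csm (hol_shift x0 openT)) (x := x0) I.
    apply: filterS2 (continuous_near_le c2 e0) (disc_nbhs x0 d0) => z /=.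
    rewrite subrr toC0 Normc.normc0 expr0n mulr0 !subr0 => hz zd.
    rewrite ger0_norm ?mulr_ge0 ?exprn_ge0 ?N_ge0 //.
    have [->|zx] := eqVneq z x0.
      by rewrite subrr toC0 Normc.normc0 expr0n mulr0 ltW.
    rewrite ger0_norm ?exprn_ge0 ?N_ge0 // in hz.
    apply: le_trans hz; rewrite ler_piMl ?exprn_ge0 ?N_ge0 //.
    rewrite -exprM exprn_ile1 ?N_ge0 //; apply: hb; apply: hd => //; exact/eqP.
  - move=> y By; apply: ler_pM; rewrite ?exprn_ge0 ?N_ge0 //.
      by rewrite lerXn2r ?nnegrE ?exprn_ge0 ?N_ge0 //; apply: bmax; rewrite inE.
    rewrite lerXn2r ?nnegrE ?N_ge0 //.
    by apply: le_trans (N_le_mx_norm _) _; rewrite (By : `|y - x0| = r) mulr_natl.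
  - move=> y yr nBy; have [->|yx] := eqVneq y x0.
      by left; rewrite subrr toC0 Normc.normc0 expr0n mulr0 mulr_ge0 // exprn_ge0 // exprn_ge0.
    right; have [U Uy [hU Ux0]] := Fh y (rd y yr) (elimN eqP yx).
    exists (os U `&` [set z | `|z - x0| < r]); split.
    + by apply: openI; [exact: os_open|exact: open_square].
    + by split=> //=; rewrite lt_neqAle yr andbT; apply/eqP.
    + by move=> z [_ /ltW].
    exists (fun z => F z ^+ m * toC (z - x0)).
      have oU' : open (os U `&` [set z | `|z - x0| < r]).
        by apply: openI; [exact: os_open|exact: open_square].
      apply: hol_mul => //; last exact: hol_shift.
      by apply: hol_exp => //; apply: hol_sub hU => z [].
    by move=> z _; rewrite Normc.normcM NX [RHS]exprMn exprAC.
rewrite leNgt; apply/negP => sx.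
have zp : 0 < N (toC (x - x0)) ^+ 2.
  by rewrite exprn_gt0 // N_gt0 toCB subr_eq0 (inj_eq (@toC_inj R)); apply/eqP.
have Fp : 0 < N (F x) ^+ 2 by rewrite exprn_gt0 //; exact: le_lt_trans sx.
pose t := s ^+ 2 / N (F x) ^+ 2.
have t1 : t < 1.
  by rewrite /t ltr_pdivrMr // mul1r ltrXn2r ?nnegrE ?N_ge0.
have t0 : 0 <= t by rewrite divr_ge0 ?(ltW Fp) // exprn_ge0.
have ck : (fun k => (2 * r) ^+ 2 * t ^+ k) @ \oo --> (0 : R).
  rewrite -(mulr0 ((2 * r) ^+ 2)); apply: cvgM; first exact: cvg_cst.
  by apply: cvg_expr; rewrite ger0_norm.
have [m _ /(_ m (leqnn m))] := @cvgr_dist_lt _ _ _ _ _ _ _ ck _ zp.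
have q0 : 0 <= (2 * r) ^+ 2 * t ^+ m.
  by apply: mulr_ge0; apply: exprn_ge0.
rewrite /= sub0r normrN (ger0_norm q0) ltNge /t expr_div_n mulrA => /negP; apply.
have Fm : 0 < N (F x) ^+ 2 ^+ m by exact: exprn_gt0.
rewrite ler_pdivlMr // [X in X <= _]mulrC; apply: le_trans (bound m) _.
by rewrite mulrC.
Qed.

(** If the supremum S is not attained, every point, puncture or not, has a neighbourhood on which
    |h| stays below some s < S; by compactness one s < S serves for all of M. *)
Lemma regular_max_exists : exists2 p, qM p != 0 & forall q, qM q != 0 -> N (h q) <= N (h p).
Proof.
apply: contrapT => nmax.
have [p0 qp0] := exists_regular.
pose A := [set N (h q) | q in [set q | qM q != 0]].
have sA : has_sup A.
  split; first by exists (N (h p0)), p0.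
  by exists 1 => _ [q /= qq <-]; exact: hb.
pose S := sup A.
have hS q : qM q != 0 -> N (h q) < S.
  move=> qq; have le r : qM r != 0 -> N (h r) <= S by move=> rr; apply: sup_upper_bound => //; exists r.
  rewrite lt_neqAle le // andbT; apply: contra_notN nmax => /eqP e.
  by exists q => // r rr; rewrite e; exact: le.
have loc (p : M) : exists2 s, s < S & \forall q \near p, qM q != 0 -> N (h q) <= s.
  have [qp|qp] := eqVneq (qM p) 0; first exact: puncture_bound.
  have e0 : 0 < (S - N (h p)) / 2 by rewrite divr_gt0 // subr_gt0 hS.
  exists ((S + N (h p)) / 2); first by have := hS p qp; lra.
  apply: filterS (regular_continuous_N qp e0) => q hq _.
  have -> : h q = h p + (h q - h p) by rewrite addrC subrK.
  by apply: le_trans (ND _ _) _; move: hq; lra.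
have nc := (compact_near_coveringP [set: M]).1 cM.
have hn : \forall s \near S^'-, [set: M] `<=` (fun q => qM q != 0 -> N (h q) <= s).
  apply: (nc R S^'- (fun s q => qM q != 0 -> N (h q) <= s)) => p _.
  have [s sS hs] := loc p; exists ([set q | qM q != 0 -> N (h q) <= s], [set s' | s < s']).
    by split=> //=; exact: nbhs_left_gt.
  by move=> [q s'] [/= h1 h2] qq; apply: le_trans (h1 qq) (ltW h2).
have : \forall s \near S^'-, s < S by exact: nbhs_left_lt.
move=> hn2; have [s [h1 h2]] := filter_ex (filterI hn hn2).
have : S <= s by apply: ge_sup; [exact: sA.1|move=> _ [q qq <-]; exact: h1].
by rewrite leNgt h2.
Qed.

Lemma bounded_hol_const : exists c, forall p, qM p != 0 -> h p = c.
Proof.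
have [p qp hp] := regular_max_exists.
by exists (h p) => q; exact: regular_locally_max.
Qed.

End Bounded.

Section Quartic.
Variables (n : nat) (f : M -> 'rV[R]_n.+1).
Hypothesis hf : isosurface g f.
Notation pPhi := (pPhi g f).
Notation rhoR := (rhoR g).
Notation sigR := (sigR g).

Lemma Phi_bound P x : os (pW P) x ->
  N ((pPhi P : smoothfun (pW P)) x) <= rhoR P x * sigR P x.
Proof.
move=> Wx; rewrite ev_ip //; apply: le_trans (N_ip_le _) _.
rewrite /hip -ev_cjv // -ev_ip // (ip_f2f2b (surface_cmP hg ig hf P)) sfM //.
by rewrite -/(psig g P) (psigE hg ig Wx) (prhoE hg ig Wx).1 -rmorphM /= mulrC.
Qed.

(* |<F, F>|^6 / |Q|^8; since it is bounded by the square of [qM], the junk value 0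
   at the zeros of Q makes it continuous. *)
Lemma psiM_ex : {psi : M -> R | forall P p, inP P p -> psi p =
  N ((pPhi P : smoothfun (pW P)) (px P p)) ^+ 6 / (rhoR P (px P p) ^+ 2 * sigR P (px P p)) ^+ 4}.
Proof.
apply: cid; have [|G hG] := @patch_glue R M R 0 (fun=> True)
  (fun P x => N ((pPhi P : smoothfun (pW P)) x) ^+ 6 / (rhoR P x ^+ 2 * sigR P x) ^+ 4).
  move=> P P' _ PP; split=> // p P'p; have W'x := px_W P'p.
  rewrite (pPhi_trans hg ig hf PP) // (rhoR_trans hg ig PP) // (sigR_trans hg ig PP) //.
  have -> : (((pjac P P' ^+ 4 * pphi PP (pPhi P)) : sfR (pW P')) : smoothfun (pW P')) (px P' p) =
      (pjac P P' : smoothfun (pW P')) (px P' p) ^+ 4 * (pPhi P : smoothfun (pW P)) (px P p).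
    rewrite sfM // pphiE // ptrans_px //; congr (_ * _).
    by rewrite !exprS expr0 !sfM // sf1.
  rewrite Normc.normcM NX -/(lN P P' p).
  have := lN_gt0 PP P'p; move: (lN _ _ _) (N _) (rhoR _ _) (sigR _ _) => l a b c l0.
  have [->|c0] := eqVneq c 0; first by rewrite !mulr0 !expr0n /= !invr0 !mulr0.
  have [->|b0] := eqVneq b 0; first by rewrite !(mulr0, expr0n, mul0r) /= !(mulr0, mul0r, expr0n, invr0).
  by field; rewrite c0 b0 gt_eqF.
by exists G => P p; exact: hG.
Qed.
Definition psiM := sval psiM_ex.
Lemma psiME P p : inP P p -> psiM p =
  N ((pPhi P : smoothfun (pW P)) (px P p)) ^+ 6 / (rhoR P (px P p) ^+ 2 * sigR P (px P p)) ^+ 4.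
Proof. exact: (svalP psiM_ex). Qed.

Lemma psiM_ge0 p : 0 <= psiM p.
Proof.
have Pp := some_patchP p; rewrite (psiME Pp).
have Wx := px_W Pp.
rewrite divr_ge0 ?exprn_ge0 ?N_ge0 // mulr_ge0 ?exprn_ge0 //.
  by rewrite ltW // (prhoE hg ig Wx).2.
exact: (sigR_ge0 hg ig xi1 gxi Wx).
Qed.

Lemma psiM_le p : psiM p <= qM p ^+ 2.
Proof.
have Pp := some_patchP p; have Wx := px_W Pp.
rewrite (psiME Pp) (qME hg ig Pp).
have := Phi_bound Wx; have := N_ge0 ((pPhi (some_patch p) : smoothfun (pW (some_patch p))) (px (some_patch p) p)).
have := (prhoE hg ig Wx).2; have := sigR_ge0 hg ig xi1 gxi Wx.
move: (N _) (rhoR _ _) (sigR _ _) => a r s s0 r0 a0 ars.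
have [->|sn0] := eqVneq s 0; first by rewrite mulr0 expr0n invr0 mulr0 mul0r expr0n.
have sp : 0 < s by rewrite lt_neqAle eq_sym sn0.
have p0 : 0 < (r ^+ 2 * s) ^+ 4 by rewrite exprn_gt0 // mulr_gt0 // exprn_gt0.
rewrite ler_pdivrMr //.
have -> : (s / r) ^+ 2 * (r ^+ 2 * s) ^+ 4 = (r * s) ^+ 6 by field; rewrite gt_eqF.
by rewrite lerXn2r ?nnegrE // mulr_ge0 // ltW.
Qed.

Lemma psiM_hol P p : good P -> inP P p ->
  psiM p = N (((pPhi P ^+ 3 * pqi g xi P ^+ 4 : sfR (pW P)) : smoothfun (pW P)) (px P p)) ^+ 2.
Proof.
move=> gP Pp; have Wx := px_W Pp; rewrite (psiME Pp) -(N_pQ hg ig xi1 gxi Wx).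
have e3 (a : smoothfun (pW P)) k : (a ^+ k : smoothfun (pW P)) (px P p) = a (px P p) ^+ k.
  by elim: k => [|k IH]; rewrite ?expr0 ?sf1 // !exprS sfM // IH.
rewrite sfM // !e3 sfofE //; last first.
  by apply: csm_inv gP _; [exact: os_open|exact: sv_smooth].
rewrite Normc.normcM !NX Normc.normcV.
have b0 : N ((pQ P : smoothfun (pW P)) (px P p)) != 0 by rewrite N_eq0; exact: gP Wx.
by move: (N _) (N _) b0 => a b b0; field.
Qed.

Lemma psiM_continuous : continuous psiM.
Proof.
move=> p; have [qp|qp] := eqVneq (qM p) 0.
  have p0 : psiM p = 0.
    apply/eqP; rewrite eq_le psiM_ge0 andbT; apply: le_trans (psiM_le p) _.
    by rewrite qp expr0n.
  apply: near_le_continuous => e e0.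
  have d0 : 0 < Num.min 1 e by rewrite lt_min ltr01.
  have qc : continuous qM by exact: qM_continuous.
  apply: filterS (continuous_near_le (qc p) d0) => q; rewrite qp subr0 p0 subr0.
  rewrite !ger0_norm ?psiM_ge0 ?(qM_ge0 hg ig xi1 gxi) // le_min => /andP[h1 h2].
  apply: le_trans (psiM_le q) _; apply: le_trans h2.
  by rewrite expr2 ler_piMl // (qM_ge0 hg ig xi1 gxi).
have [P [Pp gP]] := regular_patch qp.
move=> S Sp; apply: (nbhs_patch Pp).
have c1 := csm_continuous_N (sv_smooth ((pPhi P ^+ 3 * pqi g xi P ^+ 4 : sfR (pW P)) : smoothfun (pW P))) (px_W Pp).
have h : \forall x \near px P p, S (N (((pPhi P ^+ 3 * pqi g xi P ^+ 4 : sfR (pW P)) : smoothfun (pW P)) x) ^+ 2).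
  by apply: c1; rewrite -(psiM_hol gP Pp).
apply: filterS2 h (open_nbhs_nbhs (conj (os_open (pW P)) (px_W Pp))) => x hx Wx.
by rewrite /= (psiM_hol gP (inP_inv Wx)) px_inv.
Qed.

Lemma good_db_q P : good P -> db (pqi g xi P) = 0.
Proof.
move=> gP; apply: (hol_db (F := fun x => ((pQ P : smoothfun (pW P)) x)^-1)).
by apply: hol_inv => //; [exact: os_open|exact: (hol_pQ hg ig gxi P)].
Qed.

Lemma dbX (A : dring R) (a : A) k : db a = 0 -> db (a ^+ k) = 0.
Proof.
by move=> h; elim: k => [|k IH]; rewrite ?expr0 ?db1 // exprS dbM h IH mul0r mulr0 addr0.
Qed.

(** The set where psi attains its maximum is closed. If the maximum is positive it is also open, psi
    being there the square modulus of the holomorphic function <F, F>^3 / Q^4. So psi would be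
    constant, although it vanishes at a zero of Q. *)
Lemma Phi_eq0 : (exists p, qM p = 0) -> forall P, pPhi P = 0.
Proof.
move=> [z0 qz0].
have M0 : [set: M] !=set0 by exists z0.
have cpsi : {within [set: M], continuous psiM} by exact/continuous_subspaceT/psiM_continuous.
have [p _ pmax] := compact_EVT_max M0 cM cpsi.
have z0' : psiM z0 = 0.
  by apply/eqP; rewrite eq_le psiM_ge0 andbT; apply: le_trans (psiM_le _) _; rewrite qz0 expr0n.
have psi0 : psiM p = 0.
  apply/eqP; apply: contrapT => /negP pp.
  suff : psiM z0 = psiM p by rewrite z0' => h; move: pp; rewrite -h eqxx.
  have := @clopen_surface R M [set q | psiM q = psiM p]; apply=> //= q.
    move=> qp; have qq : qM q != 0.
      apply: contraNneq pp => q0; rewrite -qp eq_le psiM_ge0 andbT.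
      by apply: le_trans (psiM_le _) _; rewrite q0 expr0n.
    have [P [Pq gP]] := regular_patch qq.
    set F : smoothfun (pW P) := (pPhi P ^+ 3 * pqi g xi P ^+ 4 : sfR (pW P)).
    have hF : hol (os (pW P)) F.
      apply: db_hol; rewrite /F dbM (dbX _ (db_pPhi hg ig hf P)) (dbX _ (good_db_q gP)).
      by rewrite mul0r mulr0 addr0.
    apply: (nbhs_patch Pq).
    have hm : \forall x \near px P q, N (F x) <= N (F (px P q)).
      apply: (near_open (os_open (pW P)) (px_W Pq)) => x Wx.
      rewrite -(@ler_pXn2r _ 2) ?nnegrE ?N_ge0 // -[x](px_inv Wx).
      rewrite -(psiM_hol gP (inP_inv Wx)) -(psiM_hol gP Pq) qp.
      by apply: pmax; rewrite inE.
    apply: filterS2 (hol_strong_max (os_open (pW P)) hF (px_W Pq) hm)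
      (open_nbhs_nbhs (conj (os_open (pW P)) (px_W Pq))) => x hx Wx.
    by rewrite /= (psiM_hol gP (inP_inv Wx)) px_inv // -/F hx -(psiM_hol gP Pq).
  move=> qp; have e0 : 0 < `|psiM q - psiM p| / 2.
    by rewrite divr_gt0 // normr_gt0 subr_eq0; apply/eqP.
  apply: filterS (continuous_near_le (@psiM_continuous q) e0) => x + xp.
  by rewrite xp distrC; move: e0; move: (`|_|) => a; lra.
move=> P; apply: sfP => x Wx; rewrite sf0 //; apply/eqP; rewrite -N_eq0.
have Px := inP_inv Wx.
have /eqP : psiM (ptoM P x) = 0.
  by apply/eqP; rewrite eq_le psiM_ge0 andbT -psi0; apply: pmax; rewrite inE.
rewrite (psiME Px) (px_inv Wx) mulf_eq0 expf_eq0 /= invr_eq0 expf_eq0 /=.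
rewrite mulf_eq0 expf_eq0 /= (gt_eqF (prhoE hg ig Wx).2) /= => /orP[//|/eqP s0].
(* Where sigma = 0, [psiM] has the default value 0 and says nothing about <F, F>; the bound by rho
   sigma takes over. *)
by rewrite eq_le N_ge0 andbT; apply: le_trans (Phi_bound Wx) _; rewrite s0 mulr0.
Qed.
End Quartic.
End Global.

(** * Constancy of the frame data *)

Section Constancy.
Context {R : realType}.
Notation V := 'rV[R]_2.
Notation C := R[i].
Notation N := (@Normc.normc R).

Lemma ortho_ring (W : oset V) n x (L : seq 'rV[sfR W]_n) : os W x ->
  (forall v, v \in L -> (ip v (cjv v) : smoothfun W) x != 0) ->
  pairwise (fun u v => ip u (cjv v) == 0) L -> (size L <= n)%N.
Proof.
move=> Wx nz pw; rewrite -(size_map (fun v => ev v x)).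
have h (u v : 'rV[sfR W]_n) : hip (ev u x) (ev v x) = (ip u (cjv v) : smoothfun W) x.
  by rewrite /hip -ev_cjv // -ev_ip.
apply: ortho_size.
  by apply/allP => _ /mapP[v Lv ->]; rewrite h nz.
rewrite pairwise_map; apply: sub_pairwise pw => u v /= /eqP e.
by rewrite h e sf0.
Qed.

Lemma sf_locally_constant (W : oset V) (a : smoothfun W) x : os W x ->
  dz (a : sfR W) = 0 -> db (a : sfR W) = 0 -> \forall y \near x, a y = a x.
Proof.
move=> Wx da ba; have ha := db_hol ba.
have [d d0 hd] := nbhs_disc (open_nbhs_nbhs (conj (os_open W) Wx)).
apply: filterS (disc_nbhs x d0) => y /= yd; apply/eqP; rewrite -subr_eq0 -N_eq0.
rewrite eq_le N_ge0 andbT -(mul0r (N (toC (y - x)))).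
have -> : a y = a (x + (y - x)) by rewrite addrC subrK.
apply: (hol_MVT ha) => t t1.
have Wt : os W (x + t *: (y - x)).
  apply: hd; rewrite addrC addKr toCZ Normc.normcM N_real.
  by apply: le_lt_trans yd; rewrite ler_piMl // N_ge0.
by split=> //; rewrite -(hol_dz ha Wt) da sf0 // Normc.normc0.
Qed.

Lemma near_fin (T : topologicalType) (J : finType) (x : T) (P : J -> T -> Prop) :
  (forall j, \forall y \near x, P j y) -> \forall y \near x, forall j, P j y.
Proof.
move=> h; have : \forall y \near x, forall j, j \in enum J -> P j y.
  elim: (enum J) => [|j s IH]; first by apply: filterE.
  apply: filterS2 (h j) IH => y hj hs k; rewrite inE => /orP[/eqP ->//|]; exact: hs.
by apply: filterS => y hy j; apply: hy; rewrite mem_enum.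
Qed.

Lemma exists_ortho m n (A : 'M[C]_(m, n)) : (m < n)%N ->
  exists2 u : 'rV[C]_n, u != 0 & forall i, ip u (row i A) = 0.
Proof.
move=> mn; have : kermx A^T != 0.
  rewrite -mxrank_eq0 mxrank_ker subn_eq0 -ltnNge; apply: leq_ltn_trans mn.
  exact: rank_leq_col.
move=> /rowV0Pn[u /sub_kermxP hu u0]; exists u => // i.
have := congr1 (fun B : 'rV[C]_m => B 0 i) hu; rewrite !mxE => <-.
by apply: eq_bigr => j _; rewrite !mxE.
Qed.

Variables (M : riemannSurface R).

(** The real or the imaginary part of u is nonzero, and both are orthogonal to f; the hyperplane
    orthogonal to it cuts out a proper great subsphere. *)
Lemma not_substantial n (f : M -> 'rV[R]_n.+1) (u : 'rV[C]_n.+1) :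
  range f `<=` usphere R n -> u != 0 -> (forall p, ip u (rc (f p)) = 0) -> ~ substantial f.
Proof.
move=> fS u0 hu.
pose re : 'rV[R]_n.+1 := map_mx (@complex.Re R) u.
pose im : 'rV[R]_n.+1 := map_mx (@complex.Im R) u.
have hr p : dot re (f p) = 0 /\ dot im (f p) = 0.
  have uE : u = rc re + 'i%C *: rc im.
    by apply/rowP => j; rewrite !mxE; case: (u 0 j) => a b; apply: complex_eq;
      rewrite ?(cReD, cImD, cReM, cImM) /=; ring.
  have := hu p; rewrite uE ipDl ipZl !ip_rc => /eqP; rewrite eq_complex ?(cReD, cImD, cReM, cImM) /=.
  by rewrite !(mul0r, mulr0, mul1r, subr0, addr0, add0r) => /andP[/eqP -> /eqP].
have main (v : 'rV[R]_n.+1) : v != 0 -> (forall p, dot v (f p) = 0) -> ~ substantial f.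
  move=> v0 hv sub.
  have lin : linear (fun x : 'rV[R]_n.+1 => x *m v^T).
    by move=> a x y; rewrite mulmxDl scalemxAl.
  pose Lm := GRing.isLinear.Build R 'rV[R]_n.+1 'M[R]_1 *:%R _ lin.
  pose L : {linear 'rV[R]_n.+1 -> 'M[R]_1} := HB.pack (fun x : 'rV[R]_n.+1 => x *m v^T) Lm.
  pose K := lker (linfun L).
  apply: (sub K).
    move=> KT; have : v \in K by rewrite KT memvf.
    rewrite memv_ker lfunE /= => /eqP h; move: v0; rewrite (@dot_eq0 _ _ v) ?eqxx //.
    by rewrite /dot h mxE.
  move=> _ [p _ <-]; split; first by apply: fS; exists p.
  rewrite /= memv_ker lfunE /=; apply/eqP/matrixP => i j; rewrite !ord1 [RHS]mxE.
  by rewrite -[LHS]/(dot (f p) v) dotC hv.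
have [re0|re0] := eqVneq re 0; last by apply: (main re) => // p; case: (hr p).
have [im0|im0] := eqVneq im 0; last by apply: (main im) => // p; case: (hr p).
case/eqP: u0; apply/rowP => j; apply: complex_eq; rewrite mxE /=.
  by have := congr1 (fun B : 'rV[R]_n.+1 => B 0 j) re0; rewrite !mxE.
by have := congr1 (fun B : 'rV[R]_n.+1 => B 0 j) im0; rewrite !mxE.
Qed.

Section Glued.
Variables (reg : M -> Prop) (gd : cpatch M -> Prop).
Hypothesis hreg : forall p, reg p -> exists P, inP P p /\ gd P.
Hypothesis hconn : forall A : set M,
  (forall p, reg p -> A p -> \forall q \near p, A q) ->
  (forall p, reg p -> ~ A p -> \forall q \near p, ~ A q) ->
  forall p q, reg p -> reg q -> A p -> A q.
Hypothesis hsub : forall P P', gd P -> sub_patch P' P -> gd P'.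

(** Entries killed by dz and db are locally constant, and connectedness makes the constants agree.
    The set of points is kept abstract: it is M itself when Q = 0, and the complement of the zeros
    of Q otherwise. *)
Lemma glued_constant a b (I : forall P : cpatch M, 'M[sfR (pW P)]_(a, b)) :
  (forall P P' (PP : sub_patch P' P), gd P -> gd P' -> forall i j, I P' i j = pphi PP (I P i j)) ->
  (forall P, gd P -> forall i j, dz (I P i j) = 0 /\ db (I P i j) = 0) ->
  exists K : 'M[C]_(a, b), forall P p, gd P -> inP P p -> reg p ->
    forall i j, (I P i j : smoothfun (pW P)) (px P p) = K i j.
Proof.
move=> htr hc.
have [|G hG] := @patch_glue R M 'M[C]_(a, b) 0 gd
    (fun P x => \matrix_(i, j) (I P i j : smoothfun (pW P)) x).
  move=> P P' gP PP; have gP' := hsub gP PP; split=> // p P'p.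
  apply/matrixP => i j; rewrite !mxE (htr _ _ PP) // pphiE ?ptrans_px //; exact: (px_W P'p).
have [[p0 rp0]|nr] := pselect (exists p, reg p); last first.
  by exists 0 => P p _ _ rp; case: nr; exists p.
exists (G p0) => P p gP Pp rp i j.
have loc q : reg q -> \forall r \near q, G r = G q.
  move=> /hreg[P1 [P1q gP1]]; apply: (nbhs_patch P1q).
  have h : \forall y \near px P1 q, forall ij : 'I_a * 'I_b,
      (I P1 ij.1 ij.2 : smoothfun (pW P1)) y = (I P1 ij.1 ij.2 : smoothfun (pW P1)) (px P1 q).
    apply: near_fin => ij; have [h1 h2] := hc P1 gP1 ij.1 ij.2.
    exact: sf_locally_constant (px_W P1q) h1 h2.
  apply: filterS2 h (open_nbhs_nbhs (conj (os_open (pW P1)) (px_W P1q))) => y hy Wy.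
  rewrite (hG _ _ gP1 (inP_inv Wy)) (hG _ _ gP1 P1q) px_inv //.
  by apply/matrixP => k l; rewrite !mxE (hy (k, l)).
have : G p = G p0.
  apply: (hconn (A := [set q | G q = G p0]) _ _ rp0 rp) => //= q rq.
    by move=> e; apply: filterS (loc q rq) => r /= ->.
  by move=> e; apply: filterS (loc q rq) => r /= ->.
by rewrite (hG _ _ gP Pp) => <-; rewrite mxE.
Qed.
End Glued.

Section Cases.
Variables (g : M -> 'rV[R]_7) (xi : 'rV[R]_7).
Hypotheses (hg : pseudoholomorphic_curve g) (ig : immersion g).
Hypotheses (xi1 : dot xi xi = 1) (gxi : forall p, dot (g p) xi = 0).
Notation qM := (qM hg ig).
Notation pQ := (pQ g xi).
Notation pqi := (pqi g xi).
Notation prho := (prho g).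
Notation prhoV := (prhoV g).
Notation good := (good g xi).

Section Flat.
Hypothesis flat : forall p, qM p = 0.
Variables (n : nat) (f : M -> 'rV[R]_n.+1).
Hypothesis hf : isosurface g f.
Let sf : smooth_map f. Proof. by have [[_ []]] := hf. Qed.

Lemma flat_F2 P : pF2 g f P = 0.
Proof.
have cm := surface_cmP hg ig hf P.
apply: ev_ext => x Wx; rewrite [RHS](_ : _ = 0); last first.
  by apply/rowP => j; rewrite !mxE sf0.
apply: hip_eq0; rewrite /hip -ev_cjv // -ev_ip // (ip_f2f2b cm).
have /eqP := flat (ptoM P x); rewrite (qM_eq0 hg ig xi1 gxi (inP_inv Wx)) px_inv //.
rewrite (pQ_eq0 hg ig xi1 gxi Wx) => /eqP s0.
by rewrite sfM // -/(psig g P) (psigE hg ig Wx) s0 mul0r.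
Qed.

(** The projection [transfer3] is a constant matrix K. A vector u orthogonal to f, f_z and its
    conjugate at one point, which exists since n + 1 > 3, satisfies u K = 0. At every other point
    <u, f> = <u K, f> = 0. *)
Lemma flat_not_substantial : (3 <= n)%N -> ~ substantial f.
Proof.
move=> n3.
have [K hK] := @glued_constant (fun=> True) (fun=> True)
  (fun p _ => ex_intro _ (some_patch p) (conj (some_patchP p) Logic.I))
  (fun A h1 h2 p q _ _ => @clopen_surface R M A (fun x => h1 x Logic.I) (fun x => h2 x Logic.I) p q)
  (fun _ _ _ _ => Logic.I) n.+1 n.+1
  (fun P => transfer3 (pv P f) (prhoV P))
  (fun P P' PP _ _ => transfer3_transition (pphi_dmorph PP) (prho_inv hg ig P) (prho_inv hg ig P')
     (pv_trans PP sf) (prho_trans hg ig PP))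
  (fun P _ i j => conj (dz_transfer3 (surface_cmP hg ig hf P) (flat_F2 P) i j)
     (etrans (congr1 cj (congr1 dz (cj_transfer3 (surface_cmP hg ig hf P) i j)))
       (etrans (congr1 cj (dz_transfer3 (surface_cmP hg ig hf P) (flat_F2 P) i j)) (rmorph0 _)))).
have [_ [p0 _] _ _] := hg.
pose P := some_patch p0; have Pp0 : inP P p0 := some_patchP p0.
pose x0 := px P p0; have Wx0 : os (pW P) x0 := px_W Pp0.
pose F := \matrix_(i < 3) nth 0 [:: ev (pv P f) x0; ev (dzv (pv P f)) x0; ev (cjv (dzv (pv P f))) x0] i.
have [u u0 hu] := exists_ortho F (n3 : (3 < n.+1)%N).
have h0 := hu (inord 0); have h1 := hu (inord 1); have h2 := hu (inord 2).
rewrite rowK inordK //= in h0; rewrite rowK inordK //= in h1; rewrite rowK inordK //= in h2.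
have uK : u *m K = 0.
  pose U : 'rV[sfR (pW P)]_n.+1 := map_mx dk u.
  have eU : ev U x0 = u by apply/rowP => j; rewrite !mxE mksfE.
  have -> : u *m K = ev (U *m transfer3 (pv P f) (prhoV P)) x0.
    have [phi hphi] := ev_ex Wx0.
    apply/rowP => j; rewrite !mxE -hphi rmorph_sum; apply: eq_bigr => i _.
    by rewrite rmorphM !hphi (hK P p0) // !mxE mksfE.
  rewrite mul_transfer3 evD // !evZ // evD // !evZ // !ev_ip // eU h0 h1 h2.
  by rewrite !scale0r addr0 scaler0 addr0.
apply: (not_substantial (u := u) _ u0); first by case: hf => [[]].
move=> p; pose P1 := some_patch p; have P1p : inP P1 p := some_patchP p.
have Wx := px_W P1p; have cm := surface_cmP hg ig hf P1.
pose U : 'rV[sfR (pW P1)]_n.+1 := map_mx dk u.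
have eU : ev U (px P1 p) = u by apply/rowP => j; rewrite !mxE mksfE.
have e : ev (U *m transfer3 (pv P1 f) (prhoV P1)) (px P1 p) = 0.
  rewrite -[RHS]uK; have [phi hphi] := ev_ex Wx.
  apply/rowP => j; rewrite !mxE -hphi rmorph_sum; apply: eq_bigr => i _.
  by rewrite rmorphM !hphi (hK P1 p) // !mxE mksfE.
rewrite -(ev_pv sf P1p) -eU -ev_ip //.
have : ip (U *m transfer3 (pv P1 f) (prhoV P1)) (pv P1 f) = ip U (pv P1 f).
  rewrite mul_transfer3 !(ipDl, ipZl) (cm_sphere cm) (ip_f1f cm) (ip_f1bf cm).
  by rewrite !mulr0 addr0 mulr0 addr0 mulr1.
by move=> <-; rewrite ev_ip // e ip0l.
Qed.
End Flat.

(** * The case of isolated zeros of the cubic differential *)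

Section Curved.
Hypothesis cM : compact [set: M].
Hypothesis iso : forall p : M, ~ \forall q \near p, qM q = 0.
Hypothesis zero : exists p, qM p = 0.

Section Surface.
Variables (n : nat) (f : M -> 'rV[R]_n.+1).
Hypothesis hf : isosurface g f.
Let sf : smooth_map f. Proof. by have [[_ []]] := hf. Qed.
Let phi0 P : ip (F2 (pv P f) (prho P) (prhoV P)) (F2 (pv P f) (prho P) (prhoV P)) = 0.
Proof. exact: (Phi_eq0 xi1 gxi cM hf zero P). Qed.
Let cm P := surface_cmP hg ig hf P.
Let dbQ P := db_pQ hg ig gxi P.
Let QQ P := QQP hg ig xi1 gxi P.
Let hq P (gP : good P) : pQ P * pqi P = 1 := good_inv gP.

Definition pC P := Fc (pv P f) (prho P) (prhoV P) (pqi P).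

Lemma pC_trans P P' (PP : sub_patch P' P) : good P -> good P' ->
  pC P' = pphi PP (pC P).
Proof.
move=> gP gP'; apply: (Fc_transition (pphi_dmorph PP) (prho_inv hg ig P) (prho_inv hg ig P')
  (pv_trans PP sf) (prho_trans hg ig PP) (hq gP) (hq gP')).
exact: pQ_trans.
Qed.

(** |<eta, eta>| is at most the Hermitian square norm of eta, which is 1. *)
Lemma pC_bound P x : good P -> os (pW P) x -> N ((pC P : smoothfun (pW P)) x) <= 1.
Proof.
move=> gP Wx; rewrite /pC FcE ev_ip //; apply: le_trans (N_ip_le _) _.
rewrite /hip -ev_cjv // -ev_ip // (ip_etaetab (cm P) (dbQ P) (hq gP) (QQ P)) sf1 //.
Qed.

Lemma pC_const : exists2 c : C, N c <= 1 & forall P, good P -> pC P = dk c.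
Proof.
have [|h hh] := @patch_glue R M C 0 good (fun P x => (pC P : smoothfun (pW P)) x).
  move=> P P' gP PP; have gP' := good_sub hg ig PP gP; split=> // p P'p.
  by rewrite (pC_trans PP gP gP') pphiE ?ptrans_px //; exact: (px_W P'p).
have [|p qp|c hc] := @bounded_hol_const R M g xi hg ig xi1 gxi cM iso h.
- move=> P gP; apply: (hol_ext (os_open (pW P)) (F := (pC P : smoothfun (pW P)))).
    by move=> x Wx; rewrite (hh _ _ gP (inP_inv Wx)) px_inv.
  exact: db_hol (db_c (cm P) (dbQ P) (hq gP) (QQ P) (phi0 P)).
- have [P [Pp gP]] := regular_patch xi1 gxi qp.
  by rewrite (hh _ _ gP Pp) pC_bound //; exact: px_W.
have hP P : good P -> pC P = dk c.
  move=> gP; apply: sfP => x Wx; rewrite [RHS]mksfE // -(hc (ptoM P x)).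
    by rewrite (hh _ _ gP (inP_inv Wx)) px_inv.
  exact: (@good_regular _ _ _ _ hg ig xi1 gxi _ _ gP (inP_inv Wx)).
exists c => //; have [p qp] := exists_regular iso.
have [P [Pp gP]] := regular_patch xi1 gxi qp.
by have := pC_bound gP (px_W Pp); rewrite hP // mksfE //; exact: (px_W Pp).
Qed.

Lemma kapE P c : pC P = dk c -> 1 - pC P * cj (pC P) = dk (1 - c * conjc c).
Proof. by move=> ->; rewrite cj_dk rmorphB rmorph1 rmorphM. Qed.

Lemma dz_pC P : good P -> dz (pC P) = 0.
Proof. by have [c _ hc] := pC_const => gP; rewrite hc // dz_dk. Qed.

Notation frameP P := (frame (pv P f) (prho P) (prhoV P) (pqi P)).
Notation defectP P := (eta_defect (pv P f) (prho P) (prhoV P) (pqi P)).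
Notation kP P := (Fk (pv P f) (prho P) (prhoV P) (pqi P)).

Lemma frame_nonzero P x v : good P -> os (pW P) x -> v \in frameP P ->
  (ip v (cjv v) : smoothfun (pW P)) x != 0.
Proof.
move=> gP Wx; have [h1 h2 h3 h4 h5] := frame_norm (cm P) (dbQ P) (hq gP) (QQ P).
have rn : (prho P : smoothfun (pW P)) x != 0.
  by rewrite (prhoE hg ig Wx).1 eq_complex /= eqxx andbT gt_eqF // (prhoE hg ig Wx).2.
have on : (1 : smoothfun (pW P)) x != 0 by rewrite sf1 // oner_eq0.
by rewrite !inE => /orP[|/orP[|/orP[|/orP[|/orP[]]]]] /eqP ->; rewrite ?cjvK
  ?h1 ?h2 ?h3 ?h4 ?h5 // ipC h4.
Qed.

Lemma frame_size P x : good P -> os (pW P) x -> (6 <= n.+1)%N.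
Proof.
move=> gP Wx.
apply: (ortho_ring Wx (L := frameP P)); first by move=> v; exact: frame_nonzero.
exact: (frame_ortho (cm P) (dbQ P) (hq gP) (QQ P) (phi0 P)).
Qed.

(** Besides the six frame vectors there are the defect of eta and k, whose square norms are 1 -
    |c|^2 and rho (1 - |c|^2). Without room for a ninth vector, the part of conj k orthogonal to k
    vanishes, which is equality in |<k, k>| <= <k, conj k>. *)
Lemma defect_size P x : good P -> os (pW P) x ->
  (1 - pC P * cj (pC P) : smoothfun (pW P)) x != 0 -> (8 <= n.+1)%N /\
  ((n.+1 <= 8)%N -> (ip (kP P) (kP P) * cj (ip (kP P) (kP P)) : smoothfun (pW P)) x =
    ((prho P * (1 - pC P * cj (pC P))) ^+ 2 : smoothfun (pW P)) x).
Proof.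
move=> gP Wx c1; have dc := dz_pC gP.
pose kap := 1 - pC P * cj (pC P).
have ortho6 := frame_ortho (cm P) (dbQ P) (hq gP) (QQ P) (phi0 P).
have ortho7 := frame_ortho_defect (cm P) (dbQ P) (hq gP) (QQ P) (phi0 P).
have dd := ip_defect_defect (cm P) (dbQ P) (hq gP) (QQ P).
have orthok := frame_ortho_k (cm P) (dbQ P) (hq gP) (QQ P) (phi0 P) dc.
have orthokb := frame_ortho_kb (cm P) (dbQ P) (hq gP) (QQ P) (phi0 P) dc.
have kk := ip_kkb (cm P) (dbQ P) (hq gP) (QQ P) (phi0 P).
rewrite -/(pC P) -/kap in kk; rewrite -/(pC P) -/kap in dd.
have rn : (prho P : smoothfun (pW P)) x != 0.
  by rewrite (prhoE hg ig Wx).1 eq_complex /= eqxx andbT gt_eqF // (prhoE hg ig Wx).2.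
pose L7 := rcons (frameP P) (defectP P).
have nz7 v : v \in L7 -> (ip v (cjv v) : smoothfun (pW P)) x != 0.
  by rewrite mem_rcons inE => /orP[/eqP ->|]; [rewrite dd|exact: frame_nonzero].
have pw7 : pairwise (fun u v => ip u (cjv v) == 0) L7.
  by rewrite /L7 pairwise_rcons ortho6 ortho7.
pose L8 := rcons L7 (kP P).
have nz8 v : v \in L8 -> (ip v (cjv v) : smoothfun (pW P)) x != 0.
  rewrite mem_rcons inE => /orP[/eqP ->|]; last exact: nz7.
  by rewrite kk sfM // mulf_neq0.
have pw8 : pairwise (fun u v => ip u (cjv v) == 0) L8.
  by rewrite /L8 pairwise_rcons pw7 orthok.
split; first exact: (ortho_ring Wx nz8 pw8).
move=> n8.
have [cc hcc hC] := pC_const.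
have hn : (1 - cc * conjc cc) != 0.
  by move: c1; rewrite (kapE (hC _ gP)) mksfE.
pose ki : sfR (pW P) := dk (1 - cc * conjc cc)^-1.
have kki : kap * ki = 1.
  by rewrite /kap /ki (kapE (hC _ gP)) -rmorphM divff // rmorph1.
have cjkap : cj kap = kap.
  by rewrite /kap rmorphB rmorph1 rmorphM cjK [cj _ * _]mulrC.
have cjki : cj ki = ki.
  have h : kap * cj ki = 1 by rewrite -cjkap -rmorphM kki rmorph1.
  by rewrite -[LHS]mulr1 -kki mulrA [cj ki * _]mulrC h mul1r.
pose mu := ip (kP P) (kP P).
have hr := prho_inv hg ig P.
have cr := cj_r (cm P); have crho := cj_rho (cm P).
(* The coefficient <conj k, conj k> / <k, conj k> of the projection of conj k to k. *)
pose a := cj mu * (prhoV P * ki).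
have ca : cj a = mu * (prhoV P * ki) by rewrite !rmorphM cjK cr cjki.
pose w2 := cjv (kP P) - a *: kP P.
have cw2 : cjv w2 = kP P - cj a *: cjv (kP P) by rewrite cjvB cjvZ cjvK.
have orth9 : all (fun u => ip u (cjv w2) == 0) L8.
  rewrite /L8 all_rcons; apply/andP; split.
    by rewrite cw2 ipDr ipNr ipZr kk ca -/mu; apply/eqP; ring: hr kki.
  apply/allP => v Lv; have /allP /(_ _ Lv) /eqP h1 := orthok.
  have /allP /(_ _ Lv) := orthokb; rewrite cjvK => /eqP h2.
  by rewrite cw2 ipDr ipNr ipZr h1 h2 mulr0 subr0.
have nw : ip w2 (cjv w2) = prho P * kap - mu * cj mu * (prhoV P * ki).
  rewrite cw2 !(ipDl, ipDr, ipNl, ipNr, ipZl, ipZr) ca.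
  have -> : ip (cjv (kP P)) (cjv (kP P)) = cj mu by rewrite cj_ip.
  by rewrite (ipC (cjv (kP P))) kk -/mu /a; ring: hr kki.
have [w0|w0] := eqVneq ((ip w2 (cjv w2) : smoothfun (pW P)) x) 0.
  have e : mu * cj mu = (prho P * kap - ip w2 (cjv w2)) * (prho P * kap).
    by rewrite nw; ring: hr kki.
  by rewrite e -/kap expr2 [LHS]sfM // [RHS]sfM // sfD // sfN // w0 subr0.
have : (9 <= n.+1)%N.
  apply: (ortho_ring Wx (L := rcons L8 w2)).
    by move=> v; rewrite mem_rcons inE => /orP[/eqP ->//|]; exact: nz8.
  by rewrite pairwise_rcons pw8 orth9.
by rewrite ltnNge n8.
Qed.

(** [qM] is continuous and vanishes at some point; if it were 1 at every regular point, it would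
    vanish on a whole neighbourhood of that zero, which [iso] excludes. *)
Lemma zero_not_regular1 : (forall p, qM p != 0 -> qM p = 1) -> False.
Proof.
move=> h; have [z qz] := zero; have qc : continuous qM by exact: qM_continuous.
have h2 : 0 < 1 / 2 :> R by rewrite divr_gt0.
apply: (iso (p := z)); apply: filterS (continuous_near_le (qc z) h2) => q.
rewrite qz subr0 => hq'; apply/eqP; apply: contraT => /h q1.
by move: hq'; rewrite q1 normr1; lra.
Qed.

Lemma pC_unit : (n <= 7)%N -> exists2 c : C, c * conjc c = 1 & forall P, good P -> pC P = dk c.
Proof.
move=> n7; have [c c1 hc] := pC_const; exists c => //.
apply/eqP; apply: contraT => cc; exfalso; apply: zero_not_regular1 => p qp.
have [P [Pp gP]] := regular_patch xi1 gxi qp.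
have cn y : os (pW P) y -> (1 - pC P * cj (pC P) : smoothfun (pW P)) y != 0.
  move=> Wy; rewrite (kapE (hc _ gP)) mksfE //.
  by rewrite subr_eq0 eq_sym.
have mm : ip (kP P) (kP P) * cj (ip (kP P) (kP P)) = (prho P * (1 - pC P * cj (pC P))) ^+ 2.
  by apply: sfP => y Wy; apply: (defect_size gP Wy (cn y Wy)).2.
pose mu := ip (kP P) (kP P).
pose ki : sfR (pW P) := dk (1 - c * conjc c)^-1.
have kki : (1 - pC P * cj (pC P)) * ki = 1.
  rewrite /ki (kapE (hc _ gP)) -rmorphM divff ?rmorph1 //.
  by rewrite subr_eq0 eq_sym.
have hr := prho_inv hg ig P.
have hm : mu * (cj mu * (prhoV P * ki) ^+ 2) = 1.
  rewrite mulrA (mm : mu * cj mu = _); move: kki; move: (1 - _) => kap kki; by ring: hr kki.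
have := sigma_of_parallel (cm P) (dbQ P) (hq gP) (QQ P) (phi0 P) (dz_pC gP) hm mm.
rewrite (qME hg ig Pp) => e.
have -> : sigR g P (px P p) = rhoR g P (px P p) by rewrite /sigR /rhoR /psig e.
by rewrite divff // gt_eqF // (prhoE hg ig (px_W Pp)).2.
Qed.

(** For |c| = 1 the defect of eta has norm 0. *)
Lemma degenerateP c P : c * conjc c = 1 -> good P -> pC P = dk c ->
  degenerate (prho P) (prhoV P) (pqi P) (dk c) (pv P f).
Proof.
move=> cc gP hc; split; [exact: cm|exact: phi0|exact: hc|].
apply/eqP; rewrite -subr_eq0 -hc -/(pC P); apply/eqP; apply: ev_ext => x Wx.
rewrite [RHS](_ : _ = 0); last by apply/rowP => j; rewrite !mxE sf0.
apply: hip_eq0; rewrite /hip -ev_cjv // -ev_ip //.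
rewrite (ip_defect_defect (cm P) (dbQ P) (hq gP) (QQ P)) -/(pC P) hc cj_dk -rmorphM cc.
by rewrite rmorph1 subrr sf0.
Qed.

Lemma size_ge5 : (5 <= n)%N.
Proof.
have [p qp] := exists_regular iso.
have [P [Pp gP]] := regular_patch xi1 gxi qp.
exact: frame_size gP (px_W Pp).
Qed.
End Surface.

(** No open set consists of zeros of Q, so identities between smooth functions extend over the zeros
    by continuity. *)
Lemma regular_dense P (a : smoothfun (pW P)) :
  (forall p, inP P p -> qM p != 0 -> a (px P p) = 0) -> a = 0 :> sfR (pW P).
Proof.
move=> h; apply: sfP => x Wx; rewrite sf0 //; apply/eqP; rewrite -N_eq0; apply: contraT.
rewrite N_eq0 -N_gt0 => n0; have Px := inP_inv Wx; case: (iso (p := ptoM P x)).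
have [d d0 hd] := csm_continuous_dist (sv_smooth a) Wx (divr_gt0 n0 (ltr0n R 2)).
apply: (nbhs_patch Px); rewrite px_inv //.
apply: filterS2 (disc_nbhs x d0) (open_nbhs_nbhs (conj (os_open (pW P)) Wx)) => y /= yd Wy.
apply/eqP; apply: contraT => qy; have := hd y yd.
by rewrite -[y](px_inv Wy) (h _ (inP_inv Wy)) // sub0r NN; move: n0; lra.
Qed.

Section TwoSurfaces.
Variables (n n' : nat) (f : M -> 'rV[R]_n.+1) (f' : M -> 'rV[R]_n'.+1) (c : C).
Hypotheses (hf : isosurface g f) (hf' : isosurface g f').
Hypotheses (cc : c * conjc c = 1).
Hypotheses (hc : forall P, good P -> pC f P = dk c) (hc' : forall P, good P -> pC f' P = dk c).
Let sf : smooth_map f. Proof. by have [[_ []]] := hf. Qed.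
Let sf' : smooth_map f'. Proof. by have [[_ []]] := hf'. Qed.

Definition pT P := transfer (prho P) (prhoV P) (pqi P) (pv P f) (pv P f').

Let ccP (P : cpatch M) : dk c * cj (dk c) = 1 :> sfR (pW P).
Proof. by rewrite cj_dk -rmorphM cc rmorph1. Qed.

Let dzT P : good P -> forall i j, dz (pT P i j) = 0.
Proof.
move=> gP i j.
exact: (dz_transfer (db_pQ hg ig gxi P) (good_inv gP) (QQP hg ig xi1 gxi P) (ccP P) (dz_dk _ _)
  (degenerateP hf cc gP (hc gP)) (degenerateP hf' cc gP (hc' gP))).
Qed.

Let cjT P : good P -> forall i j, cj (pT P i j) = pT P i j.
Proof.
move=> gP i j.
exact: (cj_transfer (ccP P) (degenerateP hf cc gP (hc gP)) (degenerateP hf' cc gP (hc' gP))).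
Qed.

Lemma transfer_const : exists K : 'M[C]_(n.+1, n'.+1), forall P p, good P -> inP P p ->
  forall i j, (pT P i j : smoothfun (pW P)) (px P p) = K i j.
Proof.
have hreg (p : M) : qM p != 0 -> exists P, inP P p /\ good P by exact: regular_patch.
have hconn (A : set M) : (forall p, qM p != 0 -> A p -> \forall q \near p, A q) ->
    (forall p, qM p != 0 -> ~ A p -> \forall q \near p, ~ A q) ->
    forall p q, qM p != 0 -> qM q != 0 -> A p -> A q.
  exact: (clopen_regular xi1 gxi iso).
have hsub P P' : good P -> sub_patch P' P -> good P' by move=> gP PP; exact: good_sub PP gP.
have [||K hK] := glued_constant hreg hconn hsub (I := pT).
- move=> P P' PP gP gP' i j.
  exact: (transfer_transition (pphi_dmorph PP) (prho_inv hg ig P) (prho_inv hg ig P')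
    (pv_trans PP sf) (pv_trans PP sf') (prho_trans hg ig PP) (good_inv gP) (good_inv gP')
    (pQ_trans xi hg ig PP)).
- move=> P gP i j; split; first exact: dzT.
  by rewrite /db cjT // dzT // rmorph0.
exists K => P p gP Pp; apply: hK => //; exact: (@good_regular _ _ _ _ hg ig xi1 gxi _ _ gP Pp).
Qed.

Lemma transfer_apply (K : 'M[C]_(n.+1, n'.+1)) : (forall P p, good P -> inP P p ->
    forall i j, (pT P i j : smoothfun (pW P)) (px P p) = K i j) ->
  forall p, rc (f' p) = rc (f p) *m K.
Proof.
move=> hK p; have [P Pp] : exists P : cpatch M, inP P p by exact: cover_patch.
have Wx := px_W Pp.
have e : pv P f' = pv P f *m map_mx dk K.
  apply/rowP => j; apply/eqP; rewrite -subr_eq0; apply/eqP.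
  apply: regular_dense => q Pq qq; have [P1 [P1q gP1]] := regular_patch xi1 gxi qq.
  have Wq := px_W Pq; have Wq1 := px_W P1q.
  have [phi hphi] := ev_ex Wq; have [phi1 hphi1] := ev_ex Wq1.
  rewrite -hphi rmorphB !hphi [X in _ - X](_ : _ = (rc (f q) *m K) 0 j); last first.
    rewrite -hphi !mxE rmorph_sum; apply: eq_bigr => i _; rewrite rmorphM !hphi.
    congr (_ * _); last by rewrite mxE mksfE.
    by have := congr1 (fun v : 'rV[C]_n.+1 => v 0 i) (ev_pv sf Pq); rewrite !mxE.
  have := congr1 (fun v : 'rV[C]_n'.+1 => v 0 j) (ev_pv sf' Pq); rewrite mxE => ->.
  rewrite -(ev_pv sf P1q) -(ev_pv sf' P1q).
  rewrite -{1}(transfer_f (pv P1 f') (degenerateP hf cc gP1 (hc gP1))) -/(pT P1).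
  apply/eqP; rewrite subr_eq0; apply/eqP; rewrite !mxE -hphi1 rmorph_sum.
  by apply: eq_bigr => i _; rewrite rmorphM !hphi1 (hK P1 q) // !mxE.
rewrite -(ev_pv sf Pp) -(ev_pv sf' Pp) e.
have [phi hphi] := ev_ex Wx.
apply/rowP => j; rewrite !mxE -hphi rmorph_sum; apply: eq_bigr => i _.
by rewrite rmorphM !hphi !mxE mksfE.
Qed.

Lemma transfer_real (K : 'M[C]_(n.+1, n'.+1)) : (forall P p, good P -> inP P p ->
    forall i j, (pT P i j : smoothfun (pW P)) (px P p) = K i j) ->
  K = map_mx (fun a => a%:C%C) (map_mx (@complex.Re R) K).
Proof.
move=> hK; have [p qp] := exists_regular iso.
have [P [Pp gP]] := regular_patch xi1 gxi qp; have Wx := px_W Pp.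
apply/matrixP => i j; rewrite !mxE -(hK P p gP Pp).
have := congr1 (fun a : smoothfun (pW P) => complex.Im (a (px P p))) (cjT gP i j).
rewrite mksfE // cIm_conj => h; apply: complex_eq => //=.
by move: h; set a := complex.Im _; lra.
Qed.
End TwoSurfaces.

Section OneSurface.
Variables (n : nat) (f : M -> 'rV[R]_n.+1) (c : C).
Hypotheses (hf : isosurface g f) (cc : c * conjc c = 1).
Hypothesis hc : forall P, good P -> pC f P = dk c.
Let sf : smooth_map f. Proof. by have [[_ []]] := hf. Qed.

(** [transfer f f] is a constant symmetric matrix K that fixes f and kills any u orthogonal to the
    six frame vectors at one point; hence <u, f> = <u K, f> = 0 everywhere. For n >= 6 such a
    nonzero u exists. *)
Lemma degenerate_not_substantial : (6 <= n)%N -> ~ substantial f.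
Proof.
move=> n6; have [K hK] := transfer_const hf hf cc hc hc.
have fK := transfer_apply hf hf cc hc hK.
have [p0 qp0] := exists_regular iso.
have [P [Pp gP]] := regular_patch xi1 gxi qp0; have Wx := px_W Pp.
pose x0 := px P p0; pose e := Fe (pv P f) (prho P) (prhoV P) (pqi P).
pose eta := Feta (pv P f) (prho P) (prhoV P) (pqi P).
pose F := \matrix_(i < 6) nth 0 [:: ev (pv P f) x0; ev (dzv (pv P f)) x0;
  ev (cjv (dzv (pv P f))) x0; ev e x0; ev (cjv e) x0; ev (cjv eta) x0] i.
have [u u0 hu] := exists_ortho F (n6 : (6 < n.+1)%N).
have h0 := hu (inord 0); have h1 := hu (inord 1); have h2 := hu (inord 2).
have h3 := hu (inord 3); have h4 := hu (inord 4); have h5 := hu (inord 5).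
rewrite rowK inordK //= in h0; rewrite rowK inordK //= in h1; rewrite rowK inordK //= in h2.
rewrite rowK inordK //= in h3; rewrite rowK inordK //= in h4; rewrite rowK inordK //= in h5.
have uK : u *m K = 0.
  pose U : 'rV[sfR (pW P)]_n.+1 := map_mx dk u.
  have eU : ev U x0 = u by apply/rowP => j; rewrite !mxE mksfE.
  have -> : u *m K = ev (U *m pT f f P) x0.
    have [phi hphi] := ev_ex Wx.
    apply/rowP => j; rewrite !mxE -hphi rmorph_sum; apply: eq_bigr => i _.
    by rewrite rmorphM !hphi (hK P p0) // !mxE mksfE.
  have zD m (v w : 'rV[sfR (pW P)]_m) : ev v x0 = 0 -> ev w x0 = 0 -> ev (v + w) x0 = 0.
    by move=> v0 w0; rewrite (evD v w Wx) v0 w0 addr0.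
  have zZ m a (v : 'rV[sfR (pW P)]_m) : ev v x0 = 0 -> ev (a *: v) x0 = 0.
    by move=> v0; rewrite (evZ a v Wx) v0 scaler0.
  have zI m (v : 'rV[sfR (pW P)]_n.+1) (w : 'rV[sfR (pW P)]_m) :
      ip u (ev v x0) = 0 -> ev (ip U v *: w) x0 = 0.
    by move=> hv; rewrite (evZ (ip U v) w Wx) (ev_ip U v Wx) eU hv scale0r.
  rewrite /pT mul_transfer.
  apply: (zD); last by apply: zI.
  apply: (zD); last by apply: (zZ); apply: (zD); apply: zI.
  by apply: (zD); [apply: zI|apply: (zZ); apply: (zD); apply: zI].
have KT : K^T = K.
  apply/matrixP => i j; rewrite mxE -!(hK P p0 gP Pp); congr (sv _ _).
  have ccP : dk c * cj (dk c) = 1 :> sfR (pW P) by rewrite cj_dk -rmorphM cc rmorph1.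
  have dg := degenerateP hf cc gP (hc gP).
  by rewrite /pT -[in LHS](transfer_tr ccP dg dg) mxE.
apply: (not_substantial (u := u) _ u0); first by case: hf => [[]].
move=> p; rewrite fK.
have -> v w : ip v w = (v *m w^T) 0 0 :> C.
  by rewrite mxE; apply: eq_bigr => i _; rewrite mxE.
by rewrite trmx_mul KT mulmxA uK mul0mx mxE.
Qed.
End OneSurface.

Lemma no_surface n (f : M -> 'rV[R]_n.+1) : isosurface g f -> substantial f ->
  (4 <= n <= 7)%N -> n = 5%N.
Proof.
move=> hf sub /andP[n4 n7]; have n5 := size_ge5 hf.
have [c cc hc] := pC_unit hf n7.
apply/eqP; rewrite eqn_leq n5 andbT leqNgt; apply/negP => n6.
exact: degenerate_not_substantial hf cc hc n6 sub.
Qed.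

(** K carries f to f', and K times its transpose is K1 = [transfer f f], which fixes f. As f is
    substantial, K1 = 1, so the real matrix K is orthogonal. *)
Lemma congruent_of_same_c n (f f' : M -> 'rV[R]_n.+1) c : isosurface g f -> isosurface g f' ->
  c * conjc c = 1 ->
  (forall P, good P -> pC f P = dk c) -> (forall P, good P -> pC f' P = dk c) ->
  substantial f -> congruent f f'.
Proof.
move=> hf hf' cc hc hc' sub.
have [K hK] := transfer_const hf hf' cc hc hc'.
have fK := transfer_apply hf hf' cc hc hK.
have KR := transfer_real hf hf' cc hc hc' hK.
have [K1 hK1] := transfer_const hf hf cc hc hc.
have fK1 := transfer_apply hf hf cc hc hK1.
have [p0 qp0] := exists_regular iso.
have [P [Pp gP]] := regular_patch xi1 gxi qp0; have Wx := px_W Pp.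
have ccP : dk c * cj (dk c) = 1 :> sfR (pW P) by rewrite cj_dk -rmorphM cc rmorph1.
have dg := degenerateP hf cc gP (hc P gP); have dg' := degenerateP hf' cc gP (hc' P gP).
have K1e : K1 = 1%:M.
  apply/eqP; rewrite -subr_eq0; apply: contraT => nz.
  have [j hj] : exists j, row j (K1 - 1%:M)^T != 0.
    apply/existsP; apply: contraNT nz; rewrite negb_exists => /forallP h.
    rewrite -trmx_eq0; apply/eqP/row_matrixP => j; rewrite row0; apply/eqP.
    by have := h j; rewrite negbK.
  exfalso; apply: (not_substantial (f := f) (u := row j (K1 - 1%:M)^T)) => //.
    by case: hf => [[]].
  move=> p; rewrite ipC.
  have -> : ip (rc (f p)) (row j (K1 - 1%:M)^T) = (rc (f p) *m (K1 - 1%:M)) 0 j.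
    by rewrite mxE; apply: eq_bigr => i _; rewrite !mxE.
  by rewrite mulmxBr mulmx1 -fK1 subrr mxE.
have KK : K *m K^T = 1%:M.
  rewrite -K1e; apply/matrixP => i j; rewrite mxE -(hK1 P p0 gP Pp).
  rewrite /pT -(transfer_comp (db_pQ hg ig gxi P) (good_inv gP) (QQP hg ig xi1 gxi P) ccP
    (dz_dk _ _) dg dg' dg) -(transfer_tr ccP dg dg').
  have [phi hphi] := ev_ex Wx.
  rewrite mxE -hphi rmorph_sum; apply: eq_bigr => l _.
  rewrite [K^T _ _]mxE -(hK P p0 gP Pp i l) -(hK P p0 gP Pp j l) rmorphM -!hphi.
  by congr (_ * phi _); rewrite [RHS]mxE.
pose B := map_mx (@complex.Re R) K.
have BB : B *m B^T = 1%:M.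
  have KE i l : K i l = (B i l)%:C%C by rewrite [in LHS]KR !mxE.
  apply/matrixP => i j; have := congr1 (fun A : 'M[C]_n.+1 => complex.Re (A i j)) KK.
  rewrite [(K *m _) i j]mxE [(B *m _) i j]mxE.
  have -> : \sum_l K i l * K^T l j = (\sum_l B i l * B^T l j)%:C%C.
    by rewrite rmorph_sum; apply: eq_bigr => l _; rewrite [K^T l j]mxE [B^T l j]mxE !KE -rmorphM.
  by rewrite /= => ->; rewrite !mxE; case: (i == j).
have B'B : B^T *m B = 1%:M by exact: mulmx1C.
have dB x y : dot (x *m B) (y *m B) = dot x y.
  by rewrite /dot trmx_mul mulmxA -(mulmxA x) BB mulmx1.
exists (fun x => x *m B).
  split.
    split=> [x Sx|x y _ _ /(congr1 (fun v => v *m B^T))|y Sy].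
    - by rewrite /usphere /= dB.
    - by rewrite -!mulmxA BB !mulmx1.
    - exists (y *m B^T); last by rewrite -mulmxA B'B mulmx1.
      by rewrite /usphere /= -dB -mulmxA B'B mulmx1.
  by move=> x y _ _; rewrite dB.
move=> p; have := fK p; rewrite KR -/B => h; apply/rowP => j.
have := congr1 (fun v : 'rV[C]_n.+1 => complex.Re (v 0 j)) h.
by rewrite -(map_mxM (@real_complex R)) !mxE /= => ->.
Qed.
End Curved.
End Cases.
End Constancy.

(** * Finite dimensionality *)

Section Relations.
Variables (R : rcfType) (A : dring R) (I : finType) (c : I -> R[i]).
Variables (al be bi rho r : A) (X X1 E H Eb X1b : I -> A).
Hypotheses (hb : be * bi = 1) (hr : rho * r = 1).
Hypotheses (h1 : forall j, dz (X j) = X1 j) (h2 : forall j, dz (X1 j) = al * X1 j + be * E j).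
Hypotheses (h3 : forall j, dz (E j) = rho * H j) (h4 : forall j, dz (H j) = - dk (c j) * Eb j).
Hypotheses (h5 : forall j, dz (Eb j) = al * Eb j - be * X1b j).
Hypotheses (h6 : forall j, dz (X1b j) = - rho * X j).
Let L (a : I -> R[i]) (Y : I -> A) : A := \sum_j dk (a j) * Y j.

Let dzL a Y : dz (L a Y) = L a (fun j => dz (Y j)).
Proof. by rewrite dz_sum; apply: eq_bigr => j _; rewrite dzM dz_dk mul0r add0r. Qed.
Let LD a (s t : A) Y Z : L a (fun j => s * Y j + t * Z j) = s * L a Y + t * L a Z.
Proof. by rewrite /L !mulr_sumr -big_split; apply: eq_bigr => j _ /=; ring. Qed.
Let LE a Y Z : (forall j, Y j = Z j) -> L a Y = L a Z.
Proof. by move=> YZ; apply: eq_bigr => j _; rewrite YZ. Qed.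
Let cancel (s t x : A) : s * t = 1 -> s * x = 0 -> x = 0.
Proof. by move=> st h; rewrite -[LHS]mul1r -st mulrAC h mul0r. Qed.

(* Differentiating the relation along f, f_z, e, eta, ebar, fbar_z, f returns it
   with each coefficient multiplied by [c j]. *)
Lemma relation_shift (a : I -> R[i]) :
  \sum_j dk (a j) * X j = 0 -> \sum_j dk (a j * c j) * X j = 0.
Proof.
rewrite -/(L a X) -/(L (fun j => a j * c j) X) => x0; pose b j := a j * c j.
have x1 : L a X1 = 0 by rewrite -(LE a h1) -dzL x0 dz0.
have e0 : L a E = 0.
  apply: (cancel hb); have := dzL a X1; rewrite (LE a h2) LD x1 dz0 mulr0 add0r.
  by move=> <-.
have t0 : L a H = 0.
  apply: (cancel hr); have := LD a rho 0 H H; rewrite mul0r addr0 => <-.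
  by rewrite -[RHS]dz0 -[X in dz X]e0 dzL; apply: LE => j; rewrite /= h3; ring.
have eb0 : L b Eb = 0.
  rewrite -[RHS]oppr0 -[X in - X]dz0 -t0 dzL /L -sumrN; apply: eq_bigr => j _.
  by rewrite h4 /b rmorphM; ring.
have y0 : L b X1b = 0.
  apply: (cancel hb); apply: oppr_inj; rewrite oppr0 -mulNr.
  have := LD b al (- be) Eb X1b; rewrite eb0 mulr0 add0r => <-.
  by rewrite -[RHS]dz0 -[X in dz X]eb0 dzL; apply: LE => j; rewrite /= h5; ring.
apply: (cancel hr); apply: oppr_inj; rewrite oppr0 -mulNr.
have := LD b (- rho) 0 X X; rewrite mul0r addr0 => <-.
by rewrite -[RHS]dz0 -[X in dz X]y0 dzL; apply: LE => j; rewrite /= h6; ring.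
Qed.

(* Lagrange interpolation: the relation is multiplied by a polynomial in [c]
   vanishing at all the other [c j]. *)
Lemma relation_split (a : I -> R[i]) : injective c ->
  \sum_j dk (a j) * X j = 0 -> forall j, dk (a j) * X j = 0.
Proof.
move=> ci h j.
have hs (s : seq I) : \sum_k dk (a k * \prod_(i <- s) (c k - c i)) * X k = 0.
  elim: s => [|i s IH].
    by rewrite -[RHS]h; apply: eq_bigr => k _; rewrite big_nil mulr1.
  pose b k := a k * \prod_(i <- s) (c k - c i).
  have := relation_shift (a := b) IH => IH2.
  have : 0 = 0 - dk (c i) * 0 :> A by rewrite mulr0 subr0.
  move=> h0; rewrite [RHS]h0 -[X in _ = X - _]IH2 -[X in _ * X]IH mulr_sumr -sumrB.
  by apply: eq_bigr => k _; rewrite big_cons /b !rmorphM rmorphB; ring.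
have := hs [seq i <- enum I | i != j]; rewrite (bigD1 j) //= [X in _ + X]big1 => [|k kj]; last first.
  rewrite (bigD1_seq k) ?filter_uniq -?enumT ?enum_uniq ?mem_filter ?kj -?enumT ?mem_enum //=.
  by rewrite subrr mul0r mulr0 rmorph0 mul0r.
rewrite addr0 rmorphM mulrAC => e; set p := \prod_(i <- _) _ in e.
have p0 : p != 0.
  rewrite /p prodf_seq_neq0; apply/allP => i; rewrite mem_filter => /andP[ij _].
  by apply/implyP => _; rewrite subr_eq0 (inj_eq ci) eq_sym.
by apply: (cancel (s := dk p) (t := dk p^-1)); rewrite -?rmorphM ?divff ?rmorph1 // mulrC.
Qed.
End Relations.

Section Eigenfunctions.
Context {R : realType} (M : riemannSurface R) (g : M -> 'rV[R]_7) (xi : 'rV[R]_7).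
Notation V := 'rV[R]_2.
Notation E := (@basis_vec R).
Notation C := R[i].
Notation N := (@Normc.normc R).
Hypotheses (hg : pseudoholomorphic_curve g) (ig : immersion g).
Hypotheses (xi1 : dot xi xi = 1) (gxi : forall p, dot (g p) xi = 0).
Hypothesis cM : compact [set: M].
Implicit Types (P : cpatch M) (p q : M) (u : M -> R).
Notation qM := (qM hg ig).
Notation prho := (prho g).
Notation prhoV := (prhoV g).

(** Laplace eigenfunctions: for the metric 2 rho |dz|^2 the equation reads Delta u = - 2 u.
    Smoothness of u is expressed by the ring element [a]. *)
Definition eigen u := forall P, exists a : sfR (pW P),
  (forall x, os (pW P) x -> (a : smoothfun (pW P)) x = (u (ptoM P x))%:C%C) /\
  db (dz a) = - (prho P * a).

Lemma eigen_coord n (f : M -> 'rV[R]_n.+1) j : isosurface g f -> eigen (fun p => f p 0 j).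
Proof.
move=> hf P; have cm := surface_cmP hg ig hf P; have sf : smooth_map f by case: hf => [[_ []]].
exists (pv P f 0 j); split=> [x Wx|].
  have := congr1 (fun v : 'rV[C]_n.+1 => v 0 j) (ev_pv sf (inP_inv Wx)).
  by rewrite px_inv // !mxE.
have := congr1 (fun v : 'rV_n.+1 => v 0 j) (cm_minimal cm).
by rewrite !mxE mulNr.
Qed.

Lemma eigen_sum (I : finType) (c : I -> R) (u : I -> M -> R) :
  (forall i, eigen (u i)) -> eigen (fun p => \sum_i c i * u i p).
Proof.
move=> hu P; pose a i := projT1 (cid (hu i P)); have ha i := projT2 (cid (hu i P)).
exists (\sum_i dk (c i)%:C%C * a i); split=> [x Wx|].
  have [phi hphi] := ev_ex Wx.
  rewrite -hphi rmorph_sum [RHS]rmorph_sum; apply: eq_bigr => i _.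
  by rewrite !rmorphM !hphi mksfE // (ha i).1.
rewrite dz_sum db_sum mulr_sumr -sumrN; apply: eq_bigr => i _.
rewrite dzM dz_dk mul0r add0r dbM db_dk mul0r add0r (ha i).2 -/(a i).
by move: (a i) (prho P) (dk _) => x y z; ring.
Qed.

Lemma N_conj_mul (z : C) : z * conjc z = (N z ^+ 2)%:C%C.
Proof.
by apply: complex_eq; rewrite ?N_mul_conj //= cImM cRe_conj cIm_conj mulrN mulrC addNr.
Qed.

Section Bound.
Variables (u : M -> R) (K A : R).
Hypotheses (hu : eigen u) (hK : forall p, qM p <= K) (AE : A = (K + 2) / 2).

Definition eig P : sfR (pW P) := projT1 (cid (hu P)).
Lemma eigE P x : os (pW P) x -> (eig P : smoothfun (pW P)) x = (u (ptoM P x))%:C%C.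
Proof. exact: (projT2 (cid (hu P))).1. Qed.
Lemma eig_eq P : db (dz (eig P)) = - (prho P * eig P).
Proof. exact: (projT2 (cid (hu P))).2. Qed.
Lemma eig_real P : cj (eig P) = eig P.
Proof.
apply: sfP => x Wx; rewrite mksfE // eigE //.
by apply: complex_eq; rewrite //= oppr0.
Qed.
Lemma eig_trans P P' (PP : sub_patch P' P) : eig P' = pphi PP (eig P).
Proof.
apply: sfP => x Wx; rewrite pphiE // !eigE //; last exact: ptrans_W.
by rewrite /ptrans ptoMK //; apply: PP; exact: inP_inv.
Qed.

(** With 2 A = K + 2 and q = sigma / rho, the coefficient 2 A - q - 1 of |u_z|^2 in the Laplacian of
    this function is K + 1 - q, hence at least 1. *)
Let F P := dz (eig P) * cj (dz (eig P)) * prhoV P + dk A%:C%C * (eig P * eig P).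

Let F_trans P P' (PP : sub_patch P' P) : F P' = pphi PP (F P).
Proof.
have dm := pphi_dmorph PP; have hl := dm_inv dm; have hlb := cj_inv hl.
have ek : pphi PP (dk A%:C%C) = dk A%:C%C.
  by apply: sfP => x Wx; rewrite pphiE // !mksfE //; exact: ptrans_W.
rewrite /F (eig_trans PP) (dm_dz dm) (rmorphD (pphi PP)) (rmorphM (pphi PP) (dk _)) ek; move: (dk _) => k; rewrite !rmorphM (dm_cj dm).
rewrite (r_transition dm (prho_inv hg ig P) (prho_inv hg ig P') (prho_trans hg ig PP)).
congr (_ + _); move: (pphi PP) (pjac _ _) (pjaci _ _) hl hlb => phi l li hl hlb.
by ring: hl hlb.
Qed.

Let FM_ex : {h : M -> R | forall P p, inP P p ->
  h p = complex.Re ((F P : smoothfun (pW P)) (px P p))}.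
Proof.
apply: cid; have [|G hG] := @patch_glue R M R 0 (fun=> True)
    (fun P x => complex.Re ((F P : smoothfun (pW P)) x)).
  move=> P P' _ PP; split=> // p P'p; rewrite (F_trans PP) pphiE ?ptrans_px //.
  exact: (px_W P'p).
by exists G => P p; exact: hG.
Qed.

Lemma eig_gradient P x : os (pW P) x -> exists2 w : C,
  (dz (eig P) : smoothfun (pW P)) x = w &
  complex.Re ((F P : smoothfun (pW P)) x) = N w ^+ 2 / rhoR g P x + A * u (ptoM P x) ^+ 2.
Proof.
move=> Wx; eexists; first by [].
have [phi hphi] := ev_ex Wx; have cjE (a : smoothfun (pW P)) : (cj (a : sfR (pW P)) : smoothfun (pW P)) x = conjc (a x).
  exact: mksfE.
have kE (z : C) : ((dk z : sfR (pW P)) : smoothfun (pW P)) x = z by exact: mksfE.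
rewrite /F -hphi rmorphD !rmorphM !hphi cjE kE (prhoVE hg ig Wx) eigE // N_conj_mul.
by rewrite -!rmorphM -rmorphD /= !expr2.
Qed.

(* The maximum principle for |u_z|^2 / rho + A u^2. *)
Lemma gradient_bound S : (forall p, u p ^+ 2 <= S) -> forall P x, os (pW P) x ->
  N ((dz (eig P) : smoothfun (pW P)) x) ^+ 2 <= (K + 1 + A) * S * rhoR g P x.
Proof.
move=> hS; have [h hE] := FM_ex.
have ch : continuous h.
  apply: patch_continuous => p; have Pp := some_patchP p; exists (some_patch p) => //.
  have Wx := px_W Pp.
  apply: (near_eq_continuous (f := fun x => complex.Re ((F (some_patch p) : smoothfun _) x))).
    apply: (near_open (os_open (pW (some_patch p))) Wx) => y Wy.
    by rewrite (hE _ _ (inP_inv Wy)) px_inv.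
  exact: (@Re_continuous R (pW (some_patch p)) (F (some_patch p)) _ Wx).
have [_ [p00 _] _ _] := hg.
have [p0 _ hmax] := compact_EVT_max (ex_intro _ p00 Logic.I) cM (continuous_subspaceT ch).
have K0 : 0 <= K by apply: le_trans (hK p0); exact: (qM_ge0 hg ig xi1 gxi).
have hp0 : h p0 <= (K + 1 + A) * S.
  pose P := some_patch p0; have Pp : inP P p0 := some_patchP p0; have Wx := px_W Pp.
  have [w we Fe] := eig_gradient Wx; rewrite ptoMK // in Fe.
  have lap : complex.Re ((db (dz (F P)) : smoothfun (pW P)) (px P p0)) <= 0.
    apply: laplacian_at_max Wx _ => y Wy; rewrite -hE // -[y](px_inv Wy) -hE; last exact: inP_inv.
    by apply: hmax; rewrite inE.
  have cm := curve_cmP hg ig P.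
  have lg := laplacian_gradient (prho_inv hg ig P) (cj_rho cm) (eig_real P) (eig_eq P).
  have ls := laplacian_square (eig_real P) (eig_eq P).
  move: lap; rewrite /F dzD dbD lg dzM dz_dk mul0r add0r dbM db_dk mul0r add0r ls.
  set u2 := dz (dz _) - _; rewrite -/(psig g P); move: u2 => u2.
  have := psigE hg ig Wx; move: (psig g P) (sigR g P (px P p0)) (qME hg ig Pp) => sg si qE sgE.
  have [phi hphi] := ev_ex Wx; have cjE (a : smoothfun (pW P)) :
    (cj (a : sfR (pW P)) : smoothfun (pW P)) (px P p0) = conjc (a (px P p0)) by exact: mksfE.
  have kE (z : C) : ((dk z : sfR (pW P)) : smoothfun (pW P)) (px P p0) = z by exact: mksfE.
  rewrite -hphi !(rmorphD, rmorphN, rmorphM) rmorph1 !hphi !cjE kE we.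
  rewrite (prhoVE hg ig Wx) (prhoE hg ig Wx).1 sgE eigE // ptoMK // !N_conj_mul.
  have := hK p0; rewrite qE (hE P p0 Pp) Fe; have [_ r0] := prhoE hg ig Wx.
  move: (rhoR g P (px P p0)) (u p0) (N w) (N ((u2 : smoothfun (pW P)) (px P p0))) r0 Fe (hS p0) => rh t nw m r0 _ ht.
  pose q := si / rh; have -> : si = q * rh by rewrite mulfVK // gt_eqF.
  rewrite mulfK ?gt_eqF // => qK.
  rewrite [X in complex.Re X](_ : _ = (m ^+ 2 * rh^-1 - (q * rh * rh^-1 + 1) * nw ^+ 2 + rh * (t * t) +
    A * (nw ^+ 2 + nw ^+ 2 - (rh * (t * t) + rh * (t * t))))%:C%C); last first.
    by rewrite !(rmorphD, rmorphN, rmorphM) rmorph1.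
  rewrite /= mulfK ?gt_eqF // -expr2 => lap.
  have m0 : 0 <= m ^+ 2 * rh^-1 by rewrite mulr_ge0 ?sqr_ge0 // invr_ge0 ltW.
  have hn : nw ^+ 2 <= (K + 1) * (rh * t ^+ 2).
    have nn := sqr_ge0 nw; have : (K - q) * nw ^+ 2 >= 0 by rewrite mulr_ge0 // subr_ge0.
    move: lap m0; rewrite AE; move: (m ^+ 2 * _) (nw ^+ 2) (rh * _) => a b d; nra.
  have : nw ^+ 2 / rh <= (K + 1) * t ^+ 2.
    by rewrite ler_pdivrMr //; apply: le_trans hn _; rewrite mulrCA [rh * _]mulrC mulrA.
  have A0 : 0 <= A by rewrite AE; lra.
  move: (nw ^+ 2 / rh) => y hy.
  have : 0 <= (K + 1 + A) * (S - t ^+ 2) by rewrite mulr_ge0 ?subr_ge0 // ; lra.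
  by move: hy; rewrite !mulrDl; move: (t ^+ 2) => z; nra.
move=> P x Wx; have [w -> e] := eig_gradient Wx; have [_ r0] := prhoE hg ig Wx.
rewrite -ler_pdivrMr //; apply: le_trans hp0; apply: le_trans (hmax (ptoM P x) _); last by rewrite inE.
rewrite (hE _ _ (inP_inv Wx)) px_inv // e lerDl mulr_ge0 ?sqr_ge0 // AE; lra.
Qed.
End Bound.

Lemma qM_bounded : exists K, forall p, qM p <= K.
Proof.
have [_ [p0 _] _ _] := hg; have cq : continuous qM by exact: qM_continuous.
have [p _ hp] := compact_EVT_max (ex_intro _ p0 Logic.I) cM (continuous_subspaceT cq).
by exists (qM p) => q; apply: hp; rewrite inE.
Qed.

(** The constant in [gradient_bound] does not depend on u, so the neighbourhood depends on p alone:
    on it every eigenfunction varies by at most half of any bound for its modulus. *)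
Lemma eigen_oscillation p : \forall q \near p, forall u S, eigen u ->
  (forall p, u p ^+ 2 <= S) -> (u q - u p) ^+ 2 <= S / 4.
Proof.
have [K hK] := qM_bounded; pose A := (K + 2) / 2; pose L := K + 1 + A.
have K0 : 0 <= K by apply: le_trans (hK p); exact: (qM_ge0 hg ig xi1 gxi).
have L0 : 0 <= L by rewrite /L /A; lra.
pose P := some_patch p; have Pp : inP P p := some_patchP p; have Wx := px_W Pp.
pose x0 := px P p; pose C1 := rhoR g P x0 + 1.
have C10 : 0 <= C1 by rewrite /C1; have [_] := prhoE hg ig Wx; rewrite -/x0; lra.
have near1 := continuous_near_le (@Re_continuous R (pW P) (prho P) x0 Wx) ltr01.
have [d0 d00 hd] := nbhs_disc (filterI near1 (open_nbhs_nbhs (conj (os_open (pW P)) Wx))).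
pose B := 4 * C1 * L; have B0 : 0 <= B by rewrite !mulr_ge0.
(* Then B e^2 = B / (4 (1 + B)^2) is at most 1/4, the factor of S in the claim. *)
pose e := 1 / (2 * (1 + B)); have e0 : 0 < e by rewrite divr_gt0 // mulr_gt0 //; lra.
pose d := Num.min d0 e; have dd : 0 < d by rewrite lt_min d00 e0.
have Bd : B * d ^+ 2 <= 1 / 4.
  have de : d <= e by rewrite ge_min lexx orbT.
  have {}de : d ^+ 2 <= e ^+ 2 by rewrite ler_pXn2r ?nnegrE ?(ltW dd) ?(ltW e0).
  apply: le_trans (ler_wpM2l B0 de) _.
  have -> : B * e ^+ 2 = B / (1 + B) ^+ 2 * (1 / 4) by rewrite /e; field; lra.
  rewrite ler_piMl // ler_pdivrMr ?exprn_gt0 //; nra.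
apply: (nbhs_patch Pp); apply: filterS (disc_nbhs x0 dd) => y /= yd u S hu hS.
pose a := eig hu P; pose f z := complex.Re ((a : smoothfun (pW P)) z); pose v := y - x0.
have seg (t : R) : `|t| <= `|1 : R| -> os (pW P) (x0 + t *: v) /\ rhoR g P (x0 + t *: v) <= C1.
  rewrite normr1 => t1; have := hd (x0 + t *: v); case.
    rewrite addrC addKr toCZ Normc.normcM N_real.
    apply: le_lt_trans (lt_le_trans yd _); last by rewrite ge_min lexx.
    by rewrite ler_piMl // N_ge0.
  by move=> h1 h2; split=> //; move: h1; rewrite ler_norml /rhoR /C1 -/x0 /rhoR => /andP[_]; lra.
have sa : smooth (os (pW P)) f := (sv_smooth a).1.
have [t /seg h|t /seg[Wz rz] h] := @line_MVT _ _ f x0 v 1.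
  by apply: smooth_derivable sa _; case: h.
set z := x0 + t *: v in Wz rz h; rewrite scale1r mul1r in h.
have ey : x0 + v = y by rewrite /v addrC subrK.
have [Wy _] : os (pW P) y /\ rhoR g P y <= C1.
  by have := seg 1; rewrite normr1 lexx scale1r ey; apply.
have fE q : inP P q -> f (px P q) = u q.
  by move=> Pq; rewrite /f eigE ?ptoMK //; exact: px_W.
rewrite ey -[y](px_inv Wy) !fE // in h; last exact: inP_inv.
have Dv : 'D_v f z = v 0 0 * 'D_(E 0) f z + v 0 1 * 'D_(E 1) f z.
  have df := smooth_differentiable sa Wz.
  by rewrite !deriveE // diff_row2 // -!deriveE.
pose w := (dz a : smoothfun (pW P)) z.
have e1 : w = 2^-1 * (cderive 0 a z - 'i%C * cderive 1 a z) by exact: sf_dzE.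
have e2 : conjc w = 2^-1 * (cderive 0 a z + 'i%C * cderive 1 a z).
  rewrite -(sf_dbE a Wz); have -> : sf_conj a = a by exact: (eig_real hu P).
  by rewrite mksfE.
have c0E : cderive 0 a z = w + conjc w by rewrite e2; move: e1 => ->; field.
have c1E : 'i%C * cderive 1 a z = conjc w - w by rewrite e2; move: e1 => ->; field.
have d0E : 'D_(E 0) f z = 2 * complex.Re w.
  by rewrite -Re_cderive c0E cReD cRe_conj; lra.
have d1E : 'D_(E 1) f z = - 2 * complex.Im w.
  have := congr1 (@complex.Im R) c1E; rewrite -Re_cderive cImM cImD cIm_conj /=.
  have -> : complex.Im (- w) = - complex.Im w by case: (w).
  by move: (complex.Im _) (complex.Re _) (complex.Im w) => b1 b2 b3; lra.
have wb : N w ^+ 2 <= L * S * rhoR g P z by exact: (gradient_bound hu hK (erefl A) hS Wz).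
have S0 : 0 <= S by apply: le_trans (hS p); exact: sqr_ge0.
have vb : N (toC v) ^+ 2 <= d ^+ 2.
  by rewrite ler_pXn2r ?nnegrE ?N_ge0 ?ltW.
rewrite h Dv d0E d1E.
have vE : N (toC v) ^+ 2 = v 0 0 ^+ 2 + v 0 1 ^+ 2 by rewrite N_sqr.
have h1 : (v 0 0 * (2 * complex.Re w) + v 0 1 * (- 2 * complex.Im w)) ^+ 2 <=
    4 * (N (toC v) ^+ 2 * N w ^+ 2).
  rewrite vE (N_sqr w); move: (v 0 0) (v 0 1) (complex.Re w) (complex.Im w) => x1 x2 x3 x4.
  rewrite -subr_ge0 [leRHS](_ : _ = 4 * (x1 * x4 + x2 * x3) ^+ 2); last by ring.
  by rewrite mulr_ge0 // sqr_ge0.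
apply: le_trans h1 _.
have h2 : N w ^+ 2 <= L * S * C1 by apply: le_trans wb _; rewrite ler_wpM2l // mulr_ge0.
have h3 : N (toC v) ^+ 2 * N w ^+ 2 <= d ^+ 2 * (L * S * C1).
  by apply: ler_pM => //; exact: sqr_ge0.
have h4 := ler_wpM2r S0 Bd; rewrite /B in h4.
have four : 0 <= 4 :> R by [].
apply: le_trans (ler_wpM2l four h3) _.
have -> : 4 * (d ^+ 2 * (L * S * C1)) = 4 * C1 * L * d ^+ 2 * S by ring.
by apply: le_trans h4 _; rewrite div1r mulrC.
Qed.

Lemma eigen_continuous u : eigen u -> continuous u.
Proof.
move=> hu; apply: patch_continuous => p; have Pp := some_patchP p.
have Wx := px_W Pp; exists (some_patch p) => //.
apply: (near_eq_continuous (f := fun x => complex.Re ((eig hu (some_patch p) : smoothfun _) x))).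
  by apply: (near_open (os_open (pW (some_patch p))) Wx) => y Wy; rewrite eigE.
exact: (@Re_continuous R (pW (some_patch p)) (eig hu (some_patch p)) _ Wx).
Qed.

(* An eigenfunction that vanishes on the net is at most half its maximum everywhere. *)
Lemma eigen_net : exists s : seq M, forall u, eigen u ->
  (forall p, List.In p s -> u p = 0) -> forall p, u p = 0.
Proof.
(* The filter of properties shared by all lists that contain some fixed list; compactness in its
   near-covering form then yields one finite net. *)
pose F : set_system (seq M) := [set X | exists s : seq M,
  forall t, (forall p, List.In p s -> List.In p t) -> X t].
have FF : Filter F.
  split; first by exists [::].
    move=> X Y [s hs] [t ht]; exists (s ++ t) => r hr; split.
      by apply: hs => p ps; apply: hr; apply: List.in_or_app; left.
    by apply: ht => p pt; apply: hr; apply: List.in_or_app; right.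
  by move=> X Y XY [s hs]; exists s => t /hs /XY.
pose B q p := forall u S, eigen u -> (forall p, u p ^+ 2 <= S) -> (u q - u p) ^+ 2 <= S / 4.
have nc := (compact_near_coveringP [set: M]).1 cM.
have : \forall t \near F, [set: M] `<=` (fun q => exists2 p, List.In p t & B q p).
  apply: (nc (seq M) F (fun t q => exists2 p, List.In p t & B q p)) => p _.
  exists ([set q | B q p], [set t | List.In p t]); last by move=> [q t] [/= h1 h2]; exists p.
  split=> /=; first exact: eigen_oscillation.
  by exists [:: p] => t; apply; left.
move=> [s hs]; exists s => u hu us; have {}hs := hs s (fun p => id).
have [_ [p0 _] _ _] := hg; have cu := eigen_continuous hu.
have cu2 : continuous (fun p => u p ^+ 2) by move=> p; apply: cvgM; exact: cu.
have [p1 _ hp1] := compact_EVT_max (ex_intro _ p0 Logic.I) cM (continuous_subspaceT cu2).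
have hS p : u p ^+ 2 <= u p1 ^+ 2 by apply: hp1; rewrite inE.
have [p ps /(_ u _ hu hS)] := hs p1 Logic.I; rewrite (us p ps) subr0 => h.
have z : u p1 ^+ 2 = 0 by apply/eqP; rewrite eq_le sqr_ge0 andbT; lra.
by move=> q; apply/eqP; rewrite -sqrf_eq0 eq_le sqr_ge0 andbT -z.
Qed.

(** An eigenfunction is determined by its values on the net, so one more function than there are
    points in the net gives a linear relation. *)
Lemma eigen_dependent : exists m, forall u : 'I_m.+1 -> M -> R, (forall i, eigen (u i)) ->
  exists2 a : 'rV[R]_m.+1, a != 0 & forall p, \sum_i a 0 i * u i p = 0.
Proof.
have [s hs] := eigen_net; exists (size s) => u hu; have [_ [p0 _] _ _] := hg.
pose A := \matrix_(i < (size s).+1, j < size s) u i (nth p0 s j).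
have : kermx A != 0.
  rewrite -mxrank_eq0 mxrank_ker subn_eq0 -ltnNge ltnS; exact: rank_leq_col.
move=> /rowV0Pn[a /sub_kermxP ha a0]; exists a => //.
apply: (hs _ (eigen_sum (fun i => a 0 i) hu)) => p ps.
have [j js <-] : exists2 j, (j < size s)%N & nth p0 s j = p.
  elim: s ps {hs hu A ha a a0 u} => //= q s IH [->|/IH[j js e]]; first by exists 0%N.
  by exists j.+1.
have := congr1 (fun B : 'rV[R]_(size s) => B 0 (Ordinal js)) ha; rewrite [RHS]mxE mxE => e; rewrite -[RHS]e.
by apply: eq_bigr => i _; rewrite mxE.
Qed.

(** * Finiteness of the moduli space *)

Section Finiteness.
Hypothesis iso : forall p : M, ~ \forall q \near p, qM q = 0.
Hypothesis zero : exists p, qM p = 0.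
Notation good := (good g xi).

Definition invariant n (f : M -> 'rV[R]_n.+1) (c : C) :=
  c * conjc c = 1 /\ forall P, good P -> pC g xi f P = dk c.

(** From each surface a coordinate function that is nonzero at one regular point is taken. Too many
    of these are linearly dependent, and for distinct constants [relation_split] makes each term of
    the relation vanish. *)
Lemma few_invariants n : exists m, forall (f : 'I_m.+1 -> M -> 'rV[R]_n.+1) c,
  (forall i, isosurface g (f i)) -> (forall i, invariant (f i) (c i)) -> ~ injective c.
Proof.
have [m hm] := eigen_dependent; exists m => f c hf hc ci.
have [p0 qp0] := exists_regular iso.
have [P [Pp gP]] := regular_patch xi1 gxi qp0; have Wx := px_W Pp.
have hk j : exists k, f j p0 0 k != 0.
  apply/existsP; rewrite -negb_forall; apply/negP => /forallP h0.
  have [[/(_ (f j p0)) h1 _ _] _] := hf j; have := h1 (ex_intro2 _ _ p0 Logic.I erefl).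
  rewrite /usphere /= (_ : f j p0 = 0); last by apply/rowP => k; rewrite mxE; exact/eqP.
  by rewrite /dot mul0mx mxE => /eqP; rewrite eq_sym oner_eq0.
pose k j := projT1 (cid (hk j)); have k0 j : f j p0 0 (k j) != 0 := projT2 (cid (hk j)).
have [a a0 ha] := hm (fun j p => f j p 0 (k j)) (fun j => eigen_coord (k j) (hf j)).
pose X j : sfR (pW P) := pv P (f j) 0 (k j).
have XE j q : inP P q -> (X j : smoothfun (pW P)) (px P q) = (f j q 0 (k j))%:C%C.
  move=> Pq; have sf : smooth_map (f j) by case: (hf j) => [[_ []]].
  by have := congr1 (fun v : 'rV[C]_n.+1 => v 0 (k j)) (ev_pv sf Pq); rewrite /X !mxE.
have rel : \sum_j dk (a 0 j)%:C%C * X j = 0.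
  apply: sfP => x Wy; have [phi hphi] := ev_ex Wy; rewrite -hphi rmorph_sum [RHS]sf0 //.
  have := congr1 (fun b : R => b%:C%C) (ha (ptoM P x)); rewrite rmorph0 rmorph_sum => e; rewrite -[RHS]e.
  apply: eq_bigr => j _; rewrite !rmorphM !hphi mksfE //.
  by have := XE j _ (inP_inv Wy); rewrite px_inv // => ->.
have dbQ := db_pQ hg ig gxi P; have hq := good_inv gP; have QQ := QQP hg ig xi1 gxi P.
have cm j := surface_cmP hg ig (hf j) P; have hr := prho_inv hg ig P.
have dg j := degenerateP xi1 gxi cM zero (hf j) (hc j).1 gP ((hc j).2 P gP).
suff h j : dk (a 0 j)%:C%C * X j = 0.
  case/eqP: a0; apply/rowP => j; rewrite mxE.
  have := congr1 (fun b : smoothfun (pW P) => complex.Re (b (px P p0))) (h j).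
  rewrite sfM // mksfE // XE // sf0 // cReM /= mulr0 subr0 => /eqP.
  by rewrite mulf_eq0 (negbTE (k0 j)) orbF => /eqP.
move: j; refine (@relation_split R (sfR (pW P)) 'I_m.+1 c (dz (prho P) * prhoV P) (pQ g xi P * prhoV P)
  (prho P * pqi g xi P) (prho P) (prhoV P) X (fun j => dzv (pv P (f j)) 0 (k j))
  (fun j => Fe (pv P (f j)) (prho P) (prhoV P) (pqi g xi P) 0 (k j))
  (fun j => Feta (pv P (f j)) (prho P) (prhoV P) (pqi g xi P) 0 (k j))
  (fun j => cjv (Fe (pv P (f j)) (prho P) (prhoV P) (pqi g xi P)) 0 (k j))
  (fun j => cjv (dzv (pv P (f j))) 0 (k j)) _ hr _ _ _ _ _ _ (fun j => (a 0 j)%:C%C) ci rel).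
- by move: hq hr; move: (pQ _ _ _) (pqi _ _ _) (prhoV P) (prho P) => q1 q2 q3 q4 hq hr; ring: hq hr.
- by move=> j; rewrite dz_entry.
- by move=> j; rewrite dz_entry (dzv_f1e (cm j) hq) !mxE.
- by move=> j; rewrite dz_entry (dzv_e (cm j)) !mxE.
- move=> j; rewrite dz_entry (dzv_eta_degenerate (cm j) dbQ hq QQ) (dg_c (dg j)) ?dz_dk //.
  + by rewrite [LHS]mxE.
  + exact: dg_eta (dg j).
  + by rewrite cj_dk -rmorphM (hc j).1 rmorph1.
- by move=> j; rewrite dz_entry (dzv_eb (cm j) dbQ hq QQ) !mxE.
- by move=> j; rewrite dz_entry (dzv_f1b (cm j)) [LHS]mxE.
Qed.

Lemma congruent_trans n (f f' f'' : M -> 'rV[R]_n.+1) : range f `<=` usphere R n ->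
  congruent f f' -> congruent f' f'' -> congruent f f''.
Proof.
move=> fS [t [tb ta] ft] [s [sb sa] fs]; exists (s \o t); last by move=> p; rewrite fs ft.
split=> [|x y Sx Sy]; first exact: set_bij_comp tb sb.
by have [tS _ _] := tb; rewrite /= sa ?ta //; exact: tS.
Qed.

(** The class of f is determined by its constant c, and only finitely many constants occur. *)
Lemma moduli_finite : finite_set (moduli_space g 5).
Proof.
pose ims := isometric_minimal_surfaces g 5.
pose cls f := [set f' | ims f' /\ congruent f f'].
have iso_ims f : ims f -> isosurface g f by case.
have cls_eq f f' c : ims f -> ims f' -> invariant f c -> invariant f' c -> cls f = cls f'.
  move=> h h' ic ic'; have [hm sub _] := h; have [hm' sub' _] := h'.
  have fS : range f `<=` usphere R 5 by case: hm.
  have fS' : range f' `<=` usphere R 5 by case: hm'.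
  have cg := congruent_of_same_c xi1 gxi cM iso zero (iso_ims f h) (iso_ims f' h') ic.1 ic.2 ic'.2 sub.
  have cg' := congruent_of_same_c xi1 gxi cM iso zero (iso_ims f' h') (iso_ims f h) ic.1 ic'.2 ic.2 sub'.
  by apply/seteqP; split=> f0 [h0 c0]; split=> //; [exact: congruent_trans cg' c0|
    exact: congruent_trans cg c0].
pose Cs : set C := [set c | exists2 f, ims f & invariant f c].
have fC : finite_set Cs.
  apply: contrapT => inf; have [m hm] := few_invariants 5.
  have [B BC Bm] := infinite_set_fset m.+1 inf.
  have hB (i : 'I_m.+1) : Cs (nth 0 (finmap.enum_fset B) i).
    by apply: BC; apply: mem_nth; exact: leq_trans (ltn_ord i) Bm.
  pose f i := projT1 (cid2 (hB i)).
  apply: (hm f (fun i => nth 0 (finmap.enum_fset B) i)).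
  - by move=> i; apply: iso_ims; rewrite /f; case: (cid2 (hB i)).
  - by move=> i; rewrite /f; case: (cid2 (hB i)).
  - move=> i j /eqP; rewrite nth_uniq ?finmap.fset_uniq ?(leq_trans (ltn_ord _) Bm) // => /eqP e.
    exact: val_inj.
pose rep c := if pselect (exists2 f, ims f & invariant f c) is left h then cls (projT1 (cid2 h)) else set0.
apply: sub_finite_set (finite_image rep fC) => X [f hf ->].
have n7 : (5 <= 7)%N by [].
have [c cc hc] := pC_unit xi1 gxi cM iso zero (iso_ims f hf) n7.
have ic : invariant f c by [].
exists c; first by exists f.
rewrite /rep; case: pselect => [h|[]]; last by exists f.
by case: (cid2 h) => f1 /= h1 i1; exact: cls_eq h1 hf i1 ic.
Qed.
End Finiteness.
End Eigenfunctions.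

(** * Primitives and cube roots of holomorphic functions *)

Section Primitive.
Context {R : realType}.
Notation V := 'rV[R]_2.
Notation E := (@basis_vec R).
Notation C := R[i].
Notation N := (@Normc.normc R).
Notation mu := (@lebesgue_measure R).

Lemma derive_1d (u : V -> R) (F : R -> R) (x v : V) (s : R) :
  (forall h : R, u (h *: v + x) = F (h *: 1 + s)) -> derivable F s 1 ->
  derivable u x v /\ 'D_v u x = 'D_1 F s.
Proof.
move=> uF.
have e : (fun h : R => h^-1 *: ((u \o shift x) (h *: v) - u x)) =
    (fun h : R => h^-1 *: ((F \o shift s) (h *: 1) - F s)).
  apply: funext => h /=; rewrite uF; congr (_ *: (_ - _)).
  by have := uF 0; rewrite !scale0r !add0r.
by rewrite /derivable /derive e.
Qed.

Lemma norm_row2_le (h : V) (r : R) : `|h 0 0| <= r -> `|h 0 1| <= r -> `|h| <= r.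
Proof.
move=> h0 h1; rewrite [leLHS]/Num.Def.normr/= mx_normrE; apply: bigmax_le => /=.
  exact: le_trans h0.
move=> [i j] _ /=; rewrite (ord1 i); move: j; exact: ord2_ind.
Qed.

Section Square.
Variables (U : set V) (a b : V -> R) (x0 : V) (r : R).
Hypotheses (r0 : 0 < r) (KU : [set y : V | `|y - x0| <= r] `<=` U).
Hypotheses (sa : smooth U a) (sb : smooth U b).
Hypothesis closed_form : forall x, U x -> 'D_(E 1) a x = 'D_(E 0) b x.

Let pt (s t : R) : V := x0 + s *: E 0 + t *: E 1.
Let ptE s t : pt s t = x0 + t *: E 1 + s *: E 0. Proof. by rewrite /pt addrAC. Qed.

Let pt_norm s t : `|s| <= r -> `|t| <= r -> `|pt s t - x0| <= r.
Proof.
move=> hs ht; rewrite /pt -[X in X - _]addrA [X in `|X|]addrC addKr.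
by apply: norm_row2_le; rewrite !mxE /= !(mulr1, mulr0, addr0, add0r).
Qed.

Let ptU s t : `|s| <= r -> `|t| <= r -> U (pt s t).
Proof.
by move=> hs ht; apply: KU; exact: pt_norm.
Qed.

Let der0 f s t : smooth U f -> `|s| <= r -> `|t| <= r ->
  is_derive s (1 : R) (fun s => f (pt s t)) ('D_(E 0) f (pt s t)).
Proof.
move=> sf hs ht; have dv : derivable f (x0 + t *: E 1 + s *: E 0) (E 0).
  by apply: smooth_derivable sf _; rewrite -ptE; exact: ptU.
have := is_derive_line dv; rewrite -ptE.
by rewrite (_ : (fun s => f (x0 + t *: E 1 + s *: E 0)) = fun s => f (pt s t)) //;
  apply: funext => y; rewrite ptE.
Qed.

Let der1 f s t : smooth U f -> `|s| <= r -> `|t| <= r ->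
  is_derive t (1 : R) (fun t => f (pt s t)) ('D_(E 1) f (pt s t)).
Proof.
move=> sf hs ht; apply: (is_derive_line (f := f) (x := x0 + s *: E 0)).
by apply: smooth_derivable sf _; exact: ptU.
Qed.

Let is_cont (F : R -> R) s d : is_derive s (1 : R) F d -> {for s, continuous F}.
Proof. by move=> h; apply: differentiable_continuous; apply/derivable1_diffP; case: h. Qed.

Let normr_itv (s : R) : -r <= s -> s <= r -> `|s| <= r.
Proof. by move=> h1 h2; rewrite ler_norml h1. Qed.

Let integrable_itv (F : R -> R) (c d : R) : (forall s, c <= s <= d -> {for s, continuous F}) ->
  mu.-integrable `[c, d] (EFin \o F).
Proof.
move=> cF; apply: continuous_compact_integrable; first exact: segment_compact.
by apply: continuous_in_subspaceT => s; rewrite inE /= in_itv /=; exact: cF.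
Qed.

(** The primitive of a dx + b dy, integrated from a corner of the square along its lower side and
    then upwards. *)
Let u0 (s t : R) : R := (\int[mu]_(y in `[- r, s]) a (pt y (- r)) +
  \int[mu]_(y in `[- r, t]) b (pt s y))%R.

Let nr : `|- r| <= r. Proof. by rewrite normrN ger0_norm // ltW. Qed.

Let FTC1 (F : R -> R) s : (forall t, `|t| <= r -> {for t, continuous F}) -> `|s| < r ->
  is_derive s (1 : R) (fun s => \int[mu]_(y in `[- r, s]) F y)%R (F s).
Proof.
move=> cF; rewrite ltr_norml => /andP[s1 s2].
have iF : mu.-integrable `[- r, r] (EFin \o F).
  by apply: integrable_itv => t /andP[t1 t2]; apply: cF; exact: normr_itv.
have cs : {for s, continuous F} by apply: cF; apply: normr_itv; exact: ltW.
have := @continuous_FTC1_closed R F (- r) s r s2 iF s1 cs.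
move: (fun s => _) => G [h1]; rewrite derive1E => h2; exact: DeriveDef h1 h2.
Qed.

Let u0_t s t : `|s| < r -> `|t| < r -> is_derive t (1 : R) (u0 s) (b (pt s t)).
Proof.
move=> hs ht; rewrite /u0 -[b (pt s t)]add0r; apply: is_deriveD.
apply: (FTC1 (F := fun y => b (pt s y))) => // y yr.
by apply: is_cont (der1 sb (ltW hs) yr).
Qed.

Let bnd : exists2 K, 0 <= K & forall s t, `|s| <= r -> `|t| <= r -> `|'D_(E 0) b (pt s t)| <= K.
Proof.
have cD : {within [set y : V | `|y - x0| <= r], continuous (fun y => `|'D_(E 0) b y|)}.
  apply: continuous_in_subspaceT => y /set_mem /KU Uy.
  have cb : {for y, continuous ('D_(E 0) b)} by exact: (smooth_derive 0 sb 0).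
  exact: (cvg_norm cb).
have K0 : [set y : V | `|y - x0| <= r] !=set0 by exists x0; rewrite /= subrr normr0 ltW.
have [c _ cmax] := compact_EVT_max K0 (compact_square (x0 := x0) (r := r)) cD.
exists `|'D_(E 0) b c| => // s t hs ht; apply: cmax; rewrite inE; exact: pt_norm.
Qed.

(** Differentiation under the integral sign turns b into its x-derivative, which is the y-derivative
    of a, and the fundamental theorem evaluates the integral. *)
Let part2 s t : `|s| < r -> `|t| < r ->
  is_derive s (1 : R) (fun s => \int[mu]_(y in `[- r, t]) b (pt s y))%R
    (a (pt s t) - a (pt s (- r))).
Proof.
move=> hs ht; have [K K0 hK] := bnd; have /andP[t1 t2] : - r < t < r by rewrite -ltr_norml.
have mB : measurable (`[- r, t]%classic : set R) by [].
have Is : `]- r, r[%classic s by rewrite /= in_itv /= -ltr_norml.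
have I_le x : `]- r, r[%classic x -> `|x| <= r.
  by rewrite /= in_itv /= -ltr_norml => /ltW.
have B_le y : `[- r, t]%classic y -> `|y| <= r.
  by rewrite /= in_itv /= => /andP[h1 h2]; apply: normr_itv => //; apply: le_trans h2 (ltW t2).
have intf x : `]- r, r[%classic x -> mu.-integrable `[- r, t] (EFin \o (fun y => b (pt x y))).
  move=> /I_le xr; apply: integrable_itv => y yB; apply: is_cont (der1 sb xr _).
  by apply: B_le; rewrite /= in_itv.
have derf x y : `]- r, r[%classic x -> `[- r, t]%classic y -> derivable (fun x => b (pt x y)) x 1.
  by move=> /I_le xr /B_le yr; have [] := der0 sb xr yr.
have dE x y : `]- r, r[%classic x -> `[- r, t]%classic y ->
    partial1of2 (fun x y => b (pt x y)) x y = 'D_(E 0) b (pt x y).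
  by move=> /I_le xr /B_le yr; rewrite partial1of2E; have [_] := der0 sb xr yr.
have Gub x y : `]- r, r[%classic x -> `[- r, t]%classic y ->
    `|partial1of2 (fun x y => b (pt x y)) x y| <= cst K y.
  by move=> Ix By; rewrite dE //=; apply: hK; [exact: I_le|exact: B_le].
have iK : mu.-integrable `[- r, t] (EFin \o cst K).
  by apply: integrable_itv => y _; exact: cst_continuous.
have h1 := @derivable_under_integral R _ _ mu (fun x y => b (pt x y)) _ mB s (- r) r Is intf derf
  (cst K) (fun=> K0) iK Gub.
have h2 := @differentiation_under_integral R _ _ mu (fun x y => b (pt x y)) _ mB s (- r) r Is intf derf
  (cst K) (fun=> K0) iK Gub.
move: h1 h2; rewrite derive1E; set G := (fun s => _) => h1 h2.
suff e : 'D_1 G s = a (pt s t) - a (pt s (- r)) by exact: DeriveDef h1 e.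
rewrite h2 {h1 h2 G}.
have sr := I_le _ Is.
have cDa y : `[- r, t]%classic y -> {for y, continuous (fun y => 'D_(E 1) a (pt s y))}.
  by move=> /B_le yr; apply: is_cont (der1 (smooth_derive 1 sa) sr yr).
have -> : (\int[mu]_(y in `[- r, t]) partial1of2 (fun x y => b (pt x y)) s y)%R =
    (\int[mu]_(y in `[- r, t]) 'D_(E 1) a (pt s y))%R.
  apply: eq_Rintegral => y /set_mem By; rewrite dE // closed_form //; apply: ptU => //.
  exact: B_le.
apply: (congr1 fine (@continuous_FTC2 R (fun y => 'D_(E 1) a (pt s y)) (fun y => a (pt s y))
  (- r) t t1 _ _ _)).
- apply: continuous_in_subspaceT => y /set_mem; exact: cDa.
- have ca y : `|y| <= r -> {for y, continuous (fun y => a (pt s y))}.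
    by move=> yr; apply: is_cont (der1 sa sr yr).
  split.
  + move=> y; rewrite in_itv /= => /andP[y1 y2].
    have yr : `|y| <= r by apply: normr_itv; lra.
    by have [] := der1 sa sr yr.
  + by apply: cvg_at_right_filter; exact: ca.
  + by apply: cvg_at_left_filter; apply: ca; exact: ltW.
- move=> y; rewrite in_itv /= => /andP[y1 y2].
  have yr : `|y| <= r by apply: normr_itv; lra.
  by rewrite derive1E; have [_] := der1 sa sr yr.
Qed.

Let u0_s s t : `|s| < r -> `|t| < r -> is_derive s (1 : R) (u0^~ t) (a (pt s t)).
Proof.
move=> hs ht; have -> : a (pt s t) = a (pt s (- r)) + (a (pt s t) - a (pt s (- r))).
  by rewrite addrC subrK.
apply: is_deriveD; last exact: part2.
apply: (FTC1 (F := fun y => a (pt y (- r)))) => // y yr.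
exact: is_cont (der0 sa yr nr).
Qed.

Lemma real_primitive : exists u : V -> R, [/\ smooth [set y : V | `|y - x0| < r] u,
  forall x, `|x - x0| < r -> 'D_(E 0) u x = a x &
  forall x, `|x - x0| < r -> 'D_(E 1) u x = b x].
Proof.
pose u x := u0 ((x - x0) 0 0) ((x - x0) 0 1); exists u.
pose S := [set y : V | `|y - x0| < r]; have oS : open S by exact: open_square.
have SU : S `<=` U by move=> y /ltW; exact: KU.
have xE x : x = pt ((x - x0) 0 0) ((x - x0) 0 1) by rewrite /pt -addrA -row2E addrC subrK.
have hx x i : S x -> `|(x - x0) 0 i| < r by move=> Sx; apply: le_lt_trans (row2_norm _ _) Sx.
have D0 x : S x -> derivable u x (E 0) /\ 'D_(E 0) u x = a x.
  move=> Sx; have [d1 d2] := u0_s (hx x 0 Sx) (hx x 1 Sx); rewrite -xE in d2; rewrite -d2.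
  apply: derive_1d d1 => h; rewrite /u; congr u0; rewrite !mxE /= ?mulr1 ?mulr0.
    by rewrite /GRing.scale /= mulr1 addrA.
  by rewrite add0r.
have D1 x : S x -> derivable u x (E 1) /\ 'D_(E 1) u x = b x.
  move=> Sx; have [d1 d2] := u0_t (hx x 0 Sx) (hx x 1 Sx); rewrite -xE in d2; rewrite -d2.
  apply: derive_1d d1 => h; rewrite /u; congr u0; rewrite !mxE /= ?mulr1 ?mulr0.
    by rewrite add0r.
  by rewrite /GRing.scale /= mulr1 addrA.
split; [|by move=> x /D0[]|by move=> x /D1[]].
have du x : S x -> differentiable u x.
  move=> Sx; apply: (differentiable_C1 oS) Sx => y; apply: ord2_ind => Sy.
  - by case: (D0 y Sy).
  - by case: (D1 y Sy).
  - apply: (near_eq_continuous (f := a)); last exact: (sa 0) (SU _ Sy).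
    by apply: (near_open oS Sy) => z /D0[].
  - apply: (near_eq_continuous (f := b)); last exact: (sb 0) (SU _ Sy).
    by apply: (near_open oS Sy) => z /D1[].
case=> [|k]; first by move=> x /du /differentiable_continuous.
split=> //; apply: ord2_ind.
  by apply: (Ck_ext (u := a)) => // [x /D0[]//|]; exact: Ck_sub SU (sa k).
by apply: (Ck_ext (u := b)) => // [x /D1[]//|]; exact: Ck_sub SU (sb k).
Qed.
End Square.

Lemma smooth_opp U (a : V -> R) : open U -> smooth U a -> smooth U (fun x => - a x).
Proof. by move=> oU sa k; exact: Ck_opp. Qed.

Lemma derive_opp U (a : V -> R) i x : smooth U a -> U x ->
  'D_(E i) (fun x => - a x) x = - 'D_(E i) a x.
Proof.
by move=> sa Ux; rewrite (_ : (fun x => - a x) = - a) // deriveN //; exact: smooth_derivable sa Ux.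
Qed.

(** By the Cauchy-Riemann equations Re F dx - Im F dy and Im F dx + Re F dy are closed; their
    primitives are the real and imaginary parts of W. *)
Lemma hol_primitive U F (x0 : V) (r : R) : open U -> 0 < r ->
  [set y : V | `|y - x0| <= r] `<=` U -> hol U F ->
  exists2 W, hol [set y : V | `|y - x0| < r] W &
    forall x, `|x - x0| < r -> cderive 0 W x = F x.
Proof.
move=> oU r0 KU [[sr si] hF].
pose a x := complex.Re (F x); pose b x := complex.Im (F x).
have CR x : U x -> 'D_(E 1) a x = - 'D_(E 0) b x /\ 'D_(E 1) b x = 'D_(E 0) a x.
  move=> /hF => /[dup] /(congr1 (@complex.Re R)) h1 /(congr1 (@complex.Im R)) h2.
  by move: h1 h2; rewrite cReM cImM !cderiveE /= => -> ->; split; ring.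
have [|u [su u0 u1]] := real_primitive r0 KU sr (smooth_opp oU si).
  by move=> x Ux; rewrite (derive_opp _ si Ux) (CR x Ux).1.
have [|v [sv v0 v1]] := real_primitive r0 KU si sr.
  by move=> x Ux; rewrite (CR x Ux).2.
exists (fun x => Complex (u x) (v x)).
  split; first by split.
  move=> x Sx; apply: complex_eq; rewrite ?(cReM, cImM) !cderiveE /= ?u0 ?u1 ?v0 ?v1 //=; ring.
move=> x Sx; apply: complex_eq; rewrite !cderiveE /=; [exact: u0|exact: v0].
Qed.

Lemma derive_fun1 (phi : R -> R) (d : R) (u : V -> R) (x v : V) : differentiable u x ->
  is_derive (u x) (1 : R) phi d ->
  differentiable (phi \o u) x /\ 'D_v (phi \o u) x = d * 'D_v u x.
Proof.
move=> du [dphi <-]; have dp : differentiable phi (u x) by exact/derivable1_diffP.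
have dc : differentiable (phi \o u) x by exact: differentiable_comp.
split=> //; rewrite !deriveE // diff_comp //= -[X in 'd phi _ X]mulr1.
by rewrite -[_ * 1]/(_ *: (1 : R)) linearZ /= -deriveE // /GRing.scale /= mulrC.
Qed.

Definition cexp (z : C) : C := Complex (expR (complex.Re z) * cos (complex.Im z))
  (expR (complex.Re z) * sin (complex.Im z)).

Lemma cexp_neq0 z : cexp z != 0.
Proof.
rewrite -N_eq0 -sqrf_eq0 N_sqr /cexp /= !exprMn -mulrDr cos2Dsin2 mulr1.
by rewrite gt_eqF // exprn_gt0 // expR_gt0.
Qed.

Section Exponential.
Variables (U : set V) (L : V -> C).
Hypotheses (oU : open U) (sL : csm U L).
Let a x := complex.Re (L x).
Let b x := complex.Im (L x).
Let p x := complex.Re (cexp (L x)).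
Let q x := complex.Im (cexp (L x)).

Let dpq x v : U x -> [/\ differentiable p x, differentiable q x,
  'D_v p x = p x * 'D_v a x - q x * 'D_v b x & 'D_v q x = q x * 'D_v a x + p x * 'D_v b x].
Proof.
move=> Ux; have [sa sb] := sL.
have da : differentiable a x := smooth_differentiable sa Ux.
have db : differentiable b x := smooth_differentiable sb Ux.
have [de ee] := derive_fun1 v da (is_derive_expR (a x)).
have [dc ec] := derive_fun1 v db (is_derive_cos (b x)).
have [ds es] := derive_fun1 v db (is_derive_sin (b x)).
have pE : p = (expR \o a) * (cos \o b) by [].
have qE : q = (expR \o a) * (sin \o b) by [].
split.
- by rewrite pE; exact: differentiableM.
- by rewrite qE; exact: differentiableM.
- rewrite pE deriveM; [|exact: diff_derivable|exact: diff_derivable].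
  rewrite ee ec -[(_ * _) x]/(p x) /GRing.scale /= -[p x]/(expR (a x) * cos (b x)).
  by rewrite -[q x]/(expR (a x) * sin (b x)); ring.
- rewrite qE deriveM; [|exact: diff_derivable|exact: diff_derivable].
  rewrite ee es -[(_ * _) x]/(q x) /GRing.scale /= -[p x]/(expR (a x) * cos (b x)).
  by rewrite -[q x]/(expR (a x) * sin (b x)); ring.
Qed.

Lemma csm_cexp : csm U (fun x => cexp (L x)).
Proof.
suff h k : Ck k U p /\ Ck k U q by split=> k; case: (h k).
have [sa sb] := sL.
elim: k => [|k [IHp IHq]].
  by split=> x /(dpq 0)[dp dq _ _]; exact: differentiable_continuous.
split; split=> [x /(dpq 0)[]//|i].
- apply: (Ck_ext (u := fun x => p x * 'D_(E i) a x + - (q x * 'D_(E i) b x))) => //.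
    by move=> x /(dpq (E i))[_ _ ->].
  by apply: Ck_add => //; [|apply: Ck_opp => //]; apply: Ck_mul => //; exact: smooth_derive.
- apply: (Ck_ext (u := fun x => q x * 'D_(E i) a x + p x * 'D_(E i) b x)) => //.
    by move=> x /(dpq (E i))[_ _ _ ->].
  by apply: Ck_add => //; apply: Ck_mul => //; exact: smooth_derive.
Qed.

Lemma cderive_cexp i x : U x -> cderive i (fun x => cexp (L x)) x = cexp (L x) * cderive i L x.
Proof.
move=> Ux; have [_ _ h1 h2] := dpq (E i) Ux.
by apply: complex_eq; rewrite ?(cReM, cImM) !cderiveE ?h1 ?h2 // addrC.
Qed.
End Exponential.

Lemma hol_cexp U L : open U -> hol U L -> hol U (fun x => cexp (L x)).
Proof.
move=> oU [sL hL]; split; first exact: csm_cexp.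
by move=> x Ux; rewrite !(cderive_cexp sL) // hL // mulrCA.
Qed.

Lemma nbhs_square (U : set V) x0 : open U -> U x0 ->
  exists2 r, 0 < r & [set y : V | `|y - x0| <= r] `<=` U.
Proof.
move=> oU Ux; have /nbhs_ballP[d /= d0 hd] := open_nbhs_nbhs (conj oU Ux).
exists (d / 2); first by rewrite divr_gt0.
move=> y /= yd; apply: hd; rewrite -ball_normE /ball_ /= distrC.
by apply: le_lt_trans yd _; rewrite ltr_pdivrMr // mulr_natr mulr2n ltrDl.
Qed.

Lemma hol_square_const F (x0 : V) (r : R) : hol [set y : V | `|y - x0| < r] F ->
  (forall x, `|x - x0| < r -> cderive 0 F x = 0) ->
  forall x y, `|x - x0| < r -> `|y - x0| < r -> F x = F y.
Proof.
move=> hF d0 x y xr yr; apply/eqP; rewrite -subr_eq0 -N_eq0 eq_le N_ge0 andbT.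
have -> : F x = F (x0 + (x - x0)) by rewrite addrC subrK.
have c z : `|z - x0| < r -> N (F (x0 + (z - x0)) - F x0) <= 0.
  move=> zr; rewrite -(mul0r (N (toC (z - x0)))); apply: (hol_MVT hF) => t t1.
  have h : `|x0 + t *: (z - x0) - x0| < r.
    by rewrite addrC addKr normrZ; apply: le_lt_trans zr; rewrite ler_piMl.
  by split=> //; rewrite d0 // Normc.normc0.
have -> : F y = F (x0 + (y - x0)) by rewrite [x0 + _]addrC subrK.
have := c x xr; have := c y yr; move: (F (x0 + (x - x0))) (F (x0 + (y - x0))) => z1 z2 h1 h2.
have -> : z1 - z2 = (z1 - F x0) + (F x0 - z2) by ring.
by apply: le_trans (ND _ _) _; move: h1; rewrite NB; move: h2; lra.
Qed.

(** K = exp L with L' = - Q' / (3 Q) is Q^(-1/3) up to a constant: Q K^3 has derivative 0, and a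
    cube root e of its value absorbs the constant. *)
Lemma hol_cube_root U Q x0 : open U -> U x0 -> hol U Q -> (forall x, U x -> Q x != 0) ->
  exists r c, [/\ 0 < r, [set y : V | `|y - x0| <= r] `<=` U, hol [set y : V | `|y - x0| < r] c &
    forall x, `|x - x0| < r -> c x ^+ 3 = Q x].
Proof.
move=> oU Ux hQ Q0; have [r r0 KU] := nbhs_square oU Ux.
pose F x := - (3^-1 * (cderive 0 Q x * (Q x)^-1)).
have hF : hol U F.
  apply: (hol_ext (F := fun x => - 3^-1 * (cderive 0 Q x * (Q x)^-1))) => //.
    by move=> x _; rewrite mulNr.
  apply: hol_mul => //; first exact: hol_cst.
  by apply: hol_mul => //; [exact: hol_derive|exact: hol_inv].
have [L hL LF] := hol_primitive oU r0 KU hF.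
pose S := [set y : V | `|y - x0| < r]; have oS : open S by exact: open_square.
have SU : S `<=` U by move=> y /ltW; exact: KU.
pose K x := cexp (L x); have hK : hol S K by exact: hol_cexp.
have hQS := hol_sub SU hQ; have K0 x : K x != 0 by exact: cexp_neq0.
pose H x := Q x * K x ^+ 3.
have hH : hol S H by apply: hol_mul => //; exact: hol_exp.
have dH x : S x -> cderive 0 H x = 0.
  move=> Sx; rewrite (cderiveM _ (hol_csm hQS) (hol_csm (hol_exp 3 oS hK)) Sx).
  rewrite (cderive0_exp 2 oS hK Sx) (cderive_cexp (hol_csm hL) _ Sx) LF // /F -/(K x).
  have := Q0 x (SU x Sx); move: (cderive 0 Q x) (Q x) (K x) => dq q1 k1 q10; field; exact: q10.
have Sx0 : S x0 by rewrite /S /= subrr normr0.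
have Hc x : S x -> H x = H x0 by move=> Sx; exact: (hol_square_const hH dH).
have [e he] := @complex_root R (H x0) 3 isT.
exists r, (fun x => e * (K x)^-1); split=> //.
  by apply: hol_mul => //; [exact: hol_cst|apply: hol_inv].
move=> x Sx; rewrite exprMn he -(Hc x Sx) /H exprVn mulfK //.
by rewrite expf_neq0.
Qed.

(* A local coordinate in which the cubic differential is [dz ^ 3]. *)
Lemma flat_coordinate U Q x0 : open U -> U x0 -> hol U Q -> (forall x, U x -> Q x != 0) ->
  exists r W d, [/\ 0 < r, 0 < d, [set y : V | `|y - x0| < r] `<=` U,
    hol [set y : V | `|y - x0| < r] W &
    (forall x, `|x - x0| < r -> cderive 0 W x ^+ 3 = Q x) /\
    (forall x y, `|x - x0| < r -> `|y - x0| < r -> d * N (toC (x - y)) <= N (W x - W y))].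
Proof.
move=> oU Ux hQ Q0; have [r [c [r0 KU hc c3]]] := hol_cube_root oU Ux hQ Q0.
pose S := [set y : V | `|y - x0| < r]; have oS : open S by exact: open_square.
have Sx0 : S x0 by rewrite /S /= subrr normr0.
have c0 : 0 < N (c x0).
  by rewrite N_gt0; apply: contra_eq_neq (c3 x0 Sx0) => ->; rewrite expr0n /= eq_sym Q0.
have [r1 r10 KS] := nbhs_square oS Sx0.
have [W hW Wc] := hol_primitive oS r10 KS hc.
have [d d0 hd] := csm_continuous_dist (hol_csm hc) Sx0 (divr_gt0 c0 (ltr0n R 2)).
have [r2 r20 hr2] : exists2 r2, 0 < r2 & forall y, `|y - x0| < r2 -> `|y - x0| < r1 /\ N (toC (y - x0)) < d.
  have h : nbhs x0 [set y | `|y - x0| < r1 /\ N (toC (y - x0)) < d].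
    apply: filterI (disc_nbhs x0 d0).
    by apply: open_nbhs_nbhs; split; [exact: open_square|rewrite /= subrr normr0].
  have /nbhs_ballP[r2 /= r20 hr] := h; exists r2 => // y yr; apply: hr.
  by rewrite -ball_normE /ball_ /= distrC.
pose S2 := [set y : V | `|y - x0| < r2]; have oS2 : open S2 by exact: open_square.
have S21 y : S2 y -> `|y - x0| < r1 by case/hr2.
have hW2 : hol S2 W by apply: hol_sub hW => y /S21.
(* A third of the radius, because y + t (x - y) has to stay in [S2] for all |t| <= 1, negative t
   included. *)
pose S3 := [set y : V | `|y - x0| < r2 / 3].
have S32 y : S3 y -> S2 y by rewrite /S3 /S2 /=; lra.
exists (r2 / 3), W, (N (c x0) / 2); split=> //.
- by rewrite divr_gt0.
- by rewrite divr_gt0.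
- by move=> y /S32 /S21 /ltW /KS /ltW; exact: KU.
- exact: hol_sub S32 hW2.
split=> [x /S32 /S21 xr|x y Sx Sy]; first by rewrite Wc // c3 //; exact: KS (ltW xr).
pose G z := W z + - c x0 * toC z.
have hG : hol S2 G.
  by apply: hol_add => //; apply: hol_mul => //; [exact: hol_cst|exact: hol_toC].
have dG z : S2 z -> cderive 0 G z = c z - c x0.
  move=> Sz; have sG := csm_mul oS2 (csm_cst S2 (- c x0)) (csm_toC S2).
  rewrite (cderiveD _ (hol_csm hW2) sG Sz) (cderiveM _ (csm_cst S2 (- c x0)) (csm_toC S2) Sz).
  rewrite Wc; last exact: S21.
  by rewrite (cderive_cst (- c x0) 0 z) (cderive0_toC z) mul0r add0r mulr1.
have h : N (G (y + (x - y)) - G y) <= N (c x0) / 2 * N (toC (x - y)).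
  apply: (hol_MVT hG) => t t1.
  have Sz : S2 (y + t *: (x - y)).
    rewrite /S2 /= addrAC; apply: le_lt_trans (ler_normD _ _) _; rewrite normrZ.
    have xy : `|x - y| < r2 / 3 + r2 / 3.
      have -> : x - y = (x - x0) - (y - x0) by rewrite opprB addrA subrK.
      by apply: le_lt_trans (ler_normB _ _) _; exact: ltrD.
    have : `|t| * `|x - y| <= `|x - y| by rewrite ler_piMl.
    by move: Sy xy; rewrite /=; lra.
  by split=> //; rewrite dG //; apply: hd; case: (hr2 _ Sz).
have e : c x0 * toC (x - y) = (W x - W y) - (G (y + (x - y)) - G y).
  by rewrite [y + _]addrC subrK /G toCB; ring.
have : N (c x0) * N (toC (x - y)) <= N (W x - W y) + N (G (y + (x - y)) - G y).
  by rewrite -Normc.normcM e; apply: le_trans (ND _ _) _; rewrite NN.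
lra.
Qed.

(** If W omitted the value w on a closed disc of radius m, then 1 / (W - w) would be holomorphic
    inside. On the circle |W - w| is at least d m / 2, at the centre it is smaller, against the
    maximum principle. *)
Lemma injective_open U W (d : R) : open U -> 0 < d -> hol U W ->
  (forall x y, U x -> U y -> d * N (toC (x - y)) <= N (W x - W y)) ->
  forall x (e : R), U x -> 0 < e -> exists2 e', 0 < e' &
    forall w, N (w - W x) < e' -> exists y, [/\ U y, N (toC (y - x)) < e & W y = w].
Proof.
move=> oU d0 hW inj x e Ux e0.
have [e1 e10 he1] := nbhs_disc (open_nbhs_nbhs (conj oU Ux)).
pose m := Num.min e1 e / 2; have m0 : 0 < m by rewrite divr_gt0 // lt_min e10 e0.
have mm : m < Num.min e1 e by rewrite /m; move: m0; rewrite /m; lra.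
have me1 : m < e1 by apply: lt_le_trans mm _; rewrite ge_min lexx.
have me : m < e by apply: lt_le_trans mm _; rewrite ge_min lexx orbT.
exists (d * m / 2); first by rewrite divr_gt0 // mulr_gt0.
move=> w hw; apply: contrapT => no.
pose K := [set y : V | N (toC (y - x)) <= m]; pose B := [set y : V | N (toC (y - x)) = m].
have KU y : K y -> U y by move=> /= ym; apply: he1; apply: le_lt_trans ym me1.
have W0 y : K y -> W y - w != 0.
  move=> Ky; rewrite subr_eq0; apply/eqP => yw; apply: no; exists y; split=> //; first exact: KU.
  by apply: le_lt_trans Ky me.
have cN : continuous (fun y : V => N (toC (y - x)) ^+ 2).
  move=> y; rewrite (_ : (fun y => _) = fun y => N (toC y + - toC x) ^+ 2); last first.
    by apply: funext => z; rewrite toCB.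
  have sC : csm setT (fun y : V => toC y + - toC x).
    by apply: csm_add; [exact: openT|exact: csm_toC|exact: csm_cst].
  exact: (csm_continuous_N sC (x := y) Logic.I).
have leE y : (N (toC (y - x)) <= m) = (N (toC (y - x)) ^+ 2 <= m ^+ 2).
  by rewrite ler_pXn2r // nnegrE ?N_ge0 // ltW.
have ltE y : (N (toC (y - x)) < m) = (N (toC (y - x)) ^+ 2 < m ^+ 2).
  by rewrite ltr_pXn2r // nnegrE ?N_ge0 // ltW.
have cK : compact K.
  apply: (subclosed_compact _ (compact_square (x0 := x) (r := m))).
    rewrite (_ : K = (fun y : V => N (toC (y - x)) ^+ 2) @^-1` [set t : R | t <= m ^+ 2]); last first.
      by apply/seteqP; split=> y; rewrite /K /= leE.
    by apply: closed_comp; [move=> y _; exact: cN|exact: closed_le].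
  by move=> y /= ym; apply: le_trans (mx_norm_le_N _) ym.
pose F y := (W y - w)^-1.
pose U' := [set y : V | N (toC (y - x)) < m].
have oU' : open U'.
  rewrite (_ : U' = (fun y : V => N (toC (y - x)) ^+ 2) @^-1` [set t : R | t < m ^+ 2]); last first.
    by apply/seteqP; split=> y; rewrite /U' /= ltE.
  by apply: open_comp; [move=> y _; exact: cN|exact: open_lt].
have U'K y : U' y -> K y by move=> /ltW.
have hF : hol U' F.
  apply: hol_inv => //; first by move=> y /U'K; exact: W0.
  apply: (hol_add oU' _ (hol_cst U' (- w))); apply: hol_sub hW => y /U'K; exact: KU.
have NFE y : N (F y) ^+ 2 = (N (W y + - w) ^+ 2)^-1 by rewrite /F Normc.normcV exprVn.
have hWw : hol U (fun y => W y + - w) by apply: hol_add => //; exact: hol_cst.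
have cF : {within K, continuous (fun y => N (F y) ^+ 2)}.
  rewrite (_ : (fun y => _) = fun y => (N (W y + - w) ^+ 2)^-1); last by apply: funext => y.
  apply: continuous_in_subspaceT => y /set_mem Ky.
  have nz : N (W y + - w) ^+ 2 != 0 by rewrite expf_neq0 // N_eq0 W0.
  exact: (cvgV nz (csm_continuous_N (hol_csm hWw) (KU y Ky))).
have dm : 0 < d * m by rewrite mulr_gt0.
have hmax := @maximum_principle R K B (fun y => N (F y) ^+ 2) ((2 / (d * m)) ^+ 2) cK cF.
have Kx : K x by rewrite /K /= subrr toC0 Normc.normc0 ltW.
have := hmax _ _ x Kx; rewrite NFE.
have t0 : 0 < 2 / (d * m) by rewrite divr_gt0.
move=> h; have {h} : (N (W x + - w) ^+ 2)^-1 <= (2 / (d * m)) ^+ 2.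
  apply: h => y Hy; first last.
    move=> nB; right; exists U'; split=> //; last by exists F.
    by rewrite /U' /= lt_neqAle Hy andbT; apply/eqP.
  have Ky : K y by rewrite /K /= Hy.
  have lo : d * m / 2 <= N (W y + - w).
    have := inj y x (KU y Ky) Ux; rewrite Hy.
    have -> : W y - W x = (W y + - w) + (w - W x) by rewrite addrA subrK.
    by move=> h1; have := ND (W y + - w) (w - W x); move: h1 hw; lra.
  rewrite NFE -exprVn ler_pXn2r ?nnegrE ?invr_ge0 ?N_ge0 ?(ltW t0) //.
  by rewrite -[leRHS]invf_div lef_pV2 // posrE; [move: lo dm; lra|move: dm; lra].
have Np : 0 < N (W x + - w) by rewrite N_gt0 W0.
rewrite -exprVn ler_pXn2r ?nnegrE ?invr_ge0 ?N_ge0 ?(ltW t0) // -[leRHS]invf_div.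
rewrite lef_pV2 ?posrE //; last by move: dm; lra.
by move: hw; rewrite NB; lra.
Qed.
End Primitive.

(** * Developing map of a flat surface *)

Section FlatSurface.
Context {R : realType} (M : topologicalType).
Notation V := 'rV[R]_2.
Notation C := R[i].
Notation N := (@Normc.normc R).
Notation D v := (N (toC v)).

Definition rot (om : C) (v : V) : V := ofC (om * toC v).

Lemma toC_rot om v : toC (rot om v) = om * toC v. Proof. exact: ofCK. Qed.

Lemma rotZ om (t : R) v : rot om (t *: v) = t *: rot om v.
Proof. by apply: toC_inj; rewrite !(toC_rot, toCZ) mulrCA. Qed.

Lemma unit_N (om : C) : om ^+ 3 = 1 -> N om = 1.
Proof.
move=> h; have := congr1 N h; rewrite NX Normc.normc1 => /eqP.
by rewrite pexpr_eq1 ?N_ge0 // => /eqP.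
Qed.

Lemma unit_neq0 (om : C) : om ^+ 3 = 1 -> om != 0.
Proof. by apply: contra_eq_neq => ->; rewrite expr0n /= eq_sym oner_eq0. Qed.

Lemma unit_inv (om : C) : om ^+ 3 = 1 -> om^-1 ^+ 3 = 1.
Proof. by move=> h; rewrite exprVn h invr1. Qed.

Lemma D_sub x y : D (x - y) = D (y - x).
Proof. by rewrite !toCB NB. Qed.

Lemma D_triangle x y z : D (x - z) <= D (x - y) + D (y - z).
Proof.
have -> : x - z = (x - y) + (y - z) by rewrite addrA subrK.
by rewrite toCD ND.
Qed.

Lemma D_convex (c x v : V) (r t : R) : D (x - c) < r -> D (x + v - c) < r -> 0 <= t <= 1 ->
  D (x + t *: v - c) < r.
Proof.
move=> xr yr /andP[t0 t1].
have -> : x + t *: v - c = (1 - t) *: (x - c) + t *: (x + v - c).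
  by apply/rowP => j; rewrite !mxE; ring.
rewrite toCD !toCZ; apply: le_lt_trans (ND _ _) _; rewrite !Normc.normcM !N_real.
rewrite (ger0_norm t0) ger0_norm ?subr_ge0 //.
have [->|tp] := eqVneq t 0; first by rewrite subr0 mul1r mul0r addr0.
have tp' : 0 < t by rewrite lt_neqAle eq_sym tp.
have h1 : (1 - t) * D (x - c) <= (1 - t) * r by rewrite ler_wpM2l ?subr_ge0 // ltW.
have h2 : t * D (x + v - c) < t * r by rewrite ltr_pM2l.
by move: h1 h2; lra.
Qed.

Lemma near_D (z : V) (d : R) : 0 < d -> \forall u \near z, D (u - z : V) < d.
Proof. exact: disc_nbhs. Qed.

Lemma rot_near (om : C) (y z : V) (u0 : V) (P : V -> Prop) : om ^+ 3 = 1 ->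
  (\forall v \near y + rot om (u0 - z), P v) -> \forall u \near u0, P (y + rot om (u - z)).
Proof.
move=> o3 /nbhs_disc[d d0 hd]; apply: filterS (near_D u0 d0) => u ud; apply: hd.
rewrite opprD addrACA subrr add0r toCB !toC_rot -mulrBr -toCB opprB addrA subrK.
by rewrite Normc.normcM unit_N // mul1r.
Qed.

(** Charts whose transitions are translations composed with cube roots of unity. [fa_img] says that
    they are open maps, and closure under rotation, [fa_rot], makes a rotated flat map flat
    again. *)
Record flat_atlas (A : set M -> (M -> C) -> Prop) : Prop := FlatAtlas {
  fa_open : forall B w, A B w -> open B ;
  fa_inj : forall B w p q, A B w -> B p -> B q -> w p = w q -> p = q ;
  fa_cont : forall B w p e, A B w -> B p -> 0 < e -> \forall q \near p, N (w q - w p) < e ;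
  fa_img : forall B w (p : M) (S : set M), A B w -> B p -> nbhs p S -> exists2 e, 0 < e &
    forall c, N (c - w p) < e -> exists q, [/\ S q, B q & w q = c] ;
  fa_rot : forall B w om, A B w -> om ^+ 3 = 1 -> A B (fun q => om * w q) ;
  fa_trans : forall B w B' w' p, A B w -> A B' w' -> B p -> B' p -> exists2 om, om ^+ 3 = 1 &
    \forall q \near p, w' q - w' p = om * (w q - w p) ;
  fa_cover : forall p, exists B w, A B w /\ B p
}.

Variable A : set M -> (M -> C) -> Prop.
Hypothesis FA : flat_atlas A.
Hypotheses (hM : hausdorff_space M) (cM : compact [set: M]) (conM : connected [set: M]).
Implicit Types (F G : V -> M) (z u v : V).

(** Near z the map F is the inverse of a chart, up to a translation of the plane. *)
Definition flat F z := exists B w, [/\ A B w, B (F z) &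
  \forall u \near z, B (F u) /\ w (F u) - w (F z) = toC (u - z)].

Lemma flat_ext F G z : (\forall u \near z, F u = G u) -> flat F z -> flat G z.
Proof.
move=> FG [B [w [AB Bz h]]]; have e := nbhs_singleton FG; exists B, w; rewrite -e; split=> //.
by apply: filterS2 FG h => u <-.
Qed.

Lemma flat_cont F z (S : set M) : flat F z -> nbhs (F z) S -> \forall u \near z, S (F u).
Proof.
move=> [B [w [AB Bz h]]] nS; have [e e0 he] := fa_img FA AB Bz nS.
apply: filterS2 h (near_D z e0) => u [Bu wu] ud.
have [|q [Sq Bq wq]] := he (w (F u)); first by rewrite wu.
by rewrite -(fa_inj FA AB Bq Bu wq).
Qed.

Lemma flat_open F z (U : set V) : flat F z -> nbhs z U ->
  \forall q \near F z, exists2 u, U u & F u = q.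
Proof.
move=> [B [w [AB Bz h]]] nU; have [d d0 hd] := nbhs_disc (filterI h nU).
have nB : nbhs (F z) B by apply: open_nbhs_nbhs; split=> //; exact: fa_open AB.
apply: filterS2 (fa_cont FA AB Bz d0) nB => q wq Bq.
pose u := z + ofC (w q - w (F z)).
have uz : toC (u - z) = w q - w (F z) by rewrite /u addrC addKr ofCK.
have [|[Bu wu] Uu] := hd u; first by rewrite uz.
by exists u => //; apply: (fa_inj FA AB Bu Bq); apply: (addIr (- w (F z))); rewrite wu.
Qed.

Lemma flat_inj F z : flat F z -> exists2 d, 0 < d &
  forall u v, D (u - z) < d -> D (v - z) < d -> F u = F v -> u = v.
Proof.
move=> [B [w [AB Bz h]]]; have [d d0 hd] := nbhs_disc h; exists d => // u v ud vd e.
have [_ hu] := hd u ud; have [_ hv] := hd v vd.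
by apply: (addIr (- z)); apply: toC_inj; rewrite -hu -hv e.
Qed.

Lemma flat_chart F z B w : flat F z -> A B w -> B (F z) -> exists2 om, om ^+ 3 = 1 &
  \forall u \near z, B (F u) /\ w (F u) - w (F z) = om * toC (u - z).
Proof.
move=> fF AB Bz; have [B' [w' [AB' Bz' h]]] := fF.
have [om o3 ho] := fa_trans FA AB' AB Bz' Bz; exists om => //.
have nB : nbhs (F z) B by apply: open_nbhs_nbhs; split=> //; exact: fa_open AB.
have h2 : nbhs (F z) [set q | w q - w (F z) = om * (w' q - w' (F z)) /\ B q] by exact: filterI.
by apply: filterS2 h (flat_cont fF h2) => u [_ <-] [].
Qed.

Lemma flat_germ F G z y : flat F z -> flat G y -> F z = G y -> exists2 om, om ^+ 3 = 1 &
  \forall u \near z, F u = G (y + rot om (u - z)).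
Proof.
move=> [B [w [AB Bz h]]] fG e; have By : B (G y) by rewrite -e.
have [om o3 ho] := flat_chart fG AB By; have o0 := unit_neq0 o3.
exists om^-1; first exact: unit_inv.
have {}ho : \forall u \near z, B (G (y + rot om^-1 (u - z))) /\
    w (G (y + rot om^-1 (u - z))) - w (G y) = om * toC (y + rot om^-1 (u - z) - y).
  apply: (rot_near (P := fun v => B (G v) /\ w (G v) - w (G y) = om * toC (v - y)) (unit_inv o3)).
  by rewrite subrr /rot toC0 mulr0 -toC0 toCK addr0.
apply: filterS2 h ho => u [Bu wu] [Bv wv]; apply: (fa_inj FA AB Bu Bv).
apply: (addIr (- w (G y))); rewrite wv -{1}e wu [y + _]addrC addrK toC_rot.
by rewrite mulrA divff ?mul1r.
Qed.

Lemma flat_rot G om y z u : om ^+ 3 = 1 -> flat G (y + rot om (u - z)) ->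
  flat (fun v => G (y + rot om (v - z))) u.
Proof.
move=> o3 [B [w [AB Bz h]]]; have o0 := unit_neq0 o3.
exists B, (fun q => om^-1 * w q); split=> //; first exact: (fa_rot FA AB (unit_inv o3)).
apply: filterS (rot_near o3 h) => v [Bv wv]; split=> //.
rewrite -mulrBr wv opprD addrACA subrr add0r [toC (rot _ _ - _)]toCB !toC_rot -mulrBr mulKf // -toCB.
by rewrite opprB addrA subrK.
Qed.

(** The points where the germs of F and G agree form an open and closed subset of the segment. Where
    the values agree but the germs do not, these differ by a nontrivial rotation, so that nearby F =
    G only at the point itself; where the values differ, M is Hausdorff. *)
Lemma flat_unique F G x v : (forall t : R, 0 <= t <= 1 -> flat F (x + t *: v) /\ flat G (x + t *: v)) ->
  (\forall u \near x, F u = G u) -> \forall u \near x + v, F u = G u.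
Proof.
move=> fl h0; pose B z := \forall u \near z, F u = G u.
apply: (@segment_clopen R B x v) => // [t _|t t01 nB].
  by move=> h; apply: nbhs_interior.
have [fF fG] := fl t t01; set z := x + t *: v in fF fG nB *.
have [e|ne] := pselect (F z = G z).
  have [om o3 ho] := flat_germ fF fG e.
  have o1 : om != 1.
    apply/eqP => o1; apply: nB; apply: filterS ho => u ->.
    by rewrite o1 /rot mul1r toCK addrC subrK.
  have [d d0 hd] := flat_inj fG.
  apply: filterS2 ho (near_D z d0) => u hu ud Bu.
  have [uz|uz] := eqVneq u z; first by apply: nB; rewrite -uz.
  have := nbhs_singleton Bu; rewrite hu => /hd h.
  have : z + rot om (u - z) = u.
    apply: h => //; rewrite addrC addKr toC_rot Normc.normcM unit_N // mul1r //.
  move=> /(congr1 (fun y => toC (y - z))); rewrite addrC addKr toC_rot => /eqP.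
  rewrite -subr_eq0 (_ : _ - _ = (om - 1) * toC (u - z)); last by ring.
  rewrite mulf_eq0 subr_eq0 (negbTE o1) /=.
  by rewrite -[0]toC0 (inj_eq toC_inj) subr_eq0 (negbTE uz).
have := hM; rewrite open_hausdorff => /(_ (F z) (G z)) [|[S T] [/= Sz Tz] [oS oT ST]]; first exact/eqP.
rewrite inE in Sz; rewrite inE in Tz.
have nS : nbhs (F z) S by exact: open_nbhs_nbhs.
have nT : nbhs (G z) T by exact: open_nbhs_nbhs.
apply: filterS2 (flat_cont fF nS) (flat_cont fG nT) => u Su Tu /nbhs_singleton e.
have : (S `&` T) (F u) by split=> //; rewrite e.
by rewrite (eqP ST).
Qed.

(** By compactness, inverse charts exist on discs of one radius around all points of M. This uniform
    radius drives the continuation to the whole plane. *)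
Lemma flat_uniform : exists2 e, 0 < e & forall p, exists psi, psi 0 = p /\
  forall z, D z < e -> flat psi z.
Proof.
pose P e p := exists psi, psi 0 = p /\ forall z, D z < e -> flat psi z.
have nc := (compact_near_coveringP [set: M]).1 cM.
have hn : \forall e \near 0^'+, [set: M] `<=` P e.
  apply: (nc R 0^'+ P) => p0 _; have [B [w [AB Bp0]]] := fa_cover FA p0.
  have nB : nbhs p0 B by apply: open_nbhs_nbhs; split=> //; exact: fa_open AB.
  have [e e0 he] := fa_img FA AB Bp0 nB; have e2 : 0 < e / 2 by rewrite divr_gt0.
  exists ([set p | B p /\ N (w p - w p0) < e / 2], [set d | d < e / 2]).
    split=> /=; last exact: nbhs_right_lt.
    exact: filterI nB (fa_cont FA AB Bp0 e2).
  move=> [p d] [/= [Bp wp] de].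
  have hz z : D z < d -> exists q, B q /\ w q = w p + toC z.
    move=> zd; have [|q [_ Bq wq]] := he (w p + toC z); last by exists q.
    by rewrite addrAC; apply: le_lt_trans (ND _ _) _; move: zd de wp; lra.
  pose psi z := if pselect (D z < d) is left h then projT1 (cid (hz z h)) else p.
  have hpsi z : D z < d -> B (psi z) /\ w (psi z) = w p + toC z.
    by move=> zd; rewrite /psi; case: pselect => // h; exact: projT2 (cid (hz z h)).
  exists psi; split.
    have [d0|d0] := boolP (D (0 : V) < d); last by rewrite /psi; case: pselect => // h; rewrite h in d0.
    have [B0 w0] := hpsi 0 d0; apply: (fa_inj FA AB B0 Bp).
    by rewrite w0 toC0 addr0.
  move=> z zd; have [Bz wz] := hpsi z zd; exists B, w; split=> //.
  have dz0 : 0 < d - D z by rewrite subr_gt0.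
  apply: filterS (near_D z dz0) => u uz.
  have ud : D u < d.
    have := ND (toC (u - z)) (toC z); rewrite -toCD subrK => h.
    by apply: le_lt_trans h _; move: uz; lra.
  have [Bu wu] := hpsi u ud; split=> //.
  by rewrite wu wz toCB; ring.
have [e [e0 he]] := filter_ex (filterI (nbhs_right_gt (0 : R)) hn).
by exists e => // p; exact: he.
Qed.

Variable p0 : M.
Variable e : R.
Hypothesis e0 : 0 < e.
Hypothesis he : forall p, exists psi, psi 0 = p /\ forall z, D z < e -> flat psi z.

Definition F0 : V -> M := projT1 (cid (he p0)).
Lemma F0_0 : F0 0 = p0. Proof. exact: (projT2 (cid (he p0))).1. Qed.
Lemma F0_flat z : D z < e -> flat F0 z. Proof. exact: (projT2 (cid (he p0))).2. Qed.

Definition extends r := exists F, (\forall u \near (0 : V), F u = F0 u) /\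
  forall z, D z < r -> flat F z.

Lemma D0 : D (0 : V) = 0. Proof. by rewrite toC0 Normc.normc0. Qed.

Lemma flat_segment F c r x v : (forall z, D (z - c) < r -> flat F z) ->
  D (x - c) < r -> D (x + v - c) < r -> forall t : R, 0 <= t <= 1 -> flat F (x + t *: v).
Proof. by move=> h h1 h2 t t01; apply: h; exact: D_convex. Qed.

Lemma flat_match F a : flat F a -> exists psi, (\forall u \near a, F u = psi u) /\
  forall z, D (z - a) < e -> flat psi z.
Proof.
move=> fF; have [psi [p1 p2]] := he (F a).
have f0 : flat psi 0 by apply: p2; rewrite D0.
have [om o3 ho] := flat_germ fF f0 (esym p1).
exists (fun u => psi (0 + rot om (u - a))); split=> // z za.
apply: flat_rot => //; apply: p2; rewrite add0r toC_rot Normc.normcM unit_N // mul1r.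
by [].
Qed.

(** Each point a of the disc of radius r carries a flat map [psi a] on the disc of radius e about a.
    A point u of the larger disc is assigned the value of [psi (k *: u)], where k shrinks the larger
    disc into the smaller one and moves u by less than e. *)
Lemma extends_step r : 0 < r -> extends r -> extends (r + e / 2).
Proof.
move=> r0 [F [F00 fF]].
have hpsi a : exists psi, D a < r -> (\forall u \near a, F u = psi u) /\
    forall z, D (z - a) < e -> flat psi z.
  have [ar|ar] := pselect (D a < r); last by exists F.
  by have [psi h] := flat_match (fF a ar); exists psi.
pose psi a := projT1 (cid (hpsi a)).
have psiP a : D a < r -> (\forall u \near a, F u = psi a u) /\
    forall z, D (z - a) < e -> flat (psi a) z := projT2 (cid (hpsi a)).
have fF0 z : D (z - 0) < r -> flat F z by rewrite subr0; exact: fF.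
have sub0 a : D a < r -> D (a - 0) < r by rewrite subr0.
(* The midpoint of [a] and [b] lies in the disc where [F] is defined. *)
have cons a b u : D a < r -> D b < r -> D (u - a) < e -> D (u - b) < e -> psi a u = psi b u.
  move=> ar br ua ub; have [Fa fa] := psiP a ar; have [Fb fb] := psiP b br.
  pose m := a + (2^-1 : R) *: (b - a).
  have half : 0 <= (2^-1 : R) <= 1 by apply/andP; split; lra.
  have mr : D (m - 0) < r by apply: D_convex half; [exact: sub0|rewrite [a + _]addrC subrK; exact: sub0].
  have ab : D (a - b) < e + e.
    by apply: le_lt_trans (D_triangle a u b) _; rewrite (D_sub a u); lra.
  have Nh : N (2^-1 : R)%:C%C = 2^-1 by rewrite N_real ger0_norm //; lra.
  have ma : D (m - a) < e.
    by rewrite /m addrC addKr toCZ Normc.normcM Nh D_sub; move: ab; lra.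
  have mb : D (m - b) < e.
    have -> : m - b = (2^-1 : R) *: (a - b) by apply/rowP => j; rewrite !mxE; lra.
    by rewrite toCZ Normc.normcM Nh; move: ab; lra.
  have near_m c : D c < r -> D (m - c) < e -> (\forall u \near c, F u = psi c u) ->
      (forall z, D (z - c) < e -> flat (psi c) z) -> \forall u \near m, F u = psi c u.
    move=> cr mc Fc fc; have -> : m = c + (m - c) by rewrite addrC subrK.
    apply: flat_unique Fc => t t01; split.
      by apply: flat_segment fF0 _ _ _ t01; [exact: sub0|rewrite [c + _]addrC subrK].
    apply: (flat_segment (c := c) (r := e)) t01 => //; first by rewrite subrr D0.
    by rewrite [c + _]addrC subrK.
  have h : \forall u \near m, psi a u = psi b u.
    by apply: filterS2 (near_m a ar ma Fa fa) (near_m b br mb Fb fb) => y <-.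
  have -> : u = m + (u - m) by rewrite addrC subrK.
  apply: (@nbhs_singleton _ (m + (u - m)) (fun y => psi a y = psi b y)).
  apply: flat_unique h => t t01; split.
    by apply: flat_segment fa _ _ _ t01 => //; rewrite [m + _]addrC subrK.
  by apply: flat_segment fb _ _ _ t01 => //; rewrite [m + _]addrC subrK.
pose k := r / (r + e / 2); have k1 : 0 < r + e / 2 by move: e0 r0; lra.
have k0 : 0 < k by rewrite divr_gt0.
have kr u : D u < r + e / 2 -> D (k *: u) < r /\ D (u - k *: u) < e.
  move=> ur; split.
    by rewrite toCZ Normc.normcM N_real (ger0_norm (ltW k0)) /k mulrAC ltr_pdivrMr // ltr_pM2l.
  have -> : u - k *: u = (1 - k) *: u by rewrite scalerBl scale1r.
  have kk : 1 - k = (e / 2) / (r + e / 2).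
    by rewrite /k; field; rewrite gt_eqF //; move: e0 r0; lra.
  rewrite toCZ Normc.normcM N_real kk ger0_norm; last by rewrite ltW // !divr_gt0.
  rewrite mulrAC ltr_pdivrMr //; apply: lt_trans (_ : e / 2 * (r + e / 2) < _).
    by rewrite ltr_pM2l // divr_gt0.
  by rewrite ltr_pM2r //; move: e0; lra.
exists (fun u => psi (k *: u) u); split.
  have [h1 h2] := psiP 0 (eq_ind_r (fun x => x < r) r0 D0).
  apply: filterS2 (filterI F00 h1) (filterI (near_D 0 e0) (near_D 0 k1)) => u [<- ->] [].
  rewrite subr0 => ue uk; have [h3 h4] := kr u uk.
  by apply: cons => //; rewrite ?D0 ?subr0.
move=> z zr; have [h1 h2] := kr z zr; have [h3 h4] := psiP _ h1.
apply: flat_ext (h4 z h2).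
have d1 : 0 < r + e / 2 - D z by rewrite subr_gt0.
have d2 : 0 < e - D (z - k *: z) by rewrite subr_gt0.
apply: filterS2 (near_D z d1) (near_D z d2) => u u1 u2.
have ur : D u < r + e / 2.
  by have := D_triangle u z 0; rewrite !subr0; move: u1; lra.
have [h5 h6] := kr u ur; apply: cons => //.
by apply: le_lt_trans (D_triangle u z _) _; move: u2; lra.
Qed.

Lemma extends_all r : extends r.
Proof.
have hn n : extends (e + n%:R * (e / 2)).
  elim: n => [|n IH].
    rewrite mul0r addr0; exists F0; split; last exact: F0_flat.
    by apply: filterE.
  rewrite -natr1 mulrDl mul1r addrA; apply: extends_step => //.
  by rewrite ltr_wpDr // mulr_ge0 // ltW // divr_gt0.
have [n nr] : exists n : nat, r < n%:R * (e / 2).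
  exists (Num.truncn `|r / (e / 2)|).+1; rewrite -ltr_pdivrMr ?divr_gt0 //.
  by apply: le_lt_trans (ler_norm _) _; exact: truncnS_gt.
have [F [h1 h2]] := hn n; exists F; split=> // z zr; apply: h2.
by apply: lt_trans zr _; move: nr e0; lra.
Qed.

(** Extensions to discs of different radii agree by [flat_unique] along rays; at z the one whose
    radius is the first integer above |z| is used. *)
Lemma developing : exists F, F 0 = p0 /\ forall z, flat F z.
Proof.
pose Fn n := projT1 (cid (extends_all n.+1%:R)).
have Fn0 n : \forall u \near (0 : V), Fn n u = F0 u by exact: (projT2 (cid (extends_all n.+1%:R))).1.
have Fnf n z : D z < n.+1%:R -> flat (Fn n) z by exact: (projT2 (cid (extends_all n.+1%:R))).2.
have cons m n z : D z < m.+1%:R -> D z < n.+1%:R -> Fn m z = Fn n z.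
  move=> zm zn; have -> : z = 0 + z by rewrite add0r.
  apply: (@nbhs_singleton _ (0 + z) (fun u => Fn m u = Fn n u)).
  apply: flat_unique; last by apply: filterS2 (Fn0 m) (Fn0 n) => u -> ->.
  have dz (k : nat) : D z < k.+1%:R -> forall t : R, 0 <= t <= 1 -> flat (Fn k) (0 + t *: z).
    move=> zk t t01; apply: (flat_segment (c := 0) (r := k.+1%:R)) t01.
    - by move=> y; rewrite subr0; exact: Fnf.
    - by rewrite subr0 D0.
    - by rewrite subr0 add0r.
  by move=> t t01; split; exact: dz.
have trP z : D z < (Num.truncn (D z)).+1%:R by exact: truncnS_gt.
exists (fun z => Fn (Num.truncn (D z)) z); split.
  by rewrite (nbhs_singleton (Fn0 _)) F0_0.
move=> z; have zn : D z < (Num.truncn (D z)).+1%:R by [].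
apply: flat_ext (Fnf _ _ zn); have d1 : 0 < (Num.truncn (D z)).+1%:R - D z by rewrite subr_gt0.
apply: filterS (near_D z d1) => u ud; apply: cons => //.
by have := D_triangle u z 0; rewrite !subr0; move: ud; lra.
Qed.

Variable F : V -> M.
Hypothesis fF : forall z, flat F z.

Lemma developing_germ psi z u : flat psi u -> F z = psi u ->
  exists2 om, om ^+ 3 = 1 &
  forall v, (forall t : R, 0 <= t <= 1 -> flat psi (u + t *: rot om v)) -> F (z + v) = psi (u + rot om v).
Proof.
move=> fp h; have [om o3 ho] := flat_germ (fF z) fp h; exists om => // v hv.
have e1 y : u + rot om (z + y - z) = u + rot om y by rewrite [z + y]addrC addrK.
rewrite -e1; apply: (@nbhs_singleton _ (z + v) (fun y => F y = psi (u + rot om (y - z)))).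
apply: (@flat_unique F (fun y => psi (u + rot om (y - z)))) ho => t t01; split=> //.
by apply: flat_rot => //; rewrite e1 rotZ; exact: hv.
Qed.

(** The image is open because flat maps are. If it meets the disc of a flat map around q, then F can
    be continued along the radius up to q itself, so it is also closed. *)
Lemma developing_surj p : exists z, F z = p.
Proof.
apply: (@clopen_connected M [set: M] [set p | exists z, F z = p] conM _ _ (F 0) p) => //=.
- move=> _ _ [z <-]; have := flat_open (fF z) (near_D z ltr01).
  by apply: filterS => q [u _ <-]; exists u.
- move=> q _ nq; have [psi [p1 p2]] := he q.
  have f0 : flat psi 0 by apply: p2; rewrite D0.
  have := flat_open f0 (near_D 0 e0); rewrite p1; apply: filterS => _ [u ue <-] [z hz].
  rewrite subr0 in ue; apply: nq.
  have [om o3 hom] := developing_germ (p2 u ue) hz.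
  pose v := rot om^-1 (- u).
  have ov : rot om v = - u.
    by apply: toC_inj; rewrite !toC_rot mulrA divff ?mul1r // unit_neq0.
  exists (z + v); rewrite hom ov ?subrr // => t /andP[t0 t1]; apply: p2.
  have -> : u + t *: - u = (1 - t) *: u by rewrite scalerN scalerBl scale1r.
  rewrite toCZ Normc.normcM N_real ger0_norm ?subr_ge0 //.
  by apply: le_lt_trans ue; rewrite ler_piMl ?N_ge0 // lerBlDr lerDl.
- by exists 0.
Qed.

(* If the germs at [z] and [w] differ by a nontrivial rotation, [F] is invariant
   under a rotation of the plane, which contradicts injectivity near its centre. *)
Lemma developing_period z w : F z = F w -> forall u, F (u + (w - z)) = F u.
Proof.
move=> h; have [om o3 hom] := developing_germ (fF w) h.
have G u : F u = F (w + rot om (u - z)).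
  by rewrite -hom; [rewrite [z + _]addrC subrK|move=> t _; exact: fF].
have [w1|w1] := eqVneq om 1.
  move=> u; rewrite [RHS]G w1 /rot mul1r toCK; congr F.
  by rewrite addrCA.
have o1' : 1 - om != 0 by rewrite subr_eq0 eq_sym.
(* The fixed point of u |-> w + om (u - z). *)
pose u0 := ofC ((toC w - om * toC z) / (1 - om)).
have [d d0 hd] := flat_inj (fF u0).
pose h1 : V := (d / 2) *: basis_vec R 0.
have Dh : D h1 = d / 2.
  have -> : toC h1 = (d / 2)%:C%C.
    by rewrite toCZ [toC _](_ : _ = 1) ?mulr1 //; apply: complex_eq; rewrite /= mxE.
  by rewrite N_real ger0_norm // ltW // divr_gt0.
have e1 : w + rot om (u0 + h1 - z) = u0 + rot om h1.
  apply: toC_inj; rewrite (toCD w) (toCD u0) !toC_rot toCB toCD /u0 ofCK; field; exact: o1'.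
have hd2 : d / 2 < d by rewrite ltr_pdivrMr // mulr_natr mulr2n ltrDl.
have : u0 + h1 = u0 + rot om h1.
  apply: hd.
  - by rewrite addrC addKr Dh.
  - by rewrite addrC addKr toC_rot Normc.normcM (unit_N o3) mul1r Dh.
  - by rewrite [LHS]G e1.
move=> /addrI /(congr1 toC); rewrite toC_rot => e2.
have : (1 - om) * toC h1 = 0 by rewrite mulrBl mul1r -e2 subrr.
move=> /eqP; rewrite mulf_eq0 (negbTE o1') /= -N_eq0 Dh.
by rewrite gt_eqF // divr_gt0.
Qed.

(** The images of the discs around 0 are open and exhaust M, so by compactness one of them is M. *)
Lemma developing_bounded : exists r, forall z, exists2 z', D z' < r & F z' = F z.
Proof.
pose P r p := exists2 z', D z' < r & F z' = p.
have nc := (compact_near_coveringP [set: M]).1 cM.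
have hn : \forall r \near +oo, [set: M] `<=` P r.
  apply: (nc R +oo P) => p _; have [z <-] := developing_surj p.
  exists ([set q | exists2 u, D (u - z) < 1 & F u = q], [set r | D z + 1 < r]).
    split=> /=; last by apply: nbhs_pinfty_gt; rewrite num_real.
    by apply: flat_open (fF z) (near_D z ltr01).
  move=> [q r] [/= [u uz <-] rz]; exists u => //.
  by have := D_triangle u z 0; rewrite !subr0; move: uz rz; lra.
have [r hr] := filter_ex hn; exists r => z; exact: hr.
Qed.
End FlatSurface.

(** * Lattices and the torus *)

Section Lattice.
Context {R : realType}.
Notation V := 'rV[R]_2.
Notation C := R[i].
Notation N := (@Normc.normc R).
Notation D v := (N (toC v)).
Implicit Types (u v z : V).

Definition ip2 u v : R := u 0 0 * v 0 0 + u 0 1 * v 0 1.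
Definition det2 u v : R := u 0 0 * v 0 1 - u 0 1 * v 0 0.

Lemma D_sqr v : D v ^+ 2 = ip2 v v.
Proof. by rewrite N_sqr /ip2 -!expr2. Qed.

Lemma D_le v w : (D v <= D w) = (ip2 v v <= ip2 w w).
Proof. by rewrite -!D_sqr ler_pXn2r // nnegrE N_ge0. Qed.

Lemma D_eq0 v : (D v == 0) = (v == 0).
Proof. by rewrite N_eq0 -[0]toC0 (inj_eq toC_inj). Qed.

Section Separated.
Variables (S : set V) (d : R).
Hypotheses (d0 : 0 < d) (sep : forall x y, S x -> S y -> D (x - y) < d -> x = y).

Lemma separated_closed : closed S.
Proof.
rewrite -openC openE => z nSz; rewrite /interior.
have d2 : 0 < d / 2 by rewrite divr_gt0.
have [[x [Sx xz]]|no] := pselect (exists x, S x /\ D (x - z) < d / 2); last first.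
  by apply: filterS (near_D z d2) => y yz Sy; apply: no; exists y.
have xz0 : 0 < D (x - z).
  by rewrite N_gt0 -[0]toC0 (inj_eq toC_inj) subr_eq0; apply/eqP => e; apply: nSz; rewrite -e.
apply: filterS2 (near_D z d2) (near_D z xz0) => y yz1 yz2 Sy.
have : y = x.
  apply: sep => //; apply: le_lt_trans (D_triangle y z x) _.
  by rewrite (D_sub z x); move: xz yz1; lra.
by move=> e; move: yz2; rewrite e ltxx.
Qed.

Lemma separated_min : S !=set0 -> exists2 x, S x & forall y, S y -> D x <= D y.
Proof.
move=> [x0 Sx0]; pose K := S `&` [set y : V | ip2 y y <= ip2 x0 x0].
have cq : continuous (fun y : V => N (toC y) ^+ 2) by exact: N_toC_continuous.
have cK : compact K.
  apply: (subclosed_compact _ (compact_square (x0 := (0 : V)) (r := D x0))).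
    apply: closedI; first exact: separated_closed.
    rewrite (_ : [set y : V | _] = (fun y : V => N (toC y) ^+ 2) @^-1` [set t : R | t <= ip2 x0 x0]).
      by apply: closed_comp; [move=> y _; exact: cq|exact: closed_le].
    by apply/seteqP; split=> y; rewrite /= D_sqr.
  by move=> y [_] /=; rewrite -D_le subr0 => h; apply: le_trans (mx_norm_le_N _) h.
have K0 : K !=set0 by exists x0; split=> //=.
have [x /set_mem [Sx xx] hx] := compact_EVT_min K0 cK (continuous_subspaceT cq).
exists x => // y Sy; rewrite D_le; have [h|h] := leP (ip2 y y) (ip2 x0 x0).
  by have := hx y; rewrite inE !D_sqr; apply.
by apply: le_trans xx _; exact: ltW.
Qed.
End Separated.

Lemma nearest_int (t : R) : exists m : int, `|t - m%:~R| <= 2^-1.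
Proof.
exists (Num.floor (t + 2^-1)); have /andP[h1 h2] := floor_itv (t + 2^-1).
by move: h1 h2; rewrite intrD ler_norml => h1 h2; apply/andP; split; lra.
Qed.

Lemma half_sqr (x : R) : `|x| <= 2^-1 -> x ^+ 2 <= 4^-1.
Proof. by rewrite ler_norml => /andP[h1 h2]; nra. Qed.

Lemma ip2_comb (s t : R) u v : ip2 (s *: u + t *: v) (s *: u + t *: v) =
  s ^+ 2 * ip2 u u + 2 * (s * t) * ip2 u v + t ^+ 2 * ip2 v v.
Proof. by rewrite /ip2 !mxE; ring. Qed.

Variables (L : set V) (d r : R).
Hypotheses (d0 : 0 < d) (LB : forall x y, L x -> L y -> L (x - y)).
Hypotheses (L0 : L 0) (sep : forall x, L x -> D x < d -> x = 0).
Hypothesis cob : forall z, exists2 l, L l & D (z - l) < r.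

Let sepL (S : set V) : S `<=` L -> forall x y, S x -> S y -> D (x - y) < d -> x = y.
Proof. by move=> SL x y /SL Lx /SL Ly h; apply/eqP; rewrite -subr_eq0 (sep (LB Lx Ly) h). Qed.

Lemma lattice_scale (m : int) u : L u -> L (m%:~R *: u).
Proof.
move=> Lu; have LN x : L x -> L (- x) by move=> Lx; rewrite -[- x]add0r; exact: LB.
have Ln (n : nat) : L (n%:R *: u).
  elim: n => [|n IH]; first by rewrite scale0r.
  rewrite -natr1 scalerDl scale1r -[u in _ + u]opprK; apply: LB => //; exact: LN.
case: m => n; first exact: Ln.
by rewrite NegzE rmorphN /= scaleNr; apply: LN; exact: Ln.
Qed.

(* A shortest nonzero vector of [L], and a shortest one outside its multiples. *)
Lemma lattice_basis : exists u v, [/\ det2 u v != 0, L u, L v &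
  forall l, L l -> exists m n : int, l = m%:~R *: u + n%:~R *: v].
Proof.
have r0 : 0 < r by have [l _] := cob 0; apply: le_lt_trans; exact: N_ge0.
have D_E (t : R) : 0 <= t -> D (t *: basis_vec R 0) = t.
  move=> t0; have -> : toC (t *: basis_vec R 0) = t%:C%C.
    by rewrite toCZ [toC _](_ : _ = 1) ?mulr1 //; apply: complex_eq; rewrite /= mxE.
  by rewrite N_real ger0_norm.
have [u [Lu u0] umin] : exists2 u, L u /\ u != 0 & forall y, L y /\ y != 0 -> D u <= D y.
  apply: (separated_min d0 (S := [set y | L y /\ y != 0])); first by apply: sepL => y [].
  have [l Ll lr] := cob (r *: basis_vec R 0); exists l; split=> //.
  by apply/eqP => l0; move: lr; rewrite l0 subr0 D_E ?ltxx // ltW.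
have uu : 0 < ip2 u u by rewrite -D_sqr exprn_gt0 // lt_neqAle N_ge0 andbT eq_sym D_eq0.
pose Zu : set V := [set y | exists m : int, y = m%:~R *: u].
have [v [Lv nv] vmin] : exists2 v, L v /\ ~ Zu v & forall y, L y /\ ~ Zu y -> D v <= D y.
  apply: (separated_min d0 (S := [set y | L y /\ ~ Zu y])); first by apply: sepL => y [].
  (* A vector of length r orthogonal to u: all multiples of u are at distance at least r from it, so
     the element of L within r of it is not one of them. *)
  pose z : V := (r / D u) *: (- u 0 1 *: basis_vec R 0 + u 0 0 *: basis_vec R 1).
  have [l Ll lr] := cob z; exists l; split=> // -[m lE]; move: lr; rewrite ltNge => /negP; apply.
  have Du : 0 < D u by rewrite lt_neqAle N_ge0 andbT eq_sym D_eq0.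
  rewrite -(ler_pXn2r (n := 2)) ?nnegrE ?N_ge0 ?(ltW r0) // D_sqr lE.
  have -> : ip2 (z - m%:~R *: u) (z - m%:~R *: u) = (r / D u) ^+ 2 * ip2 u u + m%:~R ^+ 2 * ip2 u u.
    by rewrite /ip2 /z !mxE /=; ring.
  rewrite -D_sqr expr_div_n mulfVK ?expf_neq0 ?gt_eqF // lerDl mulr_ge0 ?sqr_ge0 //.
have ZuL y : Zu y -> L y by move=> [m ->]; exact: lattice_scale.
have uv : ip2 u u <= ip2 v v.
  rewrite -D_le; apply: umin; split=> //; apply/eqP => v0; apply: nv.
  by exists 0; rewrite v0 scale0r.
have shift (m : int) : ~ Zu (v + m%:~R *: u).
  move=> [k hk]; apply: nv; exists (k - m); rewrite rmorphB /= scalerBl -hk addrK //.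
have Lshift (m : int) : L (v + m%:~R *: u).
  by rewrite -[_ *: u]opprK; apply: LB => //; rewrite -scaleNr -rmorphN; exact: lattice_scale.
have vm (m : int) : ip2 v v <= ip2 (v + m%:~R *: u) (v + m%:~R *: u).
  by rewrite -D_le; apply: vmin.
(* From the minimality of v against v + u and v - u. *)
have c1 : 2 * `|ip2 u v| <= ip2 u u.
  have := vm 1; have := vm (- 1); rewrite rmorphN rmorph1 scaleN1r scale1r.
  have -> : ip2 (v - u) (v - u) = ip2 v v - 2 * ip2 u v + ip2 u u by rewrite /ip2 !mxE; ring.
  have -> : ip2 (v + u) (v + u) = ip2 v v + 2 * ip2 u v + ip2 u u by rewrite /ip2 !mxE; ring.
  by case: (ler0P (ip2 u v)) => _; lra.
have det0 : det2 u v != 0.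
  apply/eqP => dt; pose t := ip2 u v / ip2 u u.
  have vt : v = t *: u.
    have e j : ip2 u u * v 0 j = ip2 u v * u 0 j.
      have e0 : ip2 u u * v 0 0 - ip2 u v * u 0 0 = - u 0 1 * det2 u v.
        by rewrite /ip2 /det2; ring.
      have e1 : ip2 u u * v 0 1 - ip2 u v * u 0 1 = u 0 0 * det2 u v.
        by rewrite /ip2 /det2; ring.
      by move: j; apply: ord2_ind; apply/eqP; rewrite -subr_eq0 ?e0 ?e1 dt mulr0.
    apply/rowP => j; rewrite mxE /t mulrAC -e mulrAC divff ?mul1r // gt_eqF //.
  have [m hm] := nearest_int t; have := vm (- m); have : v + (- m)%:~R *: u = (t - m%:~R) *: u.
    by rewrite {1}vt -scalerDl rmorphN.
  move=> ->; have -> : ip2 ((t - m%:~R) *: u) ((t - m%:~R) *: u) = (t - m%:~R) ^+ 2 * ip2 u u.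
    by rewrite /ip2 !mxE; ring.
  have h4 := half_sqr hm.
  have h5 := ler_wpM2r (ltW uu) h4 => h6.
  have : ip2 v v <= 4^-1 * ip2 v v by apply: le_trans h6 (le_trans h5 _); rewrite ler_wpM2l // invr_ge0.
  by move: uv uu; lra.
exists u, v; split=> // l Ll.
pose s := det2 l v / det2 u v; pose t := det2 u l / det2 u v.
have lE : l = s *: u + t *: v.
  apply/rowP => j; rewrite !mxE /s /t.
  by move: j; apply: ord2_ind; move: det0; rewrite /det2 => h; field.
have [m hm] := nearest_int s; have [n hn] := nearest_int t.
pose l' := l - (m%:~R *: u + n%:~R *: v).
have Ll' : L l'.
  apply: LB => //; rewrite -[n%:~R *: v]opprK; apply: LB; first exact: lattice_scale.
  by rewrite -scaleNr -rmorphN; exact: lattice_scale.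
have l'E : l' = (s - m%:~R) *: u + (t - n%:~R) *: v.
  by rewrite /l' lE; apply/rowP => j; rewrite !mxE; ring.
have [[k hk]|nl'] := pselect (Zu l').
  exists (k + m), n; rewrite rmorphD /= scalerDl -hk /l'.
  by rewrite opprD addrA -!addrA; apply/rowP => j; rewrite !mxE; ring.
have := vmin l' (conj Ll' nl'); rewrite D_le l'E ip2_comb.
have vv : 0 < ip2 v v by exact: lt_le_trans uu uv.
have hs := half_sqr hm; have ht := half_sqr hn.
(* With |a|, |b| <= 1/2, the bound [c1] gives |l'|^2 <= 3/4 |v|^2, against the minimality of v. *)
set a := s - m%:~R in hm hs *; set b := t - n%:~R in hn ht *.
have ab : `|a * b| <= 4^-1.
  rewrite normrM (_ : 4^-1 = 2^-1 * 2^-1 :> R); first exact: ler_pM.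
  by rewrite -invfM -natrM.
have h1 : a ^+ 2 * ip2 u u <= 4^-1 * ip2 v v.
  by apply: ler_pM => //; [exact: sqr_ge0|exact: ltW].
have h2 : 2 * (a * b) * ip2 u v <= 4^-1 * ip2 v v.
  apply: le_trans (ler_norm _) _; rewrite !normrM -normrM ger0_norm // mulrAC mulrC.
  by apply: ler_pM => //; exact: le_trans c1 uv.
have h3 : b ^+ 2 * ip2 v v <= 4^-1 * ip2 v v by rewrite ler_wpM2r // ltW.
move=> h; exfalso; have := le_trans h (lerD (lerD h1 h2) h3); move: vv.
by move: (ip2 v v) => x; lra.
Qed.
End Lattice.

(** * The circle as R modulo Z *)

Section Circle.
Context {R : realType}.

Definition circle (s : R) : 'rV[R]_2 :=
  cos (pi *+ 2 * s) *: basis_vec R 0 + sin (pi *+ 2 * s) *: basis_vec R 1.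

Lemma circle_continuous : continuous circle.
Proof.
have c2 : continuous (fun s : R => pi *+ 2 * s) by exact: mulrl_continuous.
move=> x; apply: (@continuousD _ _ _ (fun s : R => cos (pi *+ 2 * s) *: basis_vec R 0)
  (fun s : R => sin (pi *+ 2 * s) *: basis_vec R 1)).
  apply: (@continuous_comp _ _ _ (fun s : R => cos (pi *+ 2 * s)) (fun a : R => a *: basis_vec R 0)).
    by apply: (@continuous_comp _ _ _ (fun s : R => pi *+ 2 * s) cos); [exact: c2|exact: continuous_cos].
  exact: scalel_continuous.
apply: (@continuous_comp _ _ _ (fun s : R => sin (pi *+ 2 * s)) (fun a : R => a *: basis_vec R 1)).
  by apply: (@continuous_comp _ _ _ (fun s : R => pi *+ 2 * s) sin); [exact: c2|exact: continuous_sin].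
exact: scalel_continuous.
Qed.

Lemma circleE s : circle s 0 0 = cos (pi *+ 2 * s) /\ circle s 0 1 = sin (pi *+ 2 * s).
Proof. by rewrite !mxE /= !(mulr1, mulr0, addr0, add0r). Qed.

Lemma dot2E (x y : 'rV[R]_2) : dot x y = x 0 0 * y 0 0 + x 0 1 * y 0 1.
Proof. by rewrite /dot mxE !big_ord_recl big_ord0 !mxE addr0; congr (_ * _ + x _ _ * y _ _); apply: val_inj. Qed.

Lemma circle_usphere s : usphere R 1 (circle s).
Proof. by have [e0 e1] := circleE s; rewrite /usphere /= dot2E e0 e1 -!expr2 cos2Dsin2. Qed.

Lemma pi2_gt0 : 0 < pi *+ 2 :> R. Proof. by rewrite mulrn_wgt0 // pi_gt0. Qed.

Lemma circle_surj x : usphere R 1 x -> exists s, circle s = x.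
Proof.
rewrite /usphere /= dot2E -!expr2 => xx.
have x1 : -1 <= x 0 0 <= 1.
  rewrite -ler_norml -(ler_pXn2r (n := 2)) ?nnegrE // real_normK ?num_real // expr1n -xx lerDl.
  exact: sqr_ge0.
have sE : 1 - x 0 0 ^+ 2 = x 0 1 ^+ 2 by rewrite -xx addrAC subrr add0r.
have [t [ct st]] : exists t, cos t = x 0 0 /\ sin t = x 0 1.
  have aK : cos (acos (x 0 0)) = x 0 0 by rewrite acosK // in_itv.
  have [h|h] := leP 0 (x 0 1).
    by exists (acos (x 0 0)); rewrite sin_acos // sE sqrtr_sqr ger0_norm.
  by exists (- acos (x 0 0)); rewrite cosN sinN sin_acos // sE sqrtr_sqr ltr0_norm ?opprK.
exists (t / (pi *+ 2)); rewrite [RHS]row2E /circle mulrC divfK ?ct ?st // gt_eqF //; exact: pi2_gt0.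
Qed.

Lemma periodic_int (f : R -> R) (T : R) : periodic f T -> forall (m : int) a, f (a + T * m%:~R) = f a.
Proof.
move=> fT [n|n] a; first by rewrite -[n%:~R]/(n%:R) mulr_natr periodicn.
rewrite NegzE rmorphN /= mulrN -[n.+1%:~R]/(n.+1%:R) mulr_natr.
by rewrite -(periodicn fT n.+1) subrK.
Qed.

Lemma circle_int (m : int) s : circle (s + m%:~R) = circle s.
Proof.
by rewrite /circle mulrDr (periodic_int (@cosD2pi R)) (periodic_int (@sinD2pi R)).
Qed.

Lemma circle_inj s t : circle s = circle t -> exists m : int, s = t + m%:~R.
Proof.
move=> e; have [e0 e1] := circleE s; have [e2 e3] := circleE t; rewrite e in e0 e1.
pose m := Num.floor (s - t); exists m; pose x := s - t - m%:~R.
have /andP[h1 h2] := floor_itv (s - t); rewrite intrD in h2.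
have x0 : 0 <= x by rewrite subr_ge0.
have x1 : x < 1 by rewrite /x /m; lra.
have cx : cos (pi *+ 2 * x) = 1.
  have -> : pi *+ 2 * x = (pi *+ 2 * s - pi *+ 2 * t) + pi *+ 2 * (- m)%:~R.
    by rewrite /x rmorphN /=; ring.
  rewrite (periodic_int (@cosD2pi R)) cosB -e0 -e1 e2 e3 -!expr2; exact: cos2Dsin2.
suff : x = 0 by rewrite /x; lra.
have p0 := pi_gt0 R; have [h|h] := leP (pi *+ 2 * x) pi.
  have : pi *+ 2 * x = 0.
    apply: cos_inj; rewrite ?in_itv /= ?h ?cos0 ?lexx ?(ltW p0) // andbT.
    by rewrite mulr_ge0 // mulrn_wge0 // ltW.
  by move/eqP; rewrite mulf_eq0 gt_eqF ?pi2_gt0 //= => /eqP.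
have : pi *+ 2 - pi *+ 2 * x = 0.
  have q0 : 0 <= pi *+ 2 - pi *+ 2 * x.
    by rewrite -[X in X - _]mulr1 -mulrBr mulr_ge0 ?subr_ge0 ?(ltW x1) // ltW // pi2_gt0.
  have q1 : pi *+ 2 - pi *+ 2 * x <= pi by move: h; rewrite [pi *+ 2 in X in X - _]mulr2n; lra.
  apply: cos_inj; rewrite ?in_itv /= ?q0 ?q1 ?lexx ?(ltW p0) //.
  by rewrite cos0 addrC cosD2pi cosN.
move/eqP; rewrite -[X in X - _]mulr1 -mulrBr mulf_eq0 gt_eqF ?pi2_gt0 //= => /eqP.
by move: x1; lra.
Qed.
End Circle.

(** * The quotient of the plane by the periods *)

Section Torus.
Context {R : realType} (M : topologicalType) (F : 'rV[R]_2 -> M).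
Notation V := 'rV[R]_2.
Notation N := (@Normc.normc R).
Notation D v := (N (toC v)).
Hypothesis cM : compact [set: M].
Hypothesis surj : forall p, exists z, F z = p.
Hypothesis openF : forall z (U : set V), nbhs z U -> \forall q \near F z, exists2 u, U u & F u = q.
Hypothesis period : forall z w, F z = F w -> forall u, F (u + (w - z)) = F u.
Hypothesis local_inj : exists2 d, 0 < d & forall u v, D (u - 0) < d -> D (v - 0) < d -> F u = F v -> u = v.
Hypothesis bounded : exists r, forall z, exists2 z', D z' < r & F z' = F z.

(** The coordinates of z in a basis of the lattice of periods, taken modulo 1, depend only on F z
    and determine it. The induced map h is continuous because F is open; its inverse is continuous
    because M is compact. *)
Lemma homeomorphic_torus : homeomorphic_to M (torus R).
Proof.
have [d d0 hd] := local_inj; have [r hr] := bounded.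
pose L : set V := [set c | forall u, F (u + c) = F u].
have L0 : L 0 by move=> u; rewrite addr0.
have LN x : L x -> L (- x) by move=> Lx u; rewrite -[LHS]Lx subrK.
have LB x y : L x -> L y -> L (x - y).
  by move=> Lx Ly u; rewrite addrA (LN y Ly) Lx.
have [|||u [v [dt Lu Lv gen]]] := @lattice_basis R L d r d0 LB.
- by [].
- move=> x Lx xd; apply: hd; rewrite ?subr0 ?toC0 ?Normc.normc0 //.
  by rewrite -[RHS]Lx add0r.
- move=> z; have [z' z'r e] := hr z; exists (z - z'); last by rewrite opprB addrC subrK.
  by move=> x; apply: period.
pose s z := det2 z v / det2 u v; pose t z := det2 u z / det2 u v.
have zE z : z = s z *: u + t z *: v.
  apply/rowP => j; rewrite !mxE /s /t.
  by move: j; apply: ord2_ind; move: dt; rewrite /det2 => h; field.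
have sE a b : s (a *: u + b *: v) = a.
  by rewrite /s /det2 !mxE; move: dt; rewrite /det2 => h; field.
have tE a b : t (a *: u + b *: v) = b.
  by rewrite /t /det2 !mxE; move: dt; rewrite /det2 => h; field.
pose H z := (circle (s z), circle (t z)).
have LE c : L c -> exists m n : int, s c = m%:~R /\ t c = n%:~R.
  by move=> /gen[m [n ->]]; exists m, n; rewrite sE tE.
have Hper z w : F z = F w -> H z = H w.
  move=> e; have Lc : L (w - z) by exact: period.
  have [m [n [h1 h2]]] := LE _ Lc.
  have sw : s w = s z + s (w - z) by rewrite /s /det2 !mxE; ring.
  have tw : t w = t z + t (w - z) by rewrite /t /det2 !mxE; ring.
  by rewrite /H sw tw h1 h2 !circle_int.
have Hinj z w : H z = H w -> F z = F w.
  move=> [/circle_inj[m h1] /circle_inj[n h2]].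
  have Lc : L (m%:~R *: u + n%:~R *: v).
    by rewrite -[n%:~R *: v]opprK; apply: (LB); [|apply: (LN)]; exact: (lattice_scale LB L0).
  rewrite -[RHS]Lc; congr F; rewrite [LHS]zE h1 h2 {3}(zE w).
  by apply/rowP => j; rewrite !mxE; ring.
pose h p := H (projT1 (cid (surj p))).
have hF z : h (F z) = H z by apply: Hper; exact: (projT2 (cid (surj (F z)))).
have hT p : torus R (h p) by split; exact: circle_usphere.
have hI p q : h p = h q -> p = q.
  by move=> e; rewrite -(projT2 (cid (surj p))) -(projT2 (cid (surj q))); exact: Hinj.
have hS y : torus R y -> exists p, h p = y.
  move=> [/circle_surj[a ea] /circle_surj[b eb]]; exists (F (a *: u + b *: v)).
  by rewrite hF /H sE tE ea eb; case: (y).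
have cs : continuous s.
  rewrite (_ : s = lin2 (v 0 1 / det2 u v) (- v 0 0 / det2 u v)); first exact: lin2_continuous.
  by apply: funext => z; rewrite /s /lin2 {1}/det2; ring.
have ct : continuous t.
  rewrite (_ : t = lin2 (- u 0 1 / det2 u v) (u 0 0 / det2 u v)); first exact: lin2_continuous.
  by apply: funext => z; rewrite /t /lin2 {1}/det2; ring.
have cH : continuous H.
  move=> z; have h1 : (fun z => circle (s z)) x @[x --> z] --> circle (s z).
    by apply: (@continuous_comp _ _ _ s (@circle R)); [exact: cs|exact: circle_continuous].
  have h2 : (fun z => circle (t z)) x @[x --> z] --> circle (t z).
    by apply: (@continuous_comp _ _ _ t (@circle R)); [exact: ct|exact: circle_continuous].
  exact: (cvg_pair h1 h2).
have ch : continuous h.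
  move=> p S; have [z <-] := surj p; rewrite hF => /(cH z) nS.
  by apply: filterS (openF nS) => q [w Sw <-]; rewrite /= hF.
have [p0 _] : exists p : M, True by exists (F 0).
pose k y := if pselect (exists p, h p = y) is left e then projT1 (cid e) else p0.
have kK p : k (h p) = p.
  rewrite /k; case: pselect => [e|[]]; last by exists p.
  by apply: hI; exact: (projT2 (cid e)).
have hK y : torus R y -> h (k y) = y.
  by move=> /hS[p <-]; rewrite kK.
exists h, k; split=> //; last by move=> y; rewrite inE; exact: hK.
apply/continuous_closedP => A cA; apply/closed_subspaceP.
exists (h @` A).
  apply: compact_closed; first exact: norm_hausdorff.
  apply: continuous_compact; first exact: continuous_subspaceT.
  exact: (subclosed_compact cA cM).
apply/seteqP; split=> y [].
  by move=> [p Ap <-] Ty; split=> //; change (A (k (h p))); rewrite kK.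
by move=> Ay Ty; split=> //; rewrite -(hK y Ty); exists (k y).
Qed.
End Torus.

(** * The flat structure of a cubic differential without zeros *)

Section FlatStructure.
Context {R : realType} (M : riemannSurface R) (g : M -> 'rV[R]_7) (xi : 'rV[R]_7).
Notation V := 'rV[R]_2.
Notation C := R[i].
Notation N := (@Normc.normc R).
Notation D v := (N (toC v)).
Hypotheses (hg : pseudoholomorphic_curve g) (ig : immersion g).
Hypotheses (xi1 : dot xi xi = 1) (gxi : forall p, dot (g p) xi = 0).
Notation qM := (qM hg ig).
Notation pQ := (pQ g xi).
Hypothesis regular : forall p : M, qM p != 0.

Lemma pQ_neq0 P x : os (pW P) x -> (pQ P : smoothfun (pW P)) x != 0.
Proof.
move=> Wx; have := regular (ptoM P x).
by rewrite (qM_eq0 hg ig xi1 gxi (inP_inv Wx)) px_inv.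
Qed.

(** Coordinates w in which Q = dw^3. The lower bound on differences makes w injective and, through
    [injective_open], open. *)
Definition flat_coord (B : set M) (w : M -> C) :=
  exists (P : cpatch M) (S : oset V) (W : V -> C) (d : R),
  [/\ os S `<=` os (pW P), hol (os S) W,
    forall x, os S x -> cderive 0 W x ^+ 3 = (pQ P : smoothfun (pW P)) x,
    0 < d /\ (forall x y, os S x -> os S y -> d * D (x - y) <= N (W x - W y)) &
    (forall p, B p <-> inP P p /\ os S (px P p)) /\ forall p, B p -> w p = W (px P p)].

Lemma px_near (P : cpatch M) (p : M) (S : oset V) : inP P p -> os S (px P p) ->
  nbhs p [set q : M | inP P q /\ os S (px P q)].
Proof.
move=> Pp Sp; apply: filterI; first exact: inP_near.
apply: (nbhs_patch Pp).
apply: filterS2 (open_nbhs_nbhs (conj (os_open S) Sp))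
  (open_nbhs_nbhs (conj (os_open (pW P)) (px_W Pp))) => y Sy Wy.
by rewrite px_inv.
Qed.

Lemma ptrans_coord P P'' (PP : sub_patch P'' P) (S Q : oset V) W :
  (forall y, os Q y -> os (pW P'') y /\ os S (ptrans P P'' y)) -> hol (os S) W ->
  (forall x, os S x -> cderive 0 W x ^+ 3 = (pQ P : smoothfun (pW P)) x) ->
  hol (os Q) (fun y => W (ptrans P P'' y)) /\
  forall y, os Q y -> cderive 0 (fun y => W (ptrans P P'' y)) y ^+ 3 = (pQ P'' : smoothfun (pW P'')) y.
Proof.
move=> QW hW W3.
have TS y : os Q y -> os S (ptrans P P'' y) by case/QW.
have hT : hol (os Q) (fun y => toC (ptrans P P'' y)).
  by apply: hol_sub (ptrans_hol PP) => y /QW[].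
split; first exact: hol_comp TS hT _ hW.
move=> y Qy; have [Wy Sy] := QW y Qy.
rewrite (cderive0_comp TS hT hW Qy) exprMn W3 //.
rewrite (pQ_trans xi hg ig PP) sfM // pphiE // [RHS]mulrC; congr (_ * _).
have -> : ((pjac P P'' ^+ 3 : sfR (pW P'')) : smoothfun (pW P'')) y = (pjac P P'' : smoothfun (pW P'')) y ^+ 3.
  by rewrite !exprS expr0 !sfM // sf1.
rewrite /pjac sfofE //; exact: csm_derive (hol_csm (ptrans_hol PP)).
Qed.

(** The quotient of the derivatives of two such coordinates is holomorphic with cube 1, hence
    locally constant; so the coordinates differ by a cube root of unity and a translation. *)
Lemma flat_coord_trans B w B' w' p : flat_coord B w -> flat_coord B' w' -> B p -> B' p ->
  exists2 om, om ^+ 3 = 1 & \forall q \near p, w' q - w' p = om * (w q - w p).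
Proof.
move=> [P [S [W [d [SP hW W3 _ [BE wE]]]]]] [P' [S' [W' [d' [SP' hW' W3' _ [BE' wE']]]]]] Bp Bp'.
have [Pp Sp] := (BE p).1 Bp; have [P'p S'p] := (BE' p).1 Bp'.
pose P'' := inter_patch P P'; have P''p : inP P'' p by apply/inter_patchP.
have PP : sub_patch P'' P by move=> q /inter_patchP[].
have PP' : sub_patch P'' P' by move=> q /inter_patchP[].
have near_p : nbhs p [set q : M | (inP P q /\ os S (px P q)) /\ (inP P' q /\ os S' (px P' q))].
  exact: filterI (px_near Pp Sp) (px_near P'p S'p).
have := patch_nbhs P''p near_p.
set x := px P'' p => /nbhs_ballP[r /= r0 hr].
pose Q := Oset (open_square (x0 := x) (r := r)).
have hQ y : os Q y -> [/\ os (pW P'') y, os S (ptrans P P'' y) & os S' (ptrans P' P'' y)].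
  by move=> yr; have [|Wy [[_ Sy] [_ S'y]]] := hr y; rewrite -?ball_normE /ball_ /= 1?distrC.
have [|h1 c1] := @ptrans_coord P P'' PP S Q W _ hW W3; first by move=> y /hQ[].
have [|h2 c2] := @ptrans_coord P' P'' PP' S' Q W' _ hW' W3'; first by move=> y /hQ[].
pose w1 y := W (ptrans P P'' y); pose w2 y := W' (ptrans P' P'' y).
have oQ : open (os Q) := os_open Q.
have Qx : os Q x by rewrite /= subrr normr0.
have c10 y : os Q y -> cderive 0 w1 y != 0.
  move=> Qy; have [Wy _ _] := hQ y Qy; have := pQ_neq0 Wy.
  by rewrite -c1 // expf_eq0.
pose rho y := cderive 0 w2 y * (cderive 0 w1 y)^-1.
have hrho : hol (os Q) rho.
  by apply: hol_mul => //; [|apply: hol_inv => //]; apply: hol_derive.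
have rho3 y : os Q y -> rho y ^+ 3 = 1.
  move=> Qy; rewrite /rho exprMn exprVn c1 // c2 // divff //.
  by have [Wy _ _] := hQ y Qy; exact: pQ_neq0.
have drho y : os Q y -> cderive 0 rho y = 0.
  move=> Qy; have := cderive0_exp 2 oQ hrho Qy.
  rewrite (cderive_ext 0 oQ (G := fun=> 1) rho3 Qy) (cderive_cst 1 0 y) => /eqP.
  rewrite eq_sym mulf_eq0 mulf_eq0 pnatr_eq0 expf_eq0 /= => /orP[/eqP r0'|/eqP //].
  by have := rho3 y Qy; rewrite r0' expr0n /= => /eqP; rewrite eq_sym oner_eq0.
pose om := rho x; exists om; first exact: rho3.
have rhoc y : os Q y -> rho y = om by move=> Qy; exact: (hol_square_const hrho drho).
pose G y := w2 y + - om * w1 y.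
have hG : hol (os Q) G by apply: hol_add => //; apply: hol_mul => //; exact: hol_cst.
have dG y : os Q y -> cderive 0 G y = 0.
  move=> Qy; have so := csm_cst (os Q) (- om).
  rewrite (cderiveD _ (hol_csm h2) (csm_mul oQ so (hol_csm h1)) Qy).
  rewrite (cderiveM _ so (hol_csm h1) Qy) (cderive_cst (- om) 0 y) mul0r add0r.
  by rewrite -(rhoc y Qy) /rho mulNr mulfVK ?subrr // c10.
have Gc y : os Q y -> G y = G x by move=> Qy; exact: (hol_square_const hG dG).
have near_q : nbhs p [set q : M | inP P'' q /\ os Q (px P'' q)] by exact: px_near.
apply: filterS near_q => q [P''q Qq]; have [_ Sq S'q] := hQ _ Qq.
have Tq : ptrans P P'' (px P'' q) = px P q by exact: ptrans_px.
have Tq' : ptrans P' P'' (px P'' q) = px P' q by exact: ptrans_px.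
have Bq : B q by apply/BE; rewrite -Tq; split=> //; exact: PP.
have Bq' : B' q by apply/BE'; rewrite -Tq'; split=> //; exact: PP'.
rewrite !wE // !wE' //; have := Gc _ Qq; rewrite /G /w1 /w2 Tq Tq'.
have -> : ptrans P P'' x = px P p by exact: ptrans_px.
have -> : ptrans P' P'' x = px P' p by exact: ptrans_px.
move=> e; rewrite (_ : W' (px P' q) = W' (px P' p) + - om * W (px P p) + om * W (px P q)).
  by ring.
by rewrite -e mulNr subrK.
Qed.

Lemma flat_coord_atlas : flat_atlas flat_coord.
Proof.
split.
- move=> B w [P [S [W [d [SP hW W3 _ [BE wE]]]]]]; rewrite openE => p /BE[Pp Sp].
  by apply: filterS (px_near Pp Sp) => q h; apply/BE.
- move=> B w p q [P [S [W [d [SP hW W3 [d0 inj] [BE wE]]]]]] Bp Bq.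
  have [Pp Sp] := (BE p).1 Bp; have [Pq Sq] := (BE q).1 Bq.
  rewrite !wE // => e; have := inj _ _ Sp Sq; rewrite e subrr Normc.normc0.
  rewrite pmulr_rle0 // => h; have : D (px P p - px P q) == 0 by rewrite eq_le h N_ge0.
  rewrite N_eq0 -[0]toC0 (inj_eq toC_inj) subr_eq0 => /eqP epq.
  by rewrite -(ptoMK Pp) -(ptoMK Pq) epq.
- move=> B w p e [P [S [W [d [SP hW W3 _ [BE wE]]]]]] Bp e0.
  have [Pp Sp] := (BE p).1 Bp; have e2 : 0 < e / 2 by rewrite divr_gt0.
  have [d1 d10 hd] := csm_continuous_dist (hol_csm hW) Sp e2.
  apply: (nbhs_patch Pp).
  apply: filterS2 (near_D (px P p) d10) (open_nbhs_nbhs (conj (os_open S) Sp)) => y yd Sy.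
  have By : B (ptoM P y).
    by apply/BE; split; [exact: inP_inv (SP _ Sy)|rewrite px_inv //; exact: SP].
  rewrite !wE // px_inv; last exact: SP.
  by apply: le_lt_trans (hd y yd) _; lra.
- move=> B w p T [P [S [W [d [SP hW W3 [d0 inj] [BE wE]]]]]] Bp nT.
  have [Pp Sp] := (BE p).1 Bp.
  have [e1 e10 he1] := nbhs_disc (patch_nbhs Pp nT).
  have [e e0 he] := injective_open (os_open S) d0 hW inj Sp e10.
  exists e => // c; rewrite wE // => /he[y [Sy yd Wy]]; have [_ Ty] := he1 y yd.
  have By : B (ptoM P y).
    by apply/BE; split; [exact: inP_inv (SP _ Sy)|rewrite px_inv //; exact: SP].
  exists (ptoM P y); split=> //; rewrite wE // px_inv //; exact: SP.
- move=> B w om [P [S [W [d [SP hW W3 [d0 inj] [BE wE]]]]]] o3.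
  exists P, S, (fun y => om * W y), d; have oS := os_open S; have so := csm_cst (os S) om.
  split=> //.
  + by apply: hol_mul => //; exact: hol_cst.
  + move=> x Sx; rewrite (cderiveM _ so (hol_csm hW) Sx) (cderive_cst om 0 x) mul0r add0r.
    by rewrite exprMn o3 mul1r W3.
  + split=> // x y Sx Sy; rewrite (_ : _ - _ = om * (W x - W y)); last by rewrite mulrBr.
    by rewrite Normc.normcM (unit_N o3) mul1r; exact: inj.
  + by split=> // p Bp; rewrite wE.
- exact: flat_coord_trans.
- move=> p; pose P := some_patch p; have Pp : inP P p := some_patchP p.
  have [r [W [d [r0 d0 SW hW [W3 inj]]]]] :=
    flat_coordinate (os_open (pW P)) (px_W Pp) (hol_pQ hg ig gxi P) (@pQ_neq0 P).
  pose S := Oset (open_square (x0 := px P p) (r := r)).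
  exists [set q | inP P q /\ os S (px P q)], (fun q => W (px P q)); split.
    by exists P, S, W, d; split=> //; split.
  by split=> //; rewrite /= subrr normr0.
Qed.

Lemma regular_torus : compact [set: M] -> homeomorphic_to M (torus R).
Proof.
move=> cM; have [_ [p0 _] _ _] := hg; have FA := flat_coord_atlas.
have hM := @surface_hausdorff R M; have cnM := @surface_connected R M.
have [e e0 he] := flat_uniform FA cM.
have [F [F0 fF]] := developing FA hM p0 e0 he.
refine (@homeomorphic_torus R M F cM _ _ _ _ _).
- exact: (developing_surj FA hM cnM e0 he fF).
- by move=> z U; exact: (flat_open FA (fF z)).
- exact: (developing_period FA hM fF).
- exact: (flat_inj (fF 0)).
- exact: (developing_bounded FA hM cM cnM e0 he fF).
Qed.
End FlatStructure.

Lemma S5_normal (R : realType) (M : riemannSurface R) (g : M -> 'rV[R]_7) : lies_in_S5 g ->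
  exists2 xi : 'rV[R]_7, dot xi xi = 1 & forall p, dot (g p) xi = 0.
Proof.
move=> [V dV gV]; pose A : 'M[R]_(\dim V, 7) := \matrix_i (vbasis V)`_i.
have : kermx A^T != 0.
  by rewrite -mxrank_eq0 mxrank_ker subn_eq0 -ltnNge; apply: leq_ltn_trans (rank_leq_col _) _; rewrite dV.
move=> /rowV0Pn[u /sub_kermxP hu u0].
have Vu x : x \in V -> dot x u = 0.
  move=> /coord_vbasis ->; rewrite /dot mulmx_suml summxE big1 // => i _.
  rewrite -scalemxAl mxE; have := congr1 (fun B : 'rV[R]_(\dim V) => B 0 i) hu.
  rewrite !mxE => e; rewrite [X in _ * X](_ : _ = 0) ?mulr0 // -[RHS]e.
  by apply: eq_bigr => j _; rewrite !mxE mulrC.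
have uu : 0 < dot u u.
  rewrite lt_neqAle dot_ge0 andbT eq_sym; apply: contra_neq u0 => h; exact: dot_eq0.
exists ((Num.sqrt (dot u u))^-1 *: u).
  rewrite /dot linearZ /= -scalemxAl -scalemxAr [LHS]mxE [X in _ * X]mxE -/(dot u u) mulrA -invfM -expr2.
  by rewrite sqr_sqrtr ?(ltW uu) // mulVf // gt_eqF.
move=> p; have [_ /= Vp] := gV (g p) (ex_intro2 _ _ p Logic.I erefl).
by rewrite /dot linearZ /= -scalemxAr [LHS]mxE -/(dot (g p) u) Vu // mulr0.
Qed.

Theorem theorem1 (R : realType) (M : riemannSurface R) (g : M -> 'rV[R]_7)
  (g_pseudoholomorphic : pseudoholomorphic_curve g)
  (g_immersion : immersion g)
  (g_in_S5 : lies_in_S5 g)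
  (M_compact : compact [set: M])
  (M_not_torus : ~ homeomorphic_to M (torus R))
  (n : nat) (n_range : (4 <= n <= 7)%N) :
  (n <> 5%N -> moduli_space g n = set0) /\
  (n = 5%N -> finite_set (moduli_space g n)).
Proof.
have [xi xi1 gxi] := S5_normal g_in_S5.
pose hg := g_pseudoholomorphic; pose ig := g_immersion.
have empty m : (forall f, isosurface g f -> ~ @substantial R M m f) -> moduli_space g m = set0.
  by move=> h; apply/seteqP; split=> // X [f [hm sub hi] _]; exact: (h f (conj hm hi)).
have [[p0 h0]|iso] := pselect (exists p : M, \forall q \near p, qM hg ig q = 0).
  have flat := qM_flat xi1 gxi h0.
  have n3 : (3 <= n)%N by case/andP: n_range => /ltnW.
  have e : moduli_space g n = set0.
    by apply: empty => f hf; exact: (flat_not_substantial xi1 gxi flat hf n3).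
  by rewrite e; split=> // _; exact: finite_set0.
have {}iso (p : M) : ~ \forall q \near p, qM hg ig q = 0 by move=> h; apply: iso; exists p.
(* The hypothesis that M is not a torus enters only here, to give Q a zero. *)
have [zero|nz] := pselect (exists p, qM hg ig p = 0); last first.
  case: M_not_torus; apply: (regular_torus (hg := hg) (ig := ig) xi1 gxi) => // p.
  by apply/eqP => h; apply: nz; exists p.
split=> [n5|->]; last exact: (moduli_finite xi1 gxi M_compact iso zero).
by apply: empty => f hf sub; apply: n5; exact: (no_surface xi1 gxi M_compact iso zero hf sub n_range).
Qed.
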